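(* Let $p\in(1,\infty)$, let $0<L_3\le\min\{L_1,L_2\}$, and let $\boldsymbol{\theta}_0=(\theta_0^1,\theta_0^2,\theta_0^3)\in H$ be such that $$\min\left(\operatorname{osc}_{\bar I_{j_1}}\theta_0^{j_1},\ \operatorname{osc}_{\bar I_{j_2}}\theta_0^{j_2}\right)\ge c>0\qquad\text{for some distinct } j_1,j_2\in\{1,2,3\}.$$ Then there exist $T=T(\boldsymbol{\theta}_0)>0$, functions $\boldsymbol{\theta}=(\theta^1,\theta^2,\theta^3)$ with $\theta^j\in L^\infty(0,T;W^{1,p}(I_j))\cap H^1(0,T;L^2(I_j))$ and $\lambda^1,\lambda^2,\mu^1,\mu^2\in L^2(0,T)$ which form a weak solution on $(0,T)$ with initial datum $\boldsymbol{\theta}_0$ (that is, $\theta^j(\cdot,0)=\theta^j_0$ and properties (i), (ii), (iii) of the context hold). Moreover, letting $T_{max}$ be the maximal existence time of the evolution, if $T_{max}<+\infty$ then $$\liminf_{t\to T_{max}^-}\ \max\left(\operatorname{osc}_{\bar I_{j_1}}\theta^{j_1}(t),\ \operatorname{osc}_{\bar I_{j_2}}\theta^{j_2}(t)\right)=0\qquad\text{for some distinct } j_1,j_2\in\{1,2,3\}.$$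
   Context: $I_j=(0,L_j)$ for $j=1,2,3$. For a continuous function $f$ on $\bar I$, $\operatorname{osc}_{\bar I}f=\max_{\bar I}f-\min_{\bar I}f$. The set $H$ consists of all $\boldsymbol{\theta}=(\theta^1,\theta^2,\theta^3)\in W^{1,p}(I_1)\times W^{1,p}(I_2)\times W^{1,p}(I_3)$ (real-valued functions) such that $$\int_{I_1}(\cos\theta^1,\sin\theta^1)\,ds=\int_{I_2}(\cos\theta^2,\sin\theta^2)\,ds=\int_{I_3}(\cos\theta^3,\sin\theta^3)\,ds .$$ A weak solution on $(0,T)$ with initial datum $\boldsymbol{\theta}_0\in H$ consists of functions $\theta^j\in L^\infty(0,T;W^{1,p}(I_j))\cap H^1(0,T;L^2(I_j))$, $j=1,2,3$, with $\theta^j(\cdot,0)=\theta_0^j$, and $\lambda^1,\lambda^2,\mu^1,\mu^2\in L^2(0,T)$ such that: (i) for any $\varphi^j\in L^\infty(0,T;W^{1,p}(I_j))$, $j=1,2,3$, $$\begin{aligned} 0=&\sum_{j=1}^3\int_0^T\!\!\int_{I_j}\partial_t\theta^j\,\varphi^j\,ds\,dt+\sum_{j=1}^3\int_0^T\!\!\int_{I_j}|\theta^j_s|^{p-2}\theta^j_s\,\varphi^j_s\,ds\,dt\\ &-\int_0^T(\lambda^1-\mu^1)\int_{I_1}\sin(\theta^1)\varphi^1\,ds\,dt+\int_0^T(\lambda^2-\mu^2)\int_{I_1}\cos(\theta^1)\varphi^1\,ds\,dt\\ &+\int_0^T\lambda^1\int_{I_2}\sin(\theta^2)\varphi^2\,ds\,dt-\int_0^T\lambda^2\int_{I_2}\cos(\theta^2)\varphi^2\,ds\,dt\\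 &-\int_0^T\mu^1\int_{I_3}\sin(\theta^3)\varphi^3\,ds\,dt+\int_0^T\mu^2\int_{I_3}\cos(\theta^3)\varphi^3\,ds\,dt ; \end{aligned}$$ (ii) $|\partial_s\theta^j|^{p-2}\partial_s\theta^j\in L^\infty(0,T;L^{\frac p{p-1}}(I_j))\cap L^2(0,T;H^1(I_j))$, with $(|\partial_s\theta^1|^{p-2}\partial_s\theta^1)_s=\theta^1_t-(\lambda^1-\mu^1)\sin\theta^1+(\lambda^2-\mu^2)\cos\theta^1$, $(|\partial_s\theta^2|^{p-2}\partial_s\theta^2)_s=\theta^2_t+\lambda^1\sin\theta^2-\lambda^2\cos\theta^2$, $(|\partial_s\theta^3|^{p-2}\partial_s\theta^3)_s=\theta^3_t-\mu^1\sin\theta^3+\mu^2\cos\theta^3$, and $\theta^j_s(0,t)=\theta^j_s(L_j,t)=0$ for $j=1,2,3$ and a.e. $t\in(0,T)$; (iii) $\boldsymbol{\theta}(\cdot,t)$ satisfies the integral constraint in the definition of $H$ for all $t\in[0,T]$. Maximal existence time: $T_{max}\in(0,\infty]$ is the maximal existence time of a solution $(\boldsymbol{\theta},\lambda^1,\lambda^2,\mu^1,\mu^2)$ defined on $[0,T_{max})$ if its restriction to $(0,T)$ is a weak solution on $(0,T)$ with initial datum $\boldsymbol{\theta}_0$ for every $0<T<T_{max}$, and it cannot be extended to a weak solution on $(0,T')$ for any $T'>T_{max}$. Conventions: $|0|^{p-2}0:=0$; boundary values of $\theta^j_s$ are understood through the continuous-in-$s$ representative of $|\theta^j_s|^{p-2}\theta^j_s\in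 H^1(I_j)$; $\theta^j$ is identified with its continuous representative. *)

(* Defs.v *)
From mathcomp Require Import all_boot all_order all_algebra.
From mathcomp Require Import all_classical all_reals all_analysis.

Set Implicit Arguments.
Unset Strict Implicit.
Unset Printing Implicit Defensive.
Import Order.TTheory GRing.Theory Num.Theory.
Import numFieldNormedType.Exports.

Local Open Scope classical_set_scope.
Local Open Scope ring_scope.

Definition test_function (R : realType) (a b : R) (phi : R -> R) : Prop :=
  (forall n x, derivable (derive1n n phi) x 1) /\
  exists a' b' : R, [/\ a < a', b' < b &
    forall x, x \notin `[a', b'] -> phi x = 0].

Definition Lp (R : realType) (a b : R) (q : \bar R) (f : R -> R) : Prop :=
  measurable_fun `]a, b[ f /\
  (Lnorm lebesgue_measure q ((EFin \o f) \_ `]a, b[) < +oo)%E.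

Definition weak_derivative (R : realType) (a b : R) (f g : R -> R) : Prop :=
  forall phi, test_function a b phi ->
    \int[lebesgue_measure]_(x in `]a, b[) (f x * derive1 phi x) =
    - \int[lebesgue_measure]_(x in `]a, b[) (g x * phi x).

Definition W1p (R : realType) (p l : R) (f : R -> R) : Prop :=
  exists g, [/\ Lp 0 l p%:E f, Lp 0 l p%:E g & weak_derivative 0 l f g].

(* An element of the Bochner space L^q(0,T; L^r(0,l)) is represented by a
   jointly measurable function u, with u t s standing for u(s,t); L^r(0,l) and
   W^{1,r}(0,l) are separable for 1 < r < +oo, so this is the same as strong
   measurability of t |-> u(t). *)
Definition LqLp (R : realType) (T l : R) (q r : \bar R) (u : R -> R -> R)
    : Prop :=
  measurable_fun (`]0, T[ `*` `]0, l[) (fun z : R * R => u z.1 z.2) /\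
  (Lnorm lebesgue_measure q
     ((fun t => Lnorm lebesgue_measure r ((EFin \o u t) \_ `]0%R, l[))
        \_ `]0%R, T[) < +oo)%E.

(* u \in L^q(0,T; W^{1,r}(0,l)) with u_s = us *)
Definition LqW1p (R : realType) (T l : R) (q r : \bar R) (u us : R -> R -> R)
    : Prop :=
  [/\ LqLp T l q r u, LqLp T l q r us &
      {ae (@lebesgue_measure R), forall t, t \in `]0, T[ ->
        weak_derivative 0 l (u t) (us t)}].

(* u \in H^1(0,T; L^2(0,l)) with u_t = ut; the Bochner integrals in the
   definition of the weak derivative are computed pointwise a.e. in s. *)
Definition H1L2 (R : realType) (T l : R) (u ut : R -> R -> R) : Prop :=
  [/\ LqLp T l 2%:E 2%:E u, LqLp T l 2%:E 2%:E ut &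
      forall eta, test_function 0 T eta ->
        {ae (@lebesgue_measure R), forall s, s \in `]0, l[ ->
          \int[lebesgue_measure]_(t in `]0, T[) (u t s * derive1 eta t) =
          - \int[lebesgue_measure]_(t in `]0, T[) (ut t s * eta t)}].

(* f has a representative that is continuous on [0,l] and vanishes at 0 and
   l. *)
Definition zero_boundary (R : realType) (l : R) (f : R -> R) : Prop :=
  exists F : R -> R, [/\ {within `[0, l], continuous F},
    {ae (@lebesgue_measure R), forall s, s \in `]0, l[ -> f s = F s},
    F 0 = 0 & F l = 0].

Definition osc (R : realType) (l : R) (f : R -> R) : R :=
  sup (f @` `[0, l]) - inf (f @` `[0, l]).

(* |x|^{p-2} x, with value 0 at x = 0 *)
Definition pflux (R : realType) (p x : R) : R := `|x| `^ (p - 2) * x.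

Definition e1 : 'I_3 := @Ordinal 3 0 isT.
Definition e2 : 'I_3 := @Ordinal 3 1 isT.
Definition e3 : 'I_3 := @Ordinal 3 2 isT.

Definition network_constraint (R : realType) (L : 'I_3 -> R)
    (th : 'I_3 -> R -> R) : Prop :=
  forall i j : 'I_3,
    \int[lebesgue_measure]_(s in `]0, L i[) cos (th i s) =
    \int[lebesgue_measure]_(s in `]0, L j[) cos (th j s) /\
    \int[lebesgue_measure]_(s in `]0, L i[) sin (th i s) =
    \int[lebesgue_measure]_(s in `]0, L j[) sin (th j s).

(* Elements of W^{1,p}(0,L_j) are given by their continuous representative on
   [0,L_j]. *)
Definition setH (R : realType) (p : R) (L : 'I_3 -> R)
    (th : 'I_3 -> R -> R) : Prop :=
  (forall j, {within `[0, L j], continuous (th j)} /\ W1p p (L j) (th j)) /\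
  network_constraint L th.

(* theta E j t s stands for theta^j(s,t) *)
Record evolution (R : realType) := Evolution {
  theta : 'I_3 -> R -> R -> R ;
  lambda1 : R -> R ;
  lambda2 : R -> R ;
  mu1 : R -> R ;
  mu2 : R -> R }.

Definition weak_form (R : realType) (p : R) (L : 'I_3 -> R) (T : R)
    (E : evolution R) (ths tht : 'I_3 -> R -> R -> R) : Prop :=
  let m := @lebesgue_measure R in
  let: Evolution th la1 la2 mu1 mu2 := E in
  forall ph phs : 'I_3 -> R -> R -> R,
    (forall j, LqW1p T (L j) +oo%E p%:E (ph j) (phs j)) ->
    0 =
      \sum_(j < 3) \int[m]_(t in `]0, T[) \int[m]_(s in `]0, L j[)
        (tht j t s * ph j t s)
    + \sum_(j < 3) \int[m]_(t in `]0, T[) \int[m]_(s in `]0, L j[)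
        (pflux p (ths j t s) * phs j t s)
    - \int[m]_(t in `]0, T[) ((la1 t - mu1 t) *
        \int[m]_(s in `]0, L e1[) (sin (th e1 t s) * ph e1 t s))
    + \int[m]_(t in `]0, T[) ((la2 t - mu2 t) *
        \int[m]_(s in `]0, L e1[) (cos (th e1 t s) * ph e1 t s))
    + \int[m]_(t in `]0, T[) (la1 t *
        \int[m]_(s in `]0, L e2[) (sin (th e2 t s) * ph e2 t s))
    - \int[m]_(t in `]0, T[) (la2 t *
        \int[m]_(s in `]0, L e2[) (cos (th e2 t s) * ph e2 t s))
    - \int[m]_(t in `]0, T[) (mu1 t *
        \int[m]_(s in `]0, L e3[) (sin (th e3 t s) * ph e3 t s))
    + \int[m]_(t in `]0, T[) (mu2 t *
        \int[m]_(s in `]0, L e3[) (cos (th e3 t s) * ph e3 t s)).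

Definition flux_equation (R : realType) (T l : R) (w rhs : R -> R -> R)
    : Prop :=
  {ae (@lebesgue_measure R), forall t, t \in `]0, T[ ->
    {ae (@lebesgue_measure R), forall s, s \in `]0, l[ -> w t s = rhs t s}}.

Definition strong_form (R : realType) (p : R) (L : 'I_3 -> R) (T : R)
    (E : evolution R) (ths tht : 'I_3 -> R -> R -> R) : Prop :=
  let: Evolution th la1 la2 mu1 mu2 := E in
  exists w : 'I_3 -> R -> R -> R,
  [/\ forall j,
        LqLp T (L j) +oo%E (p / (p - 1))%:E (fun t s => pflux p (ths j t s)) /\
        LqW1p T (L j) 2%:E 2%:E (fun t s => pflux p (ths j t s)) (w j),
      flux_equation T (L e1) (w e1) (fun t s => tht e1 t s
        - (la1 t - mu1 t) * sin (th e1 t s)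
        + (la2 t - mu2 t) * cos (th e1 t s)),
      flux_equation T (L e2) (w e2) (fun t s => tht e2 t s
        + la1 t * sin (th e2 t s) - la2 t * cos (th e2 t s)),
      flux_equation T (L e3) (w e3) (fun t s => tht e3 t s
        - mu1 t * sin (th e3 t s) + mu2 t * cos (th e3 t s)) &
      forall j, {ae (@lebesgue_measure R), forall t, t \in `]0, T[ ->
        zero_boundary (L j) (fun s => pflux p (ths j t s))}].

(* theta^j is given by its representative that is continuous on
   [0,T] x [0,L_j], which exists because
   L^oo(0,T; W^{1,p}) \cap H^1(0,T; L^2) embeds into C([0,T] x [0,L_j]);
   ths and tht are its weak derivatives in s and t, unique up to null sets. *)
Definition weak_solution (R : realType) (p : R) (L : 'I_3 -> R)
    (th0 : 'I_3 -> R -> R) (T : R) (E : evolution R) : Prop :=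
  exists ths tht : 'I_3 -> R -> R -> R,
  [/\ forall j,
        [/\ {within `[0, T] `*` `[0, L j],
              continuous (fun z : R * R => theta E j z.1 z.2)},
            LqW1p T (L j) +oo%E p%:E (theta E j) (ths j),
            H1L2 T (L j) (theta E j) (tht j) &
            forall s, s \in `[0, L j] -> theta E j 0 s = th0 j s],
      [/\ Lp 0 T 2%:E (lambda1 E), Lp 0 T 2%:E (lambda2 E),
          Lp 0 T 2%:E (mu1 E) & Lp 0 T 2%:E (mu2 E)],
      weak_form p L T E ths tht,
      strong_form p L T E ths tht &
      forall t, t \in `[0, T] ->
        network_constraint L (fun j => theta E j t)].

(* E' extends E from [0,Tmax) *)
Definition extends (R : realType) (L : 'I_3 -> R) (Tmax : \bar R)
    (E E' : evolution R) : Prop :=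
  (forall j t s, 0 <= t -> (t%:E < Tmax)%E -> s \in `[0, L j] ->
     theta E' j t s = theta E j t s) /\
  {ae (@lebesgue_measure R), forall t, 0 < t -> (t%:E < Tmax)%E ->
     [/\ lambda1 E' t = lambda1 E t, lambda2 E' t = lambda2 E t,
         mu1 E' t = mu1 E t & mu2 E' t = mu2 E t]}.

Definition maximal_solution (R : realType) (p : R) (L : 'I_3 -> R)
    (th0 : 'I_3 -> R -> R) (Tmax : \bar R) (E : evolution R) : Prop :=
  [/\ (0 < Tmax)%E,
      forall T : R, 0 < T -> (T%:E < Tmax)%E -> weak_solution p L th0 T E &
      ~ exists (T' : R) (E' : evolution R),
          [/\ (Tmax < T'%:E)%E, weak_solution p L th0 T' E' &
              extends L Tmax E E']].

(* Main.v *)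
(* The flow is the L^2 gradient flow of sum_j 1/p int |theta^j_s|^p under the closing constraint,
   whose Lagrange multipliers give edge j a force A_j sin theta^j - B_j cos theta^j with
   sum_j A_j = sum_j B_j = 0. If two edges oscillate by at least c, the quadratic form
   sum_j int (a_j sin theta^j - b_j cos theta^j)^2 is coercive on such coefficients, with a constant
   that depends only on c and on a modulus of continuity of theta, hence on an energy bound.
   An explicit Euler scheme on a uniform mesh, with multipliers solving the discrete constraint,
   dissipates energy up to a linear drift p t and therefore exists on a time that depends only on c
   and the energy. Ascoli gives a uniform limit; |theta_s|^(p/2-1) theta_s is Cauchy in L^2 because
   the flux is strongly monotone, and convex combinations of theta_t and of the multipliers converge
   strongly in L^2.
   Solutions are unique: monotonicity and the constraint reduce the growth of the L^2 distance to
   Gronwall with integrable coefficients, and the multipliers are then determined wherever two edges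
   oscillate. If for each pair of edges the liminf at T_max were positive, two edges would oscillate
   by at least c near T_max; restarting with a fixed time step keeps the energy bounded up to T_max,
   and a last restart continues the solution beyond it. *)
Require Import Defs.
From mathcomp Require Import all_boot all_order all_algebra.
From mathcomp Require Import all_classical all_reals all_analysis.
From mathcomp Require Import measurable_realfun ess_sup_inf.
From mathcomp Require Import zify ring lra.
Set Implicit Arguments.
Unset Strict Implicit.
Unset Printing Implicit Defensive.
Import Order.TTheory GRing.Theory Num.Theory.
Import numFieldNormedType.Exports.
Local Open Scope classical_set_scope.
Local Open Scope ring_scope.

(* The energy is carried from one time to the next on sampled states ([net_energy] of [sample], for
   all mesh sizes). Such a bound depends on the values of theta alone, so it survives uniform limits
   and holds at every time, whereas a bound on the integral of |theta_s|^p is available at almost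
   every time; restarting at a prescribed time needs the former. The obstacle is uniformity in the
   mesh: the admissible time step of the explicit scheme degenerates with the mesh, but the
   existence time must not. Closeness to the datum comes first in L^2, from the dissipation, and the
   energy bound upgrades it to uniform closeness, which keeps the quadratic form coercive. Weak
   solutions are traded for [edge_sol], where slices are absolutely continuous. The null sets in the
   weak derivative in time depend on the test function; countably many tests with rational
   parameters remove that dependence. Nonlinear terms pass to the limit through pointwise
   convergence of the slopes, linear ones through a single sequence of convex combinations that acts
   on all unknowns at once. *)
Reserved Notation "\I_ ( x < l ) F" (at level 36, F at level 36, x, l at level 60,
  format "'[' \I_ ( x  <  l )  F ']'").
Reserved Notation "\I_ ( a < x < b ) F" (at level 36, F at level 36, a, x, b at level 60,
  format "'[' \I_ ( a  <  x  <  b )  F ']'").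
Reserved Notation "{ 'aeI' t < T , P }" (at level 0, t, T at level 60, P at level 200,
  format "{ 'aeI'  t  <  T ,  P }").
Notation "\I_ ( x < l ) F" := (\int[lebesgue_measure]_(x in `]0, l[) F) : ring_scope.
Notation "\I_ ( a < x < b ) F" := (\int[lebesgue_measure]_(x in `]a, b[) F) : ring_scope.
Notation "{ 'aeI' t < T , P }" := {ae lebesgue_measure, forall t, `]0, T[%classic t -> P}.

(** * Integrable and square integrable real-valued functions *)

Definition intg d (T : measurableType d) (R : realType)
  (mu : {measure set T -> \bar R}) (D : set T) (f : T -> R) : Prop :=
  mu.-integrable D (EFin \o f).

Definition sqint d (T : measurableType d) (R : realType)
  (mu : {measure set T -> \bar R}) (D : set T) (f : T -> R) : Prop :=
  measurable_fun D f /\ intg mu D (fun x => f x ^+ 2).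

Notation intgI l := (intg lebesgue_measure `]0, l[).
Notation sqintI l := (sqint lebesgue_measure `]0, l[).
Notation measI l := (measurable_fun `]0, l[).

Lemma inI (R : realType) (a b x : R) : `]a, b[%classic x -> a < x /\ x < b.
Proof. by rewrite /= in_itv/= => /andP. Qed.

Lemma eq_ler (R : realType) (x y : R) : x = y -> x <= y.
Proof. by move=> ->. Qed.

Section almost_everywhere.
Context d (T : measurableType d) (R : realType).
Variable mu : {measure set T -> \bar R}.
Implicit Types P Q S U : T -> Prop.

Lemma aeS P Q : (forall x, P x -> Q x) ->
  {ae mu, forall x, P x} -> {ae mu, forall x, Q x}.
Proof. by move=> PQ; apply: filterS. Qed.

Lemma aeS2 P Q S : (forall x, P x -> Q x -> S x) ->
  {ae mu, forall x, P x} -> {ae mu, forall x, Q x} -> {ae mu, forall x, S x}.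
Proof. by move=> PQS; apply: filterS2. Qed.

Lemma aeS3 P Q S U : (forall x, P x -> Q x -> S x -> U x) ->
  {ae mu, forall x, P x} -> {ae mu, forall x, Q x} -> {ae mu, forall x, S x} ->
  {ae mu, forall x, U x}.
Proof. by move=> PQSU; apply: filterS3. Qed.

Lemma aeT P : (forall x, P x) -> {ae mu, forall x, P x}.
Proof. by move=> PT; apply: filterE. Qed.

End almost_everywhere.

Section integrability.
Context d (T : measurableType d) (R : realType).
Variables (mu : {measure set T -> \bar R}) (D : set T).
Hypothesis mD : measurable D.
Implicit Types f g : T -> R.
Local Notation intg := (intg mu D).
Local Notation sqint := (sqint mu D).
Local Notation "'\I' f" := (\int[mu]_(x in D) f x) (at level 10).

Lemma intg_patch f : intg f <-> mu.-integrable setT ((EFin \o f) \_ D).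
Proof. exact: integrable_mkcond. Qed.

Lemma intg_meas f : intg f -> measurable_fun D f.
Proof. by move=> /measurable_int/measurable_EFinP. Qed.

Lemma eq_intg f g : (forall x, D x -> f x = g x) -> intg f -> intg g.
Proof.
move=> fg; apply: eq_integrable => // x; rewrite inE => Dx /=.
by rewrite fg.
Qed.

Lemma intg_le f g : measurable_fun D f ->
  (forall x, D x -> `|f x| <= g x) -> intg g -> intg f.
Proof.
move=> mf fg Ig; apply: (le_integrable mD _ _ Ig).
  exact/measurable_EFinP.
by move=> x Dx /=; rewrite lee_fin (le_trans (fg x Dx))// ler_norm.
Qed.

Lemma intg_bounded f (C : R) : (mu D < +oo)%E -> measurable_fun D f ->
  (forall x, D x -> `|f x| <= C) -> intg f.
Proof.
move=> fD mf fC; apply: measurable_bounded_integrable => //.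
exists C; split; first by rewrite num_real.
by move=> M CM x Dx /=; rewrite (le_trans (fC x Dx))// ltW.
Qed.

Lemma intgD f g : intg f -> intg g -> intg (fun x => f x + g x).
Proof. by move=> If Ig; have := integrableD mD If Ig; apply: eq_integrable. Qed.

Lemma intgB f g : intg f -> intg g -> intg (fun x => f x - g x).
Proof. by move=> If Ig; have := integrableB mD If Ig; apply: eq_integrable. Qed.

Lemma intgZ f (k : R) : intg f -> intg (fun x => k * f x).
Proof. by move=> If; have := integrableZl mD k If; apply: eq_integrable. Qed.

Lemma intg_norm f : intg f -> intg (fun x => `|f x|).
Proof. by move=> If; have := integrable_norm If; apply: eq_integrable. Qed.

Lemma intg_mul_bounded f g (C : R) : intg f -> measurable_fun D g ->
  (forall x, D x -> `|g x| <= C) -> intg (fun x => g x * f x).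
Proof.
move=> If mg gC; apply: (@intg_le _ (fun x => C * `|f x|)).
- by apply: measurable_funM => //; exact: intg_meas.
- by move=> x Dx; rewrite normrM ler_wpM2r// gC.
- exact/intgZ/intg_norm.
Qed.

Lemma intg_ge0 f : measurable_fun D f -> (forall x, D x -> 0 <= f x) ->
  (\int[mu]_(x in D) (f x)%:E < +oo)%E -> intg f.
Proof.
move=> mf f0 fy; apply/integrableP; split; first exact/measurable_EFinP.
apply: le_lt_trans fy; apply: ge0_le_integral => //=.
- by apply/measurable_EFinP; exact: measurableT_comp.
- exact/measurable_EFinP.
- by move=> x Dx; rewrite lee_fin ger0_norm// f0.
Qed.

Lemma intg_EFin f : intg f -> (\int[mu]_(x in D) (f x)%:E)%E = (\I f)%:E.
Proof. by move=> If; rewrite /Rintegral fineK//; exact: integrable_fin_num. Qed.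

Lemma eq_RI f g : (forall x, D x -> f x = g x) -> \I f = \I g.
Proof. by move=> fg; apply: eq_Rintegral => x; rewrite inE; exact: fg. Qed.

Lemma RI_eq0 f : (forall x, D x -> f x = 0) -> \I f = 0.
Proof.
move=> f0; have -> : \I f = \I (fun=> 0) by exact: eq_RI.
by rewrite Rintegral_cst// mul0r.
Qed.

Lemma le_RI f g : intg f -> intg g -> (forall x, D x -> f x <= g x) ->
  \I f <= \I g.
Proof. exact: le_Rintegral. Qed.

Lemma RI_ge0 f : (forall x, D x -> 0 <= f x) -> 0 <= \I f.
Proof. exact: Rintegral_ge0. Qed.

Lemma RI_norm f : intg f -> `|\I f| <= \I (fun x => `|f x|).
Proof. exact: le_normr_Rintegral. Qed.

Lemma RID f g : intg f -> intg g -> \I (fun x => f x + g x) = \I f + \I g.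
Proof. exact: RintegralD. Qed.

Lemma RIB f g : intg f -> intg g -> \I (fun x => f x - g x) = \I f - \I g.
Proof. exact: RintegralB. Qed.

Lemma RIZ f (k : R) : intg f -> \I (fun x => k * f x) = k * \I f.
Proof. exact: RintegralZl. Qed.

Lemma RIN f : intg f -> \I (fun x => - f x) = - \I f.
Proof.
move=> If; rewrite -mulN1r -RIZ//; apply: eq_RI => x _.
by rewrite mulN1r.
Qed.

Lemma RI_cst (k : R) : \I (fun=> k) = k * fine (mu D).
Proof. by rewrite Rintegral_cst. Qed.

Lemma ae_eq_RI f g : measurable_fun D f -> measurable_fun D g ->
  {ae mu, forall x, D x -> f x = g x} -> \I f = \I g.
Proof.
move=> mf mg fg; rewrite /Rintegral; congr fine; apply: ae_eq_integral => //.
- exact/measurable_EFinP.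
- exact/measurable_EFinP.
- by apply: filterS fg => x fg Dx /=; rewrite fg.
Qed.

Lemma ae_intg f g : measurable_fun D g -> intg f ->
  {ae mu, forall x, D x -> `|g x| <= f x} -> intg g.
Proof.
move=> mg If gf; apply/integrableP; split; first exact/measurable_EFinP.
have /integrableP[mf fy] := If.
apply: le_lt_trans fy; apply: ae_ge0_le_integral => //.
- by apply/measurable_EFinP; exact: measurableT_comp.
- by apply/measurableT_comp.
- by apply: filterS gf => x /= gf Dx; rewrite lee_fin (le_trans (gf Dx))// ler_norm.
Qed.

Lemma ae_le_RI f g : intg f -> intg g ->
  {ae mu, forall x, D x -> f x <= g x} -> \I f <= \I g.
Proof.
move=> If Ig fg.
have mf := intg_meas If; have mg := intg_meas Ig.
(* The function [min f g] equals f almost everywhere and lies below g everywhere, so the pointwise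
   comparison applies to it. *)
rewrite (@ae_eq_RI f (fun x => Num.min (f x) (g x)))//.
- apply: le_RI => //.
    apply: (@intg_le _ (fun x => `|f x| + `|g x|)).
    + exact: measurable_minr.
    + move=> x Dx; rewrite minEle; case: ifP => _; first by rewrite lerDl.
      by rewrite lerDr.
    + by apply: intgD; exact: intg_norm.
  by move=> x Dx; rewrite ge_min lexx orbT.
- exact: measurable_minr.
- by apply: filterS fg => x fg Dx; rewrite minEle fg.
Qed.

Lemma ge0_RI_eq0 f : intg f -> (forall x, D x -> 0 <= f x) -> \I f = 0 ->
  {ae mu, forall x, D x -> f x = 0}.
Proof.
move=> If f0 If0.
have mf := intg_meas If.
have : (\int[mu]_(x in D) `|(f x)%:E| = 0)%E.
  rewrite -[RHS]/(0%:E) -If0 -intg_EFin//; apply: eq_integral => x.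
  by rewrite inE => Dx; rewrite gee0_abs// lee_fin f0.
have mfE : measurable_fun D (EFin \o f) by exact/measurable_EFinP.
move=> /(ae_eq_integral_abs mu mD mfE) H.
by apply: filterS H => x /= H Dx; have := H Dx => -[].
Qed.

Lemma sqint_meas f : sqint f -> measurable_fun D f. Proof. by case. Qed.

Lemma sqintM f g : sqint f -> sqint g -> intg (fun x => f x * g x).
Proof.
move=> [mf If] [mg Ig]; apply: (@intg_le _ (fun x => f x ^+ 2 + g x ^+ 2)).
- exact: measurable_funM.
- move=> x Dx; rewrite normrM -(real_normK (num_real (f x))).
  rewrite -(real_normK (num_real (g x))).
  have := normr_ge0 (f x); have := normr_ge0 (g x); nra.
- exact: intgD.
Qed.

Lemma eq_sqint f g : (forall x, D x -> f x = g x) -> sqint f -> sqint g.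
Proof.
move=> fg [mf If]; split.
  by apply: eq_measurable_fun mf => x; rewrite inE => /fg.
by apply: eq_intg If => x Dx; rewrite fg.
Qed.

Lemma sqintZ f (k : R) : sqint f -> sqint (fun x => k * f x).
Proof.
move=> [mf If]; split; first exact: measurable_funM.
by apply: eq_intg (intgZ (k ^+ 2) If) => x _; rewrite exprMn.
Qed.

Lemma sqintD f g : sqint f -> sqint g -> sqint (fun x => f x + g x).
Proof.
move=> Sf Sg; split; first by apply: measurable_funD; case: Sf; case: Sg.
have : intg (fun x => f x ^+ 2 + g x ^+ 2 + 2 * (f x * g x)).
  apply: intgD; last by apply: intgZ; exact: sqintM.
  by apply: intgD; [case: Sf|case: Sg].
by apply: eq_intg => x _; ring.
Qed.

Lemma sqintN f : sqint f -> sqint (fun x => - f x).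
Proof. by move=> /(sqintZ (-1)); apply: eq_sqint => x _; rewrite mulN1r. Qed.

Lemma sqintB f g : sqint f -> sqint g -> sqint (fun x => f x - g x).
Proof. by move=> Sf /sqintN; exact: sqintD. Qed.

Lemma sqint_norm f : sqint f -> sqint (fun x => `|f x|).
Proof.
move=> [mf If]; split; first exact: measurableT_comp.
by apply: eq_intg If => x _; rewrite real_normK// num_real.
Qed.

Lemma sqint_mul_bounded f g (C : R) : sqint f -> measurable_fun D g ->
  (forall x, D x -> `|g x| <= C) -> sqint (fun x => g x * f x).
Proof.
move=> [mf If] mg gC; split; first exact: measurable_funM.
have : intg (fun x => g x ^+ 2 * f x ^+ 2).
  apply: (@intg_mul_bounded _ _ (C ^+ 2)) => //; first exact: measurable_funX.
  move=> x Dx; rewrite normrX lerXn2r ?nnegrE//; last exact: gC.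
  exact: le_trans (gC _ Dx).
by apply: eq_intg => x _; rewrite exprMn.
Qed.

Lemma sqint_bounded f (C : R) : (mu D < +oo)%E -> measurable_fun D f ->
  (forall x, D x -> `|f x| <= C) -> sqint f.
Proof.
move=> fD mf fC; split => //; apply: (@intg_bounded _ (C ^+ 2)) => //.
  exact: measurable_funX.
move=> x Dx; rewrite normrX lerXn2r ?nnegrE//; last exact: fC.
exact: le_trans (fC _ Dx).
Qed.

Lemma sqint_intg f : (mu D < +oo)%E -> sqint f -> intg f.
Proof.
move=> fD Sf; have S1 : sqint (fun=> 1).
  by apply: (@sqint_bounded _ 1) => // x _; rewrite normr1.
by apply: eq_intg (sqintM S1 Sf) => x _; rewrite mul1r.
Qed.

Lemma RI_AMGM f g (a : R) : 0 < a -> sqint f -> sqint g ->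
  2 * \I (fun x => `|f x * g x|) <=
    a * \I (fun x => f x ^+ 2) + a^-1 * \I (fun x => g x ^+ 2).
Proof.
move=> a0 Sf Sg.
have Ifg := sqintM Sf Sg.
have [_ If] := Sf; have [_ Ig] := Sg.
have ? := intg_norm Ifg.
rewrite -!RIZ// -RID; [|exact: intgZ..].
apply: le_RI; [exact: intgZ|by apply: intgD; exact: intgZ|].
move=> x _; rewrite normrM -(real_normK (num_real (f x))).
rewrite -(real_normK (num_real (g x))).
set u := `|f x|; set v := `|g x|.
rewrite -subr_ge0 (_ : _ - _ = a^-1 * (a * u - v) ^+ 2); last by field; rewrite gt_eqF.
by rewrite mulr_ge0 ?sqr_ge0// invr_ge0 ltW.
Qed.

Lemma RI_CS f g : sqint f -> sqint g ->
  (\I (fun x => `|f x * g x|)) ^+ 2 <=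
    \I (fun x => f x ^+ 2) * \I (fun x => g x ^+ 2).
Proof.
move=> Sf Sg; set P := \I _; set A := \I _; set B := \I _.
have P0 : 0 <= P by apply: RI_ge0.
have A0 : 0 <= A by apply: RI_ge0 => x _; exact: sqr_ge0.
have B0 : 0 <= B by apply: RI_ge0 => x _; exact: sqr_ge0.
have H a : 0 < a -> 2 * P <= a * A + a^-1 * B by move=> a0; exact: RI_AMGM.
(* The weight b / a, with a and b the square roots of the two factors, makes [RI_AMGM] sharp; the
   shift by e keeps both positive. *)
suff K e : 0 < e -> P ^+ 2 <= (A + e) * (B + e).
  apply/ler_addgt0Pr => e e0.
  have [e' [e'0 e'e]] : exists e', 0 < e' /\ (A + e') * (B + e') <= A * B + e.
    exists (Num.min 1 (e / (A + B + 1))); set m := Num.min _ _.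
    have ABp : 0 < A + B + 1 by lra.
    have m0 : 0 < m by rewrite lt_min ltr01 divr_gt0.
    split => //.
    have m1 : m <= 1 by rewrite ge_min lexx.
    have me : m <= e / (A + B + 1) by rewrite ge_min lexx orbT.
    move: me; rewrite ler_pdivlMr// => me; nra.
  exact: le_trans (K _ e'0) e'e.
move=> e0.
set a := Num.sqrt (A + e); set b := Num.sqrt (B + e).
have a0 : 0 < a by rewrite sqrtr_gt0; lra.
have b0 : 0 < b by rewrite sqrtr_gt0; lra.
have aE : a ^+ 2 = A + e by rewrite sqr_sqrtr//; lra.
have bE : b ^+ 2 = B + e by rewrite sqr_sqrtr//; lra.
have /H : 0 < b / a by rewrite divr_gt0.
rewrite invf_div => H'.
have : 2 * P <= b / a * a ^+ 2 + a / b * b ^+ 2.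
  apply: le_trans H' _; apply: lerD.
    by rewrite ler_pM2l ?divr_gt0// aE; lra.
  by rewrite ler_pM2l ?divr_gt0// bE; lra.
rewrite (_ : _ + _ = 2 * (a * b)); last by field; rewrite !gt_eqF.
rewrite ler_pM2l// => PL.
by rewrite -aE -bE -exprMn lerXn2r// nnegrE mulr_ge0// ltW.
Qed.

End integrability.

Section norm_arithmetic.
Context (R : realType).
Implicit Types (a b c d x y : R).

Lemma normD_le a b c d : `|a| <= c -> `|b| <= d -> `|a + b| <= c + d.
Proof. by move=> ac bd; apply: le_trans (ler_normD _ _) (lerD ac bd). Qed.

Lemma normB_le a b c d : `|a| <= c -> `|b| <= d -> `|a - b| <= c + d.
Proof. by move=> ac bd; apply: le_trans (ler_normB _ _) (lerD ac bd). Qed.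

Lemma sqr_near x y c : (x - y) ^+ 2 <= c -> x ^+ 2 <= 2 * (y * y) + 2 * c.
Proof. by move=> h; have := sqr_ge0 (x - 2 * y); lra. Qed.

Lemma norm_sqr_le a c : `|a| <= c -> a ^+ 2 <= c ^+ 2.
Proof.
move=> ac; rewrite -(real_normK (num_real a)) lerXn2r ?nnegrE//.
exact: le_trans ac.
Qed.

End norm_arithmetic.

(** phi k sums N i + 1 for i up to k; the summands 1 make phi strictly increasing and at least the
    identity. It serves to extract rapidly converging subsequences. *)
Lemma fast_index (N : nat -> nat) : exists phi : nat -> nat,
  [/\ forall k, (N k <= phi k)%N, forall n, (n <= phi n)%N &
      {homo phi : m n / (m < n)%N}].
Proof.
pose phi k := (\sum_(i < k.+1) (N i).+1)%N.
have phiS k : phi k.+1 = (phi k + (N k.+1).+1)%N by rewrite /phi big_ord_recr.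
have phi_mon : {homo phi : m n / (m < n)%N}.
  by apply: homo_ltn => [y x z|k]; [exact: ltn_trans|rewrite phiS; lia].
exists phi; split => //.
- by case=> [|k]; rewrite ?phiS /phi ?big_ord_recr ?big_ord0/= ?add0n; lia.
- by elim=> // n IH; exact: leq_ltn_trans IH (phi_mon _ _ (ltnSn _)).
Qed.

Lemma sum_half (R : realType) n :
  \sum_(k < n) 2^-1 ^+ k.+1 = 1 - 2^-1 ^+ n :> R.
Proof.
elim: n => [|n IH]; first by rewrite big_ord0 expr0 subrr.
by rewrite big_ord_recr/= IH exprS; field.
Qed.

Lemma cvg_le_cst (R : realType) (u : nat -> R) (l c : R) :
  u n @[n --> \oo] --> l -> (forall n, u n <= c) -> l <= c.
Proof.
move=> ul uc; apply/ler_addgt0Pr => e e0.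
have /cvgrPdist_le/(_ _ e0)[N _ /(_ N (leqnn N))/=] := ul.
by rewrite ler_norml => /andP[_]; have := uc N; lra.
Qed.

Lemma cvg_uniq (R : realType) (u : nat -> R) (l l' : R) :
  u n @[n --> \oo] --> l -> u n @[n --> \oo] --> l' -> l = l'.
Proof.
by move=> /(cvg_lim (@Rhausdorff R)) <- /(cvg_lim (@Rhausdorff R)).
Qed.

Lemma sqr_triangle (R : realDomainType) (x y z : R) :
  (x - z) ^+ 2 <= 2 * (x - y) ^+ 2 + 2 * (y - z) ^+ 2.
Proof.
rewrite -subr_ge0 (_ : _ - _ = (x - 2 * y + z) ^+ 2); first exact: sqr_ge0.
ring.
Qed.

(** * Convergence of integrals and completeness of L^2 *)

Section convergence.
Context d (T : measurableType d) (R : realType).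
Variables (mu : {measure set T -> \bar R}) (D : set T).
Hypothesis mD : measurable D.
Implicit Types f g : T -> R.
Local Notation intg := (intg mu D).
Local Notation sqint := (sqint mu D).
Local Notation "'\I' f" := (\int[mu]_(x in D) f x) (at level 10).

Lemma R_dct (u : nat -> T -> R) f g :
  (forall n, measurable_fun D (u n)) -> measurable_fun D f ->
  {ae mu, forall x, D x -> u n x @[n --> \oo] --> f x} -> intg g ->
  {ae mu, forall x, D x -> forall n, `|u n x| <= g x} ->
  [/\ intg f, \I (u n) @[n --> \oo] --> \I f &
      \I (fun x => `|u n x - f x|) @[n --> \oo] --> (0 : R)].
Proof.
move=> mu_ mf uf Ig ug.
have [] := @dominated_convergence _ _ _ mu D mD (fun n x => (u n x)%:E)
  (EFin \o f) (EFin \o g).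
- by move=> n; exact/measurable_EFinP.
- exact/measurable_EFinP.
- by apply: filterS uf => x uf Dx; apply: cvg_EFin; [exact: nearW|exact: uf].
- exact: Ig.
- by apply: filterS ug => x ug n Dx; rewrite lee_fin ug.
move=> If c1 c2.
have Iu n : intg (u n).
  by apply: ae_intg Ig _ => //; apply: filterS ug => x H Dx; exact: H.
split => //.
- have : (\I (u n))%:E @[n --> \oo] --> (\I f)%:E.
    rewrite -intg_EFin//; under eq_fun do rewrite -intg_EFin//; exact: c2.
  by move=> /fine_cvgP[].
- have : (\I (fun x => `|u n x - f x|))%:E @[n --> \oo] --> 0%:E.
    rewrite [X in X n @[n --> _] --> _](_ : _ =
      (fun n => \int[mu]_(x in D) `|(u n x)%:E - (f x)%:E|)%E) ?c1//.
    apply/funext => n; rewrite -intg_EFin//.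
    by apply: intg_norm => //; exact: intgB.
  by move=> /fine_cvgP[].
Qed.

(* Beppo Levi. *)
Lemma ae_sum_le (u : nat -> T -> R) (C : R) :
  (forall n, intg (u n)) -> (forall n x, D x -> 0 <= u n x) ->
  (forall n, \sum_(k < n) \I (u k) <= C) ->
  exists G, [/\ intg G, forall x, D x -> 0 <= G x &
    {ae mu, forall x, D x -> forall n, \sum_(k < n) u k x <= G x}].
Proof.
move=> Iu u0 uC.
pose S n x := \sum_(k < n) u k x.
have IS n : intg (S n).
  rewrite /S; elim: n => [|n IH].
    apply: (@intg_le _ _ _ _ _ mD _ (fun x => 0 * u 0%N x)).
    - by under eq_fun do rewrite big_ord0; exact: measurable_cst.
    - by move=> x Dx; rewrite big_ord0 normr0 mul0r.
    - exact/intgZ.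
  by under eq_fun do rewrite big_ord_recr/=; exact: intgD.
have RS n : \I (S n) = \sum_(k < n) \I (u k).
  elim: n => [|n IH].
    rewrite big_ord0; under eq_Rintegral do rewrite /S big_ord0.
    by rewrite RI_cst// mul0r.
  rewrite big_ord_recr/= -IH -RID//; apply: eq_RI => x _.
  by rewrite /S big_ord_recr.
have S0 n x : D x -> 0 <= S n x by move=> Dx; apply: sumr_ge0 => k _; exact: u0.
have ndS x : D x -> {homo S^~ x : n m / (n <= m)%N >-> n <= m}.
  move=> Dx n m nm; rewrite /S -(subnKC nm) big_split_ord/= lerDl.
  by apply: sumr_ge0 => k _; exact: u0.
pose g x := limn (fun n => (S n x)%:E).
have mS n : measurable_fun D (fun x => (S n x)%:E).
  by apply/measurable_EFinP; exact: intg_meas.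
have mg : measurable_fun D g.
  apply: (emeasurable_fun_cvg (fun n x => (S n x)%:E)) => // x Dx.
  apply: ereal_nondecreasing_is_cvgn => n m nm.
  by rewrite lee_fin ndS.
have leg n x : D x -> ((S n x)%:E <= g x)%E.
  move=> Dx; apply: lime_ge.
    by apply: ereal_nondecreasing_is_cvgn => i j ij; rewrite lee_fin ndS.
  by near=> m; rewrite lee_fin ndS//; near: m; exists n.
have g0 x : D x -> (0 <= g x)%E.
  by move=> Dx; apply: le_trans (leg 0%N x Dx); rewrite lee_fin S0.
have ig : mu.-integrable D g.
  apply/integrableP; split => //.
  rewrite (eq_integral g); last by move=> x /set_mem Dx; rewrite gee0_abs// g0.
  have -> : (\int[mu]_(x in D) g x =
             limn (fun n => \int[mu]_(x in D) (S n x)%:E))%E.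
    by apply: monotone_convergence.
  apply: (@le_lt_trans _ _ C%:E); last by rewrite ltry.
  apply: lime_le.
    apply: ereal_nondecreasing_is_cvgn => n m nm.
    by rewrite !intg_EFin// lee_fin le_RI// => x Dx; exact: ndS.
  by apply: nearW => n; rewrite intg_EFin// lee_fin RS.
exists (fine \o g); split.
- apply: (le_integrable mD _ _ ig).
    by apply/measurable_EFinP; exact: measurableT_comp mg.
  move=> x Dx /=.
  by have := g0 x Dx; case: (g x) => //= r; rewrite normr0 leey.
- by move=> x Dx; rewrite /= fine_ge0// g0.
- apply: filterS (integrable_ae mD ig) => x /= H Dx n.
  by rewrite -lee_fin fineK ?H// leg.
Unshelve. all: by end_near. Qed.

(** Along a subsequence the L^1 distances are at most 2^-(k+1), hence summable; the series of the |u
    - f| then converges almost everywhere, so its terms tend to 0. *)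
Lemma subseq_ae (u : nat -> T -> R) f :
  (forall n, intg (fun x => `|u n x - f x|)) ->
  (forall e, 0 < e -> exists N, forall n, (N <= n)%N ->
     \I (fun x => `|u n x - f x|) <= e) ->
  exists phi : nat -> nat, [/\ forall n, (n <= phi n)%N,
     {homo phi : m n / (m < n)%N} &
     {ae mu, forall x, D x -> u (phi n) x @[n --> \oo] --> f x}].
Proof.
move=> Iu uf.
have /choice[Nf HNf] : forall k : nat, exists N, forall n, (N <= n)%N ->
    \I (fun x => `|u n x - f x|) <= 2^-1 ^+ k.+1.
  by move=> k; apply: uf; rewrite exprn_gt0// invr_gt0.
have [phi [phi_Nf phi_id phi_mon]] := fast_index Nf.
have [//|//|n|G [IG G0 HG]] :=
  @ae_sum_le (fun k x => `|u (phi k) x - f x|) 1.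
  apply: (@le_trans _ _ (\sum_(k < n) 2^-1 ^+ k.+1)).
    by apply: ler_sum => k _; exact: HNf.
  by rewrite sum_half gerBl exprn_ge0.
exists phi; split => //; apply: filterS HG => x HG Dx.
have bS : cvgn (series (fun k => `|u (phi k) x - f x|)).
  apply: nondecreasing_is_cvgn.
    apply/nondecreasing_seqP => n; rewrite /series/= big_nat_recr//= lerDl//.
  exists (G x) => _ [n _ <-]; rewrite /series/= big_mkord; exact: HG.
have /cvgrPdist_le H := cvg_series_cvg_0 bS.
apply/cvgrPdist_le => e e0; near=> n.
rewrite distrC.
have : `|0 - `|u (phi n) x - f x| | <= e by near: n; exact: H.
by rewrite sub0r normrN normr_id.
Unshelve. all: by end_near. Qed.

(** The Riesz-Fischer theorem together with what later dominated convergence needs: convergence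
    almost everywhere along a subsequence, and a square integrable majorant of that subsequence. *)
Lemma L2_complete (u : nat -> T -> R) :
  (forall n, sqint (u n)) ->
  (forall e, 0 < e -> exists N, forall m n, (N <= m)%N -> (N <= n)%N ->
     \I (fun x => (u m x - u n x) ^+ 2) <= e) ->
  exists (phi : nat -> nat) f h, [/\ [/\ forall n, (n <= phi n)%N,
     {homo phi : m n / (m < n)%N}, sqint f & sqint h],
     {ae mu, forall x, D x -> u (phi n) x @[n --> \oo] --> f x},
     {ae mu, forall x, D x -> forall n, `|u (phi n) x| <= h x} &
     (forall e, 0 < e -> exists N, forall n, (N <= n)%N ->
       \I (fun x => (u n x - f x) ^+ 2) <= e)].
Proof.
move=> Su uC.
have /choice[Nf HNf] : forall k : nat, exists N, forall m n,
    (N <= m)%N -> (N <= n)%N ->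
    \I (fun x => (u m x - u n x) ^+ 2) <= 8^-1 ^+ k.+1.
  by move=> k; apply: uC; rewrite exprn_gt0// invr_gt0.
have [phi [phi_Nf phi_id phi_mon]] := fast_index Nf.
pose dl k x := u (phi k.+1) x - u (phi k) x.
have Sdl k : sqint (dl k) by exact: sqintB.
(* The increments are at most 8^-(k+1) in squared L^2 norm, so they remain summable with the weights
   4^k. The weighted sum G then gives the geometric bound sqrt(G) 2^-k on the increments at almost
   every point. *)
have [|n x Dx|n|G [IG G0 HG]] :=
  @ae_sum_le (fun k x => 4 ^+ k * dl k x ^+ 2) 1.
- by move=> n; apply: intgZ => //; case: (Sdl n).
- by apply: mulr_ge0; [exact: exprn_ge0|exact: sqr_ge0].
- apply: (@le_trans _ _ (\sum_(k < n) 2^-1 ^+ k.+1)).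
    apply: ler_sum => k _; rewrite RIZ//; last by case: (Sdl k).
    have H : \I (fun x => dl k x ^+ 2) <= 8^-1 ^+ k.+1.
      apply: HNf; last exact: phi_Nf.
      by apply: leq_trans (phi_Nf k) _; exact/ltnW/phi_mon.
    apply: (@le_trans _ _ (4 ^+ k * 8^-1 ^+ k.+1)).
      by rewrite ler_wpM2l// exprn_ge0.
    rewrite !exprS mulrCA -exprMn (_ : 4 * 8^-1 = 2^-1 :> R); last by field.
    by rewrite ler_wpM2r ?exprn_ge0 ?invr_ge0// lef_pV2 ?posrE//; lra.
  by rewrite sum_half gerBl exprn_ge0// invr_ge0.
pose sG (x : T) : R := Num.sqrt (G x).
have dlG x : (forall n, \sum_(k < n) 4 ^+ k * dl k x ^+ 2 <= G x) -> 
    forall k, `|dl k x| <= sG x * 2^-1 ^+ k.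
  move=> H k; rewrite -ler_pdivrMr ?exprn_gt0 ?invr_gt0//.
  rewrite exprVn invrK.
  have -> : `|dl k x| * 2 ^+ k = Num.sqrt (dl k x ^+ 2 * (2 ^+ k) ^+ 2).
    by rewrite sqrtrM ?sqr_ge0// !sqrtr_sqr (ger0_norm (exprn_ge0 _ _)).
  apply: ler_wsqrtr; apply: le_trans (H k.+1).
  rewrite big_ord_recr/= -exprM mulnC exprM.
  rewrite (_ : 2 ^+ 2 = 4 :> R); last by ring.
  rewrite mulrC lerDr sumr_ge0// => i _.
  by apply: mulr_ge0; [exact: exprn_ge0|exact: sqr_ge0].
have tel x n m : u (phi (n + m)%N) x - u (phi n) x = \sum_(k < m) dl (n + k)%N x.
  elim: m => [|m IH]; first by rewrite big_ord0 addn0 subrr.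
  by rewrite big_ord_recr/= -IH addnS /dl; ring.
have telB x : (forall n, \sum_(k < n) 4 ^+ k * dl k x ^+ 2 <= G x) ->
    forall n m, `|u (phi (n + m)%N) x - u (phi n) x| <= sG x * 2 * 2^-1 ^+ n.
  move=> H n m; rewrite tel; apply: le_trans (ler_norm_sum _ _ _) _.
  apply: (@le_trans _ _ (\sum_(k < m) sG x * 2 * 2^-1 ^+ n * 2^-1 ^+ k.+1)).
    apply: ler_sum => k _; apply: le_trans (dlG _ H _) _.
    by rewrite exprD exprS le_eqVlt; apply/orP; left; apply/eqP; field.
  rewrite -mulr_sumr sum_half ler_piMr// ?gerBl ?exprn_ge0 ?invr_ge0//.
  by rewrite !mulr_ge0 ?sqrtr_ge0 ?exprn_ge0 ?invr_ge0.
pose h (x : T) : R := `|u (phi 0%N) x| + 2 * sG x.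
have mG : measurable_fun D G by exact: (intg_meas IG).
have SsG : sqint sG.
  split.
    apply: (@eq_measurable_fun _ _ _ _ D (fun x => G x `^ 2^-1)).
      by move=> x; rewrite inE => Dx; rewrite /sG powR12_sqrt// G0.
    exact: (measurableT_comp (measurable_powR 2^-1) mG).
  by apply: eq_intg IG => // x Dx; rewrite sqr_sqrtr// G0.
have Sh : sqint h.
  by apply: sqintD => //; [exact: sqint_norm|exact: sqintZ].
have ub : {ae mu, forall x, D x -> forall n, `|u (phi n) x| <= h x}.
  apply: filterS HG => x HG Dx n; have := telB x (HG Dx) 0%N n.
  rewrite add0n expr0 mulr1 => H.
  rewrite /h -(subrK (u (phi 0%N) x) (u (phi n) x)).
  by rewrite (le_trans (ler_normD _ _))// addrC lerD2l mulrC.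
have cv : {ae mu, forall x, D x -> cvgn (fun n => u (phi n) x)}.
  apply: filterS HG => x HG Dx.
  apply/cauchy_cvgP/cauchy_exP => e e0.
  have /cvgrPdist_lt H : sG x * 2 * 2^-1 ^+ n @[n --> \oo] --> sG x * 2 * 0.
    by apply: cvgZr; apply: cvg_expr; rewrite ger0_norm ?invr_ge0// invf_lt1// ltr1n.
  have [N _ HN] := H _ e0.
  exists (u (phi N) x); exists N => // n /= Nn.
  rewrite /ball/= distrC -(subnKC Nn); apply: le_lt_trans (telB _ (HG Dx) _ _) _.
  have := HN N (leqnn _); rewrite mulr0 sub0r normrN; apply: le_lt_trans.
  exact: ler_norm.
(* The limit is set to 0 on the null set N outside of which the subsequence converges; this makes it
   a pointwise limit of measurable functions. *)
have [N [mN N0 NP]] := cv.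
pose f := (fun x => limn (fun n => u (phi n) x)) \_ (D `\` N).
have mu_ n : measurable_fun D (u n) by case: (Su n).
have mf : measurable_fun D f.
  apply: (@measurable_fun_cvg _ _ _ D (fun n => (u (phi n)) \_ (D `\` N))).
    move=> n; apply/measurable_restrict => //; first exact: measurableD.
    by apply: measurable_funS (mu_ (phi n)) => //; exact: subIsetl.
  move=> x Dx; rewrite /f /patch; case: ifPn => [/set_mem[_ xN]|_].
    by apply: (contra_notP _ xN) => /= H; apply: NP => /= H'; apply: H; exact: H'.
  exact: cvg_cst.
have uf : {ae mu, forall x, D x -> u (phi n) x @[n --> \oo] --> f x}.
  exists N; split => // x /= Hx; apply: contrapT => xN; apply: Hx => Dx.
  rewrite /f /patch mem_set//.
  apply: (contra_notP _ xN) => /= H; apply: NP => /= H'; apply: H; exact: H'.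
have fh : {ae mu, forall x, D x -> `|f x| <= h x}.
  apply: filterS2 uf ub => x H1 H2 Dx.
  apply: (@cvg_le_cst _ (fun n => `|u (phi n) x|)); last exact: H2.
  by apply: cvg_norm; exact: H1.
have Sf : sqint f.
  split => //; apply: (@ae_intg _ _ _ _ _ mD (fun x => h x ^+ 2)).
  - exact: measurable_funX.
  - by case: Sh.
  - apply: filterS fh => x fh Dx; rewrite normrX lerXn2r ?nnegrE//; last exact: fh.
    exact: le_trans (fh Dx).
exists phi, f, h; split => // e e0.
have [] := @R_dct (fun n x => (u (phi n) x - f x) ^+ 2) (cst 0)
    (fun x => 4 * h x ^+ 2).
- by move=> n; apply: measurable_funX; exact: measurable_funB.
- exact: measurable_cst.
- apply: filterS uf => x uf Dx /=; rewrite -[X in _ --> X](expr0n _ 2).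
  under eq_fun do rewrite expr2.
  have H : u (phi n) x - f x @[n --> \oo] --> (0 : R).
    by rewrite -[X in _ --> X](subrr (f x)); apply: cvgB; [exact: uf|exact: cvg_cst].
  exact: cvgM.
- by apply: intgZ => //; case: Sh.
- apply: filterS2 fh ub => x H1 H2 Dx n.
  rewrite ger0_norm ?sqr_ge0// -[X in X <= _](real_normK (num_real _)).
  rewrite (_ : 4 * _ = (2 * h x) ^+ 2); last by ring.
  have h0 : 0 <= h x by exact: le_trans (H1 Dx).
  rewrite lerXn2r ?nnegrE ?mulr_ge0//.
  apply: le_trans (ler_normB _ _) _; have := H1 Dx; have := H2 Dx n; lra.
move=> _ + _; rewrite Rintegral_cst// mul0r => /cvgrPdist_le H.
have e4 : 0 < e / 4 by lra.
have [K HK] := uC _ e4; have [M _ HM] := H _ e4.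
exists K => n Kn; pose k := maxn K M.
have S1 : sqint (fun x => u n x - u (phi k) x) by exact: sqintB.
have S2 : sqint (fun x => u (phi k) x - f x) by exact: sqintB.
have B1 := HK n (phi k) Kn (leq_trans (leq_maxl K M) (phi_id _)).
have := HM k (leq_maxr _ _); rewrite /= sub0r normrN ger0_norm; last first.
  by apply: Rintegral_ge0 => x _; exact: sqr_ge0.
move=> B2.
apply: (@le_trans _ _ (2 * \I (fun x => (u n x - u (phi k) x) ^+ 2) +
   2 * \I (fun x => (u (phi k) x - f x) ^+ 2))); last by lra.
rewrite -!RIZ//; [|by case: S2|by case: S1].
rewrite -RID//; [|by apply: intgZ => //; case: S1|by apply: intgZ => //; case: S2].
apply: le_RI => //.
- by case: (sqintB mD (Su n) Sf).
- by apply: intgD => //; apply: intgZ => //; [case: S1|case: S2].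
- move=> x _; exact: sqr_triangle.
Qed.

End convergence.

(** * Iterated integrals *)

Section fubini.
Context d1 d2 (T1 : measurableType d1) (T2 : measurableType d2) (R : realType).
Variables (m1 : {sigma_finite_measure set T1 -> \bar R})
          (m2 : {sigma_finite_measure set T2 -> \bar R}).
Local Notation mm := (m1 \x m2)%E.
Variables (A : set T1) (B : set T2).
Hypotheses (mA : measurable A) (mB : measurable B).
Implicit Types f : T1 -> T2 -> R.
Local Notation unc f := (fun z : T1 * T2 => f z.1 z.2).

Lemma measurable_slice1 f x : measurable_fun (A `*` B) (unc f) -> A x ->
  measurable_fun B (f x).
Proof.
move=> mf Ax.
have mAB : measurable (A `*` B) by exact: measurableX.
have : measurable_fun setT ((unc f) \_ (A `*` B)).
  exact/(measurable_restrictT _ mAB).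
move=> /(measurableT_comp)/(_ (pair1_measurable x)) H.
apply/(measurable_restrictT _ mB).
apply: eq_measurable_fun H => y _ /=; rewrite /patch.
have -> : ((x, y) \in A `*` B) = (y \in B).
  by apply/idP/idP => /set_mem => [[]|] *; rewrite inE.
by [].
Qed.

Lemma measurable_slice2 f y : measurable_fun (A `*` B) (unc f) -> B y ->
  measurable_fun A (f ^~ y).
Proof.
move=> mf By.
have mAB : measurable (A `*` B) by exact: measurableX.
have : measurable_fun setT ((unc f) \_ (A `*` B)).
  exact/(measurable_restrictT _ mAB).
move=> /(measurableT_comp)/(_ (pair2_measurable y)) H.
apply/(measurable_restrictT _ mA).
apply: eq_measurable_fun H => x _ /=; rewrite /patch.
have -> : ((x, y) \in A `*` B) = (x \in A).
  by apply/idP/idP => /set_mem => [[]|] *; rewrite inE.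
by [].
Qed.

Lemma restrict_slice1 f x : (fun y => ((EFin \o unc f) \_ (A `*` B)) (x, y)) =
  if x \in A then (EFin \o f x) \_ B else cst 0%E.
Proof.
apply/funext => y; rewrite /patch /=.
have -> : ((x, y) \in A `*` B) = (x \in A) && (y \in B).
  by apply/idP/andP => [/set_mem[] *|[/set_mem ? /set_mem ?]]; rewrite ?inE.
by case: (x \in A).
Qed.

Lemma restrict_slice2 f y : (fun x => ((EFin \o unc f) \_ (A `*` B)) (x, y)) =
  if y \in B then (EFin \o f ^~ y) \_ A else cst 0%E.
Proof.
apply/funext => x; rewrite /patch /=.
have -> : ((x, y) \in A `*` B) = (y \in B) && (x \in A).
  by apply/idP/andP => [/set_mem[] *|[/set_mem ? /set_mem ?]]; rewrite ?inE.
by case: (y \in B).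
Qed.

Lemma fubini_intg1 f : intg mm (A `*` B) (unc f) ->
  [/\ {ae m1, forall x, A x -> intg m2 B (f x)},
      intg m1 A (fun x => \int[m2]_(y in B) f x y) &
      \int[mm]_(z in A `*` B) f z.1 z.2 =
      \int[m1]_(x in A) \int[m2]_(y in B) f x y].
Proof.
move=> If; have mAB := measurableX mA mB.
pose F := (EFin \o unc f) \_ (A `*` B).
have IF : mm.-integrable setT F by apply/(@intg_patch _ _ _ mm _ mAB _).
have ae1 : {ae m1, forall x, A x -> intg m2 B (f x)}.
  have := ae_integrable1 IF; apply: aeS => x /=.
  rewrite restrict_slice1 => + Ax; rewrite mem_set// => H.
  exact/(@intg_patch _ _ _ m2 _ mB _).
have FE : {ae m1, forall x, setT x ->
    fubini_F m2 F x = ((EFin \o (fun x => \int[m2]_(y in B) f x y)) \_ A) x}.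
  apply: aeS ae1 => x H _; rewrite /fubini_F restrict_slice1 /patch.
  case: ifPn => [/set_mem Ax|_]; last by rewrite integral0.
  by rewrite -integral_mkcond/= -intg_EFin//; exact: H.
have IFF := integrable_fubini_F IF.
have mG : measurable_fun setT ((EFin \o (fun x => \int[m2]_(y in B) f x y)) \_ A).
  have mF := measurable_fubini_F IF.
  have -> : (EFin \o (fun x => \int[m2]_(y in B) f x y)) \_ A =
      EFin \o (fine \o fubini_F m2 F).
    apply/funext => x /=; rewrite /fubini_F restrict_slice1 /patch.
    case: ifPn => _; last by rewrite integral0.
    by rewrite -integral_mkcond.
  exact/measurable_EFinP/measurableT_comp.
split => //.
- apply/(@intg_patch _ _ _ m1 _ mA _).
  move: IFF => /integrableP[mF Foo]; apply/integrableP; split => //.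
  rewrite (@ae_eq_integral _ _ _ m1 setT (abse \o (fubini_F m2 F)))//.
  + exact: measurableT_comp.
  + exact: measurableT_comp.
  + by apply: aeS FE => x H _ /=; rewrite H.
- rewrite /Rintegral; congr fine.
  rewrite [LHS]integral_mkcond -(integral12_prod_meas1 IF) [RHS]integral_mkcond.
  have E : (\int[m1]_(x in setT) fubini_F m2 F x = \int[m1]_(x in setT)
      ((EFin \o (fun x => \int[m2]_(y in B) f x y)%R) \_ A) x)%E.
    by apply: ae_eq_integral => //; exact: (measurable_fubini_F IF).
  exact: E.
Qed.

Lemma fubini_intg2 f : intg mm (A `*` B) (unc f) ->
  [/\ {ae m2, forall y, B y -> intg m1 A (f ^~ y)},
      intg m2 B (fun y => \int[m1]_(x in A) f x y) &
      \int[mm]_(z in A `*` B) f z.1 z.2 =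
      \int[m2]_(y in B) \int[m1]_(x in A) f x y].
Proof.
move=> If; have mAB := measurableX mA mB.
pose F := (EFin \o unc f) \_ (A `*` B).
have IF : mm.-integrable setT F by apply/(@intg_patch _ _ _ mm _ mAB _).
have ae1 : {ae m2, forall y, B y -> intg m1 A (f ^~ y)}.
  have := ae_integrable2 IF; apply: aeS => y /=.
  rewrite restrict_slice2 => + By; rewrite mem_set// => H.
  exact/(@intg_patch _ _ _ m1 _ mA _).
have FE : {ae m2, forall y, setT y ->
    fubini_G m1 F y = ((EFin \o (fun y => \int[m1]_(x in A) f x y)) \_ B) y}.
  apply: aeS ae1 => y H _; rewrite /fubini_G restrict_slice2 /patch.
  case: ifPn => [/set_mem By|_]; last by rewrite integral0.
  by rewrite -integral_mkcond/= -intg_EFin//; exact: H.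
have IFF : m2.-integrable setT (fubini_G m1 F).
  have mF : measurable_fun setT F by exact: measurable_int IF.
  apply/integrableP; split; first exact: (measurable_fubini_G IF).
  have := (integrable21ltyP m1 m2 mF).1 IF; apply: le_lt_trans.
  apply: ge0_le_integral => //.
  - by apply: measurableT_comp => //; exact: (measurable_fubini_G IF).
  - apply: (measurable_fun_fubini_tonelli_G (m1 := m1) (abse \o F)).
      exact: measurableT_comp.
    by move=> y; exact: abse_ge0.
  - move=> y _; apply: le_abse_integral => //.
    exact: (measurableT_comp mF (pair2_measurable y)).
have mG : measurable_fun setT ((EFin \o (fun y => \int[m1]_(x in A) f x y)) \_ B).
  have mF := measurable_fubini_G IF.
  have -> : (EFin \o (fun y => \int[m1]_(x in A) f x y)) \_ B =
      EFin \o (fine \o fubini_G m1 F).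
    apply/funext => y /=; rewrite /fubini_G restrict_slice2 /patch.
    case: ifPn => _; last by rewrite integral0.
    by rewrite -integral_mkcond.
  exact/measurable_EFinP/measurableT_comp.
split => //.
- apply/(@intg_patch _ _ _ m2 _ mB _).
  move: IFF => /integrableP[mF Foo]; apply/integrableP; split => //.
  rewrite (@ae_eq_integral _ _ _ m2 setT (abse \o (fubini_G m1 F)))//.
  + exact: measurableT_comp.
  + exact: measurableT_comp.
  + by apply: aeS FE => x H _ /=; rewrite H.
- rewrite /Rintegral; congr fine.
  rewrite [LHS]integral_mkcond -(integral21_prod_meas1 IF) [RHS]integral_mkcond.
  have E : (\int[m2]_(y in setT) fubini_G m1 F y = \int[m2]_(y in setT)
      ((EFin \o (fun y => \int[m1]_(x in A) f x y)%R) \_ B) y)%E.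
    by apply: ae_eq_integral => //; exact: (measurable_fubini_G IF).
  exact: E.
Qed.

Lemma tonelli1 f : measurable_fun (A `*` B) (unc f) ->
  (forall x y, A x -> B y -> 0 <= f x y) ->
  (\int[mm]_(z in A `*` B) (f z.1 z.2)%:E =
   \int[m1]_(x in A) \int[m2]_(y in B) (f x y)%:E)%E.
Proof.
move=> mf f0; have mAB : measurable (A `*` B) by exact: measurableX.
rewrite integral_mkcond fubini_tonelli1; last 2 first.
- by apply/(measurable_restrictT _ mAB)/measurable_EFinP.
- move=> z; rewrite /patch; case: ifPn => // /set_mem[Az Bz].
  by rewrite lee_fin f0.
rewrite [RHS]integral_mkcond; apply: eq_integral => x _.
rewrite /fubini_F (restrict_slice1 f) /patch; case: ifPn => _.
  by rewrite -integral_mkcond.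
by rewrite integral0.
Qed.

Lemma intg_prod_dom1 f (g : T1 -> R) : measurable_fun (A `*` B) (unc f) ->
  intg m1 A g ->
  (forall x y, A x -> B y -> 0 <= f x y) ->
  {ae m1, forall x, A x -> intg m2 B (f x) /\ \int[m2]_(y in B) f x y <= g x} ->
  intg mm (A `*` B) (unc f).
Proof.
move=> mf ig f0 fC; apply: intg_ge0 => //; first exact: measurableX.
  by move=> z [Az Bz]; exact: f0.
rewrite tonelli1//.
apply: (@le_lt_trans _ _ (\int[m1]_(x in A) (`|g x|)%:E)%E); last first.
  by rewrite intg_EFin ?ltry//; exact: intg_norm.
apply: ae_ge0_le_integral => //.
- by move=> x Ax; apply: integral_ge0 => y By; rewrite lee_fin f0.
- have mAB : measurable (A `*` B) by exact: measurableX.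
  have : measurable_fun setT (fubini_F m2 ((EFin \o unc f) \_ (A `*` B))).
    apply: measurable_fun_fubini_tonelli_F.
      by apply/(measurable_restrictT _ mAB)/measurable_EFinP.
    move=> z; rewrite /patch; case: ifPn => // /set_mem[Az Bz].
    by rewrite lee_fin f0.
  move=> H; apply/(measurable_restrictT _ mA); apply: eq_measurable_fun H => x _.
  rewrite /fubini_F restrict_slice1 /patch; case: ifPn => _.
    by rewrite -integral_mkcond.
  by rewrite integral0.
- by apply/measurable_EFinP; exact: intg_meas (intg_norm _ ig).
- apply: aeS fC => x H Ax; have [Ifx C1] := H Ax.
  by rewrite intg_EFin// lee_fin (le_trans C1)// ler_norm.
Qed.

(** Tonelli's theorem for the indicator of the exceptional null set: almost every section of it is
    null. *)
Lemma ae_prod1 (P : T1 -> T2 -> Prop) :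
  {ae mm, forall z, (A `*` B) z -> P z.1 z.2} ->
  {ae m1, forall x, A x -> {ae m2, forall y, B y -> P x y}}.
Proof.
move=> [N [mN N0 NP]].
have mE : measurable_fun setT (fun z : T1 * T2 => (\1_N z)%:E : \bar R).
  exact/measurable_EFinP/measurable_indic.
have E0 z : (0 <= (\1_N z)%:E :> \bar R)%E by rewrite lee_fin.
have : (\int[mm]_z (\1_N z)%:E)%E = 0%E by rewrite integral_indic// setIT.
rewrite fubini_tonelli1 // => H.
have mF := measurable_fun_fubini_tonelli_F (m2 := m2) _ mE E0.
have F0 x : (0 <= fubini_F m2 (EFin \o \1_N) x)%E by apply: integral_ge0 => y _; rewrite lee_fin.
have : {ae m1, forall x, setT x -> fubini_F m2 (EFin \o \1_N) x = 0%E}.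
  apply/(ae_eq_integral_abs m1 measurableT mF).
  by rewrite -[RHS]H; apply: eq_integral => x _; rewrite gee0_abs.
apply: aeS => x /(_ I) Fx Ax.
exists (xsection N x); split.
- exact: measurable_xsection.
- rewrite -Fx /fubini_F -[xsection N x in LHS]setIT -integral_indic//; last first.
    exact: measurable_xsection.
  apply: eq_integral => y _ /=; rewrite !indicE; congr (_ %:R)%:E; congr nat_of_bool.
  exact: mem_xsection.
- move=> y /= nP; apply/xsectionP; apply: NP => /= H1.
  by apply: nP => By; exact: H1.
Qed.
End fubini.

(** * Integrals over intervals and absolutely continuous functions *)

Section interval_integrals.
Context (R : realType).
Local Notation mu := (@lebesgue_measure R).
Implicit Types (f g : R -> R) (a b c x y l : R).

Lemma mu_itv_lty a b : (mu `]a, b[ < +oo)%E.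
Proof. by rewrite lebesgue_measure_itv/=; case: ifP => _; rewrite ltry. Qed.

Lemma cst_intg (a b k : R) : intg mu `]a, b[ (fun=> k).
Proof.
by apply: (@intg_bounded _ _ _ mu _ _ _ `|k|) => //; exact: mu_itv_lty.
Qed.

Lemma mu_itvE l : 0 < l -> fine (mu `]0, l[) = l.
Proof. by move=> l0; rewrite lebesgue_measure_itv/= lte_fin l0 oppr0 adde0. Qed.

Lemma mu_itv_len (a b : R) : a <= b -> fine (mu `]a, b[) = b - a.
Proof.
rewrite le_eqVlt => /predU1P[->|ab]; last first.
  by rewrite /= lebesgue_measure_itv/= lte_fin ab.
by rewrite set_itvoo0 measure0 subrr.
Qed.

Lemma sub_itv_intg f a b c d : a <= c -> d <= b -> intg mu `]a, b[ f ->
  intg mu `]c, d[ f.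
Proof.
move=> ac db; apply: integrableS => //.
by apply: subset_itvW; rewrite ?ac ?db.
Qed.

Lemma RI_itv_split f a b c : a <= b -> b <= c -> intg mu `]a, c[ f ->
  \I_(a < x < c) f x =
  \I_(a < x < b) f x + \I_(b < x < c) f x.
Proof.
move=> ab bc If.
have [->|nab] := eqVneq a b.
  by rewrite set_itvoo0 Rintegral_set0 add0r.
have [->|nbc] := eqVneq b c.
  by rewrite set_itvoo0 Rintegral_set0 addr0.
have {nab}ab' : a < b by rewrite lt_neqAle nab.
have {nbc}bc' : b < c by rewrite lt_neqAle nbc.
have := @Rintegral_itvB _ f (BRight a) (BLeft c) b If.
rewrite !bnd_simp => /(_ ab bc') <-.
have E : \int[mu]_(t in `]a, b]) f t = \I_(a < t < b) f t.
  by rewrite (Rintegral_itv_bndo_bndc (sub_itv_intg (lexx a) bc If)).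
by rewrite E addrC subrK.
Qed.

Lemma le_RI_itv f a b c d : a <= b -> b <= c -> c <= d -> intg mu `]a, d[ f ->
  (forall x, 0 <= f x) -> \I_(b < x < c) f x <= \I_(a < x < d) f x.
Proof.
move=> ab bc cd fi f0; have R0 x y : 0 <= \I_(x < z < y) f z by apply: RI_ge0 => z _.
rewrite (RI_itv_split ab (le_trans bc cd) fi) (RI_itv_split bc cd) ?lerDr; last exact: sub_itv_intg fi.
by rewrite addrCA lerDl addr_ge0.
Qed.

Lemma RI_itv_sub f a x y : a <= x -> x <= y -> intg mu `]a, y[ f ->
  \I_(a < t < y) f t - \I_(a < t < x) f t =
  \I_(x < t < y) f t.
Proof. by move=> ax xy If; rewrite (RI_itv_split ax xy If) addrAC subrr add0r. Qed.

(** Truncation: the excess max(|f| - n, 0) over a high level n has small integral on the whole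
    interval, and on a short interval the rest contributes at most n + 1 times the length. *)
Lemma intg_small f l (e : R) : intgI l f -> 0 < e ->
  exists d, 0 < d /\ forall x y, 0 <= x -> x <= y -> y <= l -> y - x <= d ->
    \I_(x < t < y) `|f t| <= e.
Proof.
move=> If e0.
have mI : measurable `]0, l[ by exact: measurable_itv.
have mf := intg_meas If.
pose u n x : R := Num.max (`|f x| - n%:R) 0.
have mu_ n : measI l (u n).
  apply: measurable_maxr => //; apply: measurable_funB => //.
  exact: measurableT_comp.
have u0 n x : 0 <= u n x by rewrite /u le_max lexx orbT.
have uf n x : u n x <= `|f x|.
  by rewrite /u ge_max gerBl normr_ge0 ler0n.
have [] := @R_dct _ _ R mu `]0, l[ mI u (cst 0) (fun x => `|f x|).
- by [].
- exact: measurable_cst.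
- apply: aeT => x _ /=.
  apply/cvgrPdist_le => k k0; near=> n.
  have H : `|f x| - n%:R <= 0.
    by rewrite subr_le0; near: n; exact: nbhs_infty_ger.
  by rewrite sub0r normrN /u max_r// normr0 ltW.
- exact: intg_norm.
- by apply: aeT => x _ n; rewrite ger0_norm.
move=> _ + _; rewrite Rintegral_cst// mul0r => /cvgrPdist_le.
have e2 : 0 < e / 2 by rewrite divr_gt0.
move=> /(_ _ e2)[n _ /(_ n (leqnn n))/=].
rewrite sub0r normrN ger0_norm ?Rintegral_ge0// => Hn.
have Iu : intgI l (u n).
  apply: (@intg_le _ _ R mu _ _ (u n) (fun x => `|f x|)) => //; last exact: intg_norm.
  - exact: mu_.
  - by move=> x _; rewrite ger0_norm.
exists (e / 2 / n.+1%:R); split; first by rewrite divr_gt0// ltr0n.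
move=> x y x0 xy yl yxd.
have If' : intg mu `]x, y[ f by exact: sub_itv_intg If.
have Iu' : intg mu `]x, y[ (u n) by exact: sub_itv_intg Iu.
have Ic : intg mu `]x, y[ (fun=> n.+1%:R : R).
  apply: (@intg_bounded _ _ _ _ _ _ _ n.+1%:R) => //; first exact: mu_itv_lty.
  by move=> t _; rewrite ger0_norm.
apply: (@le_trans _ _ (\I_(x < t < y) (n.+1%:R + u n t))).
  apply: le_RI => //; [exact: intg_norm|exact: intgD|].
  move=> t _; rewrite -lerBlDl /u le_max; apply/orP; left.
  by rewrite lerD2l lerN2 ler_nat.
rewrite RID//; rewrite RI_cst//.
rewrite mu_itv_len//.
rewrite [e]splitr lerD//.
  by rewrite mulrC -ler_pdivlMr ?ltr0n.
apply: le_trans Hn.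
by apply: le_RI_itv.
Unshelve. all: by end_near. Qed.

End interval_integrals.

(** The derivative is carried as data: f is prescribed at every point of [0,l], while g matters only
    up to null sets. *)
Definition abscont (R : realType) (l : R) (f g : R -> R) : Prop :=
  intg (@lebesgue_measure R) `]0, l[ g /\
  forall x, 0 <= x -> x <= l ->
    f x = f 0 + \int[@lebesgue_measure R]_(t in `]0, x[) g t.

Section absolute_continuity.
Context (R : realType).
Local Notation mu := (@lebesgue_measure R).
Implicit Types (f g h : R -> R) (a b c x y l : R).

Lemma AC_diff l f g x y : abscont l f g -> 0 <= x -> x <= y -> y <= l ->
  f y - f x = \I_(x < t < y) g t.
Proof.
move=> [Ig fg] x0 xy yl.
rewrite (fg y) ?(le_trans x0)// (fg x) ?(le_trans xy)// opprD addrACA subrr add0r.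
rewrite RI_itv_sub//; exact: sub_itv_intg Ig.
Qed.

Lemma AC_norm l f g x y : abscont l f g -> 0 <= x -> x <= y -> y <= l ->
  `|f y - f x| <= \I_(x < t < y) `|g t|.
Proof.
move=> fg x0 xy yl; rewrite (AC_diff fg)//; apply: RI_norm => //.
by have [Ig _] := fg; exact: sub_itv_intg Ig.
Qed.

Lemma AC_unif l f g (e : R) : abscont l f g -> 0 < e ->
  exists d, 0 < d /\ forall x y, 0 <= x -> x <= y -> y <= l -> y - x <= d ->
    `|f y - f x| <= e.
Proof.
move=> fg e0; have [Ig _] := fg.
have [d [d0 H]] := intg_small Ig e0; exists d; split => // x y x0 xy yl yx.
exact: le_trans (AC_norm fg x0 xy yl) (H _ _ x0 xy yl yx).
Qed.

Lemma AC_bounded l f g x : abscont l f g -> 0 <= x -> x <= l ->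
  `|f x| <= `|f 0| + \I_(t < l) `|g t|.
Proof.
move=> fg x0 xl; have [Ig _] := fg.
rewrite -{1}(subrK (f 0) (f x)) (le_trans (ler_normD _ _))// addrC lerD2l.
apply: le_trans (AC_norm fg (lexx 0) x0 xl) _.
rewrite (RI_itv_split x0 xl); first by rewrite lerDl Rintegral_ge0.
exact: intg_norm.
Qed.

Lemma AC_continuous l f g x : abscont l f g -> 0 < x < l -> {for x, continuous f}.
Proof.
move=> fg /andP[x0 xl]; apply/cvgrPdist_le => e e0.
have [d [d0 H]] := AC_unif fg e0.
near=> y.
have y0 : 0 <= y by apply: ltW; near: y; exact: lt_nbhsr.
have yl : y <= l by apply: ltW; near: y; exact: lt_nbhsl.
have xyd : `|x - y| <= d by near: y; exact: cvgr_dist_le.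
have [xy|yx] := leP x y.
  by rewrite distrC H// 1?ltW// -(ger0_norm (_ : 0 <= y - x)) ?subr_ge0// distrC.
by rewrite H// 1?ltW// -(ger0_norm (_ : 0 <= x - y)) ?subr_ge0// ltW.
Unshelve. all: by end_near. Qed.

Lemma AC_measurable l f g : abscont l f g -> measI l f.
Proof.
move=> fg; apply: open_continuous_measurable_fun; first exact: interval_open.
by move=> x /set_mem/=; rewrite in_itv/=; exact: (AC_continuous fg).
Qed.

(** On a partition of [0,x] finer than d the local errors add up to at most e times the integral of
    h, and e is arbitrary. Products are treated by this criterion, without differentiating at any
    point. *)
Lemma AC_criterion l f g h : intgI l g -> intgI l h ->
  (forall t, 0 <= h t) ->
  (forall e, 0 < e -> exists d, 0 < d /\
    forall x y, 0 <= x -> x <= y -> y <= l -> y - x <= d ->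
    `|f y - f x - \I_(x < t < y) g t| <=
      e * \I_(x < t < y) h t) ->
  abscont l f g.
Proof.
move=> Ig Ih h0 H; split => // x x0 xl.
suff E e : 0 < e -> `|f x - f 0 - \I_(t < x) g t| <=
    e * \I_(t < l) h t.
  have /eqP : `|f x - f 0 - \I_(t < x) g t| == 0.
    rewrite eq_le normr_ge0 andbT; apply/ler_addgt0Pr => e e0; rewrite add0r.
    set K := \I_(t < l) h t in E.
    have K0 : 0 <= K by exact: Rintegral_ge0.
    apply: le_trans (E (e / (K + 1)) _) _; first by rewrite divr_gt0//; lra.
    rewrite mulrAC ler_pdivrMr; last by lra.
    by rewrite ler_pM2l//; lra.
  by move/normr0_eq0 => E0; apply/eqP; rewrite -subr_eq0 opprD addrA E0.
move=> e0; have [d [d0 {}H]] := H e e0.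
pose n := (Num.truncn (x / d)).+1.
have n0 : (0 : R) < n%:R by rewrite ltr0n.
pose r := x / n%:R.
have r0 : 0 <= r by rewrite divr_ge0// ltW.
have rd : r <= d.
  rewrite /r ler_pdivrMr// mulrC -ler_pdivrMr// ltW//.
  by rewrite /n; exact: truncnS_gt.
have K k : (k <= n)%N ->
    `|f (k%:R * r) - f 0 - \I_(t < k%:R * r) g t| <=
    e * \I_(t < k%:R * r) h t.
  elim: k => [_|k IH kn].
    by rewrite mul0r subrr set_itvoo0 !Rintegral_set0 subrr normr0 mulr0.
  have kr0 : 0 <= k%:R * r by rewrite mulr_ge0.
  have kk : k%:R * r <= k.+1%:R * r by rewrite ler_wpM2r// ler_nat.
  have krx : k.+1%:R * r <= x.
    rewrite /r mulrCA ler_piMr// ler_pdivrMr// mul1r ler_nat//.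
  have krl := le_trans krx xl.
  have Ig' : intgI (k.+1%:R * r) g by exact: sub_itv_intg Ig.
  have Ih' : intgI (k.+1%:R * r) h by exact: sub_itv_intg Ih.
  rewrite (RI_itv_split kr0 kk Ig') (RI_itv_split kr0 kk Ih') mulrDr.
  have d1 : k.+1%:R * r - k%:R * r <= d.
    by rewrite -mulrBl -natrB// subSnn mul1r.
  have := H _ _ kr0 kk krl d1; have := IH (ltnW kn).
  rewrite !ler_norml => /andP[a1 a2] /andP[b1 b2].
  by apply/andP; split; lra.
have := K n (leqnn _); rewrite /r mulrCA divff ?gt_eqF// mulr1 => /le_trans; apply.
rewrite ler_pM2l// (RI_itv_split x0 xl Ih) lerDl Rintegral_ge0//.
Qed.

Lemma AC_intg l f g h : abscont l f g -> intgI l h ->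
  intgI l (fun x => f x * h x).
Proof.
move=> fg Ih; apply: (@intg_mul_bounded _ _ _ _ _ _ _ _
    (`|f 0| + \I_(t < l) `|g t|)) => //.
  exact: AC_measurable fg.
by move=> x /=; rewrite in_itv/= => /andP[x0 xl]; apply: (AC_bounded fg); exact: ltW.
Qed.

Lemma AC_osc l f g x y t : abscont l f g -> 0 <= x -> x <= t -> t <= y -> y <= l ->
  `|f t - f x| <= \I_(x < s < y) `|g s| /\
  `|f y - f t| <= \I_(x < s < y) `|g s|.
Proof.
move=> fg x0 xt ty yl; have [Ig _] := fg.
have If' : intg mu `]x, y[ (fun s => `|g s|).
  by apply: intg_norm => //; apply: sub_itv_intg Ig.
have t0 := le_trans x0 xt; have tl := le_trans ty yl.
rewrite (RI_itv_split xt ty If'); split.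
  by apply: le_trans (AC_norm fg x0 xt tl) _; rewrite lerDl Rintegral_ge0.
by apply: le_trans (AC_norm fg t0 ty yl) _; rewrite lerDr Rintegral_ge0.
Qed.

Lemma AC_mul l f f' g g' : abscont l f f' -> abscont l g g' ->
  abscont l (fun x => f x * g x) (fun x => g x * f' x + f x * g' x).
Proof.
move=> ff gg; have [If _] := ff; have [Ig _] := gg.
have mI : measurable `]0, l[ by exact: measurable_itv.
have I1 := AC_intg gg If; have I2 := AC_intg ff Ig.
apply: (@AC_criterion _ _ _ (fun x => `|f' x| + `|g' x|)).
- exact: intgD.
- by apply: intgD => //; exact: intg_norm.
- by move=> t; rewrite addr_ge0.
move=> e e0.
have [d1 [d10 H1]] := intg_small If e0.
have [d2 [d20 H2]] := intg_small Ig e0.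
exists (Num.min d1 d2); split; first by rewrite lt_min d10.
move=> x y x0 xy yl; rewrite le_min => /andP[yx1 yx2].
have {}H1 := H1 x y x0 xy yl yx1; have {}H2 := H2 x y x0 xy yl yx2.
have sub k : intgI l k -> intg mu `]x, y[ k by apply: sub_itv_intg.
have mxy : measurable `]x, y[ by exact: measurable_itv.
(* The defect of the product rule on [x,y] is an integral of f' and g' against increments of g and
   f, which are small by uniform continuity. *)
have E : f y * g y - f x * g x - \I_(x < t < y) (g t * f' t + f t * g' t) =
   \I_(x < t < y) ((g y - g t) * f' t + (f x - f t) * g' t).
  have -> : f y * g y - f x * g x = g y * (f y - f x) + f x * (g y - g x) by ring.
  rewrite (AC_diff ff)// (AC_diff gg)// -!RIZ//; [|exact: sub..].
  rewrite -RID//; [|by apply: intgZ => //; exact: sub..].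
  rewrite -RIB//; last 2 first.
  - by apply: intgD => //; apply: intgZ => //; exact: sub.
  - by apply: intgD => //; exact: sub.
  by apply: eq_RI => // t _; ring.
have Ik : intg mu `]x, y[ (fun t => (g y - g t) * f' t + (f x - f t) * g' t).
  have : intg mu `]x, y[ (fun t => g y * f' t - g t * f' t + (f x * g' t - f t * g' t)).
    apply: intgD => //; apply: intgB => //;
      by [apply: intgZ => //; exact: sub|exact: sub].
  by apply: eq_intg => // t _; ring.
rewrite E; apply: le_trans (RI_norm _ Ik) _ => //.
have Ih : intg mu `]x, y[ (fun t => `|f' t| + `|g' t|).
  by apply: intgD => //; apply: intg_norm => //; exact: sub.
rewrite -RIZ//; apply: le_RI => //; [exact: intg_norm|exact: intgZ|].
move=> t /=; rewrite in_itv/= => /andP[xt ty].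
have [f1 f2] := AC_osc ff x0 (ltW xt) (ltW ty) yl.
have [g1 g2] := AC_osc gg x0 (ltW xt) (ltW ty) yl.
rewrite (le_trans (ler_normD _ _))// !normrM mulrDr lerD// ler_wpM2r//.
  exact: le_trans H2.
rewrite distrC; exact: le_trans H1.
Qed.

Lemma AC_sqint l f g : abscont l f g -> sqintI l f.
Proof.
move=> fg; apply: (@sqint_bounded _ _ _ mu _ _ _ (`|f 0| + \I_(t < l) `|g t|)) => //.
- exact: mu_itv_lty.
- exact: AC_measurable fg.
by move=> x /inI[x0 xl]; apply: (AC_bounded fg); exact: ltW.
Qed.

Lemma ACB l f g f' g' : abscont l f g -> abscont l f' g' ->
  abscont l (fun s => f s - f' s) (fun s => g s - g' s).
Proof.
move=> [ig fg] [ig' fg']; split=> [|x x0 xl]; first exact: intgB.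
by rewrite fg// fg'// RIB//; [ring|exact: sub_itv_intg ig|exact: sub_itv_intg ig'].
Qed.

Lemma intg_comp l (F u : R -> R) (M : R) : continuous F -> (forall a, `|F a| <= M) ->
  measI l u -> intgI l (fun s => F (u s)).
Proof.
move=> cF FM mu_; apply: (@intg_bounded _ _ _ mu _ _ _ M) => //; first exact: mu_itv_lty.
by apply: (measurableT_comp (f := F)) => //; exact: continuous_measurable_fun.
Qed.

End absolute_continuity.

(** Smoothness for all members of a class closed under differentiation: no iterated derivative has
    to be computed. *)
Lemma derivable_derive1n (R : realType) (K : set (R -> R)) :
  (forall f, K f -> exists g, K g /\ forall x, is_derive x (1 : R) f (g x)) ->
  forall f, K f -> forall n x, derivable (derive1n n f) x (1 : R).
Proof.
move=> KK f Kf n.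
have Kn : K (derive1n n f).
  elim: n => // n /KK[g [Kg fg]]; rewrite derive1nS.
  suff -> : derive1 (derive1n n f) = g by [].
  by apply/funext => x; rewrite derive1E; have /@derive_val -> := fg x.
by move=> x; have [g [_ fg]] := KK _ Kn; have /@ex_derive := fg x.
Qed.

Section derivatives.
Context (R : realType).
Implicit Types (f g : R -> R) (x c df dg : R).

Lemma dD f g x df dg : is_derive x (1 : R) f df -> is_derive x (1 : R) g dg ->
  is_derive x (1 : R) (fun y => f y + g y) (df + dg).
Proof. exact: is_deriveD. Qed.

Lemma dB f g x df dg : is_derive x (1 : R) f df -> is_derive x (1 : R) g dg ->
  is_derive x (1 : R) (fun y => f y - g y) (df - dg).
Proof. exact: is_deriveB. Qed.

Lemma dM f g x df dg : is_derive x (1 : R) f df -> is_derive x (1 : R) g dg ->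
  is_derive x (1 : R) (fun y => f y * g y) (df * g x + f x * dg).
Proof.
move=> Hf Hg; apply: (is_derive_eq (is_deriveM Hf Hg)).
by rewrite /GRing.scale/= addrC mulrC.
Qed.

Lemma dZ f x c df : is_derive x (1 : R) f df ->
  is_derive x (1 : R) (fun y => c * f y) (c * df).
Proof.
move=> Hf; have := dM (is_derive_cst c x 1) Hf.
by move=> H; apply: is_derive_eq H _; rewrite mul0r add0r.
Qed.

Lemma dX f x df k : is_derive x (1 : R) f df ->
  is_derive x (1 : R) (fun y => f y ^+ k) (k%:R * f x ^+ k.-1 * df).
Proof. by move=> /(is_deriveX k); rewrite exprfctE. Qed.

Lemma dV x : x != 0 -> is_derive x (1 : R) (fun y => y^-1) (- x^-1 ^+ 2).
Proof.
move=> x0; have := @is_deriveV _ id x 1 1 x0 (is_derive_id x 1).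
by move=> H; apply: is_derive_eq H _; rewrite /GRing.scale/= mulr1 exprVn.
Qed.

Lemma dcomp f g x df dg : is_derive (g x) (1 : R) f df ->
  is_derive x (1 : R) g dg -> is_derive x (1 : R) (fun y => f (g y)) (df * dg).
Proof. exact: is_derive1_comp. Qed.

Lemma daffine x c a : is_derive x (1 : R) (fun y => (y - a) * c) c.
Proof.
have H := dM (dB (is_derive_id x 1) (is_derive_cst a x 1)) (is_derive_cst c x 1).
by apply: is_derive_eq H _; rewrite subr0 mul1r mulr0 addr0.
Qed.

End derivatives.

(** * Test functions *)

Section bump.
Context (R : realType).
Local Notation mu := (@lebesgue_measure R).
Implicit Types (x y a b s : R) (k m n : nat).

(** The classical e^(-1/x), with powers of 1/x so that the derivative of [flat k] is a combination
    of [flat k.+1] and [flat k.+2]. *)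
Definition flat k x : R := if 0 < x then x^-1 ^+ k * expR (- x^-1) else 0.

Lemma flat_ge0 k x : 0 <= flat k x.
Proof.
rewrite /flat; case: ifP => // x0.
by rewrite mulr_ge0 ?expR_ge0// exprn_ge0// invr_ge0 ltW.
Qed.

(** The exponential series gives e^(1/x) >= x^-(k+2) / (k+2)!. The resulting factor x^2 makes the
    difference quotient at 0 tend to 0. *)
Lemma flat_le k x : 0 < x -> flat k x <= (k.+2)`!%:R * x ^+ 2.
Proof.
move=> x0; rewrite /flat x0 expRN -ler_pdivrMr ?exprn_gt0//.
rewrite mulrAC ler_pdivrMr ?expR_gt0// -ler_pdivrMl ?ltr0n ?fact_gt0//.
have := @expR_ge1Dxn R x^-1 k.+1; rewrite invr_ge0 (ltW x0) => /(_ isT).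
apply: le_trans; rewrite -exprVn -exprD addn2 mulrC lerDr//.
Qed.

Lemma is_derive_flat k x :
  is_derive x (1 : R) (flat k) (- k%:R * flat k.+1 x + flat k.+2 x).
Proof.
have [x0|x0|->] := ltgtP x 0.
- have -> : - k%:R * flat k.+1 x + flat k.+2 x = 0.
    by rewrite /flat !ltNge (ltW x0)/= mulr0 addr0.
  have H : is_derive x (1 : R) (cst (0 : R)) 0 by exact: is_derive_cst.
  apply: near_eq_is_derive H; near=> y.
  rewrite /flat ifF//; apply/negbTE; rewrite -leNgt ltW//.
  by near: y; exact: lt_nbhsl.
- have H : is_derive x (1 : R) (fun x => x^-1 ^+ k * expR (- x^-1))
      (- k%:R * flat k.+1 x + flat k.+2 x).
    rewrite /flat x0.
    have xn0 : x != 0 by rewrite gt_eqF.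
    have H1 := dV xn0.
    have H3 : is_derive x (1 : R) (fun y => - y^-1) (x^-1 ^+ 2).
      by have H := dB (is_derive_cst 0 x 1) H1; apply: is_derive_eq (is_deriveN H1) _; rewrite opprK.
    have H5 := dM (dX k H1) (dcomp (is_derive_expR _) H3).
    apply: (is_derive_eq H5).
    case: k {H5} => [|k]; first by rewrite !expr0 expr2; ring.
    by rewrite /= !exprS expr0; set E := expR _; set X := x^-1 ^+ k; ring.
  apply: near_eq_is_derive H; near=> y.
  by rewrite /flat ifT//; near: y; exact: lt_nbhsr.
- have -> : - k%:R * flat k.+1 0 + flat k.+2 0 = 0.
    by rewrite /flat ltxx mulr0 addr0.
  have H : h^-1 *: (flat k (h *: 1 + 0) - flat k 0) @[h --> (0:R)^'] --> (0 : R).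
    apply/cvgrPdist_le => e e0.
    have f0 : (0 : R) < (k.+2)`!%:R by rewrite ltr0n fact_gt0.
    near=> h.
    have h0 : h != 0 by near: h; exact: nbhs_dnbhs_neq.
    rewrite sub0r normrN addr0 {2}/flat ltxx subr0 /GRing.scale/= mulr1.
    have [hp|hn] := ltP 0 h; last first.
      by rewrite /flat ltNge hn/= mulr0 normr0 ltW.
    rewrite ger0_norm; last by rewrite mulr_ge0 ?flat_ge0// invr_ge0 ltW.
    rewrite ler_pdivrMl// (le_trans (flat_le _ hp))// expr2 mulrA mulrC.
    rewrite ler_wpM2l ?(ltW hp)// mulrC -ler_pdivlMr//.
    rewrite -[X in X <= _]gtr0_norm//.
    near: h; apply: dnbhs0_le.
    by rewrite divr_gt0.
  by apply: DeriveDef; [apply/cvg_ex; exists 0|apply/cvg_lim].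
Unshelve. all: by end_near. Qed.

Definition hump k m a s x : R :=
  flat k ((x - a) * s) * flat m (1 - (x - a) * s).

(** The linear span of the functions [hump], stable under differentiation thanks to the recursion
    for [flat]. *)
Inductive humps : (R -> R) -> Prop :=
| humps0 : humps (fun=> 0)
| humpsD c k m a s f : humps f -> humps (fun x => c * hump k m a s x + f x).

Lemma humps_derive f : humps f ->
  exists g, humps g /\ forall x, is_derive x (1 : R) f (g x).
Proof.
elim=> [|c k m a s h Kh [h' [Kh' hh']]].
  by exists (fun=> 0); split; [exact: humps0|move=> x; exact: is_derive_cst].
pose g := fun x => (c * s * - k%:R) * hump k.+1 m a s x +
  ((c * s) * hump k.+2 m a s x + ((c * s * m%:R) * hump k m.+1 a s x +
  ((- (c * s)) * hump k m.+2 a s x + h' x))).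
exists g; split; first by do 4 apply: humpsD.
move=> x.
have H1 := daffine x s a.
have H2 := dB (is_derive_cst (1 : R) x 1) H1.
have H5 := dZ c (dM (dcomp (is_derive_flat k _) H1) (dcomp (is_derive_flat m _) H2)).
have H6 := dD H5 (hh' x).
by apply: (is_derive_eq H6); rewrite /g /hump; ring.
Qed.

Lemma hump_derive1 a s : exists g, humps g /\
  forall x, is_derive x (1 : R) (hump 0 0 a s) (g x).
Proof.
have [g [Kg Hg]] := humps_derive (humpsD 1 0 0 a s humps0).
exists g; split => // x; have := Hg x.
by under [X in is_derive _ _ X _]eq_fun do rewrite mul1r addr0.
Qed.

Lemma hump_continuous a s : continuous (hump 0 0 a s).
Proof.
move=> x; apply: differentiable_continuous; apply/derivable1_diffP.
by have [g [_ /(_ x)/@ex_derive]] := hump_derive1 a s.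
Qed.

Definition bump : R -> R := hump 0 0 0 1.

Lemma bumpE a s x : hump 0 0 a s x = bump ((x - a) * s).
Proof. by rewrite /bump /hump subr0 mulr1. Qed.

Lemma bump_out x : x <= 0 \/ 1 <= x -> bump x = 0.
Proof.
rewrite /bump /hump subr0 mulr1 /flat => -[x0|x1].
  by rewrite ltNge x0/= mul0r.
by rewrite [0 < 1 - x]ltNge subr_le0 x1/= mulr0.
Qed.

Lemma bump_ge0 x : 0 <= bump x.
Proof. by rewrite mulr_ge0// flat_ge0. Qed.

Lemma bump_le1 x : bump x <= 1.
Proof.
have F y : flat 0 y <= 1.
  rewrite /flat; case: ifP => // y0; rewrite expr0 mul1r expR_le1 oppr_le0.
  by rewrite invr_ge0 ltW.
by rewrite mulr_ile1// flat_ge0.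
Qed.

Lemma bump_gt0 : 0 < bump 2^-1.
Proof.
rewrite /bump /hump subr0 mulr1 (_ : 1 - 2^-1 = 2^-1); last by field.
by rewrite mulr_gt0// /flat ifT ?invr_gt0// mulr_gt0 ?expR_gt0// exprn_gt0// invr_gt0 invr_gt0.
Qed.

Lemma bump_continuous : continuous bump.
Proof. exact: hump_continuous. Qed.

Lemma bump_intg x y : intg mu `[x, y] bump.
Proof.
apply: (@intg_bounded _ _ _ mu _ _ _ 1) => //.
- by rewrite /= lebesgue_measure_itv/=; case: ifP => _; rewrite ?ltry.
- by apply: measurable_funS (continuous_measurable_fun bump_continuous).
- by move=> t _; rewrite ger0_norm ?bump_ge0// bump_le1.
Qed.

(** The integral starts at -1 and not at 0, so that 0 is an interior point for the fundamental
    theorem of calculus; [bump] vanishes in between. *)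
Let P x := \int[mu]_(t in `[-1, x]) bump t.

Let P_le0 x : x <= 0 -> P x = 0.
Proof.
move=> x0; apply: RI_eq0 => // t /=; rewrite in_itv/= => /andP[_ tx].
by rewrite bump_out//; left; exact: le_trans x0.
Qed.

Let P_diff x y : 0 <= x -> x <= y -> P y - P x = \int[mu]_(t in `]x, y]) bump t.
Proof.
move=> x0 xy; rewrite /P Rintegral_itvB//; first exact: bump_intg.
by rewrite bnd_simp (le_trans _ x0).
Qed.

Let P_homo x y : x <= y -> P x <= P y.
Proof.
move=> xy; have [x0|x0] := leP x 0.
  by rewrite P_le0// Rintegral_ge0// => t _; exact: bump_ge0.
rewrite -subr_ge0 P_diff ?(ltW x0)// Rintegral_ge0// => t _; exact: bump_ge0.
Qed.

Let P_ge1 x : 1 <= x -> P x = P 1.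
Proof.
move=> x1; apply/eqP; rewrite -subr_eq0 P_diff//.
apply/eqP; apply: RI_eq0 => // t /=; rewrite in_itv/= => /andP[tx _].
by rewrite bump_out//; right; exact: ltW.
Qed.

Let is_derive_P x : is_derive x (1 : R) P (bump x).
Proof.
have [x0|x0] := ltP x 0.
  rewrite bump_out; last by left; exact: ltW.
  apply: near_eq_is_derive (is_derive_cst (0 : R) x 1); near=> y.
  by rewrite P_le0// ltW//; near: y; exact: lt_nbhsl.
have xu : x < x + 1 by rewrite ltrDl.
have ax : -1 < x by apply: lt_le_trans x0; rewrite ltrN10.
have [d1 d2] := continuous_FTC1_closed xu (bump_intg (-1) (x + 1)) ax (@bump_continuous x).
have E : derive1 P x = bump x by exact: d2.
by apply: DeriveDef; [exact: d1|rewrite -derive1E; exact: E].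
Unshelve. all: by end_near. Qed.

(** Otherwise the monotone function P would vanish identically, against its derivative [bump] at
    1/2. *)
Let P1_gt0 : 0 < P 1.
Proof.
rewrite lt_def -{2}(P_le0 (lexx 0)) P_homo// andbT; apply/eqP => P10.
have P0 x : P x = 0.
  have [x1|/ltW x1] := leP 1 x; first by rewrite P_ge1.
  apply/eqP; rewrite eq_le -{1}P10 P_homo//=.
  by rewrite Rintegral_ge0// => t _; exact: bump_ge0.
have H := is_derive_P 2^-1.
have H0 : is_derive (2^-1 : R) (1 : R) P 0.
  have -> : P = cst 0 by apply/funext => x; rewrite P0.
  exact: is_derive_cst.
have := bump_gt0; have /@derive_val <- := H; have /@derive_val -> := H0.
by rewrite ltxx.
Qed.

Definition step x : R := P x / P 1.

Definition step' x : R := bump x / P 1.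

Lemma step_le0 x : x <= 0 -> step x = 0.
Proof. by move=> x0; rewrite /step P_le0// mul0r. Qed.

Lemma step_ge1 x : 1 <= x -> step x = 1.
Proof. by move=> x1; rewrite /step P_ge1// divff// gt_eqF. Qed.

Lemma step_ge0 x : 0 <= step x.
Proof. by rewrite divr_ge0 ?(ltW P1_gt0)// Rintegral_ge0// => t _; exact: bump_ge0. Qed.

Lemma step_le1 x : step x <= 1.
Proof.
rewrite /step ler_pdivrMr// mul1r; have [x1|/ltW x1] := leP 1 x.
  by rewrite P_ge1.
exact: P_homo.
Qed.

Lemma is_derive_step x : is_derive x (1 : R) step (step' x).
Proof.
have := dZ (P 1)^-1 (is_derive_P x).
by under eq_fun do rewrite mulrC; rewrite mulrC.
Qed.

Lemma is_derive_step_affine a s x :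
  is_derive x (1 : R) (fun y => step ((y - a) * s)) (step' ((x - a) * s) * s).
Proof. exact: dcomp (is_derive_step _) (daffine x _ a). Qed.

(* [plateau a b n] is smooth, increases from 0 to 1 on [a, a + 1/(n+1)] and
   decreases from 1 to 0 on [b, b + 1/(n+1)]. *)
Definition plateau a b n x : R :=
  step ((x - a) * n.+1%:R) - step ((x - b) * n.+1%:R).

Definition plateau' a b n x : R :=
  step' ((x - a) * n.+1%:R) * n.+1%:R - step' ((x - b) * n.+1%:R) * n.+1%:R.

Lemma is_derive_plateau a b n x :
  is_derive x (1 : R) (plateau a b n) (plateau' a b n x).
Proof.
exact: dB (is_derive_step_affine _ _ _) (is_derive_step_affine _ _ _).
Qed.

Lemma plateau'E a b n : plateau' a b n = derive1 (plateau a b n).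
Proof.
apply/funext => x; rewrite derive1E.
by have /@derive_val -> := is_derive_plateau a b n x.
Qed.

Lemma plateau_test l a b n : 0 < a -> a <= b -> b + n.+1%:R^-1 < l ->
  test_function 0 l (plateau a b n).
Proof.
move=> a0 ab bl; split.
  (* The derivative of the plateau lies in [humps], so the class made of [humps] and of the plateau
     itself is closed under differentiation. *)
  apply: (@derivable_derive1n _
    [set f | humps f \/ f = plateau a b n]); last by right.
  move=> f [/humps_derive[g [Kg fg]]|->]; first by exists g; split => //; left.
  exists (plateau' a b n); split; last by move=> x; exact: is_derive_plateau.
  left; pose c := n.+1%:R / P 1.
  have := humpsD c 0 0 a n.+1%:R (humpsD (- c) 0 0 b n.+1%:R humps0).
  congr humps; apply/funext => x.
  by rewrite !bumpE /plateau' /step' /c; ring.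
exists a, (b + n.+1%:R^-1); split => // x; rewrite in_itv/= negb_and -!ltNge.
have n0 : (0 : R) < n.+1%:R by rewrite ltr0n.
move=> /orP[xa|bx]; rewrite /plateau.
  rewrite !step_le0 ?subrr//; rewrite nmulr_rle0// subr_lt0//.
  exact: lt_le_trans ab.
have H : 1 <= (x - b) * n.+1%:R.
  by rewrite -ler_pdivrMr// lerBrDl div1r ltW.
rewrite !step_ge1 ?subrr//; apply: le_trans H _.
by rewrite ler_pM2r// lerD2l lerN2.
Qed.

Lemma plateau_norm a b n x : `|plateau a b n x| <= 1.
Proof.
rewrite /plateau ler_norml.
have := step_ge0 ((x - a) * n.+1%:R); have := step_le1 ((x - a) * n.+1%:R).
have := step_ge0 ((x - b) * n.+1%:R); have := step_le1 ((x - b) * n.+1%:R).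
by move=> ? ? ? ?; apply/andP; split; lra.
Qed.

Lemma plateau_cvg a b x : a <= b ->
  plateau a b n x @[n --> \oo] --> (((a < x) && (x <= b))%:R : R).
Proof.
move=> ab.
have S (c : R) : step ((x - c) * n.+1%:R) @[n --> \oo] --> ((c < x)%R%:R : R).
  have [xc|cx] := leP x c.
    under eq_fun do rewrite step_le0 ?pmulr_lle0 ?ltr0n ?subr_le0//.
    exact: cvg_cst.
  apply: cvg_near_cst; near=> n; rewrite step_ge1//.
  rewrite -ler_pdivrMl ?subr_gt0// mulr1 ltW//.
  apply: (@lt_le_trans _ _ n%:R); last by rewrite ler_nat.
  by near: n; exact: nbhs_infty_gtr.
have -> : ((a < x) && (x <= b))%R%:R = (a < x)%R%:R - (b < x)%R%:R :> R.
  have [xb|bx] := leP x b; first by rewrite andbT subr0.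
  by rewrite andbF (le_lt_trans ab bx) subrr.
by apply: cvgB; exact: S.
Unshelve. all: by end_near. Qed.

Lemma step'_bound : exists M, 0 < M /\ forall x, 0 <= step' x <= M.
Proof.
exists (P 1)^-1; split; first by rewrite invr_gt0.
move=> x; rewrite /step' divr_ge0 ?bump_ge0 ?(ltW P1_gt0)//=.
by rewrite ler_piMl ?bump_le1// invr_ge0 ltW.
Qed.

Lemma step'_out x : x <= 0 \/ 1 <= x -> step' x = 0.
Proof. by move=> /bump_out E; rewrite /step' E mul0r. Qed.

Lemma continuous_step' : continuous step'.
Proof. by move=> x; apply: cvgM; [exact: bump_continuous|exact: cvg_cst]. Qed.

End bump.

Section primitives.
Context (R : realType).
Local Notation mu := (@lebesgue_measure R).

Lemma primitive_AC (l : R) (F f : R -> R) : (forall x, is_derive x (1 : R) F (f x)) ->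
  continuous f -> abscont l F f.
Proof.
move=> Ff cf.
have Fc : continuous F.
  move=> x; apply: differentiable_continuous; apply/derivable1_diffP.
  by have /@ex_derive := Ff x.
have K x y : intg mu `[x, y] f.
  apply: continuous_compact_integrable; first exact: segment_compact.
  exact: continuous_subspaceT.
split; first by apply: integrableS (K 0 l) => //; exact: subset_itv_oo_cc.
move=> x; rewrite le_eqVlt => /predU1P[<- _|x0 xl].
  by rewrite set_itvoo0 Rintegral_set0 addr0.
have := @continuous_FTC2 _ f F 0 x x0.
have -> : \I_(t < x) f t = \int[mu]_(t in `[0, x]) f t.
  rewrite Rintegral_itv_bndo_bndc; last first.
    by apply: integrableS (K 0 x) => //; exact: subset_itv_oo_cc.
  rewrite Rintegral_itv_obnd_cbnd//.
  by apply: integrableS (K 0 x) => //; exact: subset_itv_oc_cc.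
move=> H; rewrite /Rintegral (H _ _ _)/=.
- by rewrite addrCA subrr addr0.
- exact: continuous_subspaceT.
- split.
  + by move=> t _; have /@ex_derive := Ff t.
  + by apply: cvg_at_right_filter; exact: Fc.
  + by apply: cvg_at_left_filter; exact: Fc.
- by move=> t _; rewrite derive1E; have /@derive_val := Ff t.
Qed.

End primitives.

(** * Weak derivatives in one variable *)

Section du_bois_reymond.
Context (R : realType).
Local Notation mu := (@lebesgue_measure R).
Implicit Types (u g : R -> R) (a b c l x y : R).

Lemma patch_in (D : set R) u x : D x -> (u \_ D) x = u x.
Proof. by move=> Dx; rewrite /patch mem_set. Qed.

Lemma locally_integrable_patch l u : intgI l u ->
  locally_integrable setT (u \_ `]0, l[).
Proof.
move=> Iu; have If : mu.-integrable setT (EFin \o (u \_ `]0, l[)).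
  rewrite -restrict_EFin; apply/(@intg_patch _ _ _ mu `]0, l[ _ u).
    exact: measurable_itv.
  exact: Iu.
split.
- by apply/measurable_EFinP; exact: measurable_int If.
- exact: openT.
- move=> K _ cK; have /integrableP[_] : mu.-integrable K (EFin \o (u \_ `]0, l[)).
    by apply: integrableS If => //; exact: compact_measurable.
  by [].
Qed.

Lemma ae_lebesgue_pt l u : intgI l u ->
  {ae mu, forall x, lebesgue_pt (u \_ `]0, l[) x}.
Proof. by move=> /locally_integrable_patch/lebesgue_differentiation. Qed.

Lemma lebesgue_pt_avg l u a : intgI l u -> 0 < a -> a < l ->
  lebesgue_pt (u \_ `]0, l[) a -> forall e, 0 < e ->
  exists d, 0 < d /\ forall r, 0 < r -> r <= d -> 
    [/\ 0 < a - r, a + r < l &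
    \I_(a - r < x < a + r) `|u x - u a| <= e * r].
Proof.
move=> Iu a0 al /fine_cvgP[H1 /cvgrPdist_le H2] e e0.
have e2 : 0 < e / 2 by rewrite divr_gt0.
have {}H2 := H2 _ e2.
have A0 : 0 < (Num.min a (l - a)) / 2.
  by rewrite divr_gt0// lt_min a0 subr_gt0.
have [d [d0 Hd]] : exists d, 0 < d /\ forall r, 0 < r -> r <= d ->
   davg (u \_ `]0, l[) a r \is a fin_num /\
   `|0 - fine (davg (u \_ `]0, l[) a r)| <= e / 2.
  have [d d0 Hd] := filterI H1 H2; exists (d / 2); split; first by rewrite divr_gt0.
  move=> r r0 rd; apply: (Hd r) => //=; rewrite sub0r normrN gtr0_norm//.
  by apply: le_lt_trans rd _; rewrite ltr_pdivrMr// ltr_pMr// ltr1n.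
exists (Num.min d ((Num.min a (l - a)) / 2)); split; first by rewrite lt_min d0.
move=> r r0; rewrite le_min => /andP[rd].
rewrite ler_pdivlMr// le_min => /andP[ra rl].
have B1 : 0 < a - r by lra.
have B2 : a + r < l by lra.
split => //.
have [F1 F2] := Hd r r0 rd.
have mbE : mu (ball a r) = (r *+ 2)%:E by rewrite lebesgue_measure_ball// ltW.
have sub : intg mu `](a - r), (a + r)[ u.
  by apply: sub_itv_intg Iu; exact: ltW.
have Ir : intg mu `](a - r), (a + r)[ (fun x => `|u x - u a|).
  apply: intg_norm => //; apply: intgB => //.
  apply: (@intg_bounded _ _ _ mu _ _ _ `|u a|) => //; exact: mu_itv_lty.
move: F1 F2; rewrite /davg /iavg mbE ball_itv.
have -> : (\int[mu]_(y in [set` `](a - r)%R, (a + r)%R[]) 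
   `|((center ((u \_ `]0%R, l[) a) \o u \_ `]0%R, l[) y)%:E|)%E =
   (\I_(a - r < x < a + r) `|u x - u a|)%:E.
  rewrite -intg_EFin//; apply: eq_integral => y /set_mem/=; rewrite in_itv/= => /andP[y1 y2].
  rewrite !patch_in//= ?in_itv/= ?a0 ?al//.
  by rewrite (lt_trans B1 y1) (lt_trans y2 B2).
rewrite inver ifF; last by rewrite mulrn_eq0/= gt_eqF.
move=> _ /=; rewrite sub0r normrN ger0_norm; last first.
  by rewrite mulr_ge0 ?Rintegral_ge0// invr_ge0 mulrn_wge0// ltW.
rewrite ler_pdivrMl ?pmulrn_lgt0// => /le_trans; apply.
by apply: eq_ler; rewrite mulr2n; field.
Qed.

(** The rescaled [step'] are nonnegative, of mass 1, carried by an interval of length 1/(n+1) to the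
    right of a, and bounded by a multiple of n + 1: an approximate identity, which converges at
    Lebesgue points. *)
Lemma cvg_step' l u a : intgI l u -> 0 < a -> a < l ->
  lebesgue_pt (u \_ `]0, l[) a ->
  \I_(x < l) (u x * (step' ((x - a) * n.+1%:R) * n.+1%:R))
    @[n --> \oo] --> u a.
Proof.
move=> Iu a0 al /(lebesgue_pt_avg Iu a0 al) H.
have [M [M0 HM]] := @step'_bound R.
pose rho n x := step' ((x - a) * n.+1%:R) * n.+1%:R : R.
have rho_ac n : abscont l (fun x => step ((x - a) * n.+1%:R)) (rho n).
  apply: primitive_AC => [x|x].
    exact: is_derive_step_affine.
  apply: cvgM; last exact: cvg_cst.
  have H0 : (y - a) * n.+1%:R @[y --> x] --> (x - a) * n.+1%:R.
    by apply: cvgM; [apply: cvgB; [exact: cvg_id|exact: cvg_cst]|exact: cvg_cst].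
  exact: (cvg_comp _ _ H0 (@continuous_step' R _)).
have Irho n : intgI l (rho n) by case: (rho_ac n).
have n0 n : (0 : R) < n.+1%:R by rewrite ltr0n.
have rhoM n x : 0 <= rho n x <= M * n.+1%:R.
  by have /andP[h1 h2] := HM ((x - a) * n.+1%:R); rewrite mulr_ge0//= ler_wpM2r.
have mrho n : measI l (rho n) by apply: intg_meas (Irho n).
have Iurho n : intgI l (fun x => u x * rho n x).
  have : intgI l (fun x => rho n x * u x).
    apply: (@intg_mul_bounded _ _ _ mu _ _ u _ (M * n.+1%:R)) => //.
      exact: mrho.
    by move=> x _; have /andP[h1 h2] := rhoM n x; rewrite ger0_norm.
  by apply: eq_intg => // x _; rewrite mulrC.
apply/cvgrPdist_le => e e0.
have e1 : 0 < e / M by rewrite divr_gt0.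
have [d [d0 {}H]] := H _ e1.
near=> n.
pose r : R := n.+1%:R^-1.
have r0 : 0 < r by rewrite invr_gt0.
have rd : r <= d.
  rewrite invf_ple ?posrE//; apply: (@le_trans _ _ n%:R); last by rewrite ler_nat.
  by near: n; exact: nbhs_infty_ger.
have [B1 B2 {}H] := H r r0 rd.
have rho_out x : ~ (a < x < a + r) -> rho n x = 0.
  move=> nx; rewrite /rho step'_out ?mul0r//.
  have [xa|ax] := leP x a; first by left; rewrite pmulr_lle0// subr_le0.
  right; rewrite -ler_pdivrMr// div1r lerBrDl leNgt; apply/negP => h.
  by apply: nx; rewrite ax.
have mass : \I_(x < l) rho n x = 1.
  have [_ /(_ l)] := rho_ac n.
  rewrite ltW ?(lt_trans a0)// lexx => /(_ isT isT).
  rewrite step_ge1; last first.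
    by rewrite -ler_pdivrMr// div1r lerBrDl ltW.
  rewrite step_le0; first by rewrite add0r => <-.
  by rewrite pmulr_lle0// sub0r oppr_le0 ltW.
have -> : u a = \I_(x < l) (u a * rho n x) by rewrite RIZ// mass mulr1.
rewrite -RIB//; [|by apply: intgZ|exact: Iurho].
have Ib : intgI l (fun x => u a * rho n x - u x * rho n x).
  by apply: intgB => //; exact: intgZ.
apply: le_trans (RI_norm _ Ib) _ => //.
have ar : 0 <= a - r by exact: ltW.
have Iz : intgI l (fun x => `|u a * rho n x - u x * rho n x|).
  exact: intg_norm.
have aal : a - r <= a + r by lra.
rewrite (RI_itv_split ar _ Iz); last by lra.
rewrite (RI_itv_split aal (ltW B2)); last by apply: sub_itv_intg Iz.
rewrite RI_eq0//; last first.
  move=> x /=; rewrite in_itv/= => /andP[_ xa].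
  by rewrite rho_out ?mulr0 ?subrr ?normr0// => /andP[]; lra.
rewrite [\I_(a + r < x < l) _]RI_eq0//; last first.
  move=> x /=; rewrite in_itv/= => /andP[ax _].
  by rewrite rho_out ?mulr0 ?subrr ?normr0// => /andP[]; lra.
rewrite add0r addr0.
have Iu' : intg mu `](a - r), (a + r)[ (fun x => `|u x - u a|).
  apply: intg_norm => //; apply: intgB => //.
    by apply: sub_itv_intg Iu => //; exact: ltW.
  apply: (@intg_bounded _ _ _ mu _ _ _ `|u a|) => //; exact: mu_itv_lty.
apply: (@le_trans _ _ (\I_(a - r < x < a + r)
    (M * n.+1%:R * `|u x - u a|))).
  apply: le_RI => //; [by apply: sub_itv_intg Iz => //; exact: ltW|exact: intgZ|].
  move=> x _; rewrite -mulrBl normrM mulrC distrC ler_wpM2r//.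
  by have /andP[h1 h2] := rhoM n x; rewrite ger0_norm.
rewrite RIZ//.
apply: (@le_trans _ _ (M * n.+1%:R * (e / M * r))).
  by rewrite ler_wpM2l// mulr_ge0// ltW.
by rewrite /r le_eqVlt; apply/orP; left; apply/eqP; field; rewrite !gt_eqF.
Unshelve. all: by end_near. Qed.

(** The plateaus tend to the indicator of ]a,b] while their derivatives concentrate at a and b,
    which gives u a - u b in the limit at Lebesgue points. Only plateaus from a to b are tested, so
    that a countable family of tests can suffice later. *)
Lemma plateau_limit l u g a b : intgI l u -> intgI l g ->
  0 < a -> a < b -> b < l ->
  lebesgue_pt (u \_ `]0, l[) a -> lebesgue_pt (u \_ `]0, l[) b ->
  (forall n, test_function 0 l (plateau a b n) ->
    \I_(x < l) (u x * derive1 (plateau a b n) x) =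
    - \I_(x < l) (g x * plateau a b n x)) ->
  u b - u a = \I_(a < x < b) g x.
Proof.
move=> Iu Ig a0 ab bl ua ub H.
have ca := cvg_step' Iu a0 (lt_trans ab bl) ua.
have cb := cvg_step' Iu (lt_trans a0 ab) bl ub.
have n0 n : (0 : R) < n.+1%:R by rewrite ltr0n.
have mstep c n : measI l
    (fun x : R => step' ((x - c) * n.+1%:R) * n.+1%:R).
  apply: measurable_funM => //; apply: measurableT_comp.
    exact: continuous_measurable_fun (@continuous_step' R).
  by apply: measurable_funM => //; apply: measurable_funB.
have [M [M0 HM]] := @step'_bound R.
have Is c n : intgI l (fun x => u x * (step' ((x - c) * n.+1%:R) * n.+1%:R)).
  have : intgI l (fun x => (step' ((x - c) * n.+1%:R) * n.+1%:R) * u x).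
    apply: (@intg_mul_bounded _ _ _ mu _ _ u _ (M * n.+1%:R)) => //.
      exact: mstep.
    move=> x _; have /andP[h1 h2] := HM ((x - c) * n.+1%:R).
    by rewrite ger0_norm; [exact: ler_wpM2r|exact: mulr_ge0].
  by apply: eq_intg => // x _; rewrite mulrC.
have c1 : \I_(x < l) (u x * plateau' a b n x) @[n --> \oo] --> u a - u b.
  have -> : (fun n => \I_(x < l) (u x * plateau' a b n x)) =
    (fun n => \I_(x < l) (u x * (step' ((x - a) * n.+1%:R) * n.+1%:R)) -
       \I_(x < l) (u x * (step' ((x - b) * n.+1%:R) * n.+1%:R))).
    apply/funext => n; rewrite -RIB//; apply: eq_RI => // x _.
    by rewrite /plateau' mulrBr.
  exact: cvgB.
pose chi x : R := ((a < x) && (x <= b))%R%:R.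
have mchi : measI l (fun x => g x * chi x).
  apply: (@measurable_fun_cvg _ _ _ _ (fun n x => g x * plateau a b n x)).
    move=> n; apply: measurable_funM; first exact: intg_meas Ig.
    have pc : continuous (plateau a b n).
      move=> x; apply: differentiable_continuous; apply/derivable1_diffP.
      by have /@ex_derive := is_derive_plateau a b n x.
    exact: measurable_funS (continuous_measurable_fun pc).
  move=> x _; apply: cvgM; [exact: cvg_cst|exact: plateau_cvg (ltW ab)].
have [] := @R_dct _ _ _ mu `]0, l[ _ (fun n x => g x * plateau a b n x)
  (fun x => g x * chi x) (fun x => `|g x|).
- exact: measurable_itv.
- move=> n; apply: measurable_funM; first exact: intg_meas Ig.
  have pc : continuous (plateau a b n).
    move=> x; apply: differentiable_continuous; apply/derivable1_diffP.
    by have /@ex_derive := is_derive_plateau a b n x.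
  exact: measurable_funS (continuous_measurable_fun pc).
- exact: mchi.
- by apply: aeT => x _; apply: cvgM; [exact: cvg_cst|exact: plateau_cvg (ltW ab)].
- exact: intg_norm.
- by apply: aeT => x _ n; rewrite normrM ler_piMr// plateau_norm.
move=> Ichi c2 _.
have : u a - u b = - \I_(x < l) (g x * chi x).
  apply: (cvg_uniq c1).
  apply: cvg_trans (cvgN c2); apply: near_eq_cvg; near=> n.
  rewrite plateau'E H//; apply: plateau_test => //; first exact: ltW.
  rewrite -ltrBrDl invf_plt ?posrE ?subr_gt0//.
  apply: (@lt_le_trans _ _ n%:R); last by rewrite ler_nat.
  by near: n; exact: nbhs_infty_gtr.
have al := lt_trans ab bl.
rewrite (RI_itv_split (ltW a0) (ltW al) Ichi).
rewrite (RI_itv_split (ltW ab) (ltW bl)); last first.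
  by apply: sub_itv_intg Ichi => //; exact: ltW.
rewrite RI_eq0//; last first.
  move=> x /=; rewrite in_itv/= => /andP[_ xa].
  by rewrite /chi [(a < x)%R]ltNge (ltW xa) mulr0.
rewrite [\I_(b < x < l) _]RI_eq0//; last first.
  move=> x /=; rewrite in_itv/= => /andP[bx _].
  by rewrite /chi [(x <= b)%R]leNgt bx andbF mulr0.
rewrite add0r addr0 => E.
rewrite -[LHS]opprB E opprK; apply: eq_RI => // x /=; rewrite in_itv/= => /andP[ax xb].
by rewrite /chi ax (ltW xb) mulr1.
Unshelve. all: by end_near. Qed.

Lemma ae_ex_itv a b (P : R -> Prop) : a < b -> {ae mu, forall x, P x} ->
  exists x, [/\ a < x, x < b & P x].
Proof.
move=> ab [N [mN N0 NP]]; apply: contrapT => nP.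
have sub : `]a, b[%classic `<=` N.
  move=> x /=; rewrite in_itv/= => /andP[x0 xl]; apply: NP => /= Px.
  by apply: nP; exists x.
have : (mu `]a, b[ <= mu N)%E by apply: le_measure => //; rewrite inE//=.
by rewrite N0 /= lebesgue_measure_itv/= lte_fin ab -EFinB lee_fin subr_le0 leNgt ab.
Qed.

Lemma ae_ex l (P : R -> Prop) : 0 < l -> {ae mu, forall x, P x} ->
  exists x, [/\ 0 < x, x < l & P x].
Proof. exact: ae_ex_itv. Qed.

Lemma weak_derivative_ae l u g : 0 < l -> intgI l u -> intgI l g ->
  weak_derivative 0 l u g ->
  exists c, {aeI x < l,
    u x = c + \I_(t < x) g t}.
Proof.
move=> l0 Iu Ig W.
have L := ae_lebesgue_pt Iu.
have [a [a0 al La]] := ae_ex l0 L.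
exists (u a - \I_(t < a) g t).
apply: aeS L => x Lx /=; rewrite in_itv/= => /andP[x0 xl].
have [xa|ax|->] := ltgtP x a; last by rewrite subrK.
- have := plateau_limit Iu Ig x0 xa al Lx La (fun n T => W _ T).
  rewrite (RI_itv_split (ltW x0) (ltW xa)); last first.
    by apply: sub_itv_intg Ig => //; exact: ltW.
  by move=> <-; ring.
- have := plateau_limit Iu Ig a0 ax xl La Lx (fun n T => W _ T).
  rewrite (RI_itv_split (ltW a0) (ltW ax)); last first.
    by apply: sub_itv_intg Ig => //; exact: ltW.
  by move=> <-; ring.
Qed.

(** For a continuous u every interior point is a Lebesgue point, so tests with rational end points
    fix the increments of u between rationals, and continuity gives the others. Countability of the
    tests allows one null set to serve all of them. *)
Lemma plateau_abscont l u g : 0 < l -> intgI l g ->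
  {within `[0, l], continuous u} ->
  (forall (a b : rat) n, test_function 0 l (plateau (ratr a) (ratr b) n) ->
    \I_(x < l) (u x * derive1 (plateau (ratr a) (ratr b) n) x) =
    - \I_(x < l) (g x * plateau (ratr a) (ratr b) n x)) ->
  abscont l u g.
Proof.
move=> l0 Ig cu W.
have Iu : intgI l u.
  have H : intg mu `[0, l] u by apply: continuous_compact_integrable => //; exact: segment_compact.
  by apply: integrableS H => //; exact: subset_itv_oo_cc.
have [cu1 cu2 cu3] := (continuous_within_itvP u l0).1 cu.
have Leb x : 0 < x -> x < l -> lebesgue_pt (u \_ `]0, l[) x.
  move=> x0 xl; apply: (@continuous_lebesgue_pt _ _ _ `]0, l[).
  - by split; [exact: interval_open|rewrite /= in_itv/= x0].
  - exact: measurable_itv.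
  - apply: eq_measurable_fun (intg_meas Iu) => y /set_mem Dy.
    by rewrite patch_in.
  - have ux : {for x, continuous u} by apply: cu1; rewrite in_itv/= x0.
    apply: (cvg_trans _ (_ : u y @[y --> x] --> (u \_ `]0, l[) x)).
      apply: near_eq_cvg; near=> y; rewrite patch_in//= in_itv/=.
      by apply/andP; split; near: y; [exact: lt_nbhsr|exact: lt_nbhsl].
    by rewrite patch_in//= in_itv/= x0.
have Q (a b : rat) : 0 < ratr a :> R -> a < b -> ratr b < l ->
    u (ratr b) - u (ratr a) = \I_(ratr a < x < ratr b) g x.
  move=> a0 ab bl; have ab' : ratr a < ratr b :> R by rewrite ltr_rat.
  apply: (plateau_limit Iu Ig) => //.
  - by apply: Leb => //; exact: lt_trans bl.
  - by apply: Leb => //; exact: lt_trans ab'.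
  - by move=> n; exact: W.
pose G x := \I_(t < x) g t.
have GAC : abscont l G g.
  by split => // x x0 xl; rewrite {2}/G set_itvoo0 Rintegral_set0 add0r.
pose v x := u x - G x.
have vQ (a b : rat) : 0 < ratr a :> R -> ratr a < l -> 0 < ratr b :> R -> ratr b < l ->
    v (ratr b) = v (ratr a).
  wlog ab : a b / a < b.
    move=> H a0 al b0 bl; have [ab|ba|->] := ltgtP a b => //.
    - exact: H.
    - by apply/esym; exact: H.
  move=> a0 al b0 bl; have := Q a b a0 ab bl.
  have ab' : ratr a <= ratr b :> R by rewrite ler_rat ltW.
  by rewrite -(AC_diff GAC (ltW a0) ab' (ltW bl)) /v; lra.
have cmod x e : 0 <= x -> x <= l -> 0 < e -> exists d, 0 < d /\
    forall y, 0 < y -> y < l -> `|x - y| < d -> `|v x - v y| <= e.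
  move=> x0 xl e0.
  have e2 : 0 < e / 2 by rewrite divr_gt0.
  have [d1 [d10 H1]] := AC_unif GAC e2.
  have G1 y : 0 < y -> y < l -> `|x - y| < d1 -> `|G x - G y| <= e / 2.
    move=> y0 yl; have [xy|/ltW yx] := leP x y.
      rewrite distrC => h; rewrite distrC; apply: H1 => //; first exact: ltW.
      exact: le_trans (ler_norm _) (ltW h).
    move=> h; apply: H1 => //; first exact: ltW.
    exact: le_trans (ler_norm _) (ltW h).
  have [d2 [d20 H2]] : exists d, 0 < d /\
    forall y, 0 < y -> y < l -> `|x - y| < d -> `|u x - u y| <= e / 2.
    move: x0; rewrite le_eqVlt => /predU1P[<-|x0].
      have /cvgrPdist_le/(_ _ e2)[d /= d0 Hd] := cu2.
      by exists d; split => // y y0 yl h; apply: Hd.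
    move: xl; rewrite le_eqVlt => /predU1P[->|xl].
      have /cvgrPdist_le/(_ _ e2)[d /= d0 Hd] := cu3.
      by exists d; split => // y y0 yl h; apply: Hd.
    have ux : {for x, continuous u} by apply: cu1; rewrite in_itv/= x0.
    have /cvgrPdist_le/(_ _ e2)[d /= d0 Hd] := ux.
    by exists d; split => // y y0 yl h; apply: Hd.
  exists (Num.min d1 d2); split; first by rewrite lt_min d10.
  move=> y y0 yl; rewrite lt_min => /andP[h1 h2].
  have := G1 y y0 yl h1; have := H2 y y0 yl h2.
  rewrite /v (_ : u x - G x - _ = (u x - u y) - (G x - G y)); last by ring.
  by move=> h3 h4; rewrite (le_trans (ler_normB _ _))//; lra.
have dense x d : 0 <= x -> x <= l -> 0 < d -> exists q : rat,
    [/\ 0 < ratr q :> R, ratr q < l & `|x - ratr q| < d].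
  move=> x0 xl d0.
  have : Num.max 0 (x - d) < Num.min l (x + d).
    by rewrite gt_max !lt_min l0; apply/and3P; split; lra.
  move=> /rat_in_itvoo[q]; rewrite in_itv/= gt_max lt_min => /andP[/andP[q0 qd] /andP[ql qx]].
  by exists q; split => //; rewrite ltr_norml; apply/andP; split; lra.
have vE x : 0 <= x -> x <= l -> v x = v 0.
  move=> x0 xl; apply/eqP; rewrite -subr_eq0 -normr_le0.
  apply/ler_addgt0Pr => e e0; rewrite add0r.
  have e2 : 0 < e / 2 by rewrite divr_gt0.
  have [d1 [d10 H1]] := cmod x _ x0 xl e2.
  have [d2 [d20 H2]] := cmod 0 _ (lexx 0) (ltW l0) e2.
  have [q [q0 ql qx]] := dense x d1 x0 xl d10.
  have [r [r0 rl rx]] := dense 0 d2 (lexx 0) (ltW l0) d20.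
  have B1 := H1 _ q0 ql qx; have B2 := H2 _ r0 rl rx.
  rewrite (vQ r q)// in B1.
  rewrite (_ : v x - v 0 = (v x - v (ratr r)) - (v 0 - v (ratr r))); last by ring.
  by rewrite (le_trans (ler_normB _ _))//; lra.
split => // x x0 xl; have := vE x x0 xl.
by rewrite /v {2}/G set_itvoo0 Rintegral_set0 /G; lra.
Unshelve. all: by end_near. Qed.

Lemma test_abscont l phi : test_function 0 l phi ->
  abscont l phi (derive1 phi) /\ (phi 0 = 0 /\ phi l = 0).
Proof.
move=> [dphi [a' [b' [a0 bl out]]]]; split.
  apply: primitive_AC => x.
    by apply: DeriveDef; [exact: (dphi 0%N)|rewrite derive1E].
  apply: differentiable_continuous; apply/derivable1_diffP.
  exact: (dphi 1%N).
by split; apply: out; rewrite in_itv/= negb_and -!ltNge ?a0// bl orbT.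
Qed.

Lemma abscont_weak l f g : 0 < l -> abscont l f g -> weak_derivative 0 l f g.
Proof.
move=> l0 fg phi /test_abscont[pp [p0 pl]].
have [_ /(_ l (ltW l0) (lexx l))] := AC_mul fg pp.
have [Ig _] := fg; have [Ip _] := pp.
rewrite pl p0 !mulr0 add0r RID//; [|exact: AC_intg pp Ig|exact: AC_intg fg Ip].
move=> /esym/eqP; rewrite addrC addr_eq0 => /eqP ->.
by congr (- _); apply: eq_RI => // x _; rewrite mulrC.
Qed.

End du_bois_reymond.

(** * The flux *)

Section signed_power.
Context (R : realType).
Implicit Types (a b x y r s p : R).

(** The odd extension of x^r. The flux is the case r = p - 1 and [vhalf] the case r = p / 2; for r >
    0 the inverse is [spow r^-1]. *)
Definition spow r x : R := `|x| `^ (r - 1) * x.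

Lemma pfluxE p x : pflux p x = spow (p - 1) x.
Proof. by rewrite /pflux /spow -addrA -opprD. Qed.

Lemma spow_ge0E r x : 0 < r -> 0 <= x -> spow r x = x `^ r.
Proof. by move=> r0 x0; rewrite /spow ger0_norm// mulrC mulr_powRB1. Qed.

Lemma spowN r x : spow r (- x) = - spow r x.
Proof. by rewrite /spow normrN mulrN. Qed.

Lemma spow_norm r x : 0 < r -> `|spow r x| = `|x| `^ r.
Proof.
move=> r0; rewrite /spow normrM (ger0_norm (powR_ge0 _ _)) mulrC.
by rewrite mulr_powRB1.
Qed.

Lemma spow_ge0 r x : 0 <= x -> 0 <= spow r x.
Proof. by move=> x0; rewrite mulr_ge0// powR_ge0. Qed.

Lemma spow_le0 r x : x <= 0 -> spow r x <= 0.
Proof. by move=> x0; rewrite -oppr_ge0 -spowN spow_ge0// oppr_ge0. Qed.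

Lemma spow_homo r : 0 < r -> {homo spow r : x y / x <= y}.
Proof.
move=> r0 x y xy; have [x0|x0] := leP 0 x.
  have y0 := le_trans x0 xy.
  by rewrite !spow_ge0E// ge0_ler_powR ?nnegrE// ltW.
have [y0|y0] := leP 0 y.
  by rewrite (le_trans (spow_le0 _ (ltW x0)))// spow_ge0.
rewrite -[x]opprK -[y]opprK ![spow r (- - _)]spowN lerN2.
have Nx : 0 <= - x by rewrite oppr_ge0 ltW.
have Ny : 0 <= - y by rewrite oppr_ge0 ltW.
by rewrite !spow_ge0E// ge0_ler_powR ?nnegrE ?lerN2// ltW.
Qed.

Lemma spowK r x : 0 < r -> spow r^-1 (spow r x) = x.
Proof.
move=> r0; have ri0 : 0 < r^-1 by rewrite invr_gt0.
have P y : 0 <= y -> spow r^-1 (spow r y) = y.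
  move=> y0; rewrite (spow_ge0E r0)// spow_ge0E ?powR_ge0// -powRrM.
  by rewrite divff ?gt_eqF// powRr1.
have [x0|x0] := leP 0 x; first exact: P.
by rewrite -[x]opprK 2!spowN P// oppr_ge0 ltW.
Qed.

Lemma spowVK r x : 0 < r -> spow r (spow r^-1 x) = x.
Proof. by move=> r0; rewrite -{1}[r]invrK spowK// invr_gt0. Qed.

(** Monotonicity and the explicit inverse give the neighbourhood of x directly. *)
Lemma spow_continuous r : 0 < r -> continuous (spow r).
Proof.
move=> r0 x; apply/cvgrPdist_le => e e0.
have ri0 : 0 < r^-1 by rewrite invr_gt0.
pose y1 := spow r^-1 (spow r x - e); pose y2 := spow r^-1 (spow r x + e).
have y1x : y1 < x.
  rewrite ltNge; apply/negP => /(spow_homo r0); rewrite spowVK//; lra.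
have xy2 : x < y2.
  rewrite ltNge; apply/negP => /(spow_homo r0); rewrite spowVK//; lra.
near=> y.
have h1 : y1 <= y by apply: ltW; near: y; exact: lt_nbhsr.
have h2 : y <= y2 by apply: ltW; near: y; exact: lt_nbhsl.
have := spow_homo r0 h1; have := spow_homo r0 h2; rewrite !spowVK// => h3 h4.
by rewrite ler_norml; apply/andP; split; lra.
Unshelve. all: by end_near. Qed.

Lemma spow_unif r (B e : R) : 0 < r -> 0 < e -> exists d, 0 < d /\
  forall x y, `|x| <= B -> `|y| <= B -> `|x - y| <= d -> `|spow r x - spow r y| <= e.
Proof.
move=> r0 e0; apply: contrapT => nH.
have /choice[z Hz] : forall n : nat, exists z : R * R,
   [/\ `|z.1| <= B, `|z.2| <= B, `|z.1 - z.2| <= n.+1%:R^-1 &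
    e < `|spow r z.1 - spow r z.2|].
  move=> n; apply: contrapT => nz; apply: nH.
  exists n.+1%:R^-1; split; first by rewrite invr_gt0 ltr0n.
  move=> x y xB yB xy; rewrite leNgt; apply/negP => h; apply: nz.
  by exists (x, y).
have cB : compact `[- B, B]%classic by exact: segment_compact.
have FF : ProperFilter ((fun n => (z n).1) @ \oo) by exact: fmap_proper_filter.
have Fz : ((fun n => (z n).1) @ \oo) `[- B, B]%classic.
  by exists 0%N => // n _ /=; rewrite in_itv/= -ler_norml; have [] := Hz n.
have [x [_ clx]] := cB _ FF Fz.
have e3 : 0 < e / 3 by rewrite divr_gt0.
have /cvgrPdist_le/(_ _ e3)[d /= d0 Hd] := @spow_continuous r r0 x.
have d2 : 0 < d / 2 by rewrite divr_gt0.
pose N := Num.truncn (d / 2)^-1.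
have [y [[n /= Nn <-] xy]] := clx [set y | exists2 n, (N <= n)%N & (z n).1 = y]
  (ball x (d / 2)) (ex_intro2 _ _ N I (fun n Nn => ex_intro2 _ _ n Nn erefl))
  (nbhsx_ballx x _ d2).
have [_ _ h1 h2] := Hz n.
have h3 : n.+1%:R^-1 < d / 2.
  rewrite invf_plt ?posrE//; apply: lt_le_trans (truncnS_gt _) _.
  by rewrite ler_nat.
have h4 : `|x - (z n).1| < d by apply: lt_trans xy _; lra.
have h5 : `|x - (z n).2| < d.
  rewrite -(subrK (z n).1 x) -addrA; apply: le_lt_trans (ler_normD _ _) _.
  have xy' : `|x - (z n).1| < d / 2 := xy.
  by rewrite [ltRHS]splitr (ltrD xy')// (le_lt_trans h1).
have := Hd _ h4; have := Hd _ h5; move: h2.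
have -> : spow r (z n).1 - spow r (z n).2 =
  (spow r x - spow r (z n).2) - (spow r x - spow r (z n).1) by ring.
move=> h2 h6 h7; have := ler_normB (spow r x - spow r (z n).2) (spow r x - spow r (z n).1).
lra.
Qed.

(** The increments of the powers r and s control the squared increment of their mean power m. For
    equal signs, Young's inequality gives (r / m)(a^m - b^m) <= (a^r - b^r) a^(m-r), whence the
    constant r / m; for opposite signs a^(2m) = a^r a^s gives the constant 1/2. *)
Lemma spow_strong r s : 0 < r -> r <= s -> exists c, 0 < c /\ forall a b,
  c * (spow ((r + s) / 2) a - spow ((r + s) / 2) b) ^+ 2 <=
  (spow r a - spow r b) * (spow s a - spow s b).
Proof.
move=> r0 rs; set m := (r + s) / 2.
have m0 : 0 < m by rewrite /m; lra.
have s0 : 0 < s by lra.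
have rm : r <= m by rewrite /m; lra.
have sm : s = m + (m - r) by rewrite /m; lra.
clearbody m.
exists (Num.min (r / m) 2^-1); split; first by rewrite lt_min divr_gt0//= invr_gt0.
set c := Num.min _ _.
have c0 : 0 <= c by rewrite le_min invr_ge0 divr_ge0// ltW.
have c1 : c <= r / m by rewrite ge_min lexx.
have c2 : c <= 2^-1 by rewrite ge_min lexx orbT.
have P a b : 0 <= b -> b <= a -> c * (spow m a - spow m b) ^+ 2 <=
    (spow r a - spow r b) * (spow s a - spow s b).
  move=> b0 ba; have a0 := le_trans b0 ba.
  rewrite !(spow_ge0E r0)// !(spow_ge0E s0)// !(spow_ge0E m0)//.
  have amb : b `^ m <= a `^ m by rewrite ge0_ler_powR ?nnegrE// ltW.
  have arb : b `^ r <= a `^ r by rewrite ge0_ler_powR ?nnegrE// ltW.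
  have H1 : a `^ (m - r) * (a `^ m - b `^ m) <= a `^ s - b `^ s.
    have Ds x : x `^ s = x `^ m * x `^ (m - r).
      rewrite sm powRD//; apply/implyP => /eqP; lra.
    rewrite !Ds mulrBr [X in X - _]mulrC lerD2l lerN2 mulrC.
    by rewrite ler_wpM2r ?powR_ge0// ge0_ler_powR ?nnegrE// subr_ge0.
  have H2 : r / m * (a `^ m - b `^ m) <= (a `^ r - b `^ r) * a `^ (m - r).
    have [E|nE] := eqVneq r m.
      by rewrite -E subrr powRr0 mulr1 divff ?gt_eqF// mul1r.
    have mr : 0 < m - r by rewrite subr_gt0 lt_neqAle nE.
    have := @conjugate_powR _ (b `^ r) (a `^ (m - r)) (m / r) (m / (m - r)).
    move=> /(_ (powR_ge0 _ _) (powR_ge0 _ _) (divr_gt0 m0 r0) (divr_gt0 m0 mr)).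
    rewrite !invf_div -!powRrM.
    have -> : r / m + (m - r) / m = 1 by field; rewrite gt_eqF.
    have -> : r * (m / r) = m by field; rewrite gt_eqF.
    have -> : (m - r) * (m / (m - r)) = m by field; rewrite gt_eqF.
    move=> /(_ erefl) H.
    have Dr : a `^ m = a `^ r * a `^ (m - r).
      rewrite -powRD; first by rewrite addrC subrK.
      by apply/implyP => /eqP; lra.
    rewrite mulrBl -Dr.
    have := H.
    have E1 : b `^ m * (r / m) = r / m * b `^ m by ring.
    have E2 : a `^ m * ((m - r) / m) = a `^ m - r / m * a `^ m.
      by field; rewrite gt_eqF.
    by rewrite E1 E2; lra.
  apply: (@le_trans _ _ (r / m * (a `^ m - b `^ m) * (a `^ m - b `^ m))).
    by rewrite expr2 mulrA ler_wpM2r ?subr_ge0// ler_wpM2r// subr_ge0.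
  apply: (@le_trans _ _ ((a `^ r - b `^ r) * a `^ (m - r) * (a `^ m - b `^ m))).
    by rewrite ler_wpM2r// subr_ge0.
  by rewrite -mulrA ler_wpM2l// subr_ge0.
have Q a b : 0 <= a -> 0 <= b -> c * (spow m a + spow m b) ^+ 2 <=
    (spow r a + spow r b) * (spow s a + spow s b).
  move=> a0 b0.
  rewrite !(spow_ge0E r0)// !(spow_ge0E s0)// !(spow_ge0E m0)//.
  have D x : x `^ m * x `^ m = x `^ r * x `^ s.
    rewrite -!powRD; first by congr (_ `^ _); rewrite sm; lra.
      by apply/implyP => /eqP; lra.
    by apply/implyP => /eqP; lra.
  have := D a; have := D b.
  have := powR_ge0 a r; have := powR_ge0 a s; have := powR_ge0 b r.
  have := powR_ge0 b s.
  set ar := a `^ r; set as_ := a `^ s; set br := b `^ r; set bs := b `^ s.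
  set am := a `^ m; set bm := b `^ m => h1 h2 h3 h4 Db Da.
  apply: (@le_trans _ _ (2^-1 * (am + bm) ^+ 2)).
    by rewrite ler_wpM2r// sqr_ge0.
  apply: (@le_trans _ _ (am * am + bm * bm)).
    have := sqr_ge0 (am - bm); nra.
  rewrite Da Db; have := mulr_ge0 h4 h1; have := mulr_ge0 h2 h3; nra.
have P' a b : 0 <= a -> 0 <= b -> c * (spow m a - spow m b) ^+ 2 <=
    (spow r a - spow r b) * (spow s a - spow s b).
  move=> a0 b0; have [ba|/ltW ab] := leP b a; first exact: P.
  by have := P _ _ a0 ab; rewrite -sqrrN opprB => /le_trans; apply; apply: eq_ler; ring.
move=> a b; have [a0|/ltW a0] := leP 0 a; have [b0|/ltW b0] := leP 0 b.
- exact: P'.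
- have Nb : 0 <= - b by rewrite oppr_ge0.
  by have := Q _ _ a0 Nb; rewrite !spowN.
- have Na : 0 <= - a by rewrite oppr_ge0.
  have := Q _ _ Na b0; rewrite !spowN => /le_trans H.
  apply: le_trans (H _ _); last by apply: eq_ler; ring.
  by apply: eq_ler; ring.
- have Na : 0 <= - a by rewrite oppr_ge0.
  have Nb : 0 <= - b by rewrite oppr_ge0.
  have := P' _ _ Na Nb; rewrite !spowN => H.
  apply: (le_trans (le_trans _ H)); apply: eq_ler; ring.
Qed.

End signed_power.

Section flux.
Context (R : realType) (p : R).
Hypothesis p1 : 1 < p.
Let p0 : 0 < p - 1. Proof. by rewrite subr_gt0. Qed.
Let pp : 0 < p. Proof. exact: lt_trans ltr01 p1. Qed.
Let p2 : 0 < p / 2. Proof. by rewrite divr_gt0. Qed.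
Implicit Types (a b x y : R).

Lemma pflux_norm x : `|pflux p x| = `|x| `^ (p - 1).
Proof. by rewrite pfluxE spow_norm. Qed.

Lemma pflux_mul x : pflux p x * x = `|x| `^ p.
Proof.
rewrite pfluxE /spow -mulrA -expr2 -real_normK ?num_real// expr2.
rewrite [_ * (_ * _)]mulrC -mulrA [`|x| * _ `^ (_ - 1)]mulr_powRB1// .
by rewrite mulr_powRB1.
Qed.

Lemma pflux_mul_le a b : `|pflux p a * b| <= `|a| `^ p + `|b| `^ p.
Proof.
rewrite normrM pflux_norm.
have [ab|/ltW ba] := leP `|a| `|b|.
  apply: (@le_trans _ _ (`|b| `^ p)); last by rewrite lerDr powR_ge0.
  rewrite -[leRHS](@mulr_powRB1 _ _ p) ?normr_ge0//.
  by rewrite mulrC ler_wpM2l// ge0_ler_powR ?nnegrE// ltW.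
apply: (@le_trans _ _ (`|a| `^ p)); last by rewrite lerDl powR_ge0.
rewrite -[leRHS](@mulr_powRB1 _ _ p) ?normr_ge0//.
by rewrite mulrC ler_wpM2r// powR_ge0.
Qed.

Lemma pflux_convex a b :
  `|a| `^ p / p - `|b| `^ p / p <= pflux p a * (a - b).
Proof.
rewrite mulrBr pflux_mul.
have : pflux p a * b <= `|a| `^ p * ((p - 1) / p) + `|b| `^ p / p.
  apply: le_trans (ler_norm _) _; rewrite normrM pflux_norm.
  have := @conjugate_powR _ (`|a| `^ (p - 1)) `|b| (p / (p - 1)) p.
  rewrite powR_ge0 normr_ge0 divr_gt0// ?invf_div -?powRrM.
  have -> : (p - 1) / p + p^-1 = 1 by field; rewrite ?gt_eqF.
  have -> : (p - 1) * (p / (p - 1)) = p by field; rewrite ?gt_eqF.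
  by apply.
have -> : `|a| `^ p * ((p - 1) / p) = `|a| `^ p - `|a| `^ p / p by field; rewrite ?gt_eqF.
lra.
Qed.

Lemma pflux_continuous : continuous (pflux p).
Proof.
have -> : pflux p = spow (p - 1) by apply/funext => x; rewrite pfluxE.
exact: spow_continuous.
Qed.

Lemma measurable_pflux : measurable_fun setT (pflux p).
Proof. exact: continuous_measurable_fun pflux_continuous. Qed.

Lemma pflux_monotone a b : 0 <= (pflux p a - pflux p b) * (a - b).
Proof.
rewrite !pfluxE; have [ab|/ltW ba] := leP a b.
  by rewrite mulr_le0// subr_le0// spow_homo.
by rewrite mulr_ge0// subr_ge0// spow_homo.
Qed.

Definition vhalf x : R := spow (p / 2) x.

Lemma vhalf_sqr x : vhalf x ^+ 2 = `|x| `^ p.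
Proof.
rewrite -real_normK ?num_real// spow_norm//.
by rewrite -powR_mulrn ?powR_ge0// -powRrM divfK.
Qed.

(** The exponents 1 and p - 1 have mean p / 2; putting them in increasing order covers p >= 2 and p
    < 2 alike. *)
Lemma vhalf_strong : exists c, 0 < c /\ forall a b,
  c * (vhalf a - vhalf b) ^+ 2 <= (pflux p a - pflux p b) * (a - b).
Proof.
have spow1 x : spow 1 x = x by rewrite /spow subrr powRr0 mul1r.
have [h|/ltW h] := leP 1 (p - 1).
  have [c [c0 H]] := @spow_strong R 1 (p - 1) ltr01 h.
  exists c; split => // a b; have := H a b.
  by rewrite !spow1 !pfluxE /vhalf (_ : 1 + (p - 1) = p) 1?mulrC//; lra.
have [c [c0 H]] := @spow_strong R (p - 1) 1 p0 h.
exists c; split => // a b; have := H a b.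
by rewrite !spow1 !pfluxE /vhalf subrK.
Qed.

Lemma vhalfK x : spow (p / 2)^-1 (vhalf x) = x.
Proof. by rewrite /vhalf spowK. Qed.

Lemma measurable_vhalf : measurable_fun setT vhalf.
Proof. by apply: continuous_measurable_fun; apply: spow_continuous. Qed.

Lemma norm_le_pow x : `|x| <= 1 + `|x| `^ p.
Proof.
have [x1|/ltW x1] := leP `|x| 1; first by rewrite (le_trans x1)// lerDl powR_ge0.
by rewrite (le_trans (@le1r_powR _ _ p x1 (ltW p1)))// lerDr.
Qed.

(** Splits |x| at the height K. For large K the second term is a small multiple of |x|^p, which
    makes families bounded in L^p equi-integrable. *)
Lemma norm_le_equi (K x : R) : 0 < K -> `|x| <= K + `|x| `^ p / K `^ (p - 1).
Proof.
move=> K0; have [xK|/ltW Kx] := leP `|x| K.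
  by rewrite (le_trans xK)// lerDl divr_ge0 ?powR_ge0.
rewrite (@le_trans _ _ (`|x| `^ p / K `^ (p - 1)))//; last by rewrite lerDr ltW.
rewrite ler_pdivlMr ?powR_gt0// -[leRHS](@mulr_powRB1 _ _ p) ?normr_ge0//.
by rewrite ler_wpM2l// ge0_ler_powR ?nnegrE// ltW.
Qed.

End flux.

(** * Lebesgue norms in one and two variables *)

Section lebesgue_norms.
Context (R : realType).
Local Notation mu := (@lebesgue_measure R).
Implicit Types (f u : R -> R) (a b T l r q : R) (D : set R).

Lemma Lnorm_poweR (f : R -> \bar R) D r : 0 < r ->
  (Lnorm mu r%:E (f \_ D) `^ r = \int[mu]_(x in D) (`|f x| `^ r))%E.
Proof.
move=> r0; rewrite poweR_Lnorm ?gt_eqF// [RHS]integral_mkcond.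
apply: eq_integral => x _; rewrite /patch; case: ifP => // _.
by rewrite abse0 poweR0r// gt_eqF.
Qed.

Lemma Lnorm_pow u D r : 0 < r ->
  (Lnorm mu r%:E ((EFin \o u) \_ D) `^ r = \int[mu]_(x in D) (`|u x| `^ r)%:E)%E.
Proof. by move=> r0; rewrite Lnorm_poweR. Qed.

Lemma Lnorm_root (f : R -> \bar R) D r : 0 < r ->
  (Lnorm mu r%:E (f \_ D) = (Lnorm mu r%:E (f \_ D) `^ r) `^ r^-1)%E.
Proof.
by move=> r0; rewrite -poweRrM divff ?gt_eqF// poweRe1// Lnorm_ge0.
Qed.

Lemma measurable_abspow f D r : measurable_fun D f ->
  measurable_fun D (fun x => `|f x| `^ r).
Proof. move=> mf; apply: (@measurableT_comp _ _ _ _ _ _ (fun x : R => x `^ r) _ (fun x => `|f x|)) => //.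
by apply: measurableT_comp. Qed.

Lemma Lp_iff a b r f : 0 < r -> Lp a b r%:E f <->
  measurable_fun `]a, b[ f /\ intg mu `]a, b[ (fun x => `|f x| `^ r).
Proof.
move=> r0; split => -[mf h]; split => //.
  apply: intg_ge0 => //.
  - exact: measurable_abspow.
  - by rewrite -Lnorm_pow//; exact: poweR_lty.
rewrite Lnorm_root//; apply: poweR_lty.
by rewrite Lnorm_pow// intg_EFin// ltry.
Qed.

Lemma abspow2 (x : R) : `|x| `^ 2 = x ^+ 2.
Proof. by rewrite powR_mulrn// real_normK ?num_real. Qed.

Lemma Lp2_iff a b f : Lp a b 2%:E f <-> sqint mu `]a, b[ f.
Proof.
rewrite Lp_iff//; split => -[mf h]; split => //; apply: eq_intg h => //.
  by move=> x _ /=; rewrite abspow2.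
by move=> x _ /=; rewrite abspow2.
Qed.

Lemma mu_setT_gt0 : (0 < mu setT)%E.
Proof.
apply: (@lt_le_trans _ _ (mu `]0, 1[%classic)).
  by rewrite lebesgue_measure_itv/= lte_fin ltr01 sube0 lte_fin.
by apply: le_measure; rewrite ?inE//; exact: measurableT.
Qed.

Lemma slice_t (T l : R) (u : R -> R -> R) (t : R) :
  measurable_fun (`]0, T[ `*` `]0, l[) (fun z : R * R => u z.1 z.2) ->
  `]0, T[%classic t -> measI l (u t).
Proof. by move=> m tT; apply: (measurable_slice1 _ _ m tT). Qed.

Lemma slice_s (T l : R) (u : R -> R -> R) (s : R) :
  measurable_fun (`]0, T[ `*` `]0, l[) (fun z : R * R => u z.1 z.2) ->
  `]0, l[%classic s -> measI T (u^~ s).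
Proof. by move=> m tT; apply: (measurable_slice2 _ _ m tT). Qed.

Lemma LqLpy_iff T l r (u : R -> R -> R) : 0 < r -> LqLp T l +oo%E r%:E u <->
  measurable_fun (`]0, T[ `*` `]0, l[) (fun z : R * R => u z.1 z.2) /\
  exists C, {aeI t < T,
     intgI l (fun s => `|u t s| `^ r) /\
     \I_(s < l) (`|u t s| `^ r) <= C}.
Proof.
move=> r0; rewrite /LqLp.
pose n t := Lnorm mu r%:E ((EFin \o u t) \_ `]0, l[).
pose G := n \_ `]0, T[; rewrite -/n -/G.
(* The norm with exponent +oo is the essential supremum provided that the whole space has positive
   measure. *)
have LyE : Lnorm mu +oo%E G = ess_sup mu (abse \o G).
  by rewrite unlock mu_setT_gt0.
rewrite LyE; split => -[mu_ h]; split => //.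
  set S := ess_sup mu _ in h.
  exists (fine (S `^ r)%E).
  have := ess_sup_ge mu (abse \o G); apply: aeS => t /= Gt tT.
  have : (n t <= S)%E.
    apply: le_trans Gt; rewrite /G /patch mem_set//; exact: lee_abs.
  move=> nS.
  have n0 : (0 <= n t)%E by exact: Lnorm_ge0.
  have : (n t `^ r <= S `^ r)%E.
    by apply: gt0_ler_poweR; rewrite ?in_itv/= ?leey ?n0 ?(le_trans n0 nS)// ltW.
  rewrite Lnorm_pow// => H.
  have I : intgI l (fun s => `|u t s| `^ r).
    apply: intg_ge0 => //.
    - by apply: measurable_abspow; exact: slice_t mu_ tT.
    - by apply: le_lt_trans H _; exact: poweR_lty.
  split => //; rewrite -lee_fin -intg_EFin// fineK// ge0_fin_numE ?poweR_ge0//.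
  exact: poweR_lty.
move: h => [C hC].
apply: (@le_lt_trans _ _ (C%:E `^ r^-1)%E); last exact/poweR_lty/ltry.
apply/ess_supP; move: hC; apply: aeS => t /= hC.
rewrite /G /patch; case: ifPn => [/set_mem tT|_]; last by rewrite abse0 lee_fin powR_ge0.
have [I IC] := hC tT.
rewrite gee0_abs ?Lnorm_ge0// /n Lnorm_root//.
have I0 : 0 <= \I_(s < l) (`|u t s| `^ r).
  by apply: RI_ge0 => s _; exact: powR_ge0.
rewrite -poweR_EFin; apply: gt0_ler_poweR; rewrite ?in_itv/= ?leey ?poweR_ge0 ?invr_ge0 ?(ltW r0)//.
  by rewrite lee_fin (le_trans I0).
by rewrite Lnorm_pow// intg_EFin// lee_fin.
Qed.

Lemma LqLp2_iff T l (u : R -> R -> R) : LqLp T l 2%:E 2%:E u <->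
  sqint (mu \x mu)%E (`]0, T[ `*` `]0, l[) (fun z : R * R => u z.1 z.2).
Proof.
rewrite /LqLp; pose n t := Lnorm mu 2%:E ((EFin \o u t) \_ `]0, l[).
pose G := n \_ `]0, T[; rewrite -/n -/G.
have mD : measurable (`]0, T[ `*` `]0, l[ : set (R * R)) by exact: measurableX.
suff H : measurable_fun (`]0, T[ `*` `]0, l[) (fun z : R * R => u z.1 z.2) ->
    (Lnorm mu 2%:E G `^ 2 =
    \int[mu \x mu]_(z in `]0%R, T[ `*` `]0%R, l[) (u z.1 z.2 ^+ 2)%:E)%E.
  split => -[mu_ h]; split => //.
    apply: intg_ge0 => //.
    - by apply: measurable_funX.
    - by move=> z _; exact: sqr_ge0.
    - by rewrite -H//; exact: poweR_lty.
  by rewrite Lnorm_root//; apply: poweR_lty; rewrite H// intg_EFin// ltry.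
move=> mu_; rewrite Lnorm_poweR//.
rewrite (@tonelli1 _ _ _ _ _ mu mu `]0, T[%classic `]0, l[%classic _ _ (fun x y => u x y ^+ 2))//.
- apply: eq_integral => t tT; rewrite gee0_abs ?Lnorm_ge0// Lnorm_pow//.
  by apply: eq_integral => s _; rewrite abspow2.
- exact: measurable_funX.
- by move=> x y _ _; exact: sqr_ge0.
Qed.

End lebesgue_norms.

(** * Uniform continuity on closed rectangles *)

Section uniform_continuity.
Context (R : realType).
Local Notation mu := (@lebesgue_measure R).
Implicit Types (T l : R) (th : R -> R -> R).

Definition ucont2 T l th : Prop := forall e, 0 < e -> exists d, 0 < d /\
  forall t t' s s', 0 <= t <= T -> 0 <= t' <= T -> 0 <= s <= l -> 0 <= s' <= l ->
    `|t - t'| <= d -> `|s - s'| <= d -> `|th t s - th t' s'| <= e.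

Lemma compact_rectangle T l : compact (`[0, T] `*` `[0, l] : set (R * R)).
Proof. by apply: compact_setX; exact: segment_compact. Qed.

Lemma ucont2P T l th : ucont2 T l th <->
  {within `[0, T] `*` `[0, l], continuous (fun z : R * R => th z.1 z.2)}.
Proof.
split=> [H|/subspace_continuousP H].
  apply/subspace_continuousP => -[t s] [/=]; rewrite !in_itv/= => tT sl.
  apply/cvgrPdist_le => e e0; have [d [d0 Hd]] := H e e0.
  near=> z.
  have : (`[0, T] `*` `[0, l]) z by near: z; exact: withinT.
  move=> [/=]; rewrite !in_itv/= => zT zl.
  have : ball (t, s) d z.
    by near: z; apply: cvg_within; apply: nbhsx_ballx.
  move=> [/= h1 h2]; apply: Hd => //; exact: ltW.
move=> e e0; apply: contrapT => nH.
have /choice[z Hz] : forall n : nat, exists z : (R * R) * (R * R),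
   [/\ (`[0, T] `*` `[0, l]) z.1, (`[0, T] `*` `[0, l]) z.2,
    `|z.1.1 - z.2.1| <= n.+1%:R^-1, `|z.1.2 - z.2.2| <= n.+1%:R^-1 &
    e < `|th z.1.1 z.1.2 - th z.2.1 z.2.2|].
  move=> n; apply: contrapT => nz; apply: nH.
  exists n.+1%:R^-1; split; first by rewrite invr_gt0 ltr0n.
  move=> t t' s s' h1 h2 h3 h4 h5 h6; rewrite leNgt; apply/negP => h; apply: nz.
  by exists ((t, s), (t', s')); split => //=; split; rewrite /= in_itv.
have FF : ProperFilter ((fun n => (z n).1) @ \oo) by exact: fmap_proper_filter.
have Fz : ((fun n => (z n).1) @ \oo) (`[0, T] `*` `[0, l]).
  by exists 0%N => // n _ /=; have [] := Hz n.
have [x [Ax clx]] := @compact_rectangle T l _ FF Fz.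
have e3 : 0 < e / 3 by rewrite divr_gt0.
have := H x Ax => /cvgrPdist_le/(_ _ e3).
rewrite near_withinE => /nbhs_ballP[d /= d0 Hd].
have d2 : 0 < d / 2 by rewrite divr_gt0.
pose N := Num.truncn (d / 2)^-1.
have [y [[n /= Nn <-] xy]] := clx [set y | exists2 n, (N <= n)%N & (z n).1 = y]
  (ball x (d / 2)) (ex_intro2 _ _ N I (fun n Nn => ex_intro2 _ _ n Nn erefl))
  (nbhsx_ballx x _ d2).
have [A1 A2 h1 h1' h2] := Hz n.
have h3 : n.+1%:R^-1 < d / 2.
  rewrite invf_plt ?posrE//; apply: lt_le_trans (truncnS_gt _) _.
  by rewrite ler_nat.
have [xy1 xy2] : `|x.1 - (z n).1.1| < d / 2 /\ `|x.2 - (z n).1.2| < d / 2 := xy.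
have K (a b c : R) : `|a - b| < d / 2 -> `|b - c| <= n.+1%:R^-1 -> `|a - c| < d.
  move=> h4 h5; rewrite -(subrK b a) -addrA; apply: le_lt_trans (ler_normD _ _) _.
  by rewrite [ltRHS]splitr (ltrD h4)// (le_lt_trans h5).
have B1 : ball x d (z n).1.
  have hd : d / 2 < d by lra.
  by split => /=; [exact: lt_trans xy1 _|exact: lt_trans xy2 _].
have B2 : ball x d (z n).2 by split; [exact: K xy1 h1|exact: K xy2 h1'].
have := Hd _ B1 A1; have := Hd _ B2 A2; move: h2.
rewrite /from_subspace; set a := th (z n).1.1 _; set b := th (z n).2.1 _.
set c := th x.1 _.
have -> : a - b = (c - b) - (c - a) by ring.
by move=> h6 h7 h8; have := ler_normB (c - b) (c - a); lra.
Unshelve. all: by end_near. Qed.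

Lemma ucont2_bounded T l th : ucont2 T l th ->
  exists M, 0 < M /\ forall t s, 0 <= t <= T -> 0 <= s <= l -> `|th t s| <= M.
Proof.
move=> /ucont2P H; have := continuous_compact H (@compact_rectangle T l).
move=> /compact_bounded[M [_ HM]].
exists (Num.max 1 (M + 1)); split; first by rewrite lt_max ltr01.
move=> t s tT sl; apply: (HM (Num.max 1 (M + 1))).
  by rewrite lt_max ltrDl ltr01 orbT.
by exists (t, s) => //; split; rewrite /= in_itv.
Qed.

Lemma ucont2_slice T l th t : 0 <= t <= T -> ucont2 T l th ->
  {within `[0, l], continuous (th t)}.
Proof.
move=> tT H; apply/subspace_continuousP => s; rewrite /= in_itv/= => sl.
apply/cvgrPdist_le => e e0; have [d [d0 Hd]] := H e e0.
near=> s'.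
have : `[0, l]%classic s' by near: s'; exact: withinT.
rewrite /= in_itv/= => sl'.
have : ball s d s' by near: s'; apply: cvg_within; apply: nbhsx_ballx.
move=> /= h; apply: Hd => //; last exact: ltW.
by rewrite subrr normr0 ltW.
Unshelve. all: by end_near. Qed.

Lemma ucont2_swap T l th : ucont2 T l th -> ucont2 l T (fun s t => th t s).
Proof.
move=> H e e0; have [d [d0 Hd]] := H e e0; exists d; split => //.
by move=> *; exact: Hd.
Qed.

Lemma truncn_cell (x : R) (n : nat) : 0 <= x ->
  let y := (Num.truncn (x * n.+1%:R))%:R / n.+1%:R in
  [/\ 0 <= y, y <= x & x - y <= n.+1%:R^-1].
Proof.
move=> x0 /=; have n0 : 0 < n.+1%:R :> R by rewrite ltr0n.
have h0 : 0 <= x * n.+1%:R by rewrite mulr_ge0// ltW.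
have /andP[h1 h2] := truncn_itv h0.
split.
- by rewrite divr_ge0.
- by rewrite ler_pdivrMr.
- have -> : x - (Num.truncn (x * n.+1%:R))%:R / n.+1%:R =
      (x * n.+1%:R - (Num.truncn (x * n.+1%:R))%:R) / n.+1%:R.
    by rewrite mulrBl mulfK// gt_eqF.
  rewrite -[leRHS]mul1r ler_wpM2r ?invr_ge0 ?ltW//.
  have h2' : x * n.+1%:R < (Num.truncn (x * n.+1%:R))%:R + 1 by rewrite natr1.
  lra.
Qed.

Lemma measurable_cells d (X : measurableType d) (D : set X) (k : X -> nat)
    (g : nat -> X -> R) : measurable D ->
  (forall i, measurable (D `&` [set x | k x = i])) ->
  (forall i, measurable_fun D (g i)) -> measurable_fun D (fun x => g (k x) x).
Proof.
move=> mD mk mg _ Y mY.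
have -> : D `&` (fun x => g (k x) x) @^-1` Y =
    \bigcup_i ((D `&` [set x | k x = i]) `&` (D `&` g i @^-1` Y)).
  apply/seteqP; split => x /=.
    by move=> [Dx Yx]; exists (k x) => //; split; split.
  by move=> [i _ [[Dx <-] [_ h]]].
by apply: bigcup_measurable => i _; apply: measurableI => //; exact: mg.
Qed.

Lemma truncn_fiber (n i : nat) (T : R) : measurable (`]0, T[ `&`
  [set x : R | Num.truncn (x * n.+1%:R) = i] : set R).
Proof.
have n0 : 0 < n.+1%:R :> R by rewrite ltr0n.
have -> : `]0, T[ `&` [set x : R | Num.truncn (x * n.+1%:R) = i] =
    `]0, T[ `&` `[i%:R / n.+1%:R, i.+1%:R / n.+1%:R[%classic.
  apply/seteqP; split => x /=; rewrite !in_itv/= => -[/andP[x0 xT]].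
    move=> <-; split; first by rewrite x0.
    rewrite ler_pdivrMr// ltr_pdivlMr//; apply: truncn_itv.
    by rewrite mulr_ge0// ltW.
  rewrite ler_pdivrMr// ltr_pdivlMr// => /truncn_def ->.
  by rewrite x0 xT.
by apply: measurableI; exact: measurable_itv.
Qed.

Lemma measurable_fiber_prod (A B : set R) (P Q : R -> Prop) :
  measurable (A `&` P) -> measurable (B `&` Q) ->
  measurable ((A `*` B) `&` [set z : R * R | P z.1 /\ Q z.2]).
Proof.
move=> mA mB; rewrite (_ : _ `&` _ = (A `&` P) `*` (B `&` Q)).
  exact: measurableX.
by apply/seteqP; split => -[x y] /=; tauto.
Qed.

Lemma measurable_step2 (A B : set R) (k k' : R -> nat) (g : nat -> nat -> R) :
  measurable A -> measurable B ->
  (forall i, measurable (A `&` [set x | k x = i])) ->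
  (forall i, measurable (B `&` [set x | k' x = i])) ->
  measurable_fun (A `*` B) (fun z : R * R => g (k z.1) (k' z.2)).
Proof.
move=> mA mB mk mk'; have mAB : measurable (A `*` B : set (R * R)).
  exact: measurableX.
apply: (@measurable_cells _ _ _ (fun z : R * R => k z.1)
  (fun i (z : R * R) => g i (k' z.2))) => // [i|i].
  have := @measurable_fiber_prod A B _ setT (mk i).
  rewrite setIT => /(_ mB); congr measurable; congr (_ `&` _).
  by apply/seteqP; split => -[x y] //= [].
apply: (@measurable_cells _ _ _ (fun z : R * R => k' z.2)
  (fun j (z : R * R) => g i j)) => // j.
have := @measurable_fiber_prod A B setT _ _ (mk' j).
rewrite setIT => /(_ mA); congr measurable; congr (_ `&` _).
by apply/seteqP; split => -[x y] //= [].
Qed.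

(** Sampling on cells of side 1/(n+1) gives measurable step functions, which converge by uniform
    continuity. *)
Lemma ucont2_measurable T l th : ucont2 T l th ->
  measurable_fun (`]0, T[ `*` `]0, l[) (fun z : R * R => th z.1 z.2).
Proof.
move=> H; pose g n i j := th (i%:R / n.+1%:R) (j%:R / n.+1%:R).
apply: (@measurable_fun_cvg _ _ _ _ (fun n (z : R * R) =>
  g n (Num.truncn (z.1 * n.+1%:R)) (Num.truncn (z.2 * n.+1%:R)))).
- move=> n; pose k (x : R) := Num.truncn (x * n.+1%:R).
  apply: (@measurable_step2 `]0, T[%classic `]0, l[%classic k k (g n)) => // i.
    exact: truncn_fiber.
  exact: truncn_fiber.
- move=> [t s] [/=]; rewrite !in_itv/= => /andP[t0 tT] /andP[s0 sl].
apply/cvgrPdist_le => e e0; have [d [d0 Hd]] := H e e0.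
exists (Num.truncn d^-1) => // n /= Nn.
have h3 : n.+1%:R^-1 <= d.
  rewrite ltW// invf_plt ?posrE//; apply: lt_le_trans (truncnS_gt _) _.
  by rewrite ler_nat.
have [a1 a2 a3] := truncn_cell n (ltW t0); have [b1 b2 b3] := truncn_cell n (ltW s0).
apply: Hd.
- by rewrite !ltW.
- by rewrite a1 (le_trans a2)// ltW.
- by rewrite !ltW.
- by rewrite b1 (le_trans b2)// ltW.
- by rewrite ger0_norm ?subr_ge0// (le_trans a3).
- by rewrite ger0_norm ?subr_ge0// (le_trans b3).
Qed.

End uniform_continuity.

Section continuity_on_intervals.
Context (R : realType).
Local Notation mu := (@lebesgue_measure R).

Lemma within_unif (l : R) (f : R -> R) (e : R) : {within `[0, l], continuous f} -> 0 < e ->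
  exists d, 0 < d /\ forall x y, 0 <= x <= l -> 0 <= y <= l -> `|y - x| <= d ->
    `|f y - f x| <= e.
Proof.
move=> /subspace_continuousP cf e0.
(* A dummy time variable reduces the claim to the Heine-Cantor theorem in two variables,
   [ucont2P]. *)
have [|d [d0 Hd]] := (ucont2P 1 l (fun=> f)).2 _ e e0.
  apply/subspace_continuousP => -[t s] [/= _ sl].
  apply/cvgrPdist_le => b b0; have /cvgrPdist_le/(_ b b0) := cf s sl.
  rewrite !near_withinE => /nbhs_ballP[c /= c0 Hc].
  apply/nbhs_ballP; exists c => // z [_ zs] [_ zl]; exact: Hc.
exists d; split => // x y xl yl xy; apply: (Hd 0 0) => //; rewrite ?lexx ?ler01//.
by rewrite subrr normr0 ltW.
Qed.

Lemma within_bounded (l : R) (f : R -> R) : {within `[0, l], continuous f} ->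
  exists M, 0 < M /\ forall x, 0 <= x <= l -> `|f x| <= M.
Proof.
move=> cf; have uf : ucont2 1 l (fun=> f).
  move=> e e0; have [d [d0 Hd]] := within_unif cf e0; exists d; split => //.
  by move=> t t' s s' _ _ sl sl' _ sd; exact: Hd.
have [M [M0 HM]] := ucont2_bounded uf; exists M; split => // x xl.
by apply: (HM 0 x) => //; rewrite lexx ler01.
Qed.

Lemma within_measurable (l : R) (f : R -> R) : {within `[0, l], continuous f} ->
  measI l f.
Proof.
move=> cf; apply: subspace_continuous_measurable_fun => //.
by apply: continuous_subspaceW cf => z /=; rewrite !in_itv/= => /andP[/ltW -> /ltW ->].
Qed.

End continuity_on_intervals.

(** * Solutions in absolutely continuous form *)

Section product_rectangle.
Context (R : realType).
Local Notation mu := (@lebesgue_measure R).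
Local Notation m2 := (mu \x mu)%E.
Implicit Types (T l : R) (u v : R -> R -> R).
Local Notation unc u := (fun z : R * R => u z.1 z.2).
Local Notation Q T l := (`]0, T[ `*` `]0, l[ : set (R * R)).

Lemma measurable_Q T l : measurable (Q T l).
Proof. by apply: measurableX; exact: measurable_itv. Qed.

Lemma measurable_lift T l (A : R -> R) : measI T A ->
  measurable_fun (Q T l) (fun z => A z.1).
Proof.
move=> mA _ Y mY.
rewrite (_ : _ `&` _ = (`]0, T[ `&` A @^-1` Y) `*` `]0, l[).
  by apply: measurableX; [exact: mA|exact: measurable_itv].
by apply/seteqP; split => -[t s] /=; tauto.
Qed.

Lemma sqint_lift T l (A : R -> R) : sqintI T A ->
  sqint m2 (Q T l) (fun z => A z.1).
Proof.
move=> [mA iA]; split; first exact: measurable_lift.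
have mQ := measurable_Q T l.
have mA2 : measurable_fun (Q T l) (fun z => A z.1 ^+ 2).
  by apply: measurable_funX; exact: measurable_lift.
apply: intg_ge0 => //; first by move=> z _; exact: sqr_ge0.
rewrite (@tonelli1 _ _ _ _ _ mu mu `]0, T[%classic `]0, l[%classic _ _
  (fun t _ => A t ^+ 2))//; last by move=> t s _ _; exact: sqr_ge0.
have -> : (\int[mu]_(t in `]0%R, T[) \int[mu]_(_ in `]0%R, l[) (A t ^+ 2)%:E =
    \int[mu]_(t in `]0%R, T[) ((fine (mu `]0%R, l[) * A t ^+ 2)%:E))%E.
  apply: eq_integral => t _; rewrite integral_cst// [RHS]EFinM fineK 1?muleC//.
  by rewrite ge0_fin_numE// mu_itv_lty.
rewrite intg_EFin ?ltry//; exact: intgZ.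
Qed.

Lemma muQ_lty T l : (m2 (Q T l) < +oo)%E.
Proof.
rewrite product_measure1E//; [|exact: measurable_itv..].
by rewrite lte_mul_pinfty// ?ge0_fin_numE// mu_itv_lty.
Qed.

Lemma sqint_Q_intg T l u : sqint m2 (Q T l) (unc u) -> intg m2 (Q T l) (unc u).
Proof. by move=> su; apply: sqint_intg => //; [exact: measurable_Q|exact: muQ_lty]. Qed.

Lemma sqint_slice_t T l u : sqint m2 (Q T l) (unc u) ->
  {aeI t < T, sqintI l (u t)}.
Proof.
move=> [mu_ iu].
have [H _ _] := @fubini_intg1 _ _ _ _ _ mu mu `]0, T[%classic `]0, l[%classic
  (measurable_itv _) (measurable_itv _) (fun t s => u t s ^+ 2) iu.
by move: H; apply: aeS => t H tT; split; [exact: slice_t mu_ tT|exact: H].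
Qed.

Lemma sqint_slice_s T l u : sqint m2 (Q T l) (unc u) ->
  {aeI s < l, sqintI T (u^~ s)}.
Proof.
move=> [mu_ iu].
have [H _ _] := @fubini_intg2 _ _ _ _ _ mu mu `]0, T[%classic `]0, l[%classic
  (measurable_itv _) (measurable_itv _) (fun t s => u t s ^+ 2) iu.
by move: H; apply: aeS => t H tT; split; [exact: slice_s mu_ tT|exact: H].
Qed.

Lemma RI_Q T l u : intg m2 (Q T l) (unc u) ->
  [/\ {aeI t < T, intgI l (u t)},
      intgI T (fun t => \I_(s < l) u t s) &
      \int[m2]_(z in Q T l) u z.1 z.2 =
      \I_(t < T) \I_(s < l) u t s].
Proof. by move=> iu; exact: (fubini_intg1 _ _ iu). Qed.

Lemma intg_Q_dom T l u (g : R -> R) : measurable_fun (Q T l) (unc u) ->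
  intgI T g -> (forall t s, 0 <= u t s) ->
  {aeI t < T,
     intgI l (u t) /\ \I_(s < l) u t s <= g t} ->
  intg m2 (Q T l) (unc u) /\
  \int[m2]_(z in Q T l) u z.1 z.2 <= \I_(t < T) g t.
Proof.
move=> mu_ ig u0 H.
have I : intg m2 (Q T l) (unc u).
  exact: (@intg_prod_dom1 _ _ _ _ _ mu mu `]0, T[%classic `]0, l[%classic _ _ u g).
split => //; have [_ I2 ->] := RI_Q I.
by apply: ae_le_RI => //; move: H; apply: aeS => t H tT; have [] := H tT.
Qed.

Lemma intg_Q T l u v (C : R) : measurable_fun (Q T l) (unc u) ->
  measurable_fun (Q T l) (unc v) ->
  (forall t s, `]0, T[%classic t -> `]0, l[%classic s -> `|u t s| <= v t s) ->
  {aeI t < T,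
     intgI l (v t) /\ \I_(s < l) v t s <= C} ->
  intg m2 (Q T l) (unc u).
Proof.
move=> mu_ mv uv H; apply: (@intg_le _ _ _ m2 _ _ _ (unc v)) => //.
- exact: measurable_Q.
- by move=> -[t s] [/= tT sl]; exact: uv.
- apply: (@intg_prod_dom1 _ _ _ _ _ mu mu `]0, T[%classic `]0, l[%classic _ _ v (fun=> C)) => //.
    by apply: (@intg_bounded _ _ _ mu _ _ _ `|C|) => //; exact: mu_itv_lty.
  by move=> t s tT sl; apply: le_trans (uv _ _ tT sl).
Qed.

Lemma ae_sqint_bounded T l u (M : R) : measurable_fun (Q T l) (unc u) ->
  {aeI t < T,
    {aeI s < l, `|u t s| <= M}} ->
  sqint m2 (Q T l) (unc u).
Proof.
move=> mu_ H; split => //.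
have mu2 : measurable_fun (Q T l) (unc (fun t s => u t s ^+ 2)).
  exact: measurable_funX.
apply: (@intg_Q T l (fun t s => u t s ^+ 2) (fun t s => u t s ^+ 2)
  (\I_(s < l) M ^+ 2)) => //.
  by move=> t s _ _; rewrite ger0_norm// sqr_ge0.
move: H; apply: aeS => t H tT; have {}H := H tT.
have iM : intgI l (fun=> M ^+ 2).
  apply: (@intg_bounded _ _ _ mu _ _ _ `|M ^+ 2|) => //; exact: mu_itv_lty.
have mt : measI l (fun s => u t s ^+ 2).
  by apply: measurable_funX; exact: slice_t mu_ tT.
have uM : {aeI s < l, u t s ^+ 2 <= M ^+ 2}.
  move: H; apply: aeS => s H sl; have := H sl => uM.
  by rewrite -(real_normK (num_real (u t s))) ler_sqr ?nnegrE// (le_trans _ uM).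
have iu : intgI l (fun s => u t s ^+ 2).
  apply: ae_intg iM _ => //; move: uM; apply: aeS => s uM sl.
  by rewrite ger0_norm ?sqr_ge0// uM.
by split => //; exact: ae_le_RI.
Qed.

End product_rectangle.

Section edges.
Context (R : realType) (p : R).
Hypothesis p1 : 1 < p.
Local Notation mu := (@lebesgue_measure R).
Local Notation m2 := (mu \x mu)%E.
Implicit Types (T l : R) (th ths tht : R -> R -> R) (A B : R -> R).
Local Notation unc u := (fun z : R * R => u z.1 z.2).
Local Notation Q T l := (`]0, T[ `*` `]0, l[ : set (R * R)).
Let pp : 0 < p. Proof. exact: lt_trans ltr01 p1. Qed.

Definition edge_w th tht A B t s : R :=
  tht t s - A t * sin (th t s) + B t * cos (th t s).

(** The boundary conditions are built in: the flux is almost everywhere the primitive of w from 0,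
    and the zero integral of w makes that primitive vanish at l as well. *)
Definition flux_eq l (q w : R -> R) : Prop :=
  [/\ intgI l w, \I_(s < l) w s = 0 &
    {aeI s < l, q s = \I_(x < s) w x}].

(** One edge of a solution, free of test functions and for arbitrary coefficients A and B of the
    force. Relations in integrated form are stable under limits and under concatenation in time. *)
Record edge_sol T l th ths tht A B : Prop := EdgeSol {
  es_cont : ucont2 T l th;
  es_meas : measurable_fun (Q T l) (unc ths);
  es_tht : sqint m2 (Q T l) (unc tht);
  es_pow : exists C, {aeI t < T,
     intgI l (fun s => `|ths t s| `^ p) /\
     \I_(s < l) (`|ths t s| `^ p) <= C};
  es_s : {aeI t < T, abscont l (th t) (ths t)};
  es_t : {aeI s < l, abscont T (th^~ s) (tht^~ s)};
  es_A : sqintI T A;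
  es_B : sqintI T B;
  es_flux : {aeI t < T,
     flux_eq l (pflux p \o ths t) (edge_w th tht A B t)} }.

Lemma AC_within l (f g : R -> R) : abscont l f g -> {within `[0, l], continuous f}.
Proof.
move=> fg; apply/subspace_continuousP => s; rewrite /= in_itv/= => /andP[s0 sl].
apply/cvgrPdist_le => e e0; have [d [d0 H]] := AC_unif fg e0.
near=> s'.
have : `[0, l]%classic s' by near: s'; exact: withinT.
rewrite /= in_itv/= => /andP[s0' sl'].
have : ball s d s' by near: s'; apply: cvg_within; apply: nbhsx_ballx.
move=> /= /ltW; have [ss|/ltW ss] := leP s s'; rewrite /from_subspace distrC.
  by move=> h; rewrite distrC H// (le_trans (ler_norm _)).
by move=> h; rewrite H// (le_trans (ler_norm _))// distrC.
Unshelve. all: by end_near. Qed.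

Lemma flux_abscont l q w : 0 < l -> flux_eq l q w -> exists F,
  [/\ abscont l F w, F 0 = 0, F l = 0 &
   {aeI s < l, q s = F s}].
Proof.
move=> l0 [iw w0 qw]; exists (fun s => \I_(x < s) w x).
have F0 : \I_(x < 0) w x = 0.
  by rewrite set_itvoo0 /Rintegral integral_set0.
by split => //; split => // x _ _; rewrite F0 add0r.
Qed.

Lemma flux_ibp l q w Phi dPhi : 0 < l -> flux_eq l q w -> abscont l Phi dPhi ->
  measI l q -> 
  [/\ intgI l (fun s => w s * Phi s),
      intgI l (fun s => q s * dPhi s) &
  \I_(s < l) (q s * dPhi s) = - \I_(s < l) (w s * Phi s)].
Proof.
move=> l0 /(flux_abscont l0)[F [FA F0 Fl qF]] PA mq.
have [iw _] := FA; have [idP _] := PA.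
have I1 : intgI l (fun s => w s * Phi s).
  by apply: eq_intg (AC_intg PA iw) => // s _; rewrite mulrC.
have I2 := AC_intg FA idP.
have mD : measI l (fun s => q s * dPhi s).
  by apply: measurable_funM => //; exact: intg_meas idP.
have ae1 : {aeI s < l, F s * dPhi s = q s * dPhi s}.
  by move: qF; apply: aeS => s qF sl; rewrite qF.
have I3 : intgI l (fun s => q s * dPhi s).
  apply: ae_intg (intg_norm _ I2) _ => //.
  by move: ae1; apply: aeS => s h sl; rewrite h.
split => //.
have [_ /(_ l (ltW l0) (lexx l))] := AC_mul FA PA.
rewrite F0 Fl !mul0r add0r RID//; last first.
  by apply: eq_intg I1 => // s _; rewrite mulrC.
have -> : \I_(x < l) (F x * dPhi x) = \I_(s < l) (q s * dPhi s).
  by apply: ae_eq_RI => //; exact: intg_meas I2.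
have -> : \I_(x < l) (Phi x * w x) = \I_(s < l) (w s * Phi s).
  by apply: eq_RI => // s _; rewrite mulrC.
by move=> /esym/eqP; rewrite addrC addr_eq0 => /eqP.
Qed.

Lemma Lp_intg l (u : R -> R) : measI l u ->
  intgI l (fun s => `|u s| `^ p) -> intgI l u /\
  (0 < l -> \I_(s < l) `|u s| <= l + \I_(s < l) (`|u s| `^ p)).
Proof.
move=> mu_ iu.
have i1 : intgI l (fun=> 1 : R).
  by apply: (@intg_bounded _ _ _ mu _ _ _ 1) => //; [exact: mu_itv_lty|move=> ? _; rewrite normr1].
have I : intgI l u.
  apply: (@intg_le _ _ _ mu _ _ _ (fun s => 1 + `|u s| `^ p)) => //.
    by move=> s _; exact: norm_le_pow.
  exact: intgD.
split => // l0.
rewrite -[X in X + _](mu_itvE l0) -[X in X + _]mul1r -RI_cst// -RID//.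
apply: le_RI => //; [exact: intg_norm|exact: intgD|].
by move=> s _; exact: norm_le_pow.
Qed.

(** The oscillation of a slice is at most the integral of its derivative, so comparing |Phi s| with
    the average of |Phi| over the edge bounds almost all slices of the test function by one
    constant. *)
Lemma phi_facts T l ph phs : 0 < l -> LqW1p T l +oo%E p%:E ph phs ->
  exists M, {aeI t < T, exists Phi,
    [/\ abscont l Phi (phs t), forall s, `]0, l[%classic s -> `|Phi s| <= M,
      {aeI s < l, ph t s = Phi s} &
      intgI l (fun s => `|phs t s| `^ p) /\
      \I_(s < l) (`|phs t s| `^ p) <= M]}.
Proof.
move=> l0 [/(LqLpy_iff _ _ _ pp)[m1 [C1 H1]] /(LqLpy_iff _ _ _ pp)[m3 [C2 H2]] W].
pose M := l^-1 * (l + C1 + l * (l + C2)).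
exists (Num.max C2 M); move: H1 H2 W; apply: aeS3 => t H1 H2 W tT.
have [I1 b1] := H1 tT; have [I2 b2] := H2 tT.
have [iph e1] := Lp_intg (slice_t m1 tT) I1.
have [iphs e2] := Lp_intg (slice_t m3 tT) I2.
have tT' : t \in `]0, T[ by [].
have [c Hc] := weak_derivative_ae l0 iph iphs (W tT').
pose Phi x := c + \I_(x < x) phs t x.
have PA : abscont l Phi (phs t).
  split => // x _ _; rewrite /Phi set_itvoo0.
  by rewrite [\int[_]_(_ in set0) _](_ : _ = 0) ?addr0// /Rintegral integral_set0.
exists Phi; split => //; last by split; rewrite // le_max b2.
move=> s /inI[s0 sl].
rewrite le_max; apply/orP; right; rewrite /M mulrC ler_pdivlMr//.
have key y : `]0, l[%classic y -> `|Phi s| <= `|Phi y| + (l + C2).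
  rewrite /= in_itv/= => /andP[y0 yl].
  have K a b : 0 <= a -> a <= b -> b <= l -> `|Phi b - Phi a| <= l + C2.
    move=> a0 ab bl; apply: le_trans (AC_norm PA a0 ab bl) _.
    apply: le_trans (le_trans (e2 l0) _); last by rewrite lerD2l.
    rewrite [leRHS](@RI_itv_split _ _ 0 a l)//; last 2 first.
      exact: le_trans ab bl.
      exact: intg_norm.
    rewrite [X in _ <= _ + X](@RI_itv_split _ _ a b l)//; last first.
      by apply: (@sub_itv_intg _ _ 0 l) => //; exact: intg_norm.
    by rewrite addrCA lerDl addr_ge0// RI_ge0.
  rewrite -[X in `|X| <= _](subrK (Phi y)) addrC.
  apply: le_trans (ler_normD _ _) _; rewrite lerD2l.
  have [ys|/ltW sy] := leP y s; first by apply: K => //; exact: ltW.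
  by rewrite distrC; apply: K => //; exact: ltW.
have iP : intgI l (fun y => `|Phi y|).
  apply: (@ae_intg _ _ _ mu _ _ (fun y => `|ph t y|)) => //.
  - by apply: measurableT_comp => //; exact: AC_measurable PA.
  - exact: intg_norm.
  - by move: Hc; apply: aeS => y h yl; rewrite normr_id (h yl).
have : \I_(y < l) `|Phi s| <=
    \I_(y < l) (`|Phi y| + (l + C2)).
  apply: le_RI => //.
  - by apply: (@intg_bounded _ _ _ mu _ _ _ `|Phi s|) => //; [exact: mu_itv_lty|move=> ? _; rewrite normr_id].
  - apply: intgD => //.
    by apply: (@intg_bounded _ _ _ mu _ _ _ `|l + C2|) => //; exact: mu_itv_lty.
rewrite RI_cst// mu_itvE// RID//; last first.
  by apply: (@intg_bounded _ _ _ mu _ _ _ `|l + C2|) => //; exact: mu_itv_lty.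
rewrite RI_cst// mu_itvE// => /le_trans; apply.
rewrite [X in _ + X]mulrC lerD2r.
have -> : \I_(x < l) `|Phi x| = \I_(x < l) `|ph t x|.
  apply: ae_eq_RI => //.
  - exact: intg_meas iP.
  - by apply: measurableT_comp => //; exact: intg_meas iph.
  - by move: Hc; apply: aeS => y h yl; rewrite (h yl).
by apply: le_trans (e1 l0) _; rewrite lerD2l.
Qed.

Lemma measurable_sin_th T l th : ucont2 T l th ->
  measurable_fun (Q T l) (fun z => sin (th z.1 z.2)).
Proof.
move=> /ucont2_measurable; apply: measurableT_comp.
exact: continuous_measurable_fun (@continuous_sin R).
Qed.

Lemma measurable_cos_th T l th : ucont2 T l th ->
  measurable_fun (Q T l) (fun z => cos (th z.1 z.2)).
Proof.
move=> /ucont2_measurable; apply: measurableT_comp.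
exact: continuous_measurable_fun (@continuous_cos R).
Qed.

Lemma sin_norm_le1 (x : R) : `|sin x| <= 1.
Proof. by rewrite ler_norml sin_geN1 sin_le1. Qed.

Lemma cos_norm_le1 (x : R) : `|cos x| <= 1.
Proof. by rewrite ler_norml cos_geN1 cos_le1. Qed.

Lemma sqint_edge_w T l th tht A B : ucont2 T l th ->
  sqint m2 (Q T l) (unc tht) -> sqintI T A -> sqintI T B ->
  sqint m2 (Q T l) (unc (edge_w th tht A B)).
Proof.
move=> c2 st sA sB; have mQ := measurable_Q T l.
have HA : sqint m2 (Q T l) (fun z => sin (th z.1 z.2) * A z.1).
  apply: (@sqint_mul_bounded _ _ _ m2 _ _ _ _ 1) => //; first exact: sqint_lift.
    exact: measurable_sin_th.
  by move=> z _; exact: sin_norm_le1.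
have HB : sqint m2 (Q T l) (fun z => cos (th z.1 z.2) * B z.1).
  apply: (@sqint_mul_bounded _ _ _ m2 _ _ _ _ 1) => //; first exact: sqint_lift.
    exact: measurable_cos_th.
  by move=> z _; exact: cos_norm_le1.
apply: eq_sqint (sqintD _ (sqintB _ st HA) HB) => //.
by move=> z _; rewrite /edge_w; ring.
Qed.

(** Integration by parts is done on slices in s, so the identity already holds at almost every time,
    before any integration in t. *)
Lemma edge_weak_form T l th ths tht A B ph phs : 0 < l ->
  edge_sol T l th ths tht A B -> LqW1p T l +oo%E p%:E ph phs ->
  [/\ intgI T (fun t => \I_(s < l) (tht t s * ph t s)),
      intgI T (fun t => \I_(s < l) (pflux p (ths t s) * phs t s)),
      intgI T (fun t => A t * \I_(s < l) (sin (th t s) * ph t s)) &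
      intgI T (fun t => B t * \I_(s < l) (cos (th t s) * ph t s))] /\
  {aeI t < T,
    \I_(s < l) (tht t s * ph t s) +
    \I_(s < l) (pflux p (ths t s) * phs t s) -
    A t * \I_(s < l) (sin (th t s) * ph t s) +
    B t * \I_(s < l) (cos (th t s) * ph t s) = 0}.
Proof.
move=> l0 ES W; have [m1 m3] : measurable_fun (Q T l) (unc ph) /\
  measurable_fun (Q T l) (unc phs) by case: W => -[? _] [? _] _.
have [M HM] := phi_facts l0 W.
have mQ := measurable_Q T l.
have sph : sqint m2 (Q T l) (unc ph).
  apply: (@ae_sqint_bounded _ _ _ _ M) => //.
  move: HM; apply: aeS => t H tT; have [Phi [_ b e _]] := H tT.
  by move: e; apply: aeS => s e sl; rewrite e// b.
have mflux : measurable_fun (Q T l) (unc (fun t s => pflux p (ths t s))).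
  by apply: (measurableT_comp (measurable_pflux p1)); exact: es_meas ES.
have [C HC] := es_pow ES.
have i2 : intg m2 (Q T l) (unc (fun t s => pflux p (ths t s) * phs t s)).
  apply: (@intg_Q _ _ _ (fun t s => pflux p (ths t s) * phs t s)
    (fun t s => `|ths t s| `^ p + `|phs t s| `^ p) (C + M)).
  - exact: measurable_funM.
  - apply: measurable_funD.
      exact: measurableT_comp (measurable_abspow p (@measurable_id _ R setT)) (es_meas ES).
    exact: measurableT_comp (measurable_abspow p (@measurable_id _ R setT)) m3.
  - by move=> t s _ _; exact: pflux_mul_le.
  - move: HC HM; apply: aeS2 => t h1 h2 tT.
    have [I1 b1] := h1 tT; have [Phi [_ _ _ [I2 b2]]] := h2 tT.
    by split; [exact: intgD|rewrite RID// lerD].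
have trig (f : R -> R) A' : measurable_fun (Q T l) (fun z => f (th z.1 z.2)) ->
    (forall x, `|f x| <= 1) -> sqintI T A' ->
    intgI T (fun t => A' t * \I_(s < l) (f (th t s) * ph t s)) /\
    {aeI t < T, intgI l (fun s => f (th t s) * ph t s)}.
  move=> mf f1 sA.
  have s1 : sqint m2 (Q T l) (unc (fun t s => f (th t s) * ph t s)).
    by apply: (@sqint_mul_bounded _ _ _ m2 _ _ _ _ 1) => // z _; exact: f1.
  have i1 : intg m2 (Q T l) (unc (fun t s => f (th t s) * ph t s)).
    exact: (@sqint_Q_intg _ T l (fun t s => f (th t s) * ph t s)).
  have [a1 a2 _] := @RI_Q _ T l (fun t s => f (th t s) * ph t s) i1; split => //.
  apply: (@ae_intg _ _ _ mu _ _ (fun t => `|M * l| * `|A' t|)) => //.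
  - by apply: measurable_funM; [exact: sqint_meas sA|exact: intg_meas a2].
  - apply/intgZ/intg_norm => //; apply: sqint_intg => //; exact: mu_itv_lty.
  - move: a1 HM; apply: aeS2 => t a1 H tT; rewrite normrM mulrC ler_wpM2r//.
    have [Phi [PA b e _]] := H tT.
    apply: le_trans (ler_norm _); apply: le_trans (RI_norm _ (a1 tT)) _ => //.
    rewrite -[X in _ <= _ * X](mu_itvE l0) -RI_cst//; apply: ae_le_RI => //.
    + exact/intg_norm/(a1 tT).
    + by apply: (@intg_bounded _ _ _ mu _ _ _ `|M|) => //; exact: mu_itv_lty.
    + move: e; apply: aeS => s e sl; rewrite normrM -[leRHS]mul1r ler_pM//.
      by rewrite e// b.
have [A1 A2] := trig _ _ (measurable_sin_th (es_cont ES)) sin_norm_le1 (es_A ES).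
have [B1 B2] := trig _ _ (measurable_cos_th (es_cont ES)) cos_norm_le1 (es_B ES).
have i1 : intg m2 (Q T l) (unc (fun t s => tht t s * ph t s)).
  exact: sqintM (es_tht ES) sph.
have [t1 t2 _] := @RI_Q _ T l (fun t s => tht t s * ph t s) i1.
have [f1 f2 _] := @RI_Q _ T l (fun t s => pflux p (ths t s) * phs t s) i2.
split=> //.
move: HM (es_flux ES) => HM HF.
have H3 := aeS2 (fun t a b => conj a b) A2 B2.
have H4 := aeS2 (fun t a b => conj a b) t1 f1.
have H5 := aeS2 (fun t a b => conj a b) HM HF.
move: H3 H4 H5; apply: aeS3 => t [iA iB] [i_t i_f] [H F] tT.
have [Phi [PA b e _]] := H tT.
have mflux_t : measI l (pflux p \o ths t).
  exact: (@slice_t R T l (fun t s => pflux p (ths t s)) t mflux tT).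
have [iw iq IBP] := flux_ibp l0 (F tT) PA mflux_t.
rewrite IBP -RIZ//; last exact: iA.
rewrite -RIZ//; last exact: iB.
have ew : \I_(s < l) (edge_w th tht A B t s * Phi s) =
    \I_(s < l) (edge_w th tht A B t s * ph t s).
  have mph : measI l (ph t) by exact: slice_t m1 tT.
  apply: ae_eq_RI => //; first exact: intg_meas iw.
    apply: measurable_funM => //.
    have := sqint_edge_w (es_cont ES) (es_tht ES) (es_A ES) (es_B ES).
    by move=> [mw _]; exact: slice_t mw tT.
  by move: e; apply: aeS => s e sl; rewrite e.
rewrite ew; have -> : \I_(s < l) (edge_w th tht A B t s * ph t s) =
   \I_(s < l) (tht t s * ph t s) -
   \I_(s < l) (A t * (sin (th t s) * ph t s)) +
   \I_(s < l) (B t * (cos (th t s) * ph t s)).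
  rewrite -RIB//; [|exact: i_t tT|exact: intgZ (iA tT)].
  rewrite -RID//; [|exact: intgB (i_t tT) (intgZ _ _ (iA tT))|exact: intgZ (iB tT)].
  by apply: eq_RI => // s _; rewrite /edge_w; ring.
ring.
Qed.

Lemma ae_test_weak l0 (l : R) (u v F w : R -> R) : l0 = l -> 0 < l ->
  abscont l F w -> measI l u -> measI l v ->
  {aeI s < l, u s = F s} ->
  {aeI s < l, v s = w s} ->
  weak_derivative 0 l u v.
Proof.
move=> _ lp FA mu_ mv uF vw phi Tphi.
have := abscont_weak lp FA Tphi.
have [Aphi _] := test_abscont Tphi; have iphi := Aphi.1.
have mphi : measI l phi.
  exact: (@AC_measurable _ _ _ (derive1 phi)).
have mdphi : measI l (derive1 phi) by exact: intg_meas iphi.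
have mF : measI l F by exact: AC_measurable FA.
have mw : measI l w by exact: intg_meas FA.1.
have -> : \I_(x < l) (F x * derive1 phi x) =
    \I_(x < l) (u x * derive1 phi x).
  apply: ae_eq_RI => //; try exact: measurable_funM.
  by move: uF; apply: aeS => s h sl; rewrite h.
suff -> : \I_(x < l) (w x * phi x) =
    \I_(x < l) (v x * phi x) by [].
apply: ae_eq_RI => //; try exact: measurable_funM.
by move: vw; apply: aeS => s h sl; rewrite h.
Qed.

Lemma edge_to_weak T l th ths tht A B : 0 < T -> 0 < l ->
  edge_sol T l th ths tht A B ->
  [/\ LqW1p T l +oo%E p%:E th ths, H1L2 T l th tht,
      LqLp T l +oo%E (p / (p - 1))%:E (fun t s => pflux p (ths t s)),
      LqW1p T l 2%:E 2%:E (fun t s => pflux p (ths t s)) (edge_w th tht A B) &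
      {ae mu, forall t, t \in `]0, T[ ->
        zero_boundary l (fun s => pflux p (ths t s))}].
Proof.
move=> T0 l0 ES; have mQ := measurable_Q T l.
have [M [M0 thM]] := ucont2_bounded (es_cont ES).
have mth := ucont2_measurable (es_cont ES).
have p10 : 0 < p - 1 by rewrite subr_gt0.
have mflux : measurable_fun (Q T l) (unc (fun t s => pflux p (ths t s))).
  by apply: (measurableT_comp (measurable_pflux p1)); exact: es_meas ES.
have [C HC] := es_pow ES.
have sw := sqint_edge_w (es_cont ES) (es_tht ES) (es_A ES) (es_B ES).
have thb t s : `]0, T[%classic t -> `]0, l[%classic s -> `|th t s| <= M.
  rewrite /= !in_itv/= => /andP[t0 tT] /andP[s0 sl].
  by apply: thM; rewrite !ltW.
have fluxb : {aeI t < T, exists F,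
    [/\ abscont l F (edge_w th tht A B t), F 0 = 0, F l = 0 &
   {aeI s < l, pflux p (ths t s) = F s}]}.
  move: (es_flux ES); apply: aeS => t H tT; exact: flux_abscont l0 (H tT).
(* The flux is a primitive of w that vanishes at 0; by Cauchy-Schwarz its squared norm on a slice is
   at most l^2 times that of w. *)
have sflux : sqint m2 (Q T l) (unc (fun t s => pflux p (ths t s))).
  split => //.
  have sA := sqint_slice_t sw.
  have iw2 : intg m2 (Q T l) (unc (fun t s => edge_w th tht A B t s ^+ 2)).
    exact: sw.2.
  have [I1 I2 _] := @RI_Q _ T l (fun t s => edge_w th tht A B t s ^+ 2) iw2.
  have mf2 : measurable_fun (Q T l) (unc (fun t s => pflux p (ths t s) ^+ 2)).
    exact: measurable_funX.
  have [] // := @intg_Q_dom _ T l (fun t s => pflux p (ths t s) ^+ 2)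
    (fun t => (l * l) * \I_(s < l) (edge_w th tht A B t s ^+ 2)) mf2.
  - exact: intgZ.
  - by move=> t s; exact: sqr_ge0.
  move: fluxb sA; apply: aeS2 => t H sA tT; have [F [FA F0 Fl e]] := H tT.
  have sAt := sA tT.
  pose K := \I_(s < l) `|edge_w th tht A B t s|.
  have Fb s : `]0, l[%classic s -> F s ^+ 2 <= K ^+ 2.
    rewrite /= in_itv/= => /andP[s0 sl].
    rewrite -(real_normK (num_real (F s))) ler_sqr ?nnegrE ?RI_ge0//.
    have := AC_bounded FA (ltW s0) (ltW sl); rewrite F0 normr0 add0r => //.
  have K2 : K ^+ 2 <= l * \I_(s < l) (edge_w th tht A B t s ^+ 2).
    have := @RI_CS _ _ _ mu `]0, l[%classic (measurable_itv _) (fun=> 1 : R) (edge_w th tht A B t).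
    rewrite RI_cst// expr1n mul1r mu_itvE//.
    have -> : \I_(x < l) `|1 * edge_w th tht A B t x| = K.
      by apply: eq_RI => s _; rewrite mul1r.
    apply => //; apply: (@sqint_bounded _ _ _ mu _ _ _ 1) => //; first exact: mu_itv_lty.
    by move=> _ _; rewrite normr1.
  have iK : intgI l (fun=> K ^+ 2).
    by apply: (@intg_bounded _ _ _ mu _ _ _ `|K ^+ 2|) => //; exact: mu_itv_lty.
  have mft : measI l (fun s => pflux p (ths t s) ^+ 2).
    apply: measurable_funX.
    exact: (@slice_t R T l (fun t s => pflux p (ths t s)) t mflux tT).
  have qb : {aeI s < l, pflux p (ths t s) ^+ 2 <= K ^+ 2}.
    by move: e; apply: aeS => s e sl; rewrite e// Fb.
  have iq : intgI l (fun s => pflux p (ths t s) ^+ 2).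
    apply: ae_intg iK _ => //; move: qb; apply: aeS => s h sl.
    by rewrite ger0_norm ?sqr_ge0// h.
  split => //; apply: le_trans (ae_le_RI _ iq iK qb) _ => //.
  by rewrite RI_cst// mu_itvE// mulrC -mulrA ler_wpM2l// ltW.
split.
- split.
  + apply/LqLpy_iff => //; split => //; exists (M `^ p * l).
    apply: aeT => t tT; split.
      apply: (@intg_bounded _ _ _ mu _ _ _ (M `^ p)) => //; first exact: mu_itv_lty.
        by apply: measurable_abspow; exact: slice_t mth tT.
      move=> s sl; rewrite ger0_norm ?powR_ge0// ge0_ler_powR ?nnegrE//.
      + exact: ltW.
      + exact: ltW.
      + exact: thb.
    rewrite -[X in _ <= _ * X](mu_itvE l0) -RI_cst//; apply: le_RI => //.
    + apply: (@intg_bounded _ _ _ mu _ _ _ (M `^ p)) => //; first exact: mu_itv_lty.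
        by apply: measurable_abspow; exact: slice_t mth tT.
      move=> s sl; rewrite ger0_norm ?powR_ge0// ge0_ler_powR ?nnegrE//.
      * exact: ltW.
      * exact: ltW.
      * exact: thb.
    + by apply: (@intg_bounded _ _ _ mu _ _ _ `|M `^ p|) => //; exact: mu_itv_lty.
    + move=> s sl; rewrite ge0_ler_powR ?nnegrE//.
      * exact: ltW.
      * exact: ltW.
      * exact: thb.
  + by apply/LqLpy_iff => //; split; [exact: es_meas ES|exists C].
  + move: (es_s ES); apply: aeS => t H tT.
    exact: abscont_weak l0 (H tT).
- split.
  + apply/LqLp2_iff; apply: (@sqint_bounded _ _ _ m2 _ _ _ M) => //.
      exact: muQ_lty.
    by move=> [t s] [/= tT sl]; exact: thb.
  + by apply/LqLp2_iff; exact: es_tht ES.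
  + move=> eta Teta; move: (es_t ES); apply: aeS => s H sl.
    exact: abscont_weak T0 (H sl) _ Teta.
- apply/LqLpy_iff; first by rewrite divr_gt0.
  split => //; exists C; move: HC; apply: aeS => t H tT.
  have [I b] := H tT.
  have E s : `|pflux p (ths t s)| `^ (p / (p - 1)) = `|ths t s| `^ p.
    by rewrite pflux_norm// -powRrM; congr (_ `^ _); field; rewrite gt_eqF.
  split; first by apply: eq_intg I => // s _; rewrite E.
  suff -> : \I_(s < l) (`|pflux p (ths t s)| `^ (p / (p - 1))) =
    \I_(s < l) (`|ths t s| `^ p) by [].
  by apply: eq_RI => s _; exact: E.
- split.
  + exact/LqLp2_iff.
  + exact/LqLp2_iff.
  + move: fluxb (sqint_slice_t sw); apply: aeS2 => t H sws tT.
    have [F [FA F0 Fl e]] := H tT.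
    apply: (ae_test_weak (erefl l) l0 FA) => //.
    * exact: (@slice_t R T l (fun t s => pflux p (ths t s)) t mflux tT).
    * exact: sqint_meas (sws tT).
    * exact: aeT.
- move: fluxb; apply: aeS => t H tT.
  have [F [FA F0 Fl e]] := H tT; exists F; split => //.
  exact: AC_within FA.
Qed.

Lemma within_le l (c : R) (f : R -> R) : 0 < l -> {within `[0, l], continuous f} ->
  (forall s, 0 < s < l -> `|f s| <= c) -> forall s, 0 <= s <= l -> `|f s| <= c.
Proof.
move=> l0 cf H s sl; apply/ler_addgt0Pr => e e0; have [d [d0 Hd]] := within_unif cf e0.
pose q := Num.min d (l / 2).
have q0 : 0 < q by rewrite lt_min d0 divr_gt0.
have ql : q <= l / 2 by rewrite ge_min lexx orbT.
have qd : q <= d by rewrite ge_min lexx.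
have /andP[s0 sl'] := sl.
have [x [xl xs]] : exists x, 0 < x < l /\ `|x - s| <= q.
  clear - s0 sl' q0 ql; have [h|h] := leP s (l / 2); [exists (s + q / 2)|exists (s - q / 2)];
    rewrite ler_norml; split; apply/andP; split; lra.
have -> : f s = f x - (f x - f s) by ring.
apply: normB_le; first exact: H.
by apply: Hd; [|case/andP: xl => /ltW -> /ltW ->|exact: le_trans xs qd].
Qed.

Lemma ae_eq_within l (F G : R -> R) : 0 < l ->
  {within `[0, l], continuous F} -> {within `[0, l], continuous G} ->
  {aeI s < l, F s = G s} ->
  forall s, 0 <= s <= l -> F s = G s.
Proof.
move=> l0 /subspace_continuousP cF /subspace_continuousP cG FG s sl.
apply/eqP/negPn/negP => nFG.
have e0 : 0 < `|F s - G s| / 2 by rewrite divr_gt0// normr_gt0 subr_eq0.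
have sI : `[0, l]%classic s by rewrite /= in_itv.
have := cF s sI => /cvgrPdist_lt/(_ _ e0).
rewrite near_withinE => /nbhs_ballP[d1 /= d10 H1].
have := cG s sI => /cvgrPdist_lt/(_ _ e0).
rewrite near_withinE => /nbhs_ballP[d2 /= d20 H2].
pose d := Num.min d1 d2; have d0 : 0 < d by rewrite lt_min d10.
pose a := Num.max 0 (s - d); pose b := Num.min l (s + d).
have ab : a < b.
  move: sl => /andP[s0 sl]; rewrite lt_min !gt_max l0/=.
  by apply/and3P; split; lra.
have [x [ax xb /=]] := ae_ex_itv ab FG.
move: ax xb; rewrite gt_max lt_min => /andP[x0 sx] /andP[xl xs].
rewrite in_itv/= x0 xl => /(_ isT) E.
have xI : `[0, l]%classic x by rewrite /= in_itv/= !ltW.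
have sxd : `|s - x| < d by rewrite ltr_norml; apply/andP; split; lra.
have dd1 : d <= d1 by rewrite ge_min lexx.
have dd2 : d <= d2 by rewrite ge_min lexx orbT.
have {}H1 := H1 x (lt_le_trans sxd dd1) xI.
have {}H2 := H2 x (lt_le_trans sxd dd2) xI.
rewrite /from_subspace in H1 H2; rewrite -E in H2.
have := ler_normB (F s - F x) (G s - F x).
rewrite (_ : F s - F x - (G s - F x) = F s - G s); last by ring.
by move: H1 H2 => /= H1 H2; lra.
Qed.

Lemma weak_to_edge T l th ths tht A B w : 0 < T -> 0 < l ->
  ucont2 T l th -> LqW1p T l +oo%E p%:E th ths -> H1L2 T l th tht ->
  sqintI T A -> sqintI T B ->
  LqW1p T l 2%:E 2%:E (fun t s => pflux p (ths t s)) w ->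
  {ae mu, forall t, t \in `]0, T[ ->
    {ae mu, forall s, s \in `]0, l[ -> w t s = edge_w th tht A B t s}} ->
  {ae mu, forall t, t \in `]0, T[ -> zero_boundary l (fun s => pflux p (ths t s))} ->
  edge_sol T l th ths tht A B.
Proof.
move=> T0 l0 cth [_ /LqLpy_iff -/(_ pp)[mths [C HC]] Wth] [_ /LqLp2_iff stht Wtht].
move=> sA sB [/LqLp2_iff sq /LqLp2_iff sw Wq] we zb.
have sew := sqint_edge_w cth stht sA sB.
split => //.
- by exists C.
- move: HC Wth; apply: aeS2 => t H Wt tT.
  have [Ip _] := H tT; have [Is _] := Lp_intg (slice_t mths tT) Ip.
  have tT' : 0 <= t <= T by move: tT; rewrite /= in_itv/= => /andP[? ?]; rewrite !ltW.
  apply: plateau_abscont => //; first exact: ucont2_slice cth.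
  by move=> a b n tst; exact: Wt.
(* In [H1L2] the null set of s depends on the test function. Plateaus with rational end points are
   countably many, enumerated by [unpickle], so a single null set serves them all. *)
- pose eta (i : rat * rat * nat) := plateau (ratr i.1.1 : R) (ratr i.1.2) i.2.
  have : {ae mu, forall s, forall n, if @unpickle (rat * rat * nat)%type n is Some i
      then test_function 0 T (eta i) -> s \in `]0, l[ ->
        \I_(t < T) (th t s * derive1 (eta i) t) =
        - \I_(t < T) (tht t s * eta i t) else True}.
    apply: ae_foralln => n; case: unpickle => [i|]; last exact: aeT.
    have [tst|ntst] := pselect (test_function 0 T (eta i)).
      by move: (Wtht _ tst); apply: aeS.
    by apply: aeT => s /ntst.
  move: (sqint_slice_s stht); apply: aeS2 => s ss Hs sl.
  have sl' : 0 <= s <= l by move: sl; rewrite /= in_itv/= => /andP[? ?]; rewrite !ltW.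
  apply: plateau_abscont => //.
  + by apply: sqint_intg (ss sl) => //; exact: mu_itv_lty.
  + exact: ucont2_slice (ucont2_swap cth).
  + move=> a b n tst; have := Hs (pickle (a, b, n)); rewrite pickleK => /(_ tst sl).
    exact.
- have H1 := aeS2 (fun t a b => conj a b) 
    (@sqint_slice_t _ T l (fun t s => pflux p (ths t s)) sq) (sqint_slice_t sew).
  have H2 := aeS2 (fun t a b => conj a b) (sqint_slice_t sw) Wq.
  have H3 := aeS2 (fun t a b => conj a b) we zb.
  move: H1 H2 H3; apply: aeS3 => t [h1 h2] [h3 h4] [h5 h6] tT.
  have iq : intgI l (fun s => pflux p (ths t s)).
    by apply: sqint_intg (h1 tT) => //; exact: mu_itv_lty.
  have iw : intgI l (w t).
    by apply: sqint_intg (h3 tT) => //; exact: mu_itv_lty.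
  have ie : intgI l (edge_w th tht A B t).
    by apply: sqint_intg (h2 tT) => //; exact: mu_itv_lty.
  have [c Hc] := weak_derivative_ae l0 iq iw (h4 tT).
  have [F [cF qF F0 Fl]] := h6 tT.
  have ew x : x <= l -> \I_(s < x) w t s =
      \I_(s < x) edge_w th tht A B t s.
    move=> xl; apply: ae_eq_RI => //.
    + by apply: intg_meas; apply: (sub_itv_intg _ xl iw).
    + by apply: intg_meas; apply: (sub_itv_intg _ xl ie).
    + move: (h5 tT); apply: aeS => s e sx; apply: e; move: sx.
      by rewrite /= !in_itv/= => /andP[-> sx]; exact: lt_le_trans sx xl.
  (* c is the unknown constant of integration; the continuous representative F supplied by the
     boundary condition vanishes at 0, which forces c = 0. *)
  pose G x := c + \I_(s < x) edge_w th tht A B t s.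
  have G0 : G 0 = c.
    rewrite /G set_itvoo0 /Rintegral integral_set0 addr0//.
  have AG : abscont l G (edge_w th tht A B t) by split => // x _ _; rewrite G0.
  have FG : forall s, 0 <= s <= l -> F s = G s.
    apply: ae_eq_within l0 cF (AC_within AG) _.
    move: Hc qF; apply: aeS2 => s e1 e2 sl.
    rewrite -e2// e1// /G ew//.
    by move: sl; rewrite /= in_itv/= => /andP[_ /ltW].
  have c0 : c = 0 by rewrite -G0 -FG ?F0// lexx ltW.
  split => //.
  + have : G l = 0 by rewrite -FG ?Fl// lexx ltW.
    by rewrite /G c0 add0r.
  + move: Hc; apply: aeS => s e sl; rewrite /= e// c0 add0r ew//.
    by move: sl; rewrite /= in_itv/= => /andP[_ /ltW].
Qed.

End edges.

Lemma sum3 (V : zmodType) (F : 'I_3 -> V) : \sum_(j < 3) F j = F e1 + F e2 + F e3.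
Proof.
rewrite !big_ord_recl big_ord0 addr0 addrA.
by congr (F _ + F _ + F _); exact: val_inj.
Qed.

Lemma ord3P (P : 'I_3 -> Prop) : P e1 -> P e2 -> P e3 -> forall j, P j.
Proof.
move=> h1 h2 h3 [[|[|[|//]]] h].
- by rewrite (_ : Ordinal h = e1)//; exact: val_inj.
- by rewrite (_ : Ordinal h = e2)//; exact: val_inj.
- by rewrite (_ : Ordinal h = e3)//; exact: val_inj.
Qed.

Lemma ex_min3 (R : realType) (P : 'I_3 -> R -> Prop) :
  (forall j, exists r, 0 < r /\ P j r) -> (forall j r r', 0 < r' -> r' <= r -> P j r -> P j r') ->
  exists r, 0 < r /\ forall j, P j r.
Proof.
move=> H mono; have [r1 [q1 h1]] := H e1; have [r2 [q2 h2]] := H e2; have [r3 [q3 h3]] := H e3.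
have q : 0 < Num.min r1 (Num.min r2 r3) by rewrite !lt_min q1 q2.
exists (Num.min r1 (Num.min r2 r3)); split => // j.
by elim/ord3P: j; [apply: mono h1|apply: mono h2|apply: mono h3]; rewrite // !ge_min lexx ?orbT.
Qed.

Section network.
Context (R : realType) (p : R).
Hypothesis p1 : 1 < p.
Local Notation mu := (@lebesgue_measure R).
Implicit Types (T : R) (L : 'I_3 -> R) (E : evolution R).

(* Edge j carries the force A_j sin(theta) - B_j cos(theta) with A_j = split3 lambda^1 mu^1 j and
   B_j = split3 lambda^2 mu^2 j; these coefficients sum to 0 over the three edges. *)
Definition split3 (x y : R) (j : 'I_3) : R :=
  match val j with 0%N => x - y | 1%N => - x | _ => y end.

Lemma RI_sum4 T (f g h k : R -> R) : intgI T f -> intgI T g ->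
  intgI T h -> intgI T k ->
  {aeI t < T, f t + g t - h t + k t = 0} ->
  \I_(t < T) f t + \I_(t < T) g t -
  \I_(t < T) h t + \I_(t < T) k t = 0.
Proof.
move=> i1 i2 i3 i4 H; have i12 : intgI T (fun t => f t + g t) by exact: intgD.
have i123 : intgI T (fun t => f t + g t - h t) by exact: intgB.
have i1234 : intgI T (fun t => f t + g t - h t + k t) by exact: intgD.
rewrite -RID// -RIB// -RID//.
transitivity (\I_(t < T) (0 : R)); last exact: RI_eq0.
by apply: ae_eq_RI => //; exact: intg_meas i1234.
Qed.

Lemma RI_mulNl T (f g : R -> R) : intgI T (fun t => - f t * g t) ->
  \I_(t < T) (- f t * g t) = - \I_(t < T) (f t * g t).
Proof.
move=> i; rewrite -[LHS]opprK -RIN//; congr (- _).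
by apply: eq_RI => t _; rewrite mulNr opprK.
Qed.

Lemma weak_form_sum (a1 a2 a3 b1 b2 b3 c1 c2 c3 d1 d2 d3 : R) :
  a1 + b1 - c1 + d1 = 0 -> a2 + b2 - - c2 + - d2 = 0 -> a3 + b3 - c3 + d3 = 0 ->
  0 = a1 + a2 + a3 + (b1 + b2 + b3) - c1 + d1 + c2 - d2 - c3 + d3.
Proof. by move=> h1 h2 h3; lra. Qed.

Definition forceA E j t := split3 (lambda1 E t) (mu1 E t) j.
Definition forceB E j t := split3 (lambda2 E t) (mu2 E t) j.

Definition nice L (th0 : 'I_3 -> R -> R) T E (ths tht : 'I_3 -> R -> R -> R) :=
  [/\ forall j, edge_sol p T (L j) (theta E j) (ths j) (tht j) (forceA E j) (forceB E j),
      forall j s, 0 <= s <= L j -> theta E j 0 s = th0 j s &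
      forall t, 0 <= t <= T -> network_constraint L (fun j => theta E j t)].

Lemma nice_weak L th0 T E ths tht : 0 < T -> (forall j, 0 < L j) ->
  nice L th0 T E ths tht -> weak_solution p L th0 T E.
Proof.
case: E => th la1 la2 mu1 mu2 T0 L0 [ES th00 con].
exists ths, tht; split => //=.
- move=> j; have [h1 h2 _ _ _] := edge_to_weak p1 T0 (L0 j) (ES j).
  split => //; first by apply/ucont2P; exact: es_cont (ES j).
  by move=> s; rewrite in_itv/=; exact: th00.
- have A2 := es_A (ES e2); have A3 := es_A (ES e3).
  have B2 := es_B (ES e2); have B3 := es_B (ES e3).
  split; apply/Lp2_iff => //.
    by apply: eq_sqint (sqintN _ A2) => // t _; rewrite /forceA /split3/= opprK.
  by apply: eq_sqint (sqintN _ B2) => // t _; rewrite /forceB /split3/= opprK.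
- move=> ph phs W.
  have EW j := edge_weak_form p1 (L0 j) (ES j) (W j).
  have Z j : \I_(t < T) \I_(s < L j) (tht j t s * ph j t s) +
    \I_(t < T) \I_(s < L j) (pflux p (ths j t s) * phs j t s) -
    \I_(t < T) (forceA (Evolution th la1 la2 mu1 mu2) j t *
      \I_(s < L j) (sin (th j t s) * ph j t s)) +
    \I_(t < T) (forceB (Evolution th la1 la2 mu1 mu2) j t *
      \I_(s < L j) (cos (th j t s) * ph j t s)) = 0.
    have [[/= h1 h2 h3 h4] h5] := EW j.
    exact: RI_sum4.
  have := Z e3; have := Z e2; have := Z e1.
  rewrite /forceA /forceB /split3/=.
  have [[_ _ i3 i4] _] := EW e2.
  rewrite (RI_mulNl i3) (RI_mulNl i4) !sum3 => z1 z2 z3.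
  exact: weak_form_sum z1 z2 z3.
- exists (fun j => edge_w (th j) (tht j) (forceA (Evolution th la1 la2 mu1 mu2) j)
    (forceB (Evolution th la1 la2 mu1 mu2) j)).
  split.
  + by move=> j; have [_ _ h3 h4 _] := edge_to_weak p1 T0 (L0 j) (ES j).
  + apply: aeT => t _; apply: aeT => s _.
    by rewrite /edge_w /forceA /forceB /split3/=; ring.
  + apply: aeT => t _; apply: aeT => s _.
    by rewrite /edge_w /forceA /forceB /split3/=; ring.
  + apply: aeT => t _; apply: aeT => s _.
    by rewrite /edge_w /forceA /forceB /split3/=; ring.
  + by move=> j; have [_ _ _ _ h5] := edge_to_weak p1 T0 (L0 j) (ES j).
Qed.

Lemma weak_nice L th0 T E : 0 < T -> (forall j, 0 < L j) ->
  weak_solution p L th0 T E -> exists ths tht, nice L th0 T E ths tht.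
Proof.
case: E => th la1 la2 mu1 mu2 T0 L0 [ths [tht [/= H1 [l1 l2 l3 l4] _ [w [w0 w1 w2 w3 w4]] con]]].
exists ths, tht.
move: l1 l2 l3 l4 => /Lp2_iff l1 /Lp2_iff l2 /Lp2_iff l3 /Lp2_iff l4.
split => /=.
- move=> j; have [/ucont2P cth Wth Hth _] := H1 j.
  apply: (weak_to_edge (w := w j) p1 T0 (L0 j) cth Wth Hth).
  + move: j {cth Wth Hth}; apply: ord3P; rewrite /forceA /split3/=.
    * exact: sqintB.
    * exact: sqintN.
    * exact: l3.
  + move: j {cth Wth Hth}; apply: ord3P; rewrite /forceB /split3/=.
    * exact: sqintB.
    * exact: sqintN.
    * exact: l4.
  + by have [] := w0 j.
  + move: j {cth Wth Hth}; apply: ord3P.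
    * move: w1; apply: aeS => t h tT; move: (h tT); apply: aeS => s e sl.
      by rewrite e// /edge_w /forceA /forceB /split3/=; ring.
    * move: w2; apply: aeS => t h tT; move: (h tT); apply: aeS => s e sl.
      by rewrite e// /edge_w /forceA /forceB /split3/=; ring.
    * move: w3; apply: aeS => t h tT; move: (h tT); apply: aeS => s e sl.
      by rewrite e// /edge_w /forceA /forceB /split3/=; ring.
  + exact: w4.
- by move=> j s sl; have [_ _ _] := H1 j; apply; rewrite in_itv.
- by move=> t tT; apply: con; rewrite in_itv.
Qed.

End network.

(** * From L^2 bounds to uniform bounds *)

Section interpolation.
Context (R : realType).
Local Notation mu := (@lebesgue_measure R).

(* If g were larger than om + b somewhere, it would be larger than b on a whole
   window of length r. *)
Lemma sup_interp (l r om b s : R) (g : R -> R) : intgI l (fun x => g x ^+ 2) ->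
  0 < r -> r <= l ->
  (forall x y, 0 <= x -> x <= y -> y <= l -> y - x <= r -> `|g y - g x| <= om) ->
  0 <= b -> \I_(x < l) (g x ^+ 2) < b ^+ 2 * r ->
  0 <= s -> s <= l -> `|g s| <= om + b.
Proof.
move=> i2 r0 rl gom b0 gb s0 sl; rewrite leNgt; apply/negP => H.
pose a := Num.min s (l - r).
have a0 : 0 <= a by rewrite le_min s0 subr_ge0.
have arl : a + r <= l by rewrite -lerBrDr ge_min lexx orbT.
have as_ : a <= s by rewrite ge_min lexx.
have sar : s <= a + r.
  by rewrite /a; have [|] := leP s (l - r) => h; lra.
have ab : a <= a + r by rewrite lerDl ltW.
have : b ^+ 2 * r <= \I_(a < x < a + r) (g x ^+ 2).
  have E : fine (mu `]a, a + r[) = r by rewrite mu_itv_len// addrAC subrr add0r.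
  rewrite -[X in _ * X]E -RI_cst//; apply: le_RI => //.
  - by apply: (@intg_bounded _ _ _ mu _ _ _ `|b ^+ 2|) => //; exact: mu_itv_lty.
  - exact: sub_itv_intg i2.
  move=> x /inI[ax xar].
  rewrite -[leRHS]real_normK ?num_real// lerXn2r ?nnegrE//.
  have x0 : 0 <= x by lra.
  have xl : x <= l by lra.
  have : `|g s - g x| <= om.
    have [xs|/ltW sx] := leP x s; first by apply: gom => //; lra.
    by rewrite distrC; apply: gom => //; lra.
  by have := ler_distD (g x) (g s) 0; rewrite !subr0; lra.
rewrite leNgt => /negP; apply; apply: le_lt_trans gb.
rewrite [leRHS](@RI_itv_split _ _ 0 a l)//; last lra.
have i2' : intg mu `]a, l[ (fun x => g x ^+ 2) by exact: sub_itv_intg i2.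
rewrite [X in _ <= _ + X](@RI_itv_split _ _ a (a + r) l)//.
by rewrite addrCA lerDl addr_ge0// RI_ge0// => x _; exact: sqr_ge0.
Qed.

Lemma equi_power (p C e : R) : 1 < p -> 0 <= C -> 0 < e ->
  exists r, 0 < r /\ forall (l : R) (d : R -> R), measI l d ->
    intgI l (fun s => `|d s| `^ p) ->
    \I_(s < l) (`|d s| `^ p) <= C ->
    forall x y, 0 <= x -> x <= y -> y <= l -> y - x <= r ->
      \I_(x < s < y) `|d s| <= e.
Proof.
move=> p1 C0 e0.
have p10 : 0 < p - 1 by rewrite subr_gt0.
have C1 : 0 < 2 * (C + 1) / e by rewrite divr_gt0// mulr_gt0// ltr_wpDl.
(* K makes (C + 1) / K^(p-1) equal to e / 2, the summand 1 keeping K positive when C = 0. On an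
   interval of length e / (2 K) the part of |d| below K contributes the other half. *)
pose K := (2 * (C + 1) / e) `^ (p - 1)^-1.
have K0 : 0 < K by rewrite powR_gt0.
have KE : K `^ (p - 1) = 2 * (C + 1) / e.
  by rewrite -powRrM mulVf ?gt_eqF// powRr1// ltW.
exists (e / (2 * K)); split; first by rewrite divr_gt0// mulr_gt0.
move=> l d md id dC x y x0 xy yl yxr.
have i1 : intg mu `]x, y[ (fun s => `|d s| `^ p) by exact: sub_itv_intg id.
have md' : measurable_fun `]x, y[ d.
  apply: measurable_funS md => //.
  by move=> z /=; rewrite !in_itv/= => /andP[? ?]; apply/andP; split; lra.
have iK : intg mu `]x, y[ (fun=> K).
  by apply: (@intg_bounded _ _ _ mu _ _ _ `|K|) => //; exact: mu_itv_lty.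
have iK' : intg mu `]x, y[ (fun s => (K `^ (p - 1))^-1 * `|d s| `^ p).
  exact: intgZ.
have i2 : intg mu `]x, y[ (fun s => K + (K `^ (p - 1))^-1 * `|d s| `^ p).
  exact: intgD.
have le1 s : `|d s| <= K + (K `^ (p - 1))^-1 * `|d s| `^ p.
  by rewrite mulrC; exact: norm_le_equi.
have id1 : intg mu `]x, y[ (fun s => `|d s|).
  apply: (@intg_le _ _ _ mu _ _ _ (fun s => K + (K `^ (p - 1))^-1 * `|d s| `^ p)) => //.
    exact: measurableT_comp.
  by move=> s _; rewrite normr_id.
apply: (@le_trans _ _ (\I_(x < s < y) (K + (K `^ (p - 1))^-1 * `|d s| `^ p))).
  exact: le_RI.
rewrite RID// RI_cst// RIZ// KE [leRHS]splitr lerD//.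
  rewrite mu_itv_len//.
  apply: le_trans (ler_wpM2l (ltW K0) yxr) _.
  by apply: eq_ler; field; rewrite gt_eqF.
have h : \I_(x < s < y) (`|d s| `^ p) <= C + 1.
  apply: (@le_trans _ _ C); last by rewrite lerDl.
  apply: le_trans dC.
  rewrite [leRHS](@RI_itv_split _ _ 0 x l)//; last lra.
  have i2' : intg mu `]x, l[ (fun s => `|d s| `^ p) by exact: sub_itv_intg id.
  rewrite [X in _ <= _ + X](@RI_itv_split _ _ x y l)//.
  by rewrite addrCA lerDl addr_ge0// RI_ge0// => s _; exact: powR_ge0.
apply: le_trans (ler_wpM2l _ h) _; first by rewrite invr_ge0 ltW.
apply: eq_ler; field.
by rewrite !gt_eqF// ltr_wpDl.
Qed.

(** A ball of W^{1,p} for the energy, with the derivative as data. Such functions share one modulus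
    of continuity, for all l at once. *)
Definition acp (p C l : R) (g d : R -> R) := [/\ abscont l g d, measI l d,
  intgI l (fun s => `|d s| `^ p) & \I_(s < l) (`|d s| `^ p) <= C].

Lemma acp_equicont (p C e : R) : 1 < p -> 0 <= C -> 0 < e -> exists r, 0 < r /\
  forall l g d, acp p C l g d -> forall x y, 0 <= x <= l -> 0 <= y <= l ->
    `|x - y| <= r -> `|g x - g y| <= e.
Proof.
move=> p1 C0 e0; have [r [r0 H]] := equi_power p1 C0 e0; exists r; split => // l g d [A md ip b] x y.
wlog xy : x y / x <= y => [W|] /andP[x0 xl] /andP[y0 yl] h.
  by have [xy|/ltW yx] := leP x y; [|rewrite distrC]; apply: W => //; rewrite ?x0 ?xl ?y0 ?yl// distrC.
rewrite distrC; apply: le_trans (AC_norm A x0 xy yl) (H l d md ip b x y x0 xy yl _).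
by apply: le_trans h; rewrite distrC ler_norm.
Qed.

(** The difference of two members oscillates by at most e / 2 on a length r common to all of them,
    so [sup_interp] makes it at most e as soon as its L^2 norm is small. This is how L^2 control of
    the motion becomes uniform control. *)
Lemma acp_close (p C l e : R) : 1 < p -> 0 <= C -> 0 < l -> 0 < e -> exists b, 0 < b /\
  forall g d g' d', acp p C l g d -> acp p C l g' d' ->
  \I_(s < l) ((g s - g' s) ^+ 2) <= b -> forall s, 0 <= s <= l -> `|g s - g' s| <= e.
Proof.
move=> p1 C0 l0 e0; have [e4 e2] : 0 < e / 4 /\ 0 < e / 2 by split; rewrite divr_gt0.
have [r1 [r10 H]] := acp_equicont p1 C0 e4.
pose r := Num.min r1 l; have r0 : 0 < r by rewrite lt_min r10.
have b0 : 0 < (e / 2) ^+ 2 * r by rewrite mulr_gt0// exprn_gt0.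
exists ((e / 2) ^+ 2 * r / 2); split => [|g d g' d' a a' gb s /andP[s0 sl]]; first by rewrite divr_gt0.
have [A _ _ _] := a; have [A' _ _ _] := a'; have AB := ACB A A'.
rewrite [e]splitr; apply: (sup_interp (AC_sqint AB).2 r0 _ _ (ltW e2)) => //.
- by rewrite ge_min lexx orbT.
- move=> x y x0 xy yl yr.
  have K f f' : acp p C l f f' -> `|f y - f x| <= e / 4.
    move=> af; apply: (H _ _ _ af); rewrite ?x0 ?yl ?(le_trans x0)// ?(le_trans xy)//.
    by rewrite ger0_norm ?subr_ge0// (le_trans yr)// ge_min lexx.
  have -> : g y - g' y - (g x - g' x) = (g y - g x) - (g' y - g' x) by ring.
  by rewrite (_ : e / 2 = e / 4 + e / 4); [exact: normB_le (K _ _ a) (K _ _ a')|field].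
by apply: le_lt_trans gb _; rewrite ltr_pdivrMr// ltr_pMr// ltr1n.
Qed.

End interpolation.

(** * Functions on a mesh and the discrete energy of one edge *)

Section mesh.
Context (R : realType) (l h : R) (N : nat).
Hypotheses (N0 : (0 < N)%N) (h0 : 0 < h) (hN : h * N%:R = l).
Local Notation mu := (@lebesgue_measure R).
Implicit Types (g : nat -> R) (s : R).

Definition cell s : nat := Num.truncn (s / h).
Definition bar g s : R := g (cell s).

Lemma mesh_l0 : 0 < l. Proof. by rewrite -hN mulr_gt0// ltr0n. Qed.

Lemma cell_itv s : 0 <= s -> h * (cell s)%:R <= s < h * (cell s).+1%:R.
Proof.
move=> s0; have /truncn_itv : 0 <= s / h by rewrite divr_ge0// ltW.
by rewrite ler_pdivlMr// ltr_pdivrMr// ![_ * h]mulrC.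
Qed.

Lemma cell_eq s k : h * k%:R <= s -> s < h * k.+1%:R -> cell s = k.
Proof.
move=> h1 h2; apply: truncn_def.
by rewrite ler_pdivlMr// ltr_pdivrMr// ![_ * h]mulrC h1.
Qed.

Lemma cell_lt s : 0 <= s -> s < l -> (cell s < N)%N.
Proof.
move=> s0 sl; have /andP[h1 _] := cell_itv s0.
rewrite -(ltr_nat R) -(ltr_pM2l h0) hN; exact: le_lt_trans h1 sl.
Qed.

Lemma cell_fiber i : measurable (`]0, l[ `&` [set s | cell s = i] : set R).
Proof.
have -> : `]0, l[ `&` [set s | cell s = i] =
    `]0, l[ `&` `[h * i%:R, h * i.+1%:R[%classic.
  apply/seteqP; split => s /=; rewrite !in_itv/= => -[/andP[s0 sl]].
    by move=> <-; rewrite s0 sl; split => //; apply: cell_itv; exact: ltW.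
  by rewrite s0 sl => /andP[h1 h2]; split => //; exact: cell_eq.
by apply: measurableI; exact: measurable_itv.
Qed.

Lemma measurable_bar g : measI l (bar g).
Proof.
apply: (@measurable_cells _ _ _ _ cell (fun i _ => g i)) => //.
exact: cell_fiber.
Qed.

Lemma bar_bounded g s : 0 <= s -> s < l -> `|bar g s| <= \sum_(i < N) `|g i|.
Proof.
move=> s0 sl; rewrite /bar (bigD1 (Ordinal (cell_lt s0 sl)))//= lerDl.
exact: sumr_ge0.
Qed.

Lemma intg_bar g : intgI l (bar g).
Proof.
apply: (@intg_bounded _ _ _ mu _ _ _ (\sum_(i < N) `|g i|)) => //.
- exact: mu_itv_lty.
- exact: measurable_bar.
- by move=> s /inI[/ltW s0 sl]; exact: bar_bounded.
Qed.

Lemma RI_const_on (f : R -> R) (a b k : R) : a <= b ->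
  (forall s, a < s -> s < b -> f s = k) -> \I_(a < s < b) f s = (b - a) * k.
Proof.
move=> ab fk; transitivity (\I_(a < s < b) k).
  by apply: eq_RI => s /inI[sa sb]; exact: fk.
by rewrite RI_cst// mulrC mu_itv_len.
Qed.

Lemma RI_bar g k s : (k < N)%N -> h * k%:R <= s -> s <= h * k.+1%:R ->
  \I_(x < s) bar g x = h * \sum_(i < k) g i + (s - h * k%:R) * g k.
Proof.
have kl m : (m <= N)%N -> h * m%:R <= l by move=> mN; rewrite -hN ler_pM2l// ler_nat.
elim: k s => [|k IH] s kN ks sk.
  rewrite big_ord0 !mulr0 add0r subr0; rewrite mulr1 in sk; rewrite mulr0 in ks.
  rewrite (RI_const_on (k := g 0%N)) ?subr0// => x x0 xs.
  by rewrite /bar (@cell_eq _ 0%N)// ?mulr0 ?mulr1; [exact: ltW|exact: lt_le_trans xs sk].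
have sl : s <= l by apply: le_trans sk (kl _ kN).
rewrite (@RI_itv_split _ _ 0 (h * k.+1%:R) s)//; last 2 first.
  by rewrite mulr_ge0// ltW.
  by apply: sub_itv_intg (intg_bar g).
rewrite IH//; last 2 first.
  exact: ltnW.
  by rewrite ler_pM2l// ler_nat.
rewrite (RI_const_on (k := g k.+1))//; last first.
  by move=> x kx xs; rewrite /bar (@cell_eq _ k.+1)//; [exact: ltW|exact: lt_le_trans xs sk].
rewrite big_ord_recr/=; congr (_ + _).
by rewrite mulrDr; congr (_ + _); rewrite -mulrBr -natrB// subSnn mulr1.
Qed.

Definition dsum g : R := h * \sum_(i < N) g i.

Lemma RI_bar_dsum g : \I_(x < l) bar g x = dsum g.
Proof.
have N1 : (N.-1 < N)%N by rewrite prednK.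
have N2 : h * N.-1.+1%:R = l by rewrite prednK.
rewrite (RI_bar g N1); last 2 first.
- by rewrite -N2 ler_pM2l// ler_nat.
- by rewrite N2.
rewrite /dsum -[in RHS](prednK N0) big_ord_recr/= mulrDr; congr (_ + _).
by rewrite -N2 -mulrBr -natrB// subSnn mulr1.
Qed.

Lemma dsum_ge0 g : (forall i, (i < N)%N -> 0 <= g i) -> 0 <= dsum g.
Proof. by move=> g0; rewrite mulr_ge0 ?(ltW h0)// sumr_ge0// => i _; exact: g0. Qed.

Lemma le_dsum f g : (forall i, (i < N)%N -> f i <= g i) -> dsum f <= dsum g.
Proof. by move=> fg; rewrite ler_pM2l// ler_sum// => i _; exact: fg. Qed.

Lemma dsum_term g i : (forall i, 0 <= g i) -> (i < N)%N -> h * g i <= dsum g.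
Proof.
move=> g0 iN; rewrite ler_pM2l// (bigD1 (Ordinal iN))//= lerDl sumr_ge0//.
Qed.

Lemma dsumD f g : dsum (fun i => f i + g i) = dsum f + dsum g.
Proof. by rewrite /dsum big_split mulrDr. Qed.

Lemma dsumZ g k : dsum (fun i => k * g i) = k * dsum g.
Proof. by rewrite /dsum -mulr_sumr mulrCA. Qed.

Lemma eq_dsum f g : (forall i, (i < N)%N -> f i = g i) -> dsum f = dsum g.
Proof. by move=> fg; congr (_ * _); apply: eq_bigr => i _; exact: fg. Qed.

Lemma dsum_cst k : dsum (fun=> k) = l * k.
Proof. by rewrite /dsum sumr_const card_ord -mulr_natl mulrA hN. Qed.

Lemma dsum_norm g : `|dsum g| <= dsum (fun i => `|g i|).
Proof.
by rewrite normrM (ger0_norm (ltW h0)) ler_pM2l// ler_norm_sum.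
Qed.

End mesh.

Section trigonometric_bounds.
Context (R : realType).
Implicit Types (x y v : R).

Lemma mean_value (f df : R -> R) x y : (forall z, is_derive z (1 : R) f (df z)) ->
  exists c, `|c - x| <= `|y - x| /\ f y - f x = df c * (y - x).
Proof.
move=> fd; have cf : continuous f.
  by move=> z; apply: differentiable_continuous; apply/derivable1_diffP; case: (fd z).
have [xy|/ltW yx] := leP x y.
  have [c] := @MVT_segment _ f df x y xy (fun z _ => fd z) (continuous_subspaceT cf).
  rewrite in_itv/= => /andP[h1 h2] E; exists c; split => //.
  by rewrite !ger0_norm ?subr_ge0// lerD2r.
have [c] := @MVT_segment _ f df y x yx (fun z _ => fd z) (continuous_subspaceT cf).
rewrite in_itv/= => /andP[h1 h2] E; exists c; split.
  by rewrite !ler0_norm ?subr_le0// lerN2 lerD2r.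
by rewrite -[LHS]opprB E; ring.
Qed.

Lemma sin_lip x y : `|sin y - sin x| <= `|y - x|.
Proof.
have [c [_ ->]] := mean_value x y (@is_derive_sin R).
by rewrite normrM -[leRHS]mul1r ler_wpM2r// cos_norm_le1.
Qed.

Lemma cos_lip x y : `|cos y - cos x| <= `|y - x|.
Proof.
have [c [_ ->]] := mean_value x y (@is_derive_cos R).
by rewrite normrM normrN -[leRHS]mul1r ler_wpM2r// sin_norm_le1.
Qed.

Lemma sin_taylor x y : `|sin y - sin x - cos x * (y - x)| <= (y - x) ^+ 2.
Proof.
have [c [h ->]] := mean_value x y (@is_derive_sin R).
rewrite -mulrBl normrM -[leRHS]real_normK ?num_real// expr2 ler_wpM2r//.
exact: le_trans (cos_lip _ _) h.
Qed.

Lemma cos_taylor x y : `|cos y - cos x - - sin x * (y - x)| <= (y - x) ^+ 2.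
Proof.
have [c [h ->]] := mean_value x y (@is_derive_cos R).
rewrite -mulrBl normrM -[leRHS]real_normK ?num_real// expr2 ler_wpM2r//.
by rewrite -opprD normrN; exact: le_trans (sin_lip _ _) h.
Qed.

End trigonometric_bounds.

Section state.
Context (R : realType) (p : R) (l h : R) (N : nat).
Hypotheses (p1 : 1 < p) (N0 : (0 < N)%N) (h0 : 0 < h) (hN : h * N%:R = l).
Local Notation mu := (@lebesgue_measure R).
Implicit Types (x y v f : nat -> R) (s t E : R).
Let pp : 0 < p. Proof. exact: lt_trans ltr01 p1. Qed.
Let l0 : 0 < l. Proof. exact: mesh_l0 N0 h0 hN. Qed.
Local Notation dsum := (dsum h N).
Local Notation bar := (bar h).
Local Notation cell := (cell h).

(** The backward difference, set to 0 at node 0 and from node N on. This encodes zero flux at both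
    ends and removes the boundary terms from [discrete_ibp]. *)
Definition slope x i : R := if (0 < i < N)%N then (x i - x i.-1) / h else 0.
Definition flux_div x i : R := (pflux p (slope x i.+1) - pflux p (slope x i)) / h.
Definition energy x : R := dsum (fun i => `|slope x i| `^ p).

Lemma slopeDZ x v t i : slope (fun i => x i + t * v i) i = slope x i + t * slope v i.
Proof. by rewrite /slope; case: ifP => _; ring. Qed.

Lemma slope0 x : slope x 0 = 0. Proof. by []. Qed.

Lemma slopeN x : slope x N = 0. Proof. by rewrite /slope ltnn andbF. Qed.

Lemma pflux0 : pflux p 0 = 0. Proof. by rewrite /pflux mulr0. Qed.

Lemma slope_sum x k : (k < N)%N -> x 0%N + h * \sum_(i < k.+1) slope x i = x k.
Proof.
elim: k => [_|k IH kN]; first by rewrite big_ord1 slope0 mulr0 addr0.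
rewrite big_ord_recr/= mulrDr addrA IH; last exact: ltnW.
by rewrite /slope kN/= mulrC divfK ?gt_eqF// addrC subrK.
Qed.

Lemma flux_div_sum x k : h * \sum_(i < k) flux_div x i = pflux p (slope x k).
Proof.
elim: k => [|k IH]; first by rewrite big_ord0 mulr0 slope0 pflux0.
by rewrite big_ord_recr/= mulrDr IH /flux_div mulrC divfK ?gt_eqF// addrC subrK.
Qed.

Lemma dsum_flux_div x : dsum (flux_div x) = 0.
Proof. by rewrite /dsum flux_div_sum slopeN pflux0. Qed.

Lemma discrete_ibp x f : dsum (fun i => flux_div x i * f i) =
  - dsum (fun i => pflux p (slope x i) * slope f i).
Proof.
suff H k : (k < N)%N -> h * \sum_(i < k.+1) flux_div x i * f i =
    pflux p (slope x k.+1) * f k -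
    h * \sum_(i < k.+1) pflux p (slope x i) * slope f i.
  have := H N.-1; rewrite prednK// leqnn => /(_ isT).
  by rewrite slopeN pflux0 mul0r sub0r.
elim: k => [_|k IH kN].
  rewrite !big_ord1 /flux_div !slope0 pflux0 subr0 !mulr0 subr0; field.
  by rewrite gt_eqF.
rewrite big_ord_recr [in RHS]big_ord_recr/= !mulrDr IH; last exact: ltnW.
rewrite /flux_div [slope f k.+1]/slope kN/=; field.
by rewrite gt_eqF.
Qed.

Lemma dsumB f f' : dsum (fun i => f i - f' i) = dsum f - dsum f'.
Proof. by rewrite /dsum sumrB mulrBr. Qed.

Lemma energy_ge0 x : 0 <= energy x.
Proof. by apply: dsum_ge0 => // i _; exact: powR_ge0. Qed.

(** Convexity bounds the increment of the energy by a pairing with the flux at the new state; e is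
    the price for evaluating the flux at the old state, as an explicit scheme does. *)
Lemma energy_step x v t e : 0 <= t -> 
  (forall i, (i < N)%N -> `|pflux p (slope (fun i => x i + t * v i) i) -
     pflux p (slope x i)| <= e) ->
  energy (fun i => x i + t * v i) / p - energy x / p <=
  - t * dsum (fun i => flux_div x i * v i) + t * e * dsum (fun i => `|slope v i|).
Proof.
move=> t0 He; set y := fun i => x i + t * v i.
rewrite discrete_ibp mulrNN -mulrA -!dsumZ -dsumD.
have E z : energy z / p = dsum (fun i => p^-1 * `|slope z i| `^ p).
  by rewrite dsumZ mulrC.
rewrite !E.
rewrite -dsumB; apply: le_dsum => // i iN.
have := pflux_convex p1 (slope y i) (slope x i).
have := He i iN; rewrite slopeDZ => H1 H2.
rewrite ![p^-1 * _]mulrC; apply: le_trans H2 _.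
rewrite addrAC subrr add0r.
move: H1; set a := pflux p _; set b := pflux p _ => H1.
have -> : a * (t * slope v i) = t * (b * slope v i) + t * ((a - b) * slope v i) by ring.
rewrite -mulrA lerD2l ler_wpM2l//.
by apply: le_trans (ler_norm _) _; rewrite normrM ler_wpM2r.
Qed.

(** The continuous interpolant. It is constant on the first cell, where the slope is 0, and reaches
    the value x k at the right end of cell k; this explains the distance to [bar] in [hat_bar]. *)
Definition hat x s : R := x 0%N + \I_(z < s) bar (slope x) z.

Lemma hat_abscont x : abscont l (hat x) (bar (slope x)).
Proof.
split; first exact: (intg_bar h0 hN).
by move=> s _ _; rewrite /hat set_itvoo0 /Rintegral integral_set0 addr0.
Qed.

Lemma hat_bar x s : 0 <= s -> s < l -> `|hat x s - bar x s| <= h * `|bar (slope x) s|.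
Proof.
move=> s0 sl; have /andP[c1 c2] := cell_itv h0 s0; have kN := cell_lt h0 hN s0 sl.
rewrite /hat (RI_bar h0 hN _ kN c1 (ltW c2)) /bar; set k := cell s in c1 c2 kN *.
have := slope_sum x kN; rewrite big_ord_recr/= mulrDr => E.
have -> : x 0%N + (h * \sum_(i < k) slope x i + (s - h * k%:R) * slope x k) - x k =
    (s - h * k.+1%:R) * slope x k by rewrite -E -natr1; ring.
rewrite normrM ler_wpM2r// ler0_norm ?subr_le0 ?(ltW c2)// opprB.
by rewrite -natr1; lra.
Qed.

Lemma flux_bar x s : 0 <= s -> s < l ->
  `|pflux p (bar (slope x) s) - \I_(z < s) bar (flux_div x) z| <=
    h * `|bar (flux_div x) s|.
Proof.
move=> s0 sl; have /andP[c1 c2] := cell_itv h0 s0; have kN := cell_lt h0 hN s0 sl.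
rewrite (RI_bar h0 hN _ kN c1 (ltW c2)) /bar; set k := cell s in c1 c2 kN *.
rewrite flux_div_sum opprD addrA subrr add0r normrN normrM ler_wpM2r//.
rewrite ger0_norm ?subr_ge0//; move: c2; rewrite -natr1; lra.
Qed.

Lemma pflux_le (z : R) : `|pflux p z| <= 1 + `|z| `^ p.
Proof.
rewrite pflux_norm//; have [z1|/ltW z1] := leP `|z| 1.
  rewrite (@le_trans _ _ 1) ?lerDl ?powR_ge0//.
  by rewrite -[leRHS](congr1 (fun f : R -> R => f (p - 1)) (@powR1 R)) ge0_ler_powR ?nnegrE// subr_ge0 ltW.
rewrite (@le_trans _ _ (`|z| `^ p)) ?lerDr//.
by rewrite ler_powR// gerBl.
Qed.

Lemma slope_pow_le x i E : energy x <= E -> `|slope x i| `^ p <= E / h.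
Proof.
move=> xE; rewrite ler_pdivlMr// mulrC.
have E0 : 0 <= E by exact: le_trans (energy_ge0 x) xE.
have [iN|Ni] := ltnP i N.
  by apply: le_trans xE; apply: (@dsum_term _ h N h0 (fun i => `|slope x i| `^ p)) => // k; exact: powR_ge0.
by rewrite /slope [(i < N)%N]ltnNge Ni andbF normr0 powR0 ?mulr0// gt_eqF.
Qed.

Lemma slope_le x i E : energy x <= E -> `|slope x i| <= 1 + E / h.
Proof.
by move=> xE; apply: le_trans (norm_le_pow p1 _) _; rewrite lerD2l slope_pow_le.
Qed.

Lemma flux_div_le x i E : energy x <= E -> `|flux_div x i| <= 2 * (1 + E / h) / h.
Proof.
move=> xE; rewrite normrM (ger0_norm (x := h^-1)) ?invr_ge0 ?(ltW h0)//.
rewrite ler_wpM2r ?invr_ge0 ?(ltW h0)// mulr_natl mulr2n.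
apply: le_trans (ler_normB _ _) _.
by rewrite lerD// (le_trans (pflux_le _))// lerD2l slope_pow_le.
Qed.

Lemma slope_comp x (F : R -> R) i : (forall a b, `|F b - F a| <= `|b - a|) ->
  `|slope (F \o x) i| <= `|slope x i|.
Proof.
move=> HF; rewrite /slope; case: ifP => // _.
by rewrite /= !normrM ler_wpM2r.
Qed.

(** After summation by parts a 1-Lipschitz F contributes at most |slope|, and flux times slope is
    |slope|^p. The pairing is thus bounded by the energy whatever the mesh. *)
Lemma flux_div_pairing x (F : R -> R) : (forall a b, `|F b - F a| <= `|b - a|) ->
  `|dsum (fun i => flux_div x i * F (x i))| <= energy x.
Proof.
move=> HF; rewrite (discrete_ibp x (F \o x)) normrN.
apply: le_trans (dsum_norm N h0 _) _; apply: le_dsum => // i _.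
rewrite -(pflux_mul p1) -[leRHS]ger0_norm.
  by rewrite !normrM ler_wpM2l// slope_comp.
by rewrite pflux_mul// powR_ge0.
Qed.

Lemma jensen (g g' : R -> R) a b : abscont l g g' -> 0 <= a -> a < b -> b <= l ->
  intgI l (fun s => `|g' s| `^ p) ->
  (b - a) * (`|(g b - g a) / (b - a)| `^ p) <= \I_(a < s < b) (`|g' s| `^ p).
Proof.
move=> gA a0 ab bl ip; set m := (g b - g a) / (b - a).
have ba0 : 0 < b - a by rewrite subr_gt0.
have iab : intg mu `]a, b[ g' by exact: sub_itv_intg gA.1.
have ipab : intg mu `]a, b[ (fun s => `|g' s| `^ p) by exact: sub_itv_intg ip.
have cst (k : R) : intg mu `]a, b[ (fun=> k).
  by apply: (@intg_bounded _ _ _ mu _ _ _ `|k|) => //; exact: mu_itv_lty.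
have i2 : intg mu `]a, b[ (fun s => p * pflux p m * g' s) by exact: intgZ.
have i1 : intg mu `]a, b[ (fun s => `|m| `^ p - p * pflux p m * m + p * pflux p m * g' s).
  exact: intgD.
have : \I_(a < s < b) (`|m| `^ p - p * pflux p m * m + p * pflux p m * g' s) <=
    \I_(a < s < b) (`|g' s| `^ p).
  apply: le_RI => // s _.
  have := pflux_convex p1 m (g' s); rewrite -mulrBl ler_pdivrMr// => H.
  by move: H; lra.
rewrite RID// RI_cst// RIZ// mu_itv_len ?(ltW ab)//.
rewrite -(AC_diff gA a0 (ltW ab) bl).
have -> : g b - g a = m * (b - a) by rewrite /m divfK// gt_eqF.
by apply: le_trans; apply: eq_ler; ring.
Qed.

(** Jensen's inequality on each cell. The last cell is discarded, since its right end is not a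
    node. *)
Lemma energy_sample (g g' : R -> R) : abscont l g g' ->
  intgI l (fun s => `|g' s| `^ p) ->
  energy (fun i => g (h * i%:R)) <= \I_(s < l) (`|g' s| `^ p).
Proof.
move=> gA ip; set x := fun i => _.
have kl m : (m <= N)%N -> h * m%:R <= l by move=> mN; rewrite -hN ler_pM2l// ler_nat.
have H k : (k < N)%N -> h * \sum_(i < k.+1) `|slope x i| `^ p <=
    \I_(s < h * k%:R) (`|g' s| `^ p).
  elim: k => [_|k IH kN].
    rewrite big_ord1 slope0 normr0 powR0 ?gt_eqF// mulr0.
    by apply: RI_ge0 => s _; exact: powR_ge0.
  rewrite big_ord_recr/= mulrDr (@RI_itv_split _ _ 0 (h * k%:R)); last 3 first.
  - by rewrite mulr_ge0// ltW.
  - by rewrite ler_pM2l// ler_nat.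
  - by apply: sub_itv_intg ip => //; exact: kl (ltnW kN).
  rewrite lerD ?IH//; first exact: ltnW.
  have hk : h * k%:R < h * k.+1%:R by rewrite ltr_pM2l// ltr_nat.
  have := jensen gA (_ : 0 <= h * k%:R) hk (kl _ (ltnW kN)) ip.
  have -> : h * k.+1%:R - h * k%:R = h by rewrite -mulrBr -natrB// subSnn mulr1.
  by rewrite /slope kN/= /x; apply; rewrite mulr_ge0// ltW.
have N1 : (N.-1 < N)%N by rewrite prednK.
have := H _ N1; rewrite prednK// => /le_trans; apply.
rewrite [leRHS](@RI_itv_split _ _ 0 (h * N.-1%:R) l)//; last 2 first.
  by rewrite mulr_ge0// ltW.
  by apply: kl; exact: leq_pred.
by rewrite lerDl RI_ge0// => s _; exact: powR_ge0.
Qed.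

Lemma energy_RI x : energy x = \I_(s < l) (`|bar (slope x) s| `^ p).
Proof. by rewrite /energy -(RI_bar_dsum N0 h0 hN). Qed.

End state.

(** * Coercivity of the constraint *)

Section gram.
Context (R : realType).
Local Notation mu := (@lebesgue_measure R).

(* b = - <w, g_k> annihilates the kernel of the Gram matrix, hence lies in its
   row space. *)
Lemma gram_solve (X : finType) (m : X -> R) n (g : 'I_n -> X -> R) (w : X -> R) :
  (forall x, 0 <= m x) -> exists c : 'I_n -> R, forall k,
  \sum_x m x * ((w x + \sum_i c i * g i x) * g k x) = 0.
Proof.
move=> m0; pose G : 'M[R]_n := \matrix_(i, k) \sum_x m x * (g i x * g k x).
pose b : 'rV[R]_n := \row_k - \sum_x m x * (w x * g k x).
have : (b <= G)%MS.
  rewrite submxE; apply/eqP/matrixP => i j; rewrite [RHS]mxE.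
  have GE i' k : G i' k = \sum_x m x * (g i' x * g k x) by rewrite mxE.
  have GK i' : \sum_k G i' k * cokermx G k j = 0.
    by have := mulmx_coker G => /matrixP/(_ i' j); rewrite mxE [RHS]mxE.
  rewrite mxE; set K := cokermx G in GK *; clearbody K.
  (* At a column K of the cokernel the quadratic form of G is the weighted square norm of xi. It
     vanishes, hence so does m times xi, and with it the pairing of b with that column. *)
  pose xi x := \sum_k K k j * g k x.
  have xi2 : \sum_x m x * xi x ^+ 2 = 0.
    transitivity (\sum_i' K i' j * \sum_k G i' k * K k j); last first.
      by rewrite big1// => i' _; rewrite GK mulr0.
    have step i' : K i' j * \sum_k G i' k * K k j =
        \sum_x m x * ((K i' j * g i' x) * xi x).
      rewrite mulr_sumr; under eq_bigr => k _ do rewrite GE mulr_suml mulr_sumr.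
      rewrite exchange_big/=; apply: eq_bigr => x _; rewrite /xi !mulr_sumr.
      by apply: eq_bigr => k _; ring.
    rewrite (eq_bigr _ (fun i' _ => step i')) exchange_big/=.
    apply: eq_bigr => x _; rewrite -mulr_sumr; congr (_ * _).
    by rewrite -mulr_suml expr2.
  have mxi x : m x * xi x = 0.
    have : m x * xi x ^+ 2 == 0.
      have /eqP := xi2; rewrite psumr_eq0; last first.
        by move=> y _; rewrite mulr_ge0// sqr_ge0.
      by move=> /allP/(_ x); rewrite mem_index_enum => /(_ isT).
    by rewrite mulf_eq0 sqrf_eq0 => /orP[|] /eqP ->; rewrite ?mul0r ?mulr0.
  under eq_bigr => k _ do rewrite mxE mulNr mulr_suml.
  rewrite sumrN exchange_big big1 ?oppr0// => x _.
  transitivity (m x * xi x * w x); last by rewrite mxi mul0r.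
  rewrite /xi mulr_sumr mulr_suml; apply: eq_bigr => k _; ring.
move=> /submxP[D bD]; exists (fun i => D 0 i) => k.
have := congr1 (fun M : 'rV[R]_n => M 0 k) bD; rewrite !mxE => /eqP.
rewrite eq_sym -subr_eq0 opprK => /eqP E; rewrite -[RHS]E addrC {E}.
 under eq_bigr => x _ do rewrite mulrDl mulrDr.
rewrite big_split/=; congr (_ + _).
under [RHS]eq_bigr => i _ do rewrite mxE mulr_sumr.
rewrite exchange_big/=; apply: eq_bigr => x _.
rewrite mulr_suml mulr_sumr; apply: eq_bigr => i _; ring.
Qed.

Lemma osc_le l (f : R -> R) m e : 0 < l -> (forall s, 0 <= s <= l -> `|f s - m| <= e) -> osc l f <= 2 * e.
Proof.
move=> l0 H; pose img := f @` `[0, l]; have ne : img !=set0 by exists (f 0), 0 => //=; rewrite in_itv/= lexx ltW.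
have h1 : sup img <= m + e.
  apply: ge_sup => // y [s /=]; rewrite in_itv/= => sl <-.
  by have := H s sl; rewrite ler_norml => /andP[_]; rewrite lerBlDl.
have h2 : m - e <= inf img.
  apply: lb_le_inf => // y [s /=]; rewrite in_itv/= => sl <-.
  by have := H s sl; rewrite ler_norml => /andP[]; lra.
rewrite /osc -/img; lra.
Qed.

Definition trig_form (a b x : R) : R := a * sin x - b * cos x.

Lemma measurable_trig_form (D : set R) a b (u : R -> R) : measurable_fun D u ->
  measurable_fun D (fun s => trig_form a b (u s)).
Proof.
move=> mu_; apply: measurable_funB; apply: measurable_funM => //.
- by apply: measurableT_comp mu_; exact: continuous_measurable_fun (@continuous_sin R).
- by apply: measurableT_comp mu_; exact: continuous_measurable_fun (@continuous_cos R).
Qed.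

Lemma trig_form_le a b x : `|trig_form a b x| <= `|a| + `|b|.
Proof.
apply: le_trans (ler_normB _ _) _; rewrite !normrM.
by apply: lerD; rewrite -[leRHS]mulr1 ler_wpM2l// ?sin_norm_le1 ?cos_norm_le1.
Qed.

Lemma sqint_trig_form (l a b : R) (u : R -> R) : measI l u -> sqintI l (fun s => trig_form a b (u s)).
Proof.
move=> mu_; apply: (@sqint_bounded _ _ _ mu _ _ _ (`|a| + `|b|)) => //; first exact: mu_itv_lty.
  exact: measurable_trig_form.
by move=> s _; exact: trig_form_le.
Qed.

Lemma trig_form_lip a b x y :
  `|trig_form a b x - trig_form a b y| <= (`|a| + `|b|) * `|x - y|.
Proof.
have -> : trig_form a b x - trig_form a b y =
  a * (sin x - sin y) - b * (cos x - cos y) by rewrite /trig_form; ring.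
apply: le_trans (ler_normB _ _) _; rewrite !normrM mulrDl.
by apply: lerD; rewrite ler_wpM2l// ?sin_lip ?cos_lip.
Qed.

(** Cramer's rule: a and b are determined by the two values of the form, with determinant sin(w -
    v). *)
Lemma trig_pair (a b v w : R) : (a ^+ 2 + b ^+ 2) * sin (w - v) ^+ 2 <=
  2 * trig_form a b v ^+ 2 + 2 * trig_form a b w ^+ 2.
Proof.
set F := trig_form a b v; set G := trig_form a b w.
have hb : b * sin (w - v) = G * sin v - F * sin w by rewrite sinB /F /G /trig_form; ring.
have ha : a * sin (w - v) = G * cos v - F * cos w by rewrite sinB /F /G /trig_form; ring.
have -> : (a ^+ 2 + b ^+ 2) * sin (w - v) ^+ 2 = 2 * G ^+ 2 * (cos v ^+ 2 + sin v ^+ 2) +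
    2 * F ^+ 2 * (cos w ^+ 2 + sin w ^+ 2) - ((G * sin v + F * sin w) ^+ 2 + (G * cos v + F * cos w) ^+ 2).
  by rewrite mulrDl -2![_ ^+ 2 * sin _ ^+ 2]exprMn ha hb; ring.
have := sqr_ge0 (G * sin v + F * sin w); have := sqr_ge0 (G * cos v + F * cos w).
rewrite !cos2Dsin2; lra.
Qed.

(* The oscillation provides two points where f differs by q := min(c/3, 1); the form is large
   near one of them by trig_pair. *)
Lemma trig_gram (c : R) : 0 < c -> exists d : R, 0 < d /\ forall l r : R, 0 < l -> 0 < r ->
  exists k : R, 0 < k /\ forall f u : R -> R, {within `[0, l], continuous f} -> c <= osc l f ->
  (forall x y, 0 <= x <= l -> 0 <= y <= l -> `|x - y| <= r -> `|f x - f y| <= d) ->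
  measI l u -> (forall s, 0 < s < l -> `|u s - f s| <= d) ->
  forall a b, k * (a ^+ 2 + b ^+ 2) <= \I_(s < l) (trig_form a b (u s) ^+ 2).
Proof.
move=> c0; pose q := Num.min (c / 3) 1.
have q0 : 0 < q by rewrite lt_min ltr01 andbT divr_gt0.
have q1 : q <= 1 by rewrite ge_min lexx orbT.
have qc : q <= c / 3 by rewrite ge_min lexx.
pose S := sin q / 2.
have S0 : 0 < S.
  by rewrite divr_gt0// sin_gt0_pi// q0; have := pi_ge2 R; lra.
exists (S / 8); split; first by rewrite divr_gt0.
move=> l r' l0 r'0; pose r := Num.min r' (l / 2).
have r0 : 0 < r by rewrite lt_min r'0 divr_gt0.
have rr : r <= r' by rewrite ge_min lexx.
have rl : r <= l / 2 by rewrite ge_min lexx orbT.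
exists (r * (S ^+ 2 / 4)); split; first by rewrite mulr_gt0// divr_gt0// exprn_gt0.
move=> f u cf oc fr mu_ uf a b.
have O : 0 <= (0 : R) <= l by rewrite lexx ltW.
have [x [xl fx]] : exists x, 0 <= x <= l /\ (f x = f 0 + q \/ f x = f 0 - q).
  (* If f stayed within c / 3 of its value at 0, [osc_le] would bound its oscillation by 2 c / 3. *)
  have [s [sl fs]] : exists s, 0 <= s <= l /\ c / 3 < `|f s - f 0|.
    apply: contrapT => H; have := @osc_le l f (f 0) (c / 3) l0 _.
    suff h s : 0 <= s <= l -> `|f s - f 0| <= c / 3 by move=> /(_ h); lra.
    by move=> sl; rewrite leNgt; apply/negP => h; apply: H; exists s.
  have /andP[s0 sl'] := sl.
  have cs : {within `[0, s], continuous f}.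
    by apply: continuous_subspaceW cf => y /=; rewrite !in_itv/= => /andP[-> /le_trans]; apply.
  have I y : y \in `[0, s] -> 0 <= y <= l.
    by rewrite in_itv/= => /andP[-> /le_trans]; apply.
  have [fs0|fs0] := leP 0 (f s - f 0).
    move: fs; rewrite ger0_norm// => fs.
    have [|x /I xl fx] := @IVT _ f 0 s (f 0 + q) s0 cs; last by exists x; split; [|left].
    by clear - fs fs0 q0 qc; rewrite min_l ?max_r; [apply/andP; split; lra|lra..].
  move: fs; rewrite ltr0_norm// => fs.
  have [|x /I xl fx] := @IVT _ f 0 s (f 0 - q) s0 cs; last by exists x; split; [|right].
  by clear - fs fs0 q0 qc; rewrite min_r ?max_l; [apply/andP; split; lra|lra..].
have [y [yl Fy]] : exists y, 0 <= y <= l /\ (a ^+ 2 + b ^+ 2) * S ^+ 2 <= trig_form a b (f y) ^+ 2.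
  have s2 : sin (f x - f 0) ^+ 2 = sin q ^+ 2.
    by case: fx => ->; rewrite ?addrK addrC ?addKr// sinN sqrrN.
  have := trig_pair a b (f 0) (f x); rewrite s2 (_ : sin q = 2 * S); last by rewrite /S; field.
  rewrite exprMn => H.
  have [h|h] := leP ((a ^+ 2 + b ^+ 2) * S ^+ 2) (trig_form a b (f 0) ^+ 2); first by exists 0.
  by exists x; split => //; lra.
(* A window of length r inside [0,l] with end point y; as r is at most l / 2, there is room on one
   side of y. *)
have [z [z0 zl zy]] : exists z, [/\ 0 <= z, z + r <= l & forall s, z < s < z + r -> `|s - y| <= r].
  have /andP[y0 yl'] := yl.
  clear - y0 yl' r0 rl; by have [h|h] := leP (y + r) l; [exists y|exists (y - r)]; split; try lra;
    move=> s /andP[s1 s2]; rewrite ler_norml; apply/andP; split; lra.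
pose m := (a ^+ 2 + b ^+ 2) * (S ^+ 2 / 4).
have it := (sqint_trig_form a b mu_).2.
apply: (@le_trans _ _ (\I_(z < s < z + r) (trig_form a b (u s) ^+ 2))); last first.
  by apply: le_RI_itv => //; [lra|move=> s; exact: sqr_ge0].
have -> : r * (S ^+ 2 / 4) * (a ^+ 2 + b ^+ 2) = \I_(z < s < z + r) m.
  by rewrite RI_cst// mu_itv_len ?lerDl ?(ltW r0)// /m; ring.
apply: le_RI => //; [exact: cst_intg|exact: sub_itv_intg it|].
move=> s /inI[zs sz].
have sI : 0 < s < l by rewrite (le_lt_trans z0 zs) (lt_le_trans sz zl).
have us : `|u s - f y| <= S / 4.
  have -> : u s - f y = (u s - f s) + (f s - f y) by ring.
  have -> : S / 4 = S / 8 + S / 8 by field.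
  apply: normD_le; first exact: uf.
  apply: fr => //; first by case/andP: sI => /ltW -> /ltW ->.
  by apply: le_trans rr; apply: zy; rewrite zs.
have h2 : (trig_form a b (u s) - trig_form a b (f y)) ^+ 2 <= (a ^+ 2 + b ^+ 2) * (S ^+ 2 / 8).
  have h : `|trig_form a b (u s) - trig_form a b (f y)| <= (`|a| + `|b|) * (S / 4).
    by apply: le_trans (trig_form_lip _ _ _ _) _; rewrite ler_wpM2l ?addr_ge0.
  apply: le_trans (norm_sqr_le h) _; rewrite exprMn.
  rewrite -(real_normK (num_real a)) -(real_normK (num_real b)).
  have := sqr_ge0 (`|a| - `|b|); have := sqr_ge0 S; nra.
move: h2 Fy; rewrite /m; set A := trig_form _ _ (u s); set B := trig_form _ _ (f y) => h2 Fy.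
have := sqr_ge0 (2 * A - B); nra.
Qed.

Lemma split3_sum (x y : R) : split3 x y e1 + split3 x y e2 + split3 x y e3 = 0.
Proof. by rewrite /split3/=; ring. Qed.

(** The coefficients on the remaining edge are minus the sums of the other two, so their squares are
    at most twice the controlled ones; the whole sum is at most three times the controlled part. *)
Lemma network_coercive (k : R) (a b f : 'I_3 -> R) (j1 j2 : 'I_3) : 0 <= k ->
  a e1 + a e2 + a e3 = 0 -> b e1 + b e2 + b e3 = 0 -> j1 != j2 ->
  (forall j, 0 <= f j) ->
  k * (a j1 ^+ 2 + b j1 ^+ 2) <= f j1 -> k * (a j2 ^+ 2 + b j2 ^+ 2) <= f j2 ->
  k / 3 * \sum_j (a j ^+ 2 + b j ^+ 2) <= \sum_j f j.
Proof.
move=> k0 a0 b0 + f0; have := f0 e1; have := f0 e2; have := f0 e3; rewrite !sum3.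
have P (x y z x' y' z' u v w : R) : x + y + z = 0 -> x' + y' + z' = 0 -> 0 <= w ->
    k * (x ^+ 2 + x' ^+ 2) <= u -> k * (y ^+ 2 + y' ^+ 2) <= v ->
    k / 3 * (x ^+ 2 + x' ^+ 2 + (y ^+ 2 + y' ^+ 2) + (z ^+ 2 + z' ^+ 2)) <= u + v + w.
  move=> h1 h2 w0 h3 h4.
  have -> : z = - (x + y) by lra.
  have -> : z' = - (x' + y') by lra.
  have : k * (((x + y) ^+ 2) + (x' + y') ^+ 2) <=
      k * (2 * (x ^+ 2 + y ^+ 2) + 2 * (x' ^+ 2 + y' ^+ 2)).
    rewrite ler_wpM2l//; have := sqr_ge0 (x - y); have := sqr_ge0 (x' - y'); nra.
  rewrite !sqrrN; lra.
move=> f3 f2 f1.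
elim/ord3P: j1; elim/ord3P: j2 => //= _ h1 h2.
- have := P (a e1) (a e2) (a e3) (b e1) (b e2) (b e3) _ _ _ ltac:(lra) ltac:(lra) f3 h1 h2; lra.
- have := P (a e1) (a e3) (a e2) (b e1) (b e3) (b e2) _ _ _ ltac:(lra) ltac:(lra) f2 h1 h2; lra.
- have := P (a e2) (a e1) (a e3) (b e2) (b e1) (b e3) _ _ _ ltac:(lra) ltac:(lra) f3 h1 h2; lra.
- have := P (a e2) (a e3) (a e1) (b e2) (b e3) (b e1) _ _ _ ltac:(lra) ltac:(lra) f1 h1 h2; lra.
- have := P (a e3) (a e1) (a e2) (b e3) (b e1) (b e2) _ _ _ ltac:(lra) ltac:(lra) f2 h1 h2; lra.
- have := P (a e3) (a e2) (a e1) (b e3) (b e2) (b e1) _ _ _ ltac:(lra) ltac:(lra) f1 h1 h2; lra.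
Qed.

(** f has a known modulus of continuity, and u is any measurable function near it: a discrete state
    near the datum in the scheme, f itself in the uniqueness proof. The tolerance d is fixed by c
    before the modulus r is known. *)
Lemma network_gram (L : 'I_3 -> R) (c : R) : (forall j, 0 < L j) -> 0 < c ->
  exists d : R, 0 < d /\ forall r : R, 0 < r -> exists k : R, 0 < k /\
  forall (f u : 'I_3 -> R -> R) (a b : 'I_3 -> R) j1 j2, j1 != j2 ->
    c <= osc (L j1) (f j1) -> c <= osc (L j2) (f j2) ->
    (forall j, {within `[0, L j], continuous (f j)}) ->
    (forall j x y, 0 <= x <= L j -> 0 <= y <= L j -> `|x - y| <= r -> `|f j x - f j y| <= d) ->
    (forall j, measI (L j) (u j)) -> (forall j s, 0 < s < L j -> `|u j s - f j s| <= d) ->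
    a e1 + a e2 + a e3 = 0 -> b e1 + b e2 + b e3 = 0 ->
    k * \sum_j (a j ^+ 2 + b j ^+ 2) <=
    \sum_j \I_(s < L j) (trig_form (a j) (b j) (u j s) ^+ 2).
Proof.
move=> L0 c0; have [d [d0 G]] := trig_gram c0; exists d; split => // r r0.
have [|k [k0 H]] := ex_min3 (P := fun j k => forall f u : R -> R, {within `[0, L j], continuous f} ->
  c <= osc (L j) f ->
  (forall x y, 0 <= x <= L j -> 0 <= y <= L j -> `|x - y| <= r -> `|f x - f y| <= d) ->
  measI (L j) u -> (forall s, 0 < s < L j -> `|u s - f s| <= d) ->
  forall a b, k * (a ^+ 2 + b ^+ 2) <= \I_(s < L j) (trig_form a b (u s) ^+ 2))
  (fun j => G (L j) r (L0 j) r0).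
  move=> j k k' _ kk h f u h1 h2 h3 h4 h5 a b; apply: le_trans (h f u h1 h2 h3 h4 h5 a b).
  by rewrite ler_wpM2r// addr_ge0 ?sqr_ge0.
exists (k / 3); split; first by rewrite divr_gt0.
move=> f u a b j1 j2 j12 o1 o2 cf fr mu_ uf sa sb.
apply: (network_coercive (f := fun j => \I_(s < L j) (trig_form (a j) (b j) (u j s) ^+ 2)))
  sa sb j12 _ _ _; [exact: ltW|by move=> j; apply: RI_ge0 => s _; exact: sqr_ge0|..].
- exact: H (@cf j1) o1 (@fr j1) (mu_ j1) (@uf j1) _ _.
exact: H (@cf j2) o2 (@fr j2) (mu_ j2) (@uf j2) _ _.
Qed.

(** The right-hand side is linear in the coefficients and is absorbed: six AM-GM inequalities leave
    half of the quadratic sum, which is therefore at most 6 (E / k)^2, rounded up to the square 9 (E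
    / k)^2. *)
Lemma coefficient_bound (k E : R) (a b : 'I_3 -> R) : 0 < k -> 0 <= E ->
  k * (\sum_j (a j ^+ 2 + b j ^+ 2)) <= \sum_j (`|a j| + `|b j|) * E ->
  forall j, `|a j| <= 3 * E / k /\ `|b j| <= 3 * E / k.
Proof.
move=> k0 E0 H2.
have AM (x : R) : `|x| * E <= k / 2 * x ^+ 2 + E ^+ 2 / (2 * k).
  rewrite -(real_normK (num_real x)); set y := `|x|.
  have : 0 <= (k * y - E) ^+ 2 / (2 * k) by rewrite divr_ge0 ?sqr_ge0// mulr_ge0// ltW.
  have -> : (k * y - E) ^+ 2 / (2 * k) = k / 2 * y ^+ 2 + E ^+ 2 / (2 * k) - y * E.
    by field; rewrite gt_eqF.
  by rewrite subr_ge0.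
have H3 : \sum_j (`|a j| + `|b j|) * E <=
    k / 2 * (\sum_j (a j ^+ 2 + b j ^+ 2)) + 3 * E ^+ 2 / k.
  rewrite !sum3.
  have := AM (a e1); have := AM (a e2); have := AM (a e3).
  have := AM (b e1); have := AM (b e2); have := AM (b e3).
  have -> : 3 * E ^+ 2 / k = 6 * (E ^+ 2 / (2 * k)) by field; rewrite gt_eqF.
  by move=> *; lra.
set S := \sum_j _ in H2 H3.
have S6 : S <= 9 * (E / k) ^+ 2.
  have : k / 2 * S <= 3 * E ^+ 2 / k by move: (le_trans H2 H3); lra.
  rewrite -[leLHS]mulrC -ler_pdivlMr ?divr_gt0// => /le_trans; apply.
  have -> : 3 * E ^+ 2 / k / (k / 2) = 6 * (E / k) ^+ 2 by field; rewrite gt_eqF.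
  by rewrite ler_wpM2r ?sqr_ge0// ler_nat.
have Ek : 0 <= 3 * E / k by rewrite divr_ge0 ?mulr_ge0// ltW.
have bnd (x : R) : x ^+ 2 <= S -> `|x| <= 3 * E / k.
  move=> aS; rewrite -ler_sqr ?nnegrE// real_normK ?num_real//.
  by apply: le_trans aS (le_trans S6 _); apply: eq_ler; field; rewrite gt_eqF.
move=> j; have : a j ^+ 2 + b j ^+ 2 <= S.
  by rewrite /S (bigD1 j)//= lerDl sumr_ge0// => j' _; rewrite addr_ge0// sqr_ge0.
move=> jS; split; apply: bnd; apply: le_trans jS.
  by rewrite lerDl sqr_ge0.
by rewrite lerDr sqr_ge0.
Qed.

End gram.

(** * The discrete scheme *)

Section scheme.
Context (R : realType) (p : R) (L : 'I_3 -> R) (N : nat).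
Hypotheses (p1 : 1 < p) (L0 : forall j, 0 < L j) (N0 : (0 < N)%N).
Local Notation state := ('I_3 -> nat -> R).
Implicit Types (x y u v : state) (q : 'I_4 -> R) (j : 'I_3) (i : nat).
Let pp : 0 < p. Proof. exact: lt_trans ltr01 p1. Qed.

(** All edges have the same number N of cells and only the widths differ, so a state is indexed
    alike on every edge. *)
Definition width j : R := L j / N%:R.

Lemma width_gt0 j : 0 < width j. Proof. by rewrite divr_gt0// ltr0n. Qed.

Lemma widthE j : width j * N%:R = L j.
Proof. by rewrite divfK// pnatr_eq0 -lt0n. Qed.

Definition dot u v : R := \sum_j dsum (width j) N (fun i => u j i * v j i).

(** q lists the multipliers in the order lambda1, mu1, lambda2, mu2. *)
Definition mA q := split3 (q 0) (q 1).
Definition mB q := split3 (q 2%:R) (q 3%:R).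
Definition force x q j i := trig_form (mA q j) (mB q j) (x j i).
Definition vel x q j i := flux_div p (width j) N (x j) i + force x q j i.
(** The forces of the four unit multipliers, which are up to sign the gradients of the four scalar
    closing conditions. *)
Definition gen x (k : 'I_4) := force x (fun k' : 'I_4 => (k' == k)%:R).
Definition net_energy x : R := \sum_j energy p (width j) N (x j).

Lemma forceE x q j i : force x q j i = \sum_k q k * gen x k j i.
Proof.
rewrite !big_ord_recl big_ord0 /gen /force /trig_form /mA /mB.
have -> : lift ord0 ord0 = 1 :> 'I_4 by exact: val_inj.
have -> : lift ord0 (lift ord0 ord0) = 2%:R :> 'I_4 by exact: val_inj.
have -> : lift ord0 (lift ord0 (lift ord0 ord0)) = 3%:R :> 'I_4 by exact: val_inj.
elim/ord3P: j; rewrite /split3/=; ring.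
Qed.

Lemma dotE u v : dot u v = \sum_(z : 'I_3 * 'I_N) width z.1 * (u z.1 z.2 * v z.1 z.2).
Proof.
rewrite -(pair_bigA _ (fun (j : 'I_3) (i : 'I_N) => width j * (u j i * v j i)))/=.
by apply: eq_bigr => j _; rewrite /dsum mulr_sumr.
Qed.

Lemma dotC u v : dot u v = dot v u.
Proof. by rewrite !dotE; apply: eq_bigr => z _; rewrite [u _ _ * _]mulrC. Qed.

Lemma dotDZ u v t x : dot (fun j i => u j i + t * v j i) x = dot u x + t * dot v x.
Proof.
rewrite !dotE mulr_sumr -big_split; apply: eq_bigr => z _ /=; ring.
Qed.

Lemma dot_ge0 u : 0 <= dot u u.
Proof.
rewrite dotE sumr_ge0// => z _; rewrite mulr_ge0 ?(ltW (width_gt0 _))//.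
by rewrite -expr2 sqr_ge0.
Qed.

Lemma dot_AMGM u v (t : R) : 0 < t -> 2 * dot u v <= t * dot u u + t^-1 * dot v v.
Proof.
move=> t0; rewrite !dotE !mulr_sumr -big_split/=; apply: ler_sum => z _.
set a := u _ _; set b := v _ _; set w := width _.
have : 0 <= w * ((t * a - b) ^+ 2 / t).
  by rewrite mulr_ge0 ?(ltW (width_gt0 _))// divr_ge0 ?sqr_ge0// ltW.
have -> : w * ((t * a - b) ^+ 2 / t) =
   t * (w * (a * a)) + t^-1 * (w * (b * b)) - 2 * (w * (a * b)) by field; rewrite gt_eqF.
by rewrite subr_ge0.
Qed.

(** The closing constraint, linearised: the velocity is orthogonal to the gradients of the four
    conditions. *)
Definition admissible x q := forall k, dot (vel x q) (gen x k) = 0.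

Lemma exists_admissible x : exists q, admissible x q.
Proof.
pose m (z : 'I_3 * 'I_N) := width z.1.
have [q Hq] := @gram_solve R _ m 4 (fun k z => gen x k z.1 z.2)
  (fun z => flux_div p (width z.1) N (x z.1) z.2) (fun z => ltW (width_gt0 _)).
exists q => k; rewrite dotE -[RHS](Hq k); apply: eq_bigr => z _.
by rewrite /vel forceE.
Qed.

Definition mult x : 'I_4 -> R := projT1 (cid (exists_admissible x)).

Lemma multP x : admissible x (mult x).
Proof. exact: projT2 (cid (exists_admissible x)). Qed.

Definition flow x := vel x (mult x).

Lemma flow_force x q : dot (flow x) (force x q) = 0.
Proof.
rewrite dotE; under eq_bigr => z _ do rewrite forceE mulr_sumr mulr_sumr.
rewrite exchange_big big1// => k _.
transitivity (q k * dot (flow x) (gen x k)); last by rewrite multP mulr0.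
by rewrite dotE mulr_sumr; apply: eq_bigr => z _; ring.
Qed.

(** Orthogonality to the generators of lambda1 and mu1: the sums of cosines change at the same rate
    on all edges. [flow_cos] is the counterpart for the sums of sines. *)
Lemma flow_sin x j : dsum (width j) N (fun i => flow x j i * sin (x j i)) =
  dsum (width e1) N (fun i => flow x e1 i * sin (x e1 i)).
Proof.
have K (a : R) j' : dsum (width j') N (fun i => flow x j' i * (a * sin (x j' i) - 0 * cos (x j' i))) =
   a * dsum (width j') N (fun i => flow x j' i * sin (x j' i)).
  by rewrite -dsumZ; apply: eq_dsum => i _; ring.
have h k : dot (flow x) (gen x k) = 0 by exact: multP.
have := h 1; have := h 0; rewrite /dot !sum3 /gen /force /trig_form /mA /mB /split3/=.
rewrite !(subr0, oppr0, sub0r) !K; elim/ord3P: j => //; lra.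
Qed.

Lemma flow_cos x j : dsum (width j) N (fun i => flow x j i * cos (x j i)) =
  dsum (width e1) N (fun i => flow x e1 i * cos (x e1 i)).
Proof.
have K (a : R) j' : dsum (width j') N (fun i => flow x j' i * (0 * sin (x j' i) - a * cos (x j' i))) =
   - a * dsum (width j') N (fun i => flow x j' i * cos (x j' i)).
  by rewrite -dsumZ; apply: eq_dsum => i _; ring.
have h k : dot (flow x) (gen x k) = 0 by exact: multP.
have := h 3%:R; have := h 2%:R; rewrite /dot !sum3 /gen /force /trig_form /mA /mB /split3/=.
rewrite !(subr0, oppr0, sub0r) !K; elim/ord3P: j => //; lra.
Qed.

(** The velocity is the flux divergence plus the force and is orthogonal to the force, so to first
    order the energy over p decreases at the rate of the squared velocity. *)
Lemma dot_flux_flow x :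
  dot (fun j => flux_div p (width j) N (x j)) (flow x) = dot (flow x) (flow x).
Proof.
have -> : dot (flow x) (flow x) = dot (flow x) (flow x) + -1 * dot (force x (mult x)) (flow x).
  by rewrite [dot (force x (mult x)) _]dotC flow_force mulr0 addr0.
rewrite -dotDZ !dotE; apply: eq_bigr => z _.
by congr (_ * (_ * _)); rewrite /flow /vel mulN1r addrK.
Qed.

Lemma net_energy_ge0 x : 0 <= net_energy x.
Proof. by apply: sumr_ge0 => j _; apply: energy_ge0; exact: width_gt0. Qed.

Lemma energy_le_net x j : energy p (width j) N (x j) <= net_energy x.
Proof.
rewrite /net_energy (bigD1 j)//= lerDl sumr_ge0// => k _.
by apply: energy_ge0; exact: width_gt0.
Qed.

Definition coercive (k : R) x := forall q,
  k * \sum_j (mA q j ^+ 2 + mB q j ^+ 2) <= dot (force x q) (force x q).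

Lemma flux_force x q (E : R) : net_energy x <= E ->
  - dot (fun j => flux_div p (width j) N (x j)) (force x q) <=
  \sum_j (`|mA q j| + `|mB q j|) * E.
Proof.
move=> xE; apply: le_trans (ler_norm _) _; rewrite normrN.
apply: le_trans (ler_norm_sum _ _ _) _; apply: ler_sum => j _.
have xjE := le_trans (energy_le_net x j) xE.
have h := @flux_div_pairing _ p (width j) N p1 N0 (width_gt0 j) (x j).
have hs := le_trans (h sin (@sin_lip R)) xjE.
have hc := le_trans (h cos (@cos_lip R)) xjE.
have -> : dsum (width j) N (fun i => flux_div p (width j) N (x j) i * force x q j i) =
   mA q j * dsum (width j) N (fun i => flux_div p (width j) N (x j) i * sin (x j i)) -
   mB q j * dsum (width j) N (fun i => flux_div p (width j) N (x j) i * cos (x j i)).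
  rewrite -!dsumZ -dsumB; apply: eq_dsum => i _; rewrite /force /trig_form; ring.
apply: le_trans (ler_normB _ _) _.
by rewrite [X in X + _]normrM [X in _ + X]normrM mulrDl lerD// ler_wpM2l.
Qed.

(** Orthogonality of velocity and force makes the squared norm of the force equal to minus its
    pairing with the flux divergence, which the energy bounds linearly in the multipliers;
    coercivity concludes. *)
Lemma mult_bound (k E : R) x : 0 < k -> net_energy x <= E -> coercive k x ->
  forall j, `|mA (mult x) j| <= 3 * E / k /\ `|mB (mult x) j| <= 3 * E / k.
Proof.
move=> k0 xE cx; set q := mult x.
have E0 : 0 <= E := le_trans (net_energy_ge0 x) xE.
have H1 : dot (force x q) (force x q) =
    - dot (fun j => flux_div p (width j) N (x j)) (force x q).
  apply/eqP; rewrite -addr_eq0 addrC; apply/eqP; rewrite -[RHS](flow_force x q).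
  rewrite !dotE -big_split; apply: eq_bigr => z _ /=.
  by rewrite /flow /vel -/q; ring.
have := cx q; rewrite H1 => /le_trans/(_ (flux_force q xE)) H2.
exact: coefficient_bound.
Qed.

(** A crude bound that degenerates with the mesh; it serves only to choose the time step. *)
Lemma flow_bound (k E : R) : 0 < k -> exists M, 0 < M /\ forall x,
  net_energy x <= E -> coercive k x -> forall j i,
  `|flow x j i| <= M /\ `|slope (width j) N (flow x j) i| <= M.
Proof.
move=> k0; pose V := \sum_j (2 * (1 + `|E| / width j) / width j) + 6 * `|E| / k + 1.
have S0 j : 0 <= 2 * (1 + `|E| / width j) / width j.
  by rewrite divr_ge0 ?(ltW (width_gt0 j))// mulr_ge0// addr_ge0// divr_ge0// ltW// width_gt0.
have V0 : 0 <= V.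
  by rewrite /V addr_ge0// addr_ge0// ?sumr_ge0// divr_ge0 ?mulr_ge0// ltW.
pose M := V + \sum_j (2 * V / width j) + 1.
have W0 j : 0 <= 2 * V / width j by rewrite divr_ge0 ?mulr_ge0// ltW// width_gt0.
exists M; split; first by rewrite /M ltr_wpDl// addr_ge0// sumr_ge0.
move=> x xE cx j; have Vb i : `|flow x j i| <= V.
  rewrite /flow /vel /force; apply: le_trans (ler_normD _ _) _.
  have xE' : net_energy x <= `|E| by rewrite (le_trans xE)// ler_norm.
  have xjE := le_trans (energy_le_net x j) xE'.
  have f1 := flux_div_le p1 (width_gt0 j) i xjE.
  have [mA1 mB1] := mult_bound k0 xE' cx j.
  have f2 := trig_form_le (mA (mult x) j) (mB (mult x) j) (x j i).
  have f3 : 2 * (1 + `|E| / width j) / width j <= \sum_j (2 * (1 + `|E| / width j) / width j).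
    by rewrite [leRHS](bigD1 j)//= lerDl sumr_ge0.
  rewrite /V; have -> : 6 * `|E| / k = 3 * `|E| / k + 3 * `|E| / k by ring.
  by move: f1 f2 f3 mA1 mB1; lra.
move=> i; split.
  apply: le_trans (Vb i) _; rewrite /M -addrA lerDl addr_ge0// sumr_ge0//.
have : `|slope (width j) N (flow x j) i| <= 2 * V / width j.
  rewrite /slope; case: ifP => _; last by rewrite normr0.
  rewrite normrM (ger0_norm (x := (width j)^-1)); last by rewrite invr_ge0 ltW// width_gt0.
  rewrite ler_wpM2r ?invr_ge0 ?(ltW (width_gt0 j))//.
  by apply: le_trans (ler_normB _ _) _; have := Vb i; have := Vb i.-1; lra.
move=> /le_trans; apply; rewrite /M -addrA ler_wpDl//.
rewrite (bigD1 j)//= -addrA lerDl addr_ge0// sumr_ge0//.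
Qed.

Definition euler (t : R) x : state := fun j i => x j i + t * flow x j i.

(** On a given mesh the slopes stay in a bounded set, where the flux is uniformly continuous; a
    small time step then keeps the error of the explicit scheme below t. The threshold t0 depends on
    N, the drift term t does not. *)
Lemma euler_energy (k E : R) : 0 < k -> exists t0, 0 < t0 /\ forall x t,
  net_energy x <= E -> coercive k x -> 0 <= t -> t <= t0 ->
  net_energy (euler t x) / p <= net_energy x / p - t * dot (flow x) (flow x) + t.
Proof.
move=> k0; have [M [M0 HM]] := flow_bound E k0.
pose B := \sum_j (1 + `|E| / width j) + 1.
have B0 j : 0 <= 1 + `|E| / width j.
  by rewrite addr_ge0// divr_ge0// ltW// width_gt0.
pose G := \sum_j L j * M + 1.
have G0 : 0 < G by rewrite ltr_wpDl// sumr_ge0// => j _; rewrite mulr_ge0// ltW.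
have p0 : 0 < p - 1 by rewrite subr_gt0.
have [d [d0 Hd]] := @spow_unif R (p - 1) B G^-1 p0 ltac:(by rewrite invr_gt0).
pose m := Num.min 1 d; have m0 : 0 < m by rewrite lt_min ltr01.
exists (m / M); split; first by rewrite divr_gt0.
move=> x t xE cx t0 tm.
have xE' : net_energy x <= `|E| by rewrite (le_trans xE)// ler_norm.
have key j : energy p (width j) N (euler t x j) / p - energy p (width j) N (x j) / p <=
   - t * dsum (width j) N (fun i => flux_div p (width j) N (x j) i * flow x j i) +
   t * (G^-1 * (L j * M)).
  have He i : (i < N)%N -> `|pflux p (slope (width j) N (fun i => x j i + t * flow x j i) i) -
      pflux p (slope (width j) N (x j) i)| <= G^-1.
    move=> iN; rewrite !pfluxE slopeDZ.
    have sx : `|slope (width j) N (x j) i| <= 1 + `|E| / width j.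
      apply: (slope_le p1 (width_gt0 j)).
      exact: le_trans (energy_le_net x j) xE'.
    have sB : 1 + `|E| / width j + 1 <= B.
      by rewrite /B (bigD1 j)//= lerD2r lerDl sumr_ge0.
    have tv : `|t * slope (width j) N (flow x j) i| <= m.
      rewrite normrM (ger0_norm t0); have [_ h] := HM x xE cx j i.
      apply: le_trans (ler_pM _ _ tm h) _ => //.
      by rewrite divfK// gt_eqF.
    have m1 : m <= 1 by rewrite ge_min lexx.
    have md : m <= d by rewrite ge_min lexx orbT.
    apply: Hd.
    - by apply: le_trans (ler_normD _ _) _; lra.
    - lra.
    - by rewrite addrAC subrr add0r (le_trans tv).
  have := energy_step p1 N0 (width_gt0 j) t0 He; rewrite -/(euler t x j) => H.
  apply: le_trans H _; rewrite lerD2l -mulrA ler_wpM2l// ler_wpM2l ?invr_ge0 ?(ltW G0)//.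
  rewrite -(dsum_cst (widthE j)) le_dsum ?width_gt0// => i _.
  by have [] := HM x xE cx j i.
have : \sum_j (energy p (width j) N (euler t x j) / p - energy p (width j) N (x j) / p) <=
   \sum_j (- t * dsum (width j) N (fun i => flux_div p (width j) N (x j) i * flow x j i) +
   t * (G^-1 * (L j * M))) by apply: ler_sum => j _; exact: key.
rewrite sumrB -!mulr_suml big_split/= -!mulr_sumr.
rewrite -/(net_energy _) -/(net_energy _).
have -> : \sum_j dsum (width j) N (fun i => flux_div p (width j) N (x j) i * flow x j i) =
  dot (flow x) (flow x) by rewrite -dot_flux_flow.
have : t * (G^-1 * \sum_j L j * M) <= t.
  rewrite -[leRHS]mulr1 ler_wpM2l// mulrC ler_pdivrMr// mul1r /G lerDl//.
by set Z := t * (G^-1 * _) => H1 H2; lra.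
Qed.

End scheme.

Section trajectory.
Context (R : realType) (p : R) (L : 'I_3 -> R) (N : nat).
Hypotheses (p1 : 1 < p) (L0 : forall j, 0 < L j) (N0 : (0 < N)%N).
Local Notation state := ('I_3 -> nat -> R).
Implicit Types (x : state) (j : 'I_3).
Let pp : 0 < p. Proof. exact: lt_trans ltr01 p1. Qed.
Local Notation width := (width L N).
Local Notation dot := (dot L N).
Local Notation flow := (@flow R p L N L0 N0).
Local Notation euler := (@euler R p L N L0 N0).
Local Notation net_energy := (net_energy p L N).

Definition traj (t : R) x n : state := iter n (euler t) x.
Definition diss (t : R) x n : R :=
  \sum_(m < n) t * dot (flow (traj t x m)) (flow (traj t x m)).
Definition state_sub x y : state := fun j i => x j i - y j i.

Lemma diss_ge0 t x n : 0 <= t -> 0 <= diss t x n.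
Proof. by move=> t0; apply: sumr_ge0 => m _; rewrite mulr_ge0// dot_ge0. Qed.

(* Cauchy-Schwarz in time. *)
Lemma traj_dist t x n : 0 < t ->
  dot (state_sub (traj t x n) x) (state_sub (traj t x n) x) <= n%:R * t * diss t x n.
Proof.
move=> t0; elim: n => [|n IH].
  rewrite /diss big_ord0 mulr0 /state_sub /traj/=.
  rewrite (_ : (fun j i => x j i - x j i) = (fun j i => 0 * x j i))//.
    by rewrite dotE big1// => z _; ring.
  by apply/funext => j; apply/funext => i; ring.
rewrite /diss big_ord_recr/= -/(diss t x n).
set u := state_sub (traj t x n) x in IH *; set V := flow (traj t x n).
have -> : state_sub (traj t x n.+1) x = fun j i => u j i + t * V j i.
  by apply/funext => j; apply/funext => i; rewrite /state_sub /u /V /state_sub /traj/= /euler; ring.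
have -> : dot (fun j i => u j i + t * V j i) (fun j i => u j i + t * V j i) =
    dot u u + 2 * t * dot u V + t ^+ 2 * dot V V.
  rewrite !dotE !mulr_sumr -!big_split; apply: eq_bigr => z _ /=; ring.
set S := diss t x n in IH *; have V0 : 0 <= dot V V by exact: dot_ge0.
(* The weight 1 / (n t) in the AM-GM inequality below turns the factor n into (1 + 1/n) n = n + 1.
   It degenerates for n = 0, which is treated apart. *)
have [n00|n00] := posnP n.
  have S0 : 0 <= S by apply: diss_ge0; exact: ltW.
  have uV : dot u V = 0.
    by rewrite dotE big1// => z _; rewrite /u n00 /state_sub /traj/= subrr; ring.
  move: IH; rewrite n00 uV !mul0r mul1r => IH.
  have : 0 <= t * S by rewrite mulr_ge0// ltW.
  by lra.
have n0 : 0 < n%:R :> R by rewrite ltr0n.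
have := dot_AMGM L0 N0 u V (_ : 0 < (n%:R * t)^-1).
rewrite invr_gt0 mulr_gt0// invrK => /(_ isT) H.
have {}H := ler_wpM2l (ltW t0) H.
have E1 : t * ((n%:R * t)^-1 * dot u u + n%:R * t * dot V V) =
   n%:R^-1 * dot u u + n%:R * t ^+ 2 * dot V V.
  by field; rewrite !gt_eqF.
rewrite E1 in H.
have H2 : (1 + n%:R^-1) * dot u u <= (1 + n%:R^-1) * (n%:R * t * S).
  by rewrite ler_wpM2l// addr_ge0// invr_ge0 ltW.
have E2 : (1 + n%:R^-1) * (n%:R * t * S) = n.+1%:R * t * S.
  by rewrite -[n.+1%:R]natr1; field; rewrite gt_eqF.
rewrite E2 in H2.
have -> : n.+1%:R * t * (S + t * dot V V) =
   n.+1%:R * t * S + n%:R * t ^+ 2 * dot V V + t ^+ 2 * dot V V.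
  by rewrite -[n.+1%:R]natr1; ring.
lra.
Qed.

Lemma dsum_taylor (F F' : R -> R) t x j :
  (forall a b, `|F b - F a - F' a * (b - a)| <= (b - a) ^+ 2) ->
  `|dsum (width j) N (fun i => F (euler t x j i)) - dsum (width j) N (fun i => F (x j i)) -
    t * dsum (width j) N (fun i => flow x j i * F' (x j i))| <=
  t ^+ 2 * dot (flow x) (flow x).
Proof.
move=> HF; rewrite -dsumZ -!dsumB.
apply: le_trans (dsum_norm N (width_gt0 L0 N0 j) _) _.
apply: (@le_trans _ _ (dsum (width j) N (fun i => t ^+ 2 * (flow x j i * flow x j i)))).
  apply: le_dsum => [|i _]; first exact: width_gt0.
  have := HF (x j i) (euler t x j i); rewrite /euler.
  have -> : x j i + t * flow x j i - x j i = t * flow x j i by ring.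
  have -> : F' (x j i) * (t * flow x j i) = t * (flow x j i * F' (x j i)) by ring.
  by move/le_trans; apply; apply: eq_ler; ring.
rewrite dsumZ ler_wpM2l ?sqr_ge0// /dot (bigD1 j)//= lerDl sumr_ge0// => k _.
by apply: dsum_ge0 => [|i _]; rewrite ?width_gt0// -expr2 sqr_ge0.
Qed.

(** By [eqF] the first-order changes agree on edge j and on the first edge. What remains are the
    Taylor remainders, at most t times the dissipation on each of the two edges. *)
Lemma traj_drift (F F' : R -> R) t x n j : 
  (forall a b, `|F b - F a - F' a * (b - a)| <= (b - a) ^+ 2) ->
  (forall y, dsum (width j) N (fun i => flow y j i * F' (y j i)) =
    dsum (width e1) N (fun i => flow y e1 i * F' (y e1 i))) ->
  `|dsum (width j) N (fun i => F (traj t x n j i)) -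
    dsum (width e1) N (fun i => F (traj t x n e1 i))| <=
  `|dsum (width j) N (fun i => F (x j i)) - dsum (width e1) N (fun i => F (x e1 i))| +
  2 * t * diss t x n.
Proof.
move=> HF eqF; elim: n => [|n IH]; first by rewrite /diss big_ord0 mulr0 addr0.
rewrite /diss big_ord_recr/= -/(diss t x n) mulrDr addrA.
set y := traj t x n in IH *.
have h1 := dsum_taylor t y j HF; have h2 := dsum_taylor t y e1 HF.
rewrite eqF in h1.
set a := dsum _ _ _ in h1 *; set b := dsum _ _ _ in h1; set c := t * dsum _ _ _ in h1 h2.
set a' := dsum _ _ _ in h2 *; set b' := dsum _ _ _ in h2.
have -> : a - a' = (b - b') + ((a - b - c) - (a' - b' - c)) by ring.
apply: le_trans (ler_normD _ _) _; apply: lerD => //.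
apply: le_trans (ler_normB _ _) _.
have -> : 2 * t * (t * dot (flow y) (flow y)) =
  t ^+ 2 * dot (flow y) (flow y) + t ^+ 2 * dot (flow y) (flow y) by ring.
exact: lerD.
Qed.

(** A discrete continuation argument: the energy bound at one step bounds the dissipation, hence by
    [traj_dist] the distance to x, hence yields coercivity, which the energy estimate of the next
    step requires. *)
Lemma traj_bounds (k E T : R) x : 0 < k -> net_energy x / p + T <= E / p ->
  (forall y, net_energy y <= E -> dot (state_sub y x) (state_sub y x) <= T * (E / p) ->
     coercive L N k y) ->
  exists t0, 0 < t0 /\ forall t n, 0 < t -> t <= t0 -> n%:R * t <= T ->
  [/\ net_energy (traj t x n) <= E, coercive L N k (traj t x n),
      diss t x n <= E / p & net_energy (traj t x n) <= net_energy x + p * (n%:R * t)].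
Proof.
move=> k0 xE Hc; have [t0 [t00 Ht]] := euler_energy p1 L0 N0 E k0.
exists t0; split => // t n tp tt0.
have en0 y : 0 <= net_energy y / p by rewrite divr_ge0 ?net_energy_ge0// ltW.
have base m : m%:R * t <= T ->
    net_energy (traj t x m) / p + diss t x m <= net_energy x / p + m%:R * t ->
    [/\ net_energy (traj t x m) <= E, coercive L N k (traj t x m), diss t x m <= E / p &
      net_energy (traj t x m) <= net_energy x + p * (m%:R * t)].
  move=> mT H; have d0 := diss_ge0 x m (ltW tp).
  have h1 : net_energy (traj t x m) / p <= E / p by lra.
  have h2 : net_energy (traj t x m) <= E by move: h1; rewrite ler_pM2r// invr_gt0.
  have h3 : diss t x m <= E / p by have := en0 (traj t x m); lra.
  split => //.
    apply: Hc => //; apply: le_trans (traj_dist x m tp) _.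
    by apply: ler_pM => //; rewrite mulr_ge0// ltW.
  rewrite -(ler_pM2r (_ : 0 < p^-1)) ?invr_gt0// mulrDl (mulrC p) mulfK ?gt_eqF//; lra.
suff H m : m%:R * t <= T ->
    net_energy (traj t x m) / p + diss t x m <= net_energy x / p + m%:R * t.
  by move=> nT; apply: base => //; exact: H.
elim: m => [_|m IH mT]; first by rewrite /diss big_ord0 mul0r addr0.
have mT' : m%:R * t <= T.
  by apply: le_trans mT; rewrite ler_wpM2r ?ler_nat// ltW.
have {}IH := IH mT'; have [h1 h2 _ _] := base _ mT' IH.
have := Ht _ _ h1 h2 (ltW tp) tt0.
rewrite /diss big_ord_recr/= -/(diss t x m) -natr1 mulrDl mul1r.
rewrite -/(euler t _); set y := traj t x m in IH *; lra.
Qed.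

End trajectory.

Section sup_bounds.
Context (R : realType) (p : R).
Hypothesis p1 : 1 < p.
Local Notation mu := (@lebesgue_measure R).
Let pp : 0 < p. Proof. exact: lt_trans ltr01 p1. Qed.

Lemma hat_acp (l h E : R) N (x : nat -> R) : (0 < N)%N -> 0 < h -> h * N%:R = l ->
  energy p h N x <= E -> acp p E l (hat h N x) (bar h (slope h N x)).
Proof.
move=> N0 h0 hN xE; split; [exact: hat_abscont h0 hN x|exact: (measurable_bar h0)| |].
- exact: (@intg_bar R l h N h0 hN (fun i => `|slope h N x i| `^ p)).
- by rewrite -(energy_RI p N0 h0 hN).
Qed.

Lemma slope_small (E e : R) : 0 <= E -> 0 < e -> exists r : R, 0 < r /\
  forall (l h : R) N (x : nat -> R), (0 < N)%N -> 0 < h -> h * N%:R = l -> h <= r ->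
    energy p h N x <= E -> forall i, (i < N)%N -> h * `|slope h N x i| <= e.
Proof.
move=> E0 e0; have [r [r0 Hr]] := equi_power p1 E0 e0; exists r; split => //.
move=> l h N x N0 h0 hN hr xE i iN.
have [_ m1 m2 m3] := hat_acp N0 h0 hN xE.
have d : h * i.+1%:R - h * i%:R = h by rewrite -mulrBr -natrB// subSnn mulr1.
have := Hr l _ m1 m2 m3 (h * i%:R) (h * i.+1%:R) (mulr_ge0 (ltW h0) (ler0n _ _)).
rewrite ler_pM2l// ler_nat leqnSn -hN ler_pM2l// ler_nat iN d => /(_ isT isT hr).
rewrite (RI_const_on (k := `|slope h N x i|)) ?d//.
  by rewrite ler_pM2l// ler_nat.
by move=> s s1 s2; rewrite /bar (cell_eq h0 (ltW s1) s2).
Qed.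

(** The states are compared through their interpolants, to which [acp_close] applies. The radius r
    does not depend on N. *)
Lemma sup_close (l E e : R) : 0 < l -> 0 <= E -> 0 < e -> exists r : R, 0 < r /\
  forall (h : R) N (x y : nat -> R), (0 < N)%N -> 0 < h -> h * N%:R = l -> h <= r ->
    energy p h N x <= E -> energy p h N y <= E ->
    dsum h N (fun i => (x i - y i) * (x i - y i)) <= r ->
    forall i, (i < N)%N -> `|x i - y i| <= e.
Proof.
move=> l0 E0 e0; have [e2 e4] : 0 < e / 2 /\ 0 < e / 4 by split; rewrite divr_gt0.
have [b [b0 H]] := acp_close p1 E0 l0 e2.
(* Passing from [bar] to [hat] costs 8 eta^2 l in the squared L^2 distance and twice eta at a
   point. *)
pose eta := Num.min (Num.min 1 (e / 4)) (b / (16 * l)).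
have eta0 : 0 < eta by rewrite !lt_min ltr01 e4/= divr_gt0// mulr_gt0.
have eta4 : eta <= e / 4 by rewrite !ge_min lexx !orbT.
have etab : 8 * eta ^+ 2 * l <= b / 2.
  have : eta <= b / (16 * l) by rewrite ge_min lexx orbT.
  rewrite ler_pdivlMr ?mulr_gt0// => h.
  have h2 : eta ^+ 2 <= eta by rewrite expr2 ler_piMl ?(ltW eta0)// !ge_min lexx.
  by have := ler_wpM2r (ltW l0) h2; lra.
have [r [r0 Hr]] := slope_small E0 eta0.
exists (Num.min r (b / 4)); split; first by rewrite lt_min r0 divr_gt0.
move=> h N x y N0 h0 hN; rewrite !le_min => /andP[hr _] xE yE /andP[_ xyb] i iN.
have hb z s : energy p h N z <= E -> 0 < s -> s < l -> `|hat h N z s - bar h z s| <= eta.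
  move=> zE s0 sl; have [s0' sl'] := (ltW s0, ltW sl).
  apply: le_trans (hat_bar h0 hN _ s0' sl) _.
  exact: (Hr l h N z N0 h0 hN hr zE _ (cell_lt h0 hN s0' sl)).
have [ax ay] := (hat_acp N0 h0 hN xE, hat_acp N0 h0 hN yE).
have [[Ax _ _ _] [Ay _ _ _]] := (ax, ay).
have g2 : \I_(s < l) ((hat h N x s - hat h N y s) ^+ 2) <= b.
  have ixy : intgI l (bar h (fun i => (x i - y i) * (x i - y i))) by exact: intg_bar h0 hN _.
  apply: (@le_trans _ _ (\I_(s < l) (2 * bar h (fun i => (x i - y i) * (x i - y i)) s + 8 * eta ^+ 2))).
    apply: le_RI => //; first exact: (AC_sqint (ACB Ax Ay)).2.
      exact: intgD (intgZ _ _ ixy) (cst_intg _ _ _).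
    move=> s /inI[s0 sl]; have h1 := hb x s xE s0 sl; have h2 := hb y s yE s0 sl.
    rewrite /bar in h1 h2 *; set a := x _ in h1 *; set c := y _ in h2 *.
    set u := hat h N x s in h1 *; set v := hat h N y s in h2 *.
    have h3 : `|(u - v) - (a - c)| <= eta + eta.
      by rewrite (_ : _ - _ = (u - a) - (v - c)); [exact: normB_le|ring].
    rewrite (_ : 8 * eta ^+ 2 = 2 * (eta + eta) ^+ 2); last by ring.
    exact: sqr_near (norm_sqr_le h3).
  rewrite RID//; [|exact: intgZ|exact: cst_intg].
  by rewrite RIZ// RI_cst// mu_itvE// (RI_bar_dsum N0 h0 hN); lra.
(* The midpoint of cell i, an interior point where [bar] takes the value of index i. *)
pose s := h * i%:R + h / 2.
have s1 : h * i%:R < s by rewrite ltrDl divr_gt0.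
have s2 : s < h * i.+1%:R by rewrite /s -[i.+1%:R]natr1 mulrDr mulr1 ltrD2l ltr_pdivrMr// ltr_pMr// ltr1n.
have s0 : 0 < s by apply: le_lt_trans s1; rewrite mulr_ge0// ltW.
have sl : s < l by apply: lt_le_trans s2 _; rewrite -hN ler_pM2l// ler_nat.
have h1 := hb x s xE s0 sl; have h2 := hb y s yE s0 sl.
rewrite /bar (cell_eq h0 (ltW s1) s2) in h1 h2.
have := H _ _ _ _ ax ay g2 s; rewrite (ltW s0) (ltW sl) => /(_ isT) h3.
set u := hat _ _ x s in h1 h3; set v := hat _ _ y s in h2 h3.
have -> : x i - y i = (u - v) - (u - x i) + (v - y i) by ring.
by apply: le_trans (normD_le (normB_le h3 (le_trans h1 eta4)) (le_trans h2 eta4)) _; lra.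
Qed.

End sup_bounds.

Section sampling.
Context (R : realType) (p : R) (L : 'I_3 -> R).
Hypotheses (p1 : 1 < p) (L0 : forall j, 0 < L j).
Local Notation mu := (@lebesgue_measure R).
Local Notation m2 := (mu \x mu)%E.
Local Notation unc u := (fun z : R * R => u z.1 z.2).
Local Notation Q T l := (`]0, T[ `*` `]0, l[ : set (R * R)).
Let pp : 0 < p. Proof. exact: lt_trans ltr01 p1. Qed.

Definition bmeas (T l M : R) (u : R -> R -> R) : Prop :=
  measurable_fun (Q T l) (unc u) /\
  forall t s, 0 < t < T -> 0 < s < l -> `|u t s| <= M.

(** What the compactness argument retains of the scheme: th, d, V and w are the angles, slopes,
    velocities and flux divergences, m the four multipliers, and e the defect in each relation. In
    use, C stays fixed while e tends to 0. *)
Record net_approx (th0 : 'I_3 -> R -> R) (E0 C e T : R) (th d V w : 'I_3 -> R -> R -> R)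
    (m : 'I_4 -> R -> R) : Prop := NetApprox {
  ap_meas : exists M, forall j, [/\ bmeas T (L j) M (th j), bmeas T (L j) M (d j),
    bmeas T (L j) M (V j) & bmeas T (L j) M (w j)];
  ap_mult : forall k, measI T (m k);
  ap_multC : forall j t, 0 < t < T ->
    `|mA (m^~ t) j| <= C /\ `|mB (m^~ t) j| <= C;
  ap_eq : forall j t s, 0 < t < T -> 0 < s < L j ->
    V j t s = w j t s + trig_form (mA (m^~ t) j) (mB (m^~ t) j) (th j t s);
  ap_pow : forall j t, 0 < t < T -> \I_(s < L j) (`|d j t s| `^ p) <= C;
  ap_energy : forall t, 0 < t < T -> \sum_j \I_(s < L j) (`|d j t s| `^ p) <= E0 + p * t;
  ap_sq : forall j, \I_(t < T) \I_(s < L j) (V j t s ^+ 2) <= C;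
  ap_hat : forall j t, 0 < t < T -> exists g, abscont (L j) g (d j t) /\
    forall s, 0 < s < L j -> `|g s - th j t s| <= e;
  ap_time : forall j t s, 0 < t < T -> 0 < s < L j ->
    `|th j t s - th0 j s - \I_(x < t) V j x s| <= e;
  ap_flux : forall j t, 0 < t < T -> \I_(s < L j) w j t s = 0 /\
    forall s, 0 < s < L j ->
      (pflux p (d j t s) - \I_(x < s) w j t x) ^+ 2 <=
      e * \I_(x < L j) (w j t x ^+ 2);
  ap_con : forall j t, 0 < t < T ->
    `|\I_(s < L j) cos (th j t s) -
      \I_(s < L e1) cos (th e1 t s)| <= e /\
    `|\I_(s < L j) sin (th j t s) -
      \I_(s < L e1) sin (th e1 t s)| <= e }.

Definition step2 (t : R) (h : 'I_3 -> R) (G : nat -> 'I_3 -> nat -> R) j x s : R :=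
  G (cell t x) j (cell (h j) s).

Lemma step2_bmeas (t T : R) K N G : (0 < K)%N -> 0 < t -> t * K%:R = T -> (0 < N)%N ->
  exists M, forall j, bmeas T (L j) M (step2 t (width L N) G j).
Proof.
move=> K0 t0 tK N0; have w0 := width_gt0 L0 N0; have wE := widthE L N0.
exists (\sum_(n < K) \sum_j \sum_(i < N) `|G n j i|) => j; split.
  apply: (@measurable_step2 R `]0, T[%classic `]0, L j[%classic (cell t) (cell (width L N j))
    (fun n i => G n j i)) => // i.
    exact: cell_fiber.
  exact: cell_fiber.
move=> x s /andP[x0 xT] /andP[s0 sl].
have nK := cell_lt t0 tK (ltW x0) xT; have iN := cell_lt (w0 j) (wE j) (ltW s0) sl.
rewrite (bigD1 (Ordinal nK))//= (bigD1 j)//= (bigD1 (Ordinal iN))//=.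
rewrite -!addrA lerDl !addr_ge0// !sumr_ge0// => *; rewrite ?sumr_ge0// => *.
  exact: sumr_ge0.
Qed.

Variables (th0 : 'I_3 -> R -> R).
Hypothesis A0 : forall j, {within `[0, L j], continuous (th0 j)}.

Definition sample N : 'I_3 -> nat -> R := fun j i => th0 j (width L N j * i%:R).

Lemma sample_near (e : R) : 0 < e -> exists r, 0 < r /\ forall N, (0 < N)%N ->
  (forall j, width L N j <= r) -> forall j s, 0 < s < L j ->
  `|bar (width L N j) (sample N j) s - th0 j s| <= e.
Proof.
move=> e0; have [|r [r0 Hr]] := ex_min3 (fun j => within_unif (@A0 j) e0).
  by move=> j r r' _ rr H x y xl yl xy; apply: H => //; exact: le_trans rr.
exists r; split => // N N0 Nr j s /andP[s0 sl]; have w0 := width_gt0 L0 N0.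
have /andP[c1 c2] := cell_itv (w0 j) (ltW s0).
apply: Hr; rewrite ?(ltW s0) ?(ltW sl) ?(le_trans c1 (ltW sl)) ?mulr_ge0 ?(ltW (w0 j)) ?(ltW (L0 j))//.
rewrite distrC ger0_norm ?subr_ge0//; apply: le_trans (Nr j).
by move: c2; rewrite -natr1 mulrDr mulr1; lra.
Qed.

Lemma large_mesh (r : R) : 0 < r -> exists N, (0 < N)%N /\ forall j, width L N j <= r.
Proof.
move=> r0; pose S := L e1 + L e2 + L e3.
have S0 : 0 < S by rewrite !addr_gt0.
exists (Num.truncn (S / r)).+1; split => // j.
rewrite ler_pdivrMr ?ltr0n// mulrC -ler_pdivrMr//.
apply: le_trans (ltW (truncnS_gt _)); rewrite ler_pM2r ?invr_gt0//.
have := L0 e1; have := L0 e2; have := L0 e3.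
rewrite /S; elim/ord3P: j; lra.
Qed.

Lemma dsum_cos_sample (F : R -> R) N (e : R) j : (0 < N)%N -> continuous F ->
  (forall a b, `|F b - F a| <= `|b - a|) -> (forall a, `|F a| <= 1) ->
  (forall s, 0 < s < L j -> `|bar (width L N j) (sample N j) s - th0 j s| <= e) ->
  `|dsum (width L N j) N (fun i => F (sample N j i)) -
    \I_(s < L j) F (th0 j s)| <= L j * e.
Proof.
move=> N0 cF HF F1 He; have w0 := width_gt0 L0 N0; have wE := widthE L N0.
have bF (u : R -> R) (mu_ : measI (L j) u) : intgI (L j) (F \o u) := intg_comp cF F1 mu_.
have mb : measI (L j) (bar (width L N j) (sample N j)).
  exact: measurable_bar (w0 j) _.
have mt : measI (L j) (th0 j) by exact: within_measurable (@A0 j).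
rewrite -(RI_bar_dsum N0 (w0 j) (wE j)).
have -> : \I_(s < L j) bar (width L N j) (fun i => F (sample N j i)) s =
  \I_(s < L j) (F \o bar (width L N j) (sample N j)) s by [].
rewrite -RIB//; [|exact: bF..].
apply: le_trans (RI_norm _ _) _ => //; first by apply: intgB; [|exact: bF..].
rewrite -[X in _ <= X * _](mu_itvE (L0 j)) mulrC -RI_cst//.
apply: le_RI => //.
- by apply: intg_norm => //; apply: intgB; [|exact: bF..].
- exact: cst_intg.
by move=> s sl; apply: le_trans (HF _ _) _; apply: He; move: sl; rewrite /= in_itv.
Qed.

End sampling.

Section approximations.
Context (R : realType) (p : R) (L : 'I_3 -> R).
Hypotheses (p1 : 1 < p) (L0 : forall j, 0 < L j).
Local Notation mu := (@lebesgue_measure R).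
Let pp : 0 < p. Proof. exact: lt_trans ltr01 p1. Qed.

(** Bounded sampled energies stand in for a W^{1,p} bound: on fine meshes the interpolants of the
    samples lie in one energy ball and are uniformly close to the datum, which inherits their
    modulus of continuity. *)
Lemma sampled_equicont (E e : R) : 0 <= E -> 0 < e -> exists r, 0 < r /\
  forall th0, (forall j, {within `[0, L j], continuous (th0 j)}) ->
  (forall N, (0 < N)%N -> net_energy p L N (sample L th0 N) <= E) ->
  forall j x y, 0 <= x <= L j -> 0 <= y <= L j -> `|x - y| <= r -> `|th0 j x - th0 j y| <= e.
Proof.
move=> E0 e0; have e3 : 0 < e / 3 by rewrite divr_gt0.
have [r [r0 Hr]] := acp_equicont p1 E0 e3; exists r; split => // th0 A0 HE j x y xl yl xy.
apply/ler_addgt0Pr => d d0; have d4 : 0 < d / 4 by rewrite divr_gt0.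
have [r1 [r10 Hr1]] := slope_small p1 E0 d4; have [r2 [r20 Hr2]] := sample_near L0 A0 d4.
have [N [N0 HN]] := @large_mesh _ _ L0 (Num.min r1 r2) ltac:(by rewrite lt_min r10).
have w0 := width_gt0 L0 N0 j; have wE := widthE L N0 j.
have xE : energy p (width L N j) N (sample L th0 N j) <= E.
  exact: le_trans (energy_le_net p L0 N0 _ j) (HE N N0).
pose g := hat (width L N j) N (sample L th0 N j).
have ga : acp p E (L j) g _ := hat_acp N0 w0 wE xE; have [gA _ _ _] := ga.
have near s : 0 <= s <= L j -> `|g s - th0 j s| <= d / 2.
  apply: (within_le (f := fun s => g s - th0 j s) (L0 j)) => [z|z zl].
    by apply: continuousB; [apply: (AC_within gA)|apply: A0].
  have /andP[z0 zl'] := zl.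
  have -> : g z - th0 j z = (g z - bar (width L N j) (sample L th0 N j) z) +
    (bar (width L N j) (sample L th0 N j) z - th0 j z) by ring.
  have -> : d / 2 = d / 4 + d / 4 by field.
  apply: normD_le; last by apply: Hr2 => // i; apply: le_trans (HN i) _; rewrite ge_min lexx orbT.
  apply: le_trans (hat_bar w0 wE _ (ltW z0) zl') _.
  apply: Hr1 _ _ _ _ N0 w0 wE _ xE _ (cell_lt w0 wE (ltW z0) zl').
  by apply: le_trans (HN j) _; rewrite ge_min lexx.
have -> : th0 j x - th0 j y = (g x - g y) - (g x - th0 j x) + (g y - th0 j y) by ring.
have -> : e + d = e + d / 2 + d / 2 by field.
apply: normD_le; last exact: near.
apply: normB_le; last exact: near.
by apply: le_trans (Hr _ _ _ ga _ _ xl yl xy) _; lra.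
Qed.

Definition oscillates (c : R) (th0 : 'I_3 -> R -> R) :=
  exists j1 j2, [/\ j1 != j2, c <= osc (L j1) (th0 j1) & c <= osc (L j2) (th0 j2)].

(** [sup_close] upgrades L^2 closeness of y and the sample to uniform closeness, and [network_gram]
    is applied with the datum as f and the step function of y as u. The constants depend on the
    datum only through c and E. *)
Lemma coercive_near (c E : R) : 0 < c -> 0 <= E ->
  exists k r d : R, [/\ 0 < k, 0 < r, 0 < d &
  forall th0 N, (0 < N)%N -> (forall j, width L N j <= r) ->
  (forall j, {within `[0, L j], continuous (th0 j)}) -> oscillates c th0 ->
  (forall N, (0 < N)%N -> net_energy p L N (sample L th0 N) <= E) ->
  (forall j s, 0 < s < L j -> `|bar (width L N j) (sample L th0 N j) s - th0 j s| <= d) ->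
  forall y, net_energy p L N y <= E ->
  dot L N (state_sub y (sample L th0 N)) (state_sub y (sample L th0 N)) <= r -> coercive L N k y].
Proof.
move=> c0 E0; have [d [d0 G]] := network_gram L0 c0.
have [r' [r'0 Hr']] := sampled_equicont E0 d0; have [k [k0 {}G]] := G _ r'0.
have d2 : 0 < d / 2 by rewrite divr_gt0.
have [|r [r0 Hr]] := ex_min3 (fun j => sup_close p1 (L0 j) E0 d2).
  move=> j q q' _ qq H h N x y N0 h0 hN hr xE yE xy.
  exact: H (le_trans hr qq) xE yE (le_trans xy qq).
exists k, r, (d / 2); split => // th0 N N0 Nr A0 [j1 [j2 [j12 o1 o2]]] HE b0 y yE yb q.
have w0 := width_gt0 L0 N0; have wE := widthE L N0.
rewrite (_ : dot _ _ _ _ =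
    \sum_j \I_(s < L j) (trig_form (mA q j) (mB q j) (bar (width L N j) (y j) s) ^+ 2)).
  apply: (G th0 _ _ _ j1 j2) => // [|j|j s sl| |]; [exact: Hr'|exact: measurable_bar (w0 j) (y j)|
    |exact: split3_sum..].
  have /andP[s0 sl'] := sl; set u := bar (width L N j).
  have -> : u (y j) s - th0 j s = (u (y j) s - u (sample L th0 N j) s) +
    (u (sample L th0 N j) s - th0 j s) by ring.
  rewrite [leRHS]splitr; apply: normD_le; last exact: b0.
  apply: (Hr j (width L N j) N (y j) (sample L th0 N j)) => //.
  - exact: le_trans (energy_le_net p L0 N0 _ j) yE.
  - exact: le_trans (energy_le_net p L0 N0 _ j) (HE N N0).
  - apply: le_trans yb; rewrite /dot (bigD1 j)//= lerDl sumr_ge0// => i _.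
    by apply: dsum_ge0 => [|i' _]; rewrite ?w0// -expr2 sqr_ge0.
  exact: (cell_lt (w0 j) (wE j) (ltW s0) sl').
apply: eq_bigr => j _; rewrite -(RI_bar_dsum N0 (w0 j) (wE j)).
by apply: eq_RI => // s _; rewrite /bar /force expr2.
Qed.

Lemma approx_exists (c E0 : R) : 0 < c -> 0 <= E0 -> exists T C : R, 0 < T /\ forall th0 E1, E1 <= E0 ->
  (forall j, {within `[0, L j], continuous (th0 j)}) -> oscillates c th0 ->
  (forall N, (0 < N)%N -> net_energy p L N (sample L th0 N) <= E1) ->
  network_constraint L th0 -> forall e, 0 < e ->
  exists th d V w m, net_approx p L th0 E1 C e T th d V w m.
Proof.
move=> c0 E00.
(* E leaves room for the drift, at most p T <= p over the whole time interval. *)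
pose E := E0 + p; have Ep0 : 0 < E by rewrite ltr_wpDl.
have [k [r [dz [k0 r0 dz0 Hco]]]] := coercive_near c0 (ltW Ep0).
(* By [traj_dist] the squared L^2 displacement up to time T is at most T E / p; this choice keeps it
   within the radius r of coercivity. *)
pose T := Num.min 1 (r / (E / p)).
have T0 : 0 < T by rewrite lt_min ltr01 !divr_gt0.
have T1 : T <= 1 by rewrite ge_min lexx.
have Tb : T * (E / p) <= r.
  by rewrite -ler_pdivlMr ?divr_gt0// ge_min lexx orbT.
pose C := E + E / p + 3 * E / k.
have EC : E <= C by rewrite /C -addrA lerDl addr_ge0// divr_ge0// ?mulr_ge0// ltW.
have EpC : E / p <= C.
  by rewrite /C addrAC lerDr addr_ge0 ?(ltW Ep0)// divr_ge0 ?mulr_ge0// ltW.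
have EkC : 3 * E / k <= C by rewrite /C lerDr addr_ge0 ?(ltW Ep0)// divr_ge0// ltW.
exists T, C; split => // th0 E1 E10 A0 osc0 HE1 con0 e e0.
have HE0 n : (0 < n)%N -> net_energy p L n (sample L th0 n) <= E0.
  by move=> n0; exact: le_trans (HE1 n n0) E10.
pose S := L e1 + L e2 + L e3; have S0 : 0 < S by rewrite !addr_gt0.
have LS j : L j <= S.
  have := L0 e1; have := L0 e2; have := L0 e3; rewrite /S; elim/ord3P: j; lra.
(* e' bounds the distance from the sampled datum to the datum: dz is what coercivity tolerates, e /
   2 is the share of the relation in time, and S e' <= e / 4 is the error in each closing
   integral. *)
pose e' := Num.min dz (Num.min (e / 2) (e / (4 * S))).
have e'0 : 0 < e' by rewrite !lt_min dz0 !divr_gt0// mulr_gt0.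
have e'd : e' <= dz by rewrite ge_min lexx.
have e'2 : e' <= e / 2 by rewrite !ge_min lexx orbT.
have e'S : S * e' <= e / 4.
  have : e' <= e / (4 * S) by rewrite !ge_min lexx !orbT.
  move=> /(ler_wpM2l (ltW S0)) /le_trans; apply.
  by apply: eq_ler; field; rewrite gt_eqF.
have [r1 [r10 Hr1]] := slope_small p1 (ltW Ep0) e0.
have [r2 [r20 Hr2]] := sample_near L0 A0 e'0.
have [N [N0 HN]] := @large_mesh _ _ L0 (Num.min (Num.min r r1) (Num.min r2 e))
  ltac:(by rewrite !lt_min r0 r10 r20).
have Nr j : width L N j <= r by apply: le_trans (HN j) _; rewrite !ge_min lexx.
have Nr1 j : width L N j <= r1 by apply: le_trans (HN j) _; rewrite !ge_min lexx ?orbT.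
have Nr2 j : width L N j <= r2 by apply: le_trans (HN j) _; rewrite !ge_min lexx ?orbT.
have Ne j : width L N j <= e by apply: le_trans (HN j) _; rewrite !ge_min lexx ?orbT.
have w0 := width_gt0 L0 N0; have wE := widthE L N0.
pose x0 := sample L th0 N.
have x0E0 : net_energy p L N x0 <= E0.
  exact: HE0.
have x0E : net_energy p L N x0 <= E by rewrite (le_trans x0E0)// lerDl ltW.
have xET : net_energy p L N x0 / p + T <= E / p.
  rewrite /E [in leRHS]mulrDl divff ?gt_eqF// lerD// ler_wpM2r// invr_ge0 ltW//.
have Hco' y : net_energy p L N y <= E ->
    dot L N (state_sub y x0) (state_sub y x0) <= T * (E / p) -> coercive L N k y.
  move=> h1 h2; apply: (Hco th0) => // [n n0|j s sl|]; last exact: le_trans h2 Tb.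
    by apply: le_trans (HE0 n n0) _; rewrite lerDl ltW.
  by apply: le_trans e'd; apply: Hr2.
have [t0 [t00 Ht]] := traj_bounds p1 L0 N0 k0 xET Hco'.
have [M [M0 HM]] := flow_bound p1 L0 N0 E k0.
(* Three demands on the time step: t0 for the energy estimate, t M <= e / 2 for the motion within
   one step, and 2 t E / p <= e / 2 for the drift of the constraint. *)
pose tm := Num.min t0 (Num.min (e / 2 / M) (e / 4 / (E / p))).
have tm0 : 0 < tm by rewrite !lt_min t00 !divr_gt0.
pose K := (Num.truncn (T / tm)).+1; pose t := T / K%:R.
have K0 : (0 < K)%N by [].
have tp : 0 < t by rewrite divr_gt0// ltr0n.
have tK : t * K%:R = T by rewrite divfK// pnatr_eq0.
have ttm : t <= tm.
  by rewrite ler_pdivrMr ?ltr0n// mulrC -ler_pdivrMr// ltW// truncnS_gt.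
have tt0 : t <= t0 by apply: le_trans ttm _; rewrite ge_min lexx.
have tM : t * M <= e / 2.
  by rewrite -ler_pdivlMr//; apply: le_trans ttm _; rewrite !ge_min lexx !orbT.
have tE : 2 * t * (E / p) <= e / 2.
  have : t * (E / p) <= e / 4.
    by rewrite -ler_pdivlMr ?divr_gt0//; apply: le_trans ttm _; rewrite !ge_min lexx !orbT.
  by lra.
pose X n := traj p L0 N0 t x0 n.
have good n : (n <= K)%N -> [/\ net_energy p L N (X n) <= E, coercive L N k (X n),
    diss p L0 N0 t x0 n <= E / p & net_energy p L N (X n) <= net_energy p L N x0 + p * (n%:R * t)].
  move=> nK; apply: Ht => //.
  by rewrite -tK mulrC ler_pM2l// ler_nat.
have cT x : 0 < x < T -> (cell t x < K)%N.
  by move=> /andP[x0' xT]; have := cell_lt tp tK (ltW x0') xT.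
exists (step2 t (width L N) X),
  (step2 t (width L N) (fun n j => slope (width L N j) N (X n j))),
  (step2 t (width L N) (fun n => flow p L0 N0 (X n))),
  (step2 t (width L N) (fun n j => flux_div p (width L N j) N (X n j))),
  (fun q x => mult p L0 N0 (X (cell t x)) q).
have [MM [HM1 HM2 HM3 HM4]] : exists M, [/\ forall j, bmeas T (L j) M
    (step2 t (width L N) X j),
  forall j, bmeas T (L j) M (step2 t (width L N) (fun n j => slope (width L N j) N (X n j)) j),
  forall j, bmeas T (L j) M (step2 t (width L N) (fun n => flow p L0 N0 (X n)) j) &
  forall j, bmeas T (L j) M (step2 t (width L N) (fun n j => flux_div p (width L N j) N (X n j)) j)].
  have S2 G := step2_bmeas L0 G K0 tp tK N0.
  have [m1 h1] := S2 X; have [m2 h2] := S2 (fun n j => slope (width L N j) N (X n j)).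
  have [m3 h3] := S2 (fun n => flow p L0 N0 (X n)).
  have [m4 h4] := S2 (fun n j => flux_div p (width L N j) N (X n j)).
  pose m := Num.max (Num.max m1 m2) (Num.max m3 m4).
  exists m; split => j.
  - by have [a b'] := h1 j; split => // x s xT sl; apply: le_trans (b' x s xT sl) _; rewrite !le_max lexx.
  - by have [a b'] := h2 j; split => // x s xT sl; apply: le_trans (b' x s xT sl) _; rewrite !le_max lexx ?orbT.
  - by have [a b'] := h3 j; split => // x s xT sl; apply: le_trans (b' x s xT sl) _; rewrite !le_max lexx ?orbT.
  - by have [a b'] := h4 j; split => // x s xT sl; apply: le_trans (b' x s xT sl) _; rewrite !le_max lexx ?orbT.
have RIb j (F : nat -> R) : \I_(s < L j) F (cell (width L N j) s) =
    dsum (width L N j) N F.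
  exact: (RI_bar_dsum N0 (w0 j) (wE j) F).
split.
- by exists MM => j; split.
- by move=> k'; exact: (measurable_bar tp (fun n => mult p L0 N0 (X n) k')).
- move=> j x xT; have [g1 g2 _ _] := good _ (ltnW (cT x xT)).
  have [h1 h2] := mult_bound p1 L0 N0 k0 g1 g2 j.
  by split; exact: le_trans EkC.
- by [].
- move=> j x xT; have [g1 _ _ _] := good _ (ltnW (cT x xT)).
  rewrite /step2 (RIb j (fun i => `|slope (width L N j) N (X (cell t x) j) i| `^ p)).
  apply: le_trans EC; apply: le_trans g1.
  exact: (energy_le_net p L0 N0 (X (cell t x)) j).
- move=> x xT; have /andP[x1 _] := xT; have [_ _ _ g4] := good _ (ltnW (cT x xT)).
  rewrite (eq_bigr (fun j => energy p (width L N j) N (X (cell t x) j))); last first.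
    by move=> j _; rewrite /step2 (RIb j (fun i => `|slope (width L N j) N (X (cell t x) j) i| `^ p)).
  apply: le_trans g4 _; apply: lerD; [exact: HE1|rewrite ler_pM2l// mulrC].
  by have /andP[] := cell_itv tp (ltW x1).
- move=> j; apply: le_trans EpC; have [_ _ g3 _] := good K (leqnn K).
  apply: le_trans g3.
  have -> : \I_(x < T) \I_(s < L j)
      (step2 t (width L N) (fun n => flow p L0 N0 (X n)) j x s ^+ 2) =
      \I_(x < T) bar t (fun n => dsum (width L N j) N
        (fun i => flow p L0 N0 (X n) j i ^+ 2)) x.
    apply: eq_RI => x _; rewrite /step2 /bar.
    by rewrite (RIb j (fun i => flow p L0 N0 (X (cell t x)) j i ^+ 2)).
  rewrite (RI_bar_dsum K0 tp tK) /dsum -/dsum mulr_sumr /diss.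
  apply: ler_sum => n _; rewrite ler_wpM2l ?(ltW tp)// /dot (bigD1 j)//= -/(X n).
  rewrite -[leLHS]addr0; apply: lerD.
    by rewrite ler_pM2l// ler_sum// => i _; rewrite expr2.
  by apply: sumr_ge0 => i _; apply: dsum_ge0 => [|i' _]; rewrite ?w0// -expr2 sqr_ge0.
- move=> j x xT; have [g1 _ _ _] := good _ (ltnW (cT x xT)).
  exists (hat (width L N j) N (X (cell t x) j)); split.
    exact: hat_abscont (w0 j) (wE j) _.
  move=> s /andP[s0 sl]; apply: le_trans (hat_bar (w0 j) (wE j) _ (ltW s0) sl) _.
  have iN := cell_lt (w0 j) (wE j) (ltW s0) sl.
  apply: (Hr1 _ _ _ _ N0 (w0 j) (wE j) (Nr1 j) _ _ iN).
  exact: le_trans (energy_le_net p L0 N0 _ j) g1.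
- move=> j x s xT sI; have nK := cT x xT; have /andP[x1 x2] := xT.
  set i := cell (width L N j) s.
  have /andP[c1 c2] := cell_itv tp (ltW x1).
  have := RI_bar tp tK (fun n => flow p L0 N0 (X n) j i) nK c1 (ltW c2).
  rewrite /step2 -/i /bar => ->; set n := cell t x in nK c1 c2 *.
  have TE : X n j i = x0 j i + t * \sum_(m < n) flow p L0 N0 (X m) j i.
    elim: (n) => [|m IH]; first by rewrite big_ord0 mulr0 addr0.
    by rewrite big_ord_recr/= mulrDr addrA -IH.
  rewrite TE; have -> : x0 j i + t * \sum_(m < n) flow p L0 N0 (X m) j i - th0 j s -
      (t * \sum_(m < n) flow p L0 N0 (X m) j i + (x - t * n%:R) * flow p L0 N0 (X n) j i) =
      (x0 j i - th0 j s) - (x - t * n%:R) * flow p L0 N0 (X n) j i by ring.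
  rewrite [leRHS]splitr; apply: normB_le.
    by apply: le_trans e'2; apply: Hr2.
  apply: le_trans tM; rewrite normrM ger0_norm ?subr_ge0//.
  have [g1 g2 _ _] := good _ (ltnW nK).
  apply: ler_pM => //; first by rewrite subr_ge0.
    by rewrite lerBlDr addrC; move: c2; rewrite -natr1 mulrDr mulr1 => /ltW.
  by have [] := HM _ g1 g2 j i.
- move=> j x xT; split.
    rewrite /step2 (RIb j (flux_div p (width L N j) N (X (cell t x) j))).
    exact: dsum_flux_div (w0 j) _.
  move=> s /andP[s0 sl]; rewrite /step2.
  rewrite (RIb j (fun i => flux_div p (width L N j) N (X (cell t x) j) i ^+ 2)).
  have := flux_bar p (w0 j) (wE j) (X (cell t x) j) (ltW s0) sl.
  rewrite /bar => /norm_sqr_le /le_trans; apply.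
  rewrite exprMn real_normK ?num_real// expr2 -mulrA; apply: ler_pM => //.
  + exact: ltW.
  + by rewrite mulr_ge0 ?sqr_ge0// ltW.
  + apply: (@dsum_term _ _ _ (w0 j) (fun i => flux_div p (width L N j) N (X (cell t x) j) i ^+ 2)).
      by move=> i; exact: sqr_ge0.
    by have := cell_lt (w0 j) (wE j) (ltW s0) sl.
- move=> j x xT; have nK := cT x xT; have [_ _ g3 _] := good _ (ltnW nK).
  have key (F F' : R -> R) : continuous F -> (forall a b, `|F b - F a| <= `|b - a|) ->
      (forall a, `|F a| <= 1) ->
      (forall a b, `|F b - F a - F' a * (b - a)| <= (b - a) ^+ 2) ->
      (forall y, dsum (width L N j) N (fun i => flow p L0 N0 y j i * F' (y j i)) =
        dsum (width L N e1) N (fun i => flow p L0 N0 y e1 i * F' (y e1 i))) ->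
      \I_(s < L j) F (th0 j s) = \I_(s < L e1) F (th0 e1 s) ->
    `|\I_(s < L j) F (step2 t (width L N) X j x s) -
      \I_(s < L e1) F (step2 t (width L N) X e1 x s)| <= e.
    move=> h1 h2 h3 h4 h5 h6.
    rewrite /step2 (RIb j (fun i => F (X (cell t x) j i))).
    rewrite (RIb e1 (fun i => F (X (cell t x) e1 i))).
    have D := traj_drift t x0 (cell t x) h4 h5.
    apply: le_trans D _; rewrite [leRHS]splitr; apply: lerD; last first.
      apply: le_trans tE; rewrite ler_wpM2l// mulr_ge0// ltW//.
    have a1 := dsum_cos_sample L0 A0 N0 h1 h2 h3 (Hr2 N N0 Nr2 j).
    have a2 := dsum_cos_sample L0 A0 N0 h1 h2 h3 (Hr2 N N0 Nr2 e1).
    rewrite -h6 in a2.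
    set A := dsum _ _ _ in a1 *; set B := dsum _ _ _ in a2 *; set Z := \int[mu]_(s in _) _ in a1 a2.
    have -> : A - B = (A - Z) - (B - Z) by ring.
    have -> : e / 2 = e / 4 + e / 4 by field.
    apply: normB_le.
      by apply: le_trans a1 (le_trans _ e'S); rewrite ler_wpM2r// ltW.
    by apply: le_trans a2 (le_trans _ e'S); rewrite ler_wpM2r// ltW.
  split.
    apply: (key cos (fun a => - sin a)).
    + exact: continuous_cos.
    + exact: cos_lip.
    + exact: cos_norm_le1.
    + exact: cos_taylor.
    + move=> y; have := flow_sin p L0 N0 y j => h.
      have N1 j' : dsum (width L N j') N (fun i => flow p L0 N0 y j' i * - sin (y j' i)) =
          - dsum (width L N j') N (fun i => flow p L0 N0 y j' i * sin (y j' i)).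
        by rewrite -[RHS]mulN1r -dsumZ; apply: eq_dsum => i _; ring.
      by rewrite !N1 h.
    + by have [] := con0 j e1.
  apply: (key sin cos).
  + exact: continuous_sin.
  + exact: sin_lip.
  + exact: sin_norm_le1.
  + exact: sin_taylor.
  + by move=> y; exact: flow_cos.
  + by have [] := con0 j e1.
Qed.

End approximations.

(** * Compactness *)

Section ascoli.
Context (R : realType).

Lemma ultra_lim (U : set_system nat) (f : nat -> R) (M : R) : UltraFilter U ->
  (forall n, `|f n| <= M) -> exists x, forall e, 0 < e -> U [set n | `|f n - x| <= e].
Proof.
move=> UU fM; have FF : ProperFilter (f @ U) by exact: fmap_proper_filter.
have cM : compact `[- M, M]%classic by exact: segment_compact.
have FM : (f @ U) `[- M, M]%classic.
  change (U [set n | `[- M, M]%classic (f n)]).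
  by apply: filterE => n /=; rewrite in_itv/= -ler_norml.
have [x [_ clx]] := cM _ FF FM; exists x => e e0.
have [//|Un] := in_ultra_setVsetC [set n | `|f n - x| <= e] UU.
have FC : (f @ U) (f @` (~` [set n | `|f n - x| <= e])).
  change (U [set n | (f @` (~` [set n | `|f n - x| <= e])) (f n)]).
  by apply: filterS Un => n nn; exists n.
have [_ [[n /= nn <-] xn]] := clx _ _ FC (nbhsx_ballx x e e0).
by exfalso; apply: nn; rewrite distrC; apply: ltW.
Qed.

(** The contraction towards T / 2 with factor 1 - 1/(n+2). The approximations are controlled at
    interior points, and this map takes the closed interval into the open one without increasing
    distances. *)
Definition inward (T : R) (n : nat) (t : R) : R := t + (T / 2 - t) / n.+2%:R.

Lemma inward_itv T n t : 0 < T -> 0 <= t <= T -> 0 < inward T n t < T.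
Proof.
move=> T0 /andP[t0 tT]; have n0 : 0 < n.+2%:R :> R by rewrite ltr0n.
have E : inward T n t = (t * n.+1%:R + T / 2) / n.+2%:R.
  rewrite /inward (_ : n.+1%:R = n.+2%:R - 1); last by rewrite -[n.+2%:R]natr1 addrK.
  by move: n0; generalize (n.+2%:R : R) => r r0; field; rewrite gt_eqF.
rewrite E divr_gt0 ?ltr_wpDl ?mulr_ge0 ?divr_gt0//=.
rewrite ltr_pdivrMr// -[n.+2%:R]natr1 mulrDr mulr1.
have := ler_wpM2r (ler0n R n.+1) tT; lra.
Qed.

Lemma inward_dist T n t t' : `|inward T n t - inward T n t'| <= `|t - t'|.
Proof.
have -> : inward T n t - inward T n t' = (t - t') * (1 - n.+2%:R^-1).
  have n0 : 0 < n.+2%:R :> R by rewrite ltr0n.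
  by rewrite /inward; move: n0; generalize (n.+2%:R : R) => r r0; field; rewrite gt_eqF.
rewrite normrM -[leRHS]mulr1 ler_wpM2l// ger0_norm ?gerBl ?invr_ge0//.
by rewrite subr_ge0 invf_le1 ?ltr0n// ler1n.
Qed.

Lemma inward_near T n t : 0 < T -> 0 <= t <= T -> `|inward T n t - t| <= T / n.+2%:R.
Proof.
move=> T0 /andP[t0 tT]; rewrite /inward addrC addKr normrM.
rewrite (ger0_norm (x := _^-1)) ?invr_ge0// ler_wpM2r ?invr_ge0//.
by rewrite ler_norml; apply/andP; split; lra.
Qed.

(** Limits along an ultrafilter exist at all points at once and replace a diagonal extraction.
    Equicontinuity, valid from some index on, passes to the limit, and a finite grid turns
    convergence at points into uniform closeness for arbitrarily large indices. *)
Lemma ascoli (I : finType) (T : R) (l : I -> R) (u : nat -> I -> R -> R -> R) (M : R) :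
  0 < T -> (forall j, 0 < l j) ->
  (forall n j t s, 0 < t < T -> 0 < s < l j -> `|u n j t s| <= M) ->
  (forall e, 0 < e -> exists d (n0 : nat), 0 < d /\ forall n j t t' s s', (n0 <= n)%N ->
     0 < t < T -> 0 < t' < T -> 0 < s < l j -> 0 < s' < l j ->
     `|t - t'| <= d -> `|s - s'| <= d -> `|u n j t s - u n j t' s'| <= e) ->
  exists v : I -> R -> R -> R, (forall j, ucont2 T (l j) (v j)) /\
  forall e, 0 < e -> forall m, exists n, (m <= n)%N /\
    forall j t s, 0 < t < T -> 0 < s < l j -> `|u n j t s - v j t s| <= e.
Proof.
move=> T0 l0 uM uE.
have [U [UU oU]] := @ultraFilterLemma nat \oo _.
have /choice[v Hv] : forall z : I * (R * R), exists x : R,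
    (0 <= z.2.1 <= T -> 0 <= z.2.2 <= l z.1 -> forall e, 0 < e ->
    U [set n | `|u n z.1 (inward T n z.2.1) (inward (l z.1) n z.2.2) - x| <= e]).
  move=> [j [t s]] /=.
  have [[tT sl]|h] := pselect (0 <= t <= T /\ 0 <= s <= l j); last first.
    by exists 0 => tT sl; case: h.
  have [x Hx] := @ultra_lim U (fun n => u n j (inward T n t) (inward (l j) n s)) M UU
    (fun n => uM n j _ _ (inward_itv n T0 tT) (inward_itv n (l0 j) sl)).
  by exists x.
have Uinf m : U [set n | (m <= n)%N] by apply: oU; exists m.
have UN (A : set nat) : U A -> exists n, A n by move=> /filter_ex.
have vE e : 0 < e -> exists d, 0 < d /\ forall j t t' s s',
    0 <= t <= T -> 0 <= t' <= T -> 0 <= s <= l j -> 0 <= s' <= l j ->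
    `|t - t'| <= d -> `|s - s'| <= d -> `|v (j, (t, s)) - v (j, (t', s'))| <= e.
  move=> e0; have e3 : 0 < e / 3 by rewrite divr_gt0.
  have [d [n0 [d0 Hd]]] := uE _ e3; exists d; split => //.
  move=> j t t' s s' tT tT' sl sl' td sd.
  have U1 := Hv (j, (t, s)) tT sl _ e3; have U2 := Hv (j, (t', s')) tT' sl' _ e3.
  have [n [[/= h1 h2] h3]] := UN _ (filterI (filterI U1 U2) (Uinf n0)).
  have h4 := Hd n j _ _ _ _ h3 (inward_itv n T0 tT) (inward_itv n T0 tT')
    (inward_itv n (l0 j) sl) (inward_itv n (l0 j) sl')
    (le_trans (inward_dist _ _ _ _) td) (le_trans (inward_dist _ _ _ _) sd).
  set a := u n _ _ _ in h1 h4; set b := u n _ _ _ in h2 h4.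
  have -> : v (j, (t, s)) - v (j, (t', s')) =
    (b - v (j, (t', s'))) - (a - v (j, (t, s))) + (a - b) by ring.
  have -> : e = e / 3 + e / 3 + e / 3 by field.
  by apply: normD_le => //; exact: normB_le.
exists (fun j t s => v (j, (t, s))); split.
  by move=> j e e0; have [d [d0 Hd]] := vE e e0; exists d; split => // *; exact: Hd.
move=> e e0 m; have e3 : 0 < e / 3 by rewrite divr_gt0.
have [d1 [n1 [d10 H1]]] := uE _ e3; have [d2 [d20 H2]] := vE _ e3.
pose d := Num.min d1 d2 / 2; have d0 : 0 < d by rewrite divr_gt0// lt_min d10.
have dd1 : d + d <= d1 by rewrite -splitr ge_min lexx.
have dd2 : d + d <= d2 by rewrite -splitr ge_min lexx orbT.
pose N := Num.truncn d^-1.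
have Nd : N.+1%:R^-1 <= d.
  by rewrite -[leRHS]invrK lef_pV2 ?posrE ?invr_gt0 ?ltr0n// ltW// truncnS_gt.
pose S := T + \sum_j l j.
have S0 j : 0 < S /\ l j <= S.
  split; first by rewrite ltr_pwDl// sumr_ge0// => i _; exact: ltW.
  rewrite /S (bigD1 j)//= addrCA lerDl addr_ge0 ?(ltW T0)// sumr_ge0// => i _; exact: ltW.
pose K := (Num.truncn (S * N.+1%:R)).+1.
pose pt (a : 'I_K) : R := a%:R / N.+1%:R.
have grid x : 0 <= x -> x <= S -> exists a : 'I_K, 0 <= pt a /\ pt a <= x /\ x - pt a <= d.
  move=> x0 xS; have [h1 h2 h3] := truncn_cell N x0.
  have aK : (Num.truncn (x * N.+1%:R) < K)%N.
    by rewrite ltnS le_truncn// ler_wpM2r.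
  by exists (Ordinal aK); rewrite /pt/=; split => //; split => //; exact: le_trans h3 Nd.
(* The grid is finite, so the conditions at its points hold simultaneously on a set of the
   ultrafilter. *)
have U3 : U [set n | forall (j : I) (a b : 'I_K), pt a <= T -> pt b <= l j ->
    `|u n j (inward T n (pt a)) (inward (l j) n (pt b)) - v (j, (pt a, pt b))| <= e / 3].
  have pt0 a : 0 <= pt a by rewrite divr_ge0.
  pose A (z : I * ('I_K * 'I_K)) : set nat := [set n | pt z.2.1 <= T -> pt z.2.2 <= l z.1 ->
      `|u n z.1 (inward T n (pt z.2.1)) (inward (l z.1) n (pt z.2.2)) -
        v (z.1, (pt z.2.1, pt z.2.2))| <= e / 3].
  suff H z : U (A z).
    have H' : U [set n | forall z, A z n] by apply: filter_forall H.
    by apply: filterS H' => n Hn j a b; exact: (Hn (j, (a, b))).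
  rewrite /A.
  have [[h1 h2]|h] := pselect (pt z.2.1 <= T /\ pt z.2.2 <= l z.1).
    have := Hv (z.1, (pt z.2.1, pt z.2.2)); rewrite /= !pt0 h1 h2 => /(_ isT isT _ e3).
    by apply: filterS => n h _ _.
  by apply: filterE => n h1 h2; case: h.
pose n2 := Num.truncn (S / d).
have [n [/= hn [/= h1 [/= h2 h3]]]] := UN _ (filterI U3 (filterI (Uinf m) (filterI (Uinf n1) (Uinf n2)))).
exists n; split => // j t s tT sl; have [S00 lS] := S0 j.
have TS : T <= S by rewrite /S lerDl sumr_ge0// => i _; exact: ltW.
have near x y : 0 < y -> y <= S -> 0 <= x <= y -> `|inward y n x - x| <= d.
  move=> y0 yS xy; apply: le_trans (inward_near n y0 xy) _.
  rewrite ler_pdivrMr ?ltr0n// -ler_pdivrMl// mulrC.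
  apply: (@le_trans _ _ (S / d)); first by rewrite ler_wpM2r ?invr_ge0// ltW.
  apply: (le_trans (ltW (truncnS_gt (S / d)))); rewrite ler_nat.
  by rewrite ltnW// ltnS ltnS.
have /andP[t0 tT'] := tT; have /andP[s0 sl'] := sl.
have [a [a0 [a1 a2]]] := grid t (ltW t0) (le_trans (ltW tT') TS).
have [b [b0 [b1 b2]]] := grid s (ltW s0) (le_trans (ltW sl') lS).
have aT : 0 <= pt a <= T by rewrite a0 (le_trans a1)// ltW.
have bl : 0 <= pt b <= l j by rewrite b0 (le_trans b1)// ltW.
have [_ aT'] := andP aT; have [_ bl'] := andP bl.
have k1 := hn j a b aT' bl'.
have k2 : `|v (j, (t, s)) - v (j, (pt a, pt b))| <= e / 3.
  have d2' : d <= d2 by apply: le_trans dd2; rewrite lerDl ltW.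
  apply: H2; rewrite ?aT ?bl//.
  - by rewrite !ltW.
  - by rewrite !ltW.
  - by rewrite ger0_norm ?subr_ge0// (le_trans a2).
  - by rewrite ger0_norm ?subr_ge0// (le_trans b2).
have far x y z : x - z <= d -> z <= x -> `|y - z| <= d -> `|x - y| <= d1.
  move=> g1 g2 g3; apply: le_trans dd1.
  have -> : x - y = (x - z) - (y - z) by ring.
  by apply: normB_le => //; rewrite ger0_norm// subr_ge0.
have k3 : `|u n j t s - u n j (inward T n (pt a)) (inward (l j) n (pt b))| <= e / 3.
  apply: H1 => //.
  - exact: inward_itv.
  - exact: inward_itv.
  - by apply: (far _ _ (pt a)) => //; exact: near.
  - by apply: (far _ _ (pt b)) => //; exact: near.
set x := u n j t s in k3 *; set y := u n _ _ _ in k1 k3.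
have -> : x - v (j, (t, s)) = (x - y) + (y - v (j, (pt a, pt b))) -
  (v (j, (t, s)) - v (j, (pt a, pt b))) by ring.
have -> : e = e / 3 + e / 3 + e / 3 by field.
by apply: normB_le => //; exact: normD_le.
Qed.

End ascoli.

(** * Convex combinations of the tails of a sequence *)

Section convex_combinations.
Context (R : realType).
Implicit Types (u v : nat -> R) (c : (nat -> R) -> R).

(* Convex combinations, with dyadic weights, of the terms of index at least n of
   a sequence, seen as functionals of the sequence. *)
Inductive comb (n : nat) : ((nat -> R) -> R) -> Prop :=
| comb_term k : (n <= k)%N -> comb n (fun u => u k)
| comb_mid c c' : comb n c -> comb n c' -> comb n (fun u => (c u + c' u) / 2).

Lemma comb_le m n c : (m <= n)%N -> comb n c -> comb m c.
Proof.
move=> mn; elim=> [k nk|d d' _ H1 _ H2]; last exact: comb_mid.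
by apply: comb_term; exact: leq_trans nk.
Qed.

Lemma combB n c u v : comb n c -> c (fun k => u k - v k) = c u - c v.
Proof.
elim=> [k nk//|d d' _ H1 _ H2]; by rewrite H1 H2; field.
Qed.

Lemma combD n c u v : comb n c -> c (fun k => u k + v k) = c u + c v.
Proof.
elim=> [k nk//|d d' _ H1 _ H2]; by rewrite H1 H2; field.
Qed.

Lemma combZ n c (a : R) u : comb n c -> c (fun k => a * u k) = a * c u.
Proof.
elim=> [k nk//|d d' _ H1 _ H2]; by rewrite H1 H2; field.
Qed.

Lemma comb_cst n c (a : R) : comb n c -> c (fun=> a) = a.
Proof.
elim=> [k nk//|d d' _ H1 _ H2]; by rewrite H1 H2; field.
Qed.

Lemma comb_norm n c u v : comb n c -> (forall k, (n <= k)%N -> `|u k| <= v k) ->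
  `|c u| <= c v.
Proof.
move=> cc uv; elim: cc => [k nk|d d' _ H1 _ H2]; first exact: uv.
rewrite normrM (ger0_norm (x := 2^-1))// ler_wpM2r//.
exact: normD_le.
Qed.

Lemma comb_bound n c u (M : R) : comb n c -> (forall k, (n <= k)%N -> `|u k| <= M) ->
  `|c u| <= M.
Proof. by move=> cc uM; rewrite -[leRHS](comb_cst M cc); exact: (comb_norm cc). Qed.

Lemma comb_mono n c u v : comb n c -> (forall k, (n <= k)%N -> u k <= v k) -> c u <= c v.
Proof.
move=> cc uv; elim: cc => [k nk|d d' _ H1 _ H2]; first exact: uv.
by rewrite ler_wpM2r// lerD.
Qed.

Lemma comb_cvg (c : nat -> (nat -> R) -> R) u (a : R) : (forall n, comb n (c n)) ->
  u n @[n --> \oo] --> a -> c n u @[n --> \oo] --> a.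
Proof.
move=> cc ua; apply/cvgrPdist_le => e e0.
move: ua => /cvgrPdist_le/(_ _ e0)[N _ HN].
exists N => // n /= Nn; rewrite -(comb_cst a (cc n)) -(combB _ _ (cc n)).
by apply: (comb_bound (cc n)) => k nk; apply: HN; exact: leq_trans nk.
Qed.

Lemma comb_intg d (X : measurableType d) (m : {measure set X -> \bar R}) (D : set X)
    n c (f : nat -> X -> R) : measurable D ->
  comb n c -> (forall k, intg m D (f k)) ->
  intg m D (fun x => c (f^~ x)) /\
  \int[m]_(x in D) c (f^~ x) = c (fun k => \int[m]_(x in D) f k x).
Proof.
move=> mD cc mf; elim: cc => [k nk//|e e' _ [i1 H1] _ [i2 H2]].
have i3 : intg m D (fun x => e (f^~ x) + e' (f^~ x)) by exact: intgD.
have E : (fun x => (e (f^~ x) + e' (f^~ x)) / 2) =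
         (fun x => 2^-1 * (e (f^~ x) + e' (f^~ x))).
  by apply/funext => x; rewrite mulrC.
rewrite E; split; first exact: intgZ.
by rewrite RIZ// RID// H1 H2 mulrC.
Qed.

Lemma comb_sqint d (X : measurableType d) (m : {measure set X -> \bar R}) (D : set X)
    n c (f : nat -> X -> R) : measurable D ->
  comb n c -> (forall k, sqint m D (f k)) -> sqint m D (fun x => c (f^~ x)).
Proof.
move=> mD cc mf; elim: cc => [k nk//|e e' _ H1 _ H2].
have := sqintZ mD 2^-1 (sqintD mD H1 H2).
by apply: eq_sqint => // x _; rewrite mulrC.
Qed.

(* Mazur's argument: almost minimal elements of the convex hulls of the tails
   form a Cauchy sequence, by the parallelogram law. *)
Lemma mazur (Q : ((nat -> R) -> R) -> R) (C : R) :
  (forall c, 0 <= Q c) ->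
  (forall c c', comb 0 c -> comb 0 c' ->
    Q (fun u => (c u + c' u) / 2) + Q (fun u => (c u - c' u) / 2) <= (Q c + Q c') / 2) ->
  (forall k, Q (fun u => u k) <= C) ->
  exists y : nat -> (nat -> R) -> R, (forall n, comb n (y n)) /\
  forall e, 0 < e -> exists N, forall m n, (N <= m)%N -> (N <= n)%N ->
    Q (fun u => (y m u - y n u) / 2) <= e.
Proof.
move=> Q0 QP QC.
pose S n := [set Q c | c in comb n].
have S1 n : has_inf (S n).
  split; first by exists (Q (fun u => u n)), (fun u => u n) => //; exact: comb_term.
  by exists 0 => _ [c _ <-].
pose I n := inf (S n).
have IQ n c : comb n c -> I n <= Q c.
  by move=> cc; apply: ge_inf; [exact: (S1 n).2|exists c].
have IC n : I n <= C by apply: le_trans (QC n); apply: IQ; exact: comb_term.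
have Imono m n : (m <= n)%N -> I m <= I n.
  move=> mn; apply: lb_le_inf; first exact: (S1 n).1.
  by move=> _ [c cc <-]; apply: IQ; exact: comb_le cc.
have /choice[y Hy] : forall n, exists c, comb n c /\ Q c <= I n + n.+1%:R^-1.
  move=> n; have n0 : 0 < n.+1%:R^-1 :> R by rewrite invr_gt0 ltr0n.
  have [_ [c cc <-] h] := inf_adherent n0 (S1 n).
  by exists c; split => //; exact: ltW.
exists y; split; first by move=> n; have [] := Hy n.
have hs : has_sup (range I).
  by split; [exists (I 0%N), 0%N|exists C => _ [n _ <-]].
move=> e e0; have e2 : 0 < e / 2 by rewrite divr_gt0.
have [_ [N1 _ <-] HN1] := sup_adherent e2 hs.
have Isup n : I n <= sup (range I) by apply: ub_le_sup; [exact: hs.2|exists n].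
(* From N on, the infima are within e / 2 of their supremum and the slack 1/(n+1) is at most e /
   2. *)
pose N := maxn N1 (Num.truncn (e / 2)^-1).
exists N; suff H m n : (N <= m)%N -> (m <= n)%N ->
    Q (fun u => (y m u - y n u) / 2) <= e /\ Q (fun u => (y n u - y m u) / 2) <= e.
  move=> m n mN nN; have [mn|/ltnW nm] := leqP m n.
    by have [] := H m n mN mn.
  by have [] := H n m nN nm.
move=> Nm mn.
have [c1 q1] := Hy m; have [c2 q2] := Hy n.
have c2' := comb_le mn c2.
have [cm cn] := (comb_le (leq0n m) c1, comb_le (leq0n m) c2').
have h1 := IQ m _ (comb_mid c1 c2').
have h2 := IQ m _ (comb_mid c2' c1).
have hm : m.+1%:R^-1 <= e / 2.
  rewrite -[leRHS]invrK lef_pV2 ?posrE ?invr_gt0 ?ltr0n//.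
  apply: ltW; apply: lt_le_trans (truncnS_gt _) _.
  by rewrite ler_nat ltnS (leq_trans (leq_maxr N1 _)).
have hn : n.+1%:R^-1 <= m.+1%:R^-1 :> R by rewrite lef_pV2 ?posrE ?ltr0n// ler_nat.
have h3 := Isup n; have h4 := Isup m.
have h5 : I N1 <= I m by apply: Imono; exact: leq_trans (leq_maxl _ _) Nm.
have := QP _ _ cm cn; have := QP _ _ cn cm => k1 k2.
have key (a b c d i i' s r r' : R) : a + b <= (c + d) / 2 -> i <= a ->
    c <= i + r -> d <= i' + r' -> i' <= s -> s - e / 2 < i -> r <= e / 2 -> r' <= r -> b <= e.
  by move=> *; lra.
split.
  exact: key k2 h1 q1 q2 h3 (lt_le_trans HN1 h5) hm hn.
rewrite [X in _ <= X / 2]addrC in k1.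
exact: key k1 h2 q1 q2 h3 (lt_le_trans HN1 h5) hm hn.
Qed.

End convex_combinations.

(** * Uniform estimates for the approximations on one edge *)

Section edge_approximations.
Context (R : realType) (p : R).
Hypothesis p1 : 1 < p.
Local Notation mu := (@lebesgue_measure R).
Local Notation m2 := (mu \x mu)%E.
Local Notation unc u := (fun z : R * R => u z.1 z.2).
Local Notation Q T l := (`]0, T[ `*` `]0, l[ : set (R * R)).
Let pp : 0 < p. Proof. exact: lt_trans ltr01 p1. Qed.

Record eapprox (th0 : R -> R) (l C e T : R) (th d V w : R -> R -> R)
    (A B : R -> R) : Prop := Eapprox {
  ea_meas : exists M, [/\ bmeas T l M th, bmeas T l M d, bmeas T l M V & bmeas T l M w];
  ea_multC : forall t, 0 < t < T -> `|A t| <= C /\ `|B t| <= C;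
  ea_eq : forall t s, 0 < t < T -> 0 < s < l -> V t s = w t s + trig_form (A t) (B t) (th t s);
  ea_pow : forall t, 0 < t < T -> \I_(s < l) (`|d t s| `^ p) <= C;
  ea_sq : \I_(t < T) \I_(s < l) (V t s ^+ 2) <= C;
  ea_hat : forall t, 0 < t < T -> exists g, abscont l g (d t) /\
    forall s, 0 < s < l -> `|g s - th t s| <= e;
  ea_time : forall t s, 0 < t < T -> 0 < s < l ->
    `|th t s - th0 s - \I_(x < t) V x s| <= e;
  ea_flux : forall t, 0 < t < T -> \I_(s < l) w t s = 0 /\
    forall s, 0 < s < l ->
      (pflux p (d t s) - \I_(x < s) w t x) ^+ 2 <=
      e * \I_(x < l) (w t x ^+ 2) }.

Lemma approx_edge (L : 'I_3 -> R) th0 (E0 C e T : R) th d V w m (j : 'I_3) : net_approx p L th0 E0 C e T th d V w m ->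
  eapprox (th0 j) (L j) C e T (th j) (d j) (V j) (w j)
    (fun t => mA (m^~ t) j) (fun t => mB (m^~ t) j).
Proof.
move=> [[M HM] h2 h3 h4 h5 _ h6 h7 h8 h9 h10]; split => //.
- by exists M; exact: HM.
- by move=> t; exact: h3.
- by move=> t s; exact: h4.
- by move=> t; exact: h5.
- by move=> t; exact: h7.
- by move=> t s; exact: h8.
- by move=> t; exact: h9.
Qed.

Lemma bmeas_t (T l M t : R) (u : R -> R -> R) : bmeas T l M u -> 0 < t < T ->
  measI l (u t) /\ intgI l (u t) /\ sqintI l (u t).
Proof.
move=> [mu_ b] tT; have mt : measI l (u t).
  by apply: slice_t mu_ _; rewrite /= in_itv.
have bt s : `]0, l[%classic s -> `|u t s| <= M.
  by rewrite /= in_itv/= => sl; exact: b.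
split => //; split.
  by apply: (@intg_bounded _ _ _ mu _ _ _ M) => //; exact: mu_itv_lty.
by apply: (@sqint_bounded _ _ _ mu _ _ _ M) => //; exact: mu_itv_lty.
Qed.

Lemma bmeas_s (T l M s : R) (u : R -> R -> R) : bmeas T l M u -> 0 < s < l ->
  measI T (u^~ s) /\ intgI T (u^~ s) /\ sqintI T (u^~ s).
Proof.
move=> [mu_ b] sl; have mt : measI T (u^~ s).
  by apply: slice_s mu_ _; rewrite /= in_itv.
have bt t : `]0, T[%classic t -> `|u t s| <= M.
  by rewrite /= in_itv/= => tT; exact: b.
split => //; split.
  by apply: (@intg_bounded _ _ _ mu _ _ _ M) => //; exact: mu_itv_lty.
by apply: (@sqint_bounded _ _ _ mu _ _ _ M) => //; exact: mu_itv_lty.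
Qed.

Lemma bmeas_sqint T l M u : bmeas T l M u -> sqint m2 (Q T l) (unc u).
Proof.
move=> [mu_ b]; apply: (@sqint_bounded _ _ _ m2 _ _ _ M) => //.
- exact: measurable_Q.
- exact: muQ_lty.
- by move=> [t s] [/=]; rewrite !in_itv/= => tT sl; exact: b.
Qed.

Lemma cst_sqint (a b k : R) : sqint mu `]a, b[ (fun=> k).
Proof.
by apply: (@sqint_bounded _ _ _ mu _ _ _ `|k|) => //; exact: mu_itv_lty.
Qed.

Lemma RI_sqr_le (T a b : R) (u : R -> R) : 0 <= a -> a <= b -> b <= T ->
  sqintI T u ->
  (\I_(a < t < b) u t) ^+ 2 <= (b - a) * \I_(t < T) (u t ^+ 2).
Proof.
move=> a0 ab bT [mu_ iu].
have iab : intg mu `]a, b[ (fun t => u t ^+ 2) by exact: sub_itv_intg iu.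
have mab : measurable_fun `]a, b[ u.
  apply: measurable_funS mu_ => //.
  by move=> z /=; rewrite !in_itv/= => /andP[? ?]; apply/andP; split; lra.
have sab : sqint mu `]a, b[ u by [].
have iab1 : intg mu `]a, b[ u by apply: sqint_intg sab => //; exact: mu_itv_lty.
have le1 : \I_(a < t < b) (u t ^+ 2) <= \I_(t < T) (u t ^+ 2).
  rewrite [leRHS](@RI_itv_split _ _ 0 a T)//; last lra.
  have iaT : intg mu `]a, T[ (fun t => u t ^+ 2) by exact: sub_itv_intg iu.
  rewrite [X in _ <= _ + X](@RI_itv_split _ _ a b T)//.
  by rewrite addrCA lerDl addr_ge0// RI_ge0// => t _; exact: sqr_ge0.
apply: (@le_trans _ _ ((b - a) * \I_(a < t < b) (u t ^+ 2))); last first.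
  by rewrite ler_wpM2l// subr_ge0.
have := @RI_CS _ _ _ mu `]a, b[%classic (measurable_itv _) (fun=> 1 : R) u (cst_sqint a b 1) sab.
rewrite RI_cst// expr1n mul1r mu_itv_len// => /(le_trans _); apply.
rewrite -real_normK ?num_real// lerXn2r ?nnegrE ?RI_ge0//.
apply: le_trans (RI_norm _ iab1) _ => //.
by apply: eq_ler; apply: eq_RI => t _; rewrite mul1r.
Qed.

Section one.
Variables (th0 : R -> R) (l C e T : R) (th d V w : R -> R -> R) (A B : R -> R).
Hypotheses (l0 : 0 < l) (T0 : 0 < T) (EA : eapprox th0 l C e T th d V w A B).

Lemma eapprox_V2 : [/\ intgI l (fun s => \I_(t < T) (V t s ^+ 2)) &
  \I_(s < l) \I_(t < T) (V t s ^+ 2) <= C].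
Proof.
have [M [_ _ bV _]] := ea_meas EA; have [_ iV] := bmeas_sqint bV.
have [_ h2 h3] := @fubini_intg2 _ _ _ _ _ mu mu `]0, T[%classic `]0, l[%classic
  (measurable_itv _) (measurable_itv _) (fun t s => V t s ^+ 2) iV.
split => //; rewrite -h3.
have [_ _ ->] := @RI_Q _ T l (fun t s => V t s ^+ 2) iV; exact: ea_sq EA.
Qed.

(** By Cauchy-Schwarz in time, the squared displacement at s between a and b is at most (b - a)
    times the time integral of V^2; K collects the defects that are uniform in s. *)
Lemma eapprox_L2 (G : R -> R) (K a b : R) : measI l G -> 0 <= K -> 0 <= a ->
  a <= b -> b <= T ->
  (forall s, 0 < s < l -> `|G s| <= K + `|\I_(a < t < b) V t s|) ->
  \I_(s < l) (G s ^+ 2) <= 2 * K ^+ 2 * l + 2 * (b - a) * C.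
Proof.
move=> GA K0 a0 ab bT HG; have [iV2 V2C] := eapprox_V2.
have [M [_ _ bV _]] := ea_meas EA.
have ptw s : `]0, l[%classic s -> G s ^+ 2 <=
    2 * K ^+ 2 + 2 * (b - a) * \I_(t < T) (V t s ^+ 2).
  rewrite /= in_itv/= => sl.
  have [_ [_ sV]] := bmeas_s bV sl.
  have h1 := RI_sqr_le a0 ab bT sV; have h2 := HG s sl.
  set v := \int[mu]_(t in _) V t s in h1 h2.
  have h3 : G s ^+ 2 <= (K + `|v|) ^+ 2 by exact: norm_sqr_le.
  have h4 : (K + `|v|) ^+ 2 <= 2 * K ^+ 2 + 2 * v ^+ 2.
    by rewrite -[v ^+ 2]real_normK ?num_real//; have := sqr_ge0 (K - `|v|); lra.
  by apply: le_trans h3 (le_trans h4 _); rewrite lerD2l -mulrA ler_wpM2l.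
have iR : intgI l (fun s => 2 * K ^+ 2 +
    2 * (b - a) * \I_(t < T) (V t s ^+ 2)).
  by apply: intgD => //; [exact: cst_intg|exact: intgZ].
apply: (@le_trans _ _ (\I_(s < l) (2 * K ^+ 2 +
    2 * (b - a) * \I_(t < T) (V t s ^+ 2)))).
  apply: le_RI => //.
  apply: (@intg_le _ _ _ mu _ _ _ (fun s => 2 * K ^+ 2 +
    2 * (b - a) * \I_(t < T) (V t s ^+ 2))) => //.
    exact: measurable_funX.
  by move=> s sl; rewrite ger0_norm ?sqr_ge0//; exact: ptw.
rewrite RID//; [|exact: cst_intg|exact: intgZ].
rewrite RI_cst// RIZ// mu_itvE// lerD2l ler_wpM2l//.
by rewrite mulr_ge0// subr_ge0.
Qed.

Lemma eapprox_d t : 0 < t < T -> [/\ measI l (d t), intgI l (d t),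
  intgI l (fun s => `|d t s| `^ p) &
  \I_(s < l) `|d t s| <= l + C].
Proof.
move=> tT; have [M [_ bd _ _]] := ea_meas EA.
have [md [id _]] := bmeas_t bd tT.
have M0 : 0 <= M.
  have [_ b] := bd; apply: le_trans (b t (l / 2) tT _); first exact: normr_ge0.
  by rewrite divr_gt0//= ltr_pdivrMr// ltr_pMr// ltr1n.
have ip : intgI l (fun s => `|d t s| `^ p).
  apply: (@intg_bounded _ _ _ mu _ _ _ (M `^ p)) => //; first exact: mu_itv_lty.
    exact: measurable_abspow.
  move=> s; rewrite /= in_itv/= => sl; rewrite ger0_norm ?powR_ge0//.
  by rewrite ge0_ler_powR ?nnegrE// ?(ltW pp)//; exact: bd.2.
split => //; have [_ H] := Lp_intg p1 md ip.
by apply: le_trans (H l0) _; rewrite lerD2l; exact: ea_pow EA _ tT.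
Qed.

Lemma eapprox_w2 : 0 <= C -> intgI T (fun t => \I_(s < l) (w t s ^+ 2)) /\
  \I_(t < T) \I_(s < l) (w t s ^+ 2) <= 2 * C + 8 * C ^+ 2 * l * T.
Proof.
move=> C0; have [M [bth _ bV bw]] := ea_meas EA.
have [_ iw] := bmeas_sqint bw; have [_ iV] := bmeas_sqint bV.
have [h1 h2 _] := @RI_Q _ T l (fun t s => w t s ^+ 2) iw.
have [_ k2 _] := @RI_Q _ T l (fun t s => V t s ^+ 2) iV.
split => //.
apply: (@le_trans _ _ (\I_(t < T)
  (2 * \I_(s < l) (V t s ^+ 2) + 8 * C ^+ 2 * l))).
  apply: le_RI => //.
    by apply: intgD => //; [exact: intgZ|exact: cst_intg].
  move=> t; rewrite /= in_itv/= => tT.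
  have [_ [_ [_ iVt]]] := bmeas_t bV tT; have [_ [_ [_ iwt]]] := bmeas_t bw tT.
  have -> : 2 * \I_(s < l) (V t s ^+ 2) + 8 * C ^+ 2 * l =
     \I_(s < l) (2 * V t s ^+ 2 + 8 * C ^+ 2).
    rewrite RID//; [|exact: intgZ|exact: cst_intg].
    by rewrite RIZ// RI_cst// mu_itvE.
  apply: le_RI => //; first by apply: intgD => //; [exact: intgZ|exact: cst_intg].
  move=> s; rewrite /= in_itv/= => sl.
  have := ea_eq EA tT sl; have [a1 a2] := ea_multC EA tT.
  set f := trig_form _ _ _ => E.
  have f2 : f ^+ 2 <= (C + C) ^+ 2.
    by apply: norm_sqr_le; apply: le_trans (trig_form_le _ _ _) _; exact: lerD.
  have -> : w t s = V t s - f by rewrite E addrK.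
  move: f2; have -> : (C + C) ^+ 2 = 4 * C ^+ 2 by ring.
  by have := sqr_ge0 (V t s + f); set x := V t s; set y := C ^+ 2; move=> g1 g2; lra.
rewrite RID//; [|exact: intgZ|exact: cst_intg].
have -> : \I_(x < T) (8 * C ^+ 2 * l) = 8 * C ^+ 2 * l * T.
  by rewrite -[X in _ = _ * X](mu_itvE T0); exact: RI_cst.
by rewrite RIZ// lerD2r ler_wpM2l//; exact: ea_sq EA.
Qed.

End one.

Lemma eapprox_acp th0 l C e T th d V w A B t : 0 < l -> eapprox th0 l C e T th d V w A B ->
  0 < t < T -> exists g, acp p C l g (d t) /\ forall s, 0 < s < l -> `|g s - th t s| <= e.
Proof.
move=> l0 EA tT; have [g [gA gth]] := ea_hat EA tT; exists g; split => //.
by have [md _ ip _] := eapprox_d l0 EA tT; split => //; exact: ea_pow EA _ tT.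
Qed.

(** Continuity in time is obtained first in L^2, between the interpolants at t and t', and then
    uniformly by [acp_close]. It requires the defect to be below e0, so the family is equicontinuous
    only asymptotically. *)
Lemma eapprox_equicont (l C eps : R) : 0 < l -> 0 <= C -> 0 < eps ->
  exists dl e0 : R, [/\ 0 < dl, 0 < e0 &
  forall th0 e T th d V w A B, 0 < T -> eapprox th0 l C e T th d V w A B -> e <= e0 ->
  forall t t' s s', 0 < t < T -> 0 < t' < T -> 0 < s < l -> 0 < s' < l ->
    `|t - t'| <= dl -> `|s - s'| <= dl -> `|th t s - th t' s'| <= eps].
Proof.
move=> l0 C0 eps0; have e4 : 0 < eps / 4 by rewrite divr_gt0.
have [r [r0 Hr]] := acp_equicont p1 C0 e4; have [b [b0 Hb]] := acp_close p1 C0 l0 e4.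
pose e0 := Num.min (Num.min 1 (eps / 4)) (b / (64 * l)).
have e00 : 0 < e0 by rewrite !lt_min ltr01 !divr_gt0// mulr_gt0.
have e04 : e0 <= eps / 4 by rewrite !ge_min lexx !orbT.
have e0c : 2 * (4 * e0) ^+ 2 * l <= b / 2.
  have : e0 <= b / (64 * l) by rewrite ge_min lexx orbT.
  rewrite ler_pdivlMr ?mulr_gt0// => h.
  have h2 : e0 ^+ 2 <= e0 by rewrite expr2 ler_piMl ?(ltW e00)// !ge_min lexx.
  by have := ler_wpM2r (ltW l0) h2; lra.
pose dl := Num.min r (b / (4 * (C + 1))); have C1 : 0 < C + 1 by rewrite ltr_wpDl.
have dl0 : 0 < dl by rewrite lt_min r0 divr_gt0// mulr_gt0.
have dlc : 2 * dl * C <= b / 2.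
  have : dl <= b / (4 * (C + 1)) by rewrite ge_min lexx orbT.
  rewrite ler_pdivlMr ?mulr_gt0// => h; lra.
exists dl, e0; split => // th0 e T th d V w A B T0 EA ee0 t t' s s'.
wlog tt : t t' s s' / t <= t' => [W|] tT tT' sl sl' td sd.
  by have [tt|/ltW tt] := leP t t'; [|rewrite distrC]; apply: W => //; rewrite distrC.
have e_ge0 : 0 <= e := le_trans (normr_ge0 _) (ea_time EA tT sl).
have [g [ag gth]] := eapprox_acp l0 EA tT; have [g' [ag' gth']] := eapprox_acp l0 EA tT'.
have [gA _ _ _] := ag; have [gA' _ _ _] := ag'.
have /andP[t0 _] := tT; have /andP[t0' tT2] := tT'.
have [M [_ _ bV _]] := ea_meas EA.
have HG x : 0 < x < l -> `|g x - g' x| <= 4 * e + `|\I_(t < y < t') V y x|.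
  move=> xl; have [_ [iV _]] := bmeas_s bV xl.
  have iV' : intgI t' (V^~ x) by apply: sub_itv_intg iV => //; exact: ltW.
  rewrite -(RI_itv_sub (ltW t0) tt iV') distrC.
  have a1 := ea_time EA tT xl; have a2 := ea_time EA tT' xl.
  set v := \I_(y < t) _ in a1 *; set v' := \I_(y < t') _ in a2 *.
  have -> : g' x - g x = (g' x - th t' x) - (g x - th t x) + (th t' x - th0 x - v')
    - (th t x - th0 x - v) + (v' - v) by ring.
  have -> : 4 * e = e + e + e + e by ring.
  apply: le_trans (ler_normD _ _) _; rewrite lerD2r.
  apply: normB_le => //; apply: normD_le => //.
  by apply: normB_le; [exact: gth'|exact: gth].
have mG : measI l (fun x => g x - g' x).
  by apply: measurable_funB; [exact: AC_measurable gA|exact: AC_measurable gA'].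
have L2 : \I_(x < l) ((g x - g' x) ^+ 2) <= b.
  apply: le_trans (eapprox_L2 l0 EA mG _ (ltW t0) tt (ltW tT2) HG) _; first by rewrite mulr_ge0.
  rewrite [leRHS]splitr; apply: lerD.
    apply: le_trans e0c; rewrite ler_wpM2r ?(ltW l0)// ler_wpM2l//.
    by rewrite lerXn2r ?nnegrE ?mulr_ge0 ?(ltW e00)// ler_wpM2l.
  apply: le_trans dlc; rewrite ler_wpM2r// ler_wpM2l//.
  by move: td; rewrite distrC ger0_norm ?subr_ge0.
have W x : 0 < x < l -> 0 <= x <= l by move=> /andP[/ltW -> /ltW ->].
have h1 := Hb _ _ _ _ ag ag' L2 s (W s sl).
have h2 : `|g' s - g' s'| <= eps / 4.
  by apply: Hr ag' _ _ (W s sl) (W s' sl') _; rewrite (le_trans sd)// ge_min lexx.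
have -> : th t s - th t' s' = (g s - g' s) + (g' s - g' s') + (g' s' - th t' s') - (g s - th t s).
  by ring.
have -> : eps = eps / 4 + eps / 4 + eps / 4 + eps / 4 by field.
have e4' := le_trans ee0 e04.
apply: normB_le; last exact: le_trans (gth s sl) e4'.
by apply: normD_le (le_trans (gth' s' sl') e4'); exact: normD_le.
Qed.

Lemma eapprox_bounded (l C T M0 : R) : 0 < l -> 0 < T -> 0 <= C -> 0 <= M0 -> exists M,
  forall th0 e th d V w A B, (forall s, 0 < s < l -> `|th0 s| <= M0) ->
  eapprox th0 l C e T th d V w A B -> e <= 1 ->
  forall t s, 0 < t < T -> 0 < s < l -> `|th t s| <= M.
Proof.
move=> l0 T0 C0 M00; pose K := 2 + M0.
pose S := 2 * K ^+ 2 * l + 2 * T * C.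
have S0 : 0 <= S.
  rewrite addr_ge0//; last by rewrite mulr_ge0// mulr_ge0// ltW.
  by apply: mulr_ge0; [rewrite mulr_ge0// sqr_ge0|exact: ltW].
(* S bounds the squared L^2 norm of the interpolant; b >= 1 and b > S / l give b^2 l > S, as
   [sup_interp] requires. *)
pose b := S / l + 1.
have b1 : 1 <= b by rewrite lerDr divr_ge0// ltW.
have b0 := le_trans ler01 b1.
exists (l + C + b + 1) => th0 e th d V w A B HM EA e1 t s tT sl.
have [g [gA gth]] := ea_hat EA tT; have [_ id _ dC] := eapprox_d l0 EA tT.
have /andP[t0 tT'] := tT; have /andP[s0 sl'] := sl.
have HG x : 0 < x < l -> `|g x| <= K + `|\I_(y < t) V y x|.
  move=> xl; have a1 := ea_time EA tT xl; set v := \int[mu]_(y in _) _ in a1 *.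
  have -> : g x = (g x - th t x) + (th t x - th0 x - v) + th0 x + v by ring.
  apply: le_trans (ler_normD _ _) _; rewrite lerD2r /K.
  have -> : 2 + M0 = 1 + 1 + M0 by ring.
  apply: normD_le; last exact: HM.
  by apply: normD_le; [exact: le_trans (gth x xl) e1|exact: le_trans a1 e1].
have L2 := eapprox_L2 l0 EA (AC_measurable gA) (_ : 0 <= K) (lexx 0) (ltW t0) (ltW tT') HG.
have {}L2 : \I_(x < l) (g x ^+ 2) < b ^+ 2 * l.
  apply: (@le_lt_trans _ _ S).
    apply: le_trans (L2 _) _; first by rewrite addr_ge0.
    by rewrite lerD2l ler_wpM2r// ler_wpM2l// subr0 ltW.
  rewrite -ltr_pdivrMr//; apply: (@lt_le_trans _ _ b).
    by rewrite /b ltrDl.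
  by rewrite expr2 ler_peMl.
have om x y : 0 <= x -> x <= y -> y <= l -> y - x <= l -> `|g y - g x| <= l + C.
  move=> x0 xy yl _; apply: le_trans (AC_norm gA x0 xy yl) (le_trans _ dC).
  have idn : intgI l (fun s => `|d t s|) by exact: intg_norm.
  rewrite [leRHS](@RI_itv_split _ _ 0 x l)//; last lra.
  have ixl : intg mu `]x, l[ (fun s => `|d t s|) by exact: sub_itv_intg idn.
  rewrite [X in _ <= _ + X](@RI_itv_split _ _ x y l)//.
  by rewrite addrCA lerDl addr_ge0// RI_ge0.
have gb := sup_interp (AC_sqint gA).2 l0 (lexx l) om b0 L2 (ltW s0) (ltW sl').
have -> : th t s = g s - (g s - th t s) by ring.
by apply: normB_le => //; exact: le_trans (gth s sl) e1.
Qed.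

End edge_approximations.

(** * Strong convergence of the slopes *)

Section strong_compactness.
Context (R : realType) (p : R).
Hypothesis p1 : 1 < p.
Local Notation mu := (@lebesgue_measure R).
Local Notation m2 := (mu \x mu)%E.
Local Notation unc u := (fun z : R * R => u z.1 z.2).
Local Notation Q T l := (`]0, T[ `*` `]0, l[ : set (R * R)).
Local Notation harm := (fun k : nat => k.+1%:R^-1 : R).
Local Notation eapprox := (eapprox p).
Let pp : 0 < p. Proof. exact: lt_trans ltr01 p1. Qed.

Lemma eapprox_le th0 l C (e e' : R) T th d V w A B : e <= e' ->
  eapprox th0 l C e T th d V w A B -> eapprox th0 l C e' T th d V w A B.
Proof.
move=> ee [h1 h2 h3 h4 h5 h6 h7 h8]; split => //.
- move=> t tT; have [g [gA gth]] := h6 t tT; exists g; split => // s sl.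
  exact: le_trans (gth s sl) ee.
- by move=> t s tT sl; exact: le_trans (h7 t s tT sl) ee.
- move=> t tT; have [w0 wb] := h8 t tT; split => // s sl.
  apply: le_trans (wb s sl) _; rewrite ler_wpM2r//; apply: RI_ge0 => x _.
  exact: sqr_ge0.
Qed.

Lemma norm_le_sqr (x : R) : `|x| <= 1 + x ^+ 2.
Proof.
have key (z : R) : 0 <= z -> z <= 1 + z ^+ 2.
  move=> z0; have := sqr_ge0 (z - 1).
  have -> : (z - 1) ^+ 2 = z ^+ 2 - 2 * z + 1 by ring.
  lra.
by rewrite -[x ^+ 2]real_normK ?num_real//; exact: key.
Qed.

Lemma bmeas_vhalf T l M (d : R -> R -> R) : bmeas T l M d ->
  exists M', bmeas T l M' (fun t s => vhalf p (d t s)).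
Proof.
move=> [md bd]; exists (1 + M `^ p); split.
  exact: measurableT_comp (measurable_vhalf p1) md.
move=> t s tT sl; have h : vhalf p (d t s) ^+ 2 <= M `^ p.
  rewrite vhalf_sqr// ge0_ler_powR ?nnegrE ?(ltW pp)//; last exact: bd.
  exact: le_trans (normr_ge0 _) (bd t s tT sl).
by apply: le_trans (norm_le_sqr _) _; rewrite lerD2l.
Qed.

(** The flux relation of an approximation bounds a square by the defect times W. With a defect r^2
    this becomes a bound linear in r, which is why the defects are taken to be (k+1)^-2. *)
Lemma norm_le_sqr1 (x r W : R) : 0 <= r -> 0 <= W -> x ^+ 2 <= r ^+ 2 * W ->
  `|x| <= r * (1 + W).
Proof.
move=> r0 W0 H; rewrite -(@ler_sqr _ `|x|) ?nnegrE ?mulr_ge0 ?addr_ge0//.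
rewrite real_normK ?num_real// (le_trans H)// exprMn ler_wpM2l ?sqr_ge0//.
by have := sqr_ge0 W; lra.
Qed.

Section pair.
Variables (th0 : R -> R) (l C T r1 r2 et : R) (th d V w th' d' V' w' : R -> R -> R)
  (A B A' B' : R -> R).
Hypotheses (l0 : 0 < l) (T0 : 0 < T) (C0 : 0 <= C)
  (r1i : 0 <= r1 <= 1) (r2i : 0 <= r2 <= 1)
  (EA : eapprox th0 l C (r1 ^+ 2) T th d V w A B)
  (EA' : eapprox th0 l C (r2 ^+ 2) T th' d' V' w' A' B')
  (near : forall t s, 0 < t < T -> 0 < s < l -> `|th t s - th' t s| <= et).

(** The flux difference is the primitive q of w - w' plus the flux defects f. Against d - d', the
    first is integrated by parts onto the difference of the interpolants, which is uniformly small;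
    the second is small itself and meets the L^1 bound of the slopes. *)
Lemma flux_pair t : 0 < t < T ->
  \I_(s < l) ((pflux p (d t s) - pflux p (d' t s)) * (d t s - d' t s)) <=
  (et + r1 ^+ 2 + r2 ^+ 2) * (2 * l + \I_(s < l) (w t s ^+ 2) +
     \I_(s < l) (w' t s ^+ 2)) +
  (r1 * (1 + \I_(s < l) (w t s ^+ 2)) +
   r2 * (1 + \I_(s < l) (w' t s ^+ 2))) * (2 * (l + C)).
Proof.
move=> tT.
have [M [bth bd bV bw]] := ea_meas EA; have [M' [bth' bd' bV' bw']] := ea_meas EA'.
have [md [id _]] := bmeas_t bd tT; have [md' [id' _]] := bmeas_t bd' tT.
have [mw [iw sw]] := bmeas_t bw tT; have [mw' [iw' sw']] := bmeas_t bw' tT.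
have [g [gA gth]] := ea_hat EA tT; have [g' [gA' gth']] := ea_hat EA' tT.
have [w0 wb] := ea_flux EA tT; have [w0' wb'] := ea_flux EA' tT.
set W := \int[mu]_(s in _) (w t s ^+ 2) in wb *.
set W' := \int[mu]_(s in _) (w' t s ^+ 2) in wb' *.
have W0 : 0 <= W by apply: RI_ge0 => x _; exact: sqr_ge0.
have W0' : 0 <= W' by apply: RI_ge0 => x _; exact: sqr_ge0.
have [_ _ _ d1] := eapprox_d p1 l0 EA tT; have [_ _ _ d1'] := eapprox_d p1 l0 EA' tT.
pose q s := \I_(x < s) (w t x - w' t x).
have iww : intgI l (fun x => w t x - w' t x) by exact: intgB.
have qA : abscont l q (fun x => w t x - w' t x).
  split => // x x0 xl; rewrite {2}/q set_itvoo0 Rintegral_set0 add0r//.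
pose G s := g s - g' s.
have GA : abscont l G (fun s => d t s - d' t s).
  split; first exact: intgB.
  move=> x x0 xl; rewrite /G gA.2// gA'.2// RIB//; first ring.
    by apply: sub_itv_intg gA.1.
  by apply: sub_itv_intg gA'.1.
have qf : flux_eq l q (fun x => w t x - w' t x).
  split => //; first by rewrite RIB// w0 w0' subrr.
  by apply: aeT.
have [iwG iqd E] := flux_ibp l0 qf GA (AC_measurable qA).
have Gb s : `]0, l[%classic s -> `|G s| <= et + r1 ^+ 2 + r2 ^+ 2.
  rewrite /= in_itv/= => sl.
  have -> : G s = (th t s - th' t s) + (g s - th t s) - (g' s - th' t s).
    by rewrite /G; ring.
  by apply: normB_le; [apply: normD_le; [exact: near|exact: gth]|exact: gth'].
have w1 (v : R -> R) : sqintI l v -> measI l v ->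
    \I_(s < l) `|v s| <= l + \I_(s < l) (v s ^+ 2).
  move=> sv mv.
  have : \I_(s < l) `|v s| <= \I_(s < l) (1 + v s ^+ 2).
    apply: le_RI => //.
    - apply: intg_norm => //; apply: sqint_intg => //; exact: mu_itv_lty.
    - by apply: intgD => //; [exact: cst_intg|exact: sv.2].
    by move=> s _; exact: norm_le_sqr.
  by rewrite RID//; [rewrite RI_cst// mul1r mu_itvE|exact: cst_intg|exact: sv.2].
have e0 : 0 <= et + r1 ^+ 2 + r2 ^+ 2.
  have h2 : `]0, l[%classic (l / 2).
    by rewrite /= in_itv/= divr_gt0//= ltr_pdivrMr// ltr_pMr// ltr1n.
  exact: le_trans (normr_ge0 _) (Gb _ h2).
have P1 : \I_(s < l) (q s * (d t s - d' t s)) <=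
    (et + r1 ^+ 2 + r2 ^+ 2) * (2 * l + W + W').
  rewrite E; apply: le_trans (ler_norm _) _; rewrite normrN.
  apply: le_trans (RI_norm _ iwG) _ => //.
  have iN : intgI l (fun s => `|w t s| + `|w' t s|).
    by apply: intgD => //; exact: intg_norm.
  apply: (@le_trans _ _ (\I_(s < l)
      ((et + r1 ^+ 2 + r2 ^+ 2) * (`|w t s| + `|w' t s|)))).
    apply: le_RI => //; [exact: intg_norm|exact: intgZ|].
    move=> s sl; rewrite normrM mulrC; apply: ler_pM => //; first exact: Gb.
    by apply: le_trans (ler_normD _ _) _; rewrite normrN.
  rewrite RIZ//; apply: ler_wpM2l => //; rewrite RID//; [|exact: intg_norm..].
  by have := lerD (w1 _ sw mw) (w1 _ sw' mw'); rewrite -/W -/W'; lra.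
pose f s := pflux p (d t s) - pflux p (d' t s) - q s.
have fb s : `]0, l[%classic s -> `|f s| <= r1 * (1 + W) + r2 * (1 + W').
  move=> sl; have sl' : 0 < s < l by move: sl; rewrite /= in_itv.
  have -> : f s = (pflux p (d t s) - \I_(x < s) w t x) -
      (pflux p (d' t s) - \I_(x < s) w' t x).
    rewrite /f /q RIB//; first ring.
      by apply: sub_itv_intg iw => //; case/andP: sl' => _ /ltW.
    by apply: sub_itv_intg iw' => //; case/andP: sl' => _ /ltW.
  by apply: normB_le; apply: norm_le_sqr1 => //;
    [case/andP: r1i|exact: wb|case/andP: r2i|exact: wb'].
have mq := AC_measurable qA.
have mf : measI l f.
  apply: measurable_funB => //; apply: measurable_funB;
    exact: measurableT_comp (measurable_pflux p1) _.
have idd : intgI l (fun s => d t s - d' t s) by exact: intgB.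
have ifd : intgI l (fun s => f s * (d t s - d' t s)).
  exact: (@intg_mul_bounded _ _ _ mu _ _ _ _ (r1 * (1 + W) + r2 * (1 + W'))).
have K0 : 0 <= r1 * (1 + W) + r2 * (1 + W').
  by case/andP: r1i => ? _; case/andP: r2i => ? _; rewrite addr_ge0// mulr_ge0// addr_ge0.
have P2 : \I_(s < l) (f s * (d t s - d' t s)) <=
    (r1 * (1 + W) + r2 * (1 + W')) * (2 * (l + C)).
  apply: le_trans (ler_norm _) _; apply: le_trans (RI_norm _ ifd) _ => //.
  have iN : intgI l (fun s => `|d t s| + `|d' t s|).
    by apply: intgD => //; exact: intg_norm.
  apply: (@le_trans _ _ (\I_(s < l)
      ((r1 * (1 + W) + r2 * (1 + W')) * (`|d t s| + `|d' t s|)))).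
    apply: le_RI => //; [exact: intg_norm|exact: intgZ|].
    move=> s sl; rewrite normrM; apply: ler_pM => //; first exact: fb.
    by apply: le_trans (ler_normD _ _) _; rewrite normrN.
  rewrite RIZ//; apply: ler_wpM2l => //; rewrite RID//; [|exact: intg_norm..].
  by have := lerD d1 d1'; lra.
have -> : \I_(s < l) ((pflux p (d t s) - pflux p (d' t s)) * (d t s - d' t s)) =
    \I_(s < l) (q s * (d t s - d' t s)) +
    \I_(s < l) (f s * (d t s - d' t s)).
  by rewrite -RID//; apply: eq_RI => s _; rewrite /f; ring.
exact: lerD.
Qed.

End pair.

Lemma flux_pair_arith (l C et r1 r2 W W' : R) : 0 < l -> 0 <= C -> 0 <= et ->
  0 <= r1 <= 1 -> 0 <= r2 <= 1 -> 0 <= W -> 0 <= W' ->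
  (et + r1 ^+ 2 + r2 ^+ 2) * (2 * l + W + W') +
  (r1 * (1 + W) + r2 * (1 + W')) * (2 * (l + C)) <=
  (et + r1 + r2) * (1 + 2 * (l + C)) * (2 + 2 * l + W + W').
Proof.
move=> l0 C0 e0 /andP[a1 a2] /andP[b1 b2] W0 W0'.
have q1 : r1 ^+ 2 <= r1 by rewrite expr2 ler_piMl.
have q2 : r2 ^+ 2 <= r2 by rewrite expr2 ler_piMl.
have s1 : (et + r1 ^+ 2 + r2 ^+ 2) * (2 * l + W + W') <=
    (et + r1 + r2) * (2 + 2 * l + W + W').
  apply: ler_pM; rewrite ?addr_ge0 ?sqr_ge0 ?mulr_ge0 ?(ltW l0)//; lra.
have s2 : r1 * (1 + W) + r2 * (1 + W') <= (et + r1 + r2) * (2 + 2 * l + W + W').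
  apply: (@le_trans _ _ (r1 * (2 + 2 * l + W + W') + r2 * (2 + 2 * l + W + W'))).
    by apply: lerD; apply: ler_wpM2l => //; lra.
  by rewrite -mulrDl; apply: ler_wpM2r; rewrite ?addr_ge0 ?mulr_ge0 ?(ltW l0)//; lra.
have K0 : 0 <= 2 * (l + C) by rewrite mulr_ge0// addr_ge0// ltW.
have s3 := ler_wpM2r K0 s2.
have -> : (et + r1 + r2) * (1 + 2 * (l + C)) * (2 + 2 * l + W + W') =
  (et + r1 + r2) * (2 + 2 * l + W + W') +
  (et + r1 + r2) * (2 + 2 * l + W + W') * (2 * (l + C)) by ring.
exact: lerD.
Qed.

(** Strong monotonicity of the flux bounds [flux_pair] from below; its right-hand side is integrated
    in time with the bound on w from [eapprox_w2]. *)
Lemma vhalf_close (l C T : R) : 0 < l -> 0 < T -> 0 <= C -> exists K, 0 < K /\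
  forall th0 r1 r2 et th d V w A B th' d' V' w' A' B',
  0 <= r1 <= 1 -> 0 <= r2 <= 1 ->
  eapprox th0 l C (r1 ^+ 2) T th d V w A B ->
  eapprox th0 l C (r2 ^+ 2) T th' d' V' w' A' B' ->
  (forall t s, 0 < t < T -> 0 < s < l -> `|th t s - th' t s| <= et) ->
  \int[m2]_(z in Q T l) ((vhalf p (d z.1 z.2) - vhalf p (d' z.1 z.2)) ^+ 2) <=
    K * (et + r1 + r2).
Proof.
move=> l0 T0 C0; have [c [c0 Hc]] := vhalf_strong p1.
pose K2 := 2 * C + 8 * C ^+ 2 * l * T.
have K20 : 0 <= K2.
  rewrite /K2 addr_ge0 ?mulr_ge0 ?sqr_ge0//; exact: ltW.
pose K1 := (1 + 2 * (l + C)) * ((2 + 2 * l) * T + K2 + K2).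
have lC0 : 0 < 1 + 2 * (l + C) by rewrite ltr_wpDr// mulr_ge0// addr_ge0// ltW.
have K10 : 0 < K1.
  rewrite mulr_gt0// -addrA; apply: ltr_wpDr; first exact: addr_ge0.
  by rewrite mulr_gt0// addr_gt0// mulr_gt0.
exists (K1 / c); split; first exact: divr_gt0.
move=> th0 r1 r2 et th d V w A B th' d' V' w' A' B' r1i r2i EA EA' near.
have [M [bth bd bV bw]] := ea_meas EA; have [M' [bth' bd' bV' bw']] := ea_meas EA'.
have [iW WK] := eapprox_w2 l0 T0 EA C0; have [iW' WK'] := eapprox_w2 l0 T0 EA' C0.
have et0 : 0 <= et.
  have h1 : 0 < T / 2 < T by rewrite divr_gt0//= ltr_pdivrMr// ltr_pMr// ltr1n.
  have h2 : 0 < l / 2 < l by rewrite divr_gt0//= ltr_pdivrMr// ltr_pMr// ltr1n.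
  exact: le_trans (normr_ge0 _) (near _ _ h1 h2).
pose W t := \I_(s < l) (w t s ^+ 2).
pose W' t := \I_(s < l) (w' t s ^+ 2).
pose k := (et + r1 + r2) * (1 + 2 * (l + C)).
have bound := @intg_Q_dom R T l
   (fun t s => (vhalf p (d t s) - vhalf p (d' t s)) ^+ 2)
   (fun t => c^-1 * (k * (2 + 2 * l + W t + W' t))).
have iR : intgI T (fun t => 2 + 2 * l + W t + W' t).
  apply: intgD => //; apply: intgD => //; exact: cst_intg.
have [M1 b1] := bmeas_vhalf bd; have [M2 b2] := bmeas_vhalf bd'.
apply: le_trans (bound _ _ _ _).2 _.
- apply: measurable_funX; apply: measurable_funB; [exact: b1.1|exact: b2.1].
- by apply: intgZ => //; apply: intgZ.
- by move=> t s; exact: sqr_ge0.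
- apply: aeT => t; rewrite /= in_itv/= => tT.
  have [md [id _]] := bmeas_t bd tT; have [md' [id' _]] := bmeas_t bd' tT.
  have [_ [_ s1]] := bmeas_t b1 tT; have [_ [_ s2]] := bmeas_t b2 tT.
  have sB : sqintI l (fun s => vhalf p (d t s) - vhalf p (d' t s)).
    exact: sqintB.
  split; first exact: sB.2.
  rewrite ler_pdivlMl//.
  have [_ _ ip _] := eapprox_d p1 l0 EA tT; have [_ _ ip' _] := eapprox_d p1 l0 EA' tT.
  rewrite -RIZ//; last exact: sB.2.
  have W0 : 0 <= W t by apply: RI_ge0 => x _; exact: sqr_ge0.
  have W0' : 0 <= W' t by apply: RI_ge0 => x _; exact: sqr_ge0.
  have g1 := flux_pair l0 r1i r2i EA EA' near tT.
  have g2 := flux_pair_arith l0 C0 et0 r1i r2i W0 W0'.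
  apply: le_trans (le_trans g1 g2).
  apply: le_RI => //.
  + by apply: intgZ => //; exact: sB.2.
  + have Mp x : `|x| <= `|M| + `|M'| -> `|pflux p x| <= (`|M| + `|M'|) `^ (p - 1).
      by move=> h; rewrite pflux_norm// ge0_ler_powR ?nnegrE ?subr_ge0 ?(ltW p1)// addr_ge0.
    apply: (@intg_bounded _ _ _ mu _ _ _ (((`|M| + `|M'|) `^ (p - 1) +
       (`|M| + `|M'|) `^ (p - 1)) * (`|M| + `|M'|))) => //.
    * exact: mu_itv_lty.
    * apply: measurable_funM; last exact: measurable_funB.
      by apply: measurable_funB; exact: measurableT_comp (measurable_pflux p1) _.
    move=> s; rewrite /= in_itv/= => sl.
    have h1 := le_trans (bd.2 t s tT sl) (ler_norm M).
    have h2 := le_trans (bd'.2 t s tT sl) (ler_norm M').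
    rewrite normrM; apply: ler_pM => //; last exact: normB_le.
    apply: normB_le; apply: Mp.
      by apply: le_trans h1 _; rewrite lerDl.
    by apply: le_trans h2 _; rewrite lerDr.
rewrite RIZ//; last exact: intgZ.
rewrite RIZ// /K1.
have -> : (1 + 2 * (l + C)) * ((2 + 2 * l) * T + K2 + K2) / c * (et + r1 + r2) =
  c^-1 * (k * ((2 + 2 * l) * T + K2 + K2)) by rewrite /k; ring.
have k0 : 0 <= k.
  case/andP: r1i => ? _; case/andP: r2i => ? _.
  by rewrite mulr_ge0 ?(ltW lC0)// !addr_ge0.
rewrite ler_wpM2l ?invr_ge0 ?(ltW c0)// ler_wpM2l//.
have c2 : intgI T (fun=> 2 + 2 * l) by exact: cst_intg.
rewrite RID//; last exact: intgD.
rewrite RID// RI_cst// mu_itvE//; apply: lerD => //; exact: lerD.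
Qed.

(** Two approximations differ by at most 1/(m+1) + 1/(n+1), so [vhalf_close] makes the transformed
    slopes a Cauchy sequence in L^2 of the rectangle. *)
Lemma eapprox_strong_limit th0 (l C T : R) (th d V w : nat -> R -> R -> R)
    (A B : nat -> R -> R) (th' : R -> R -> R) : 0 < l -> 0 < T -> 0 <= C ->
  (forall k, eapprox th0 l C (k.+1%:R^-1 ^+ 2) T (th k) (d k) (V k) (w k) (A k) (B k)) ->
  (forall k t s, 0 < t < T -> 0 < s < l -> `|th k t s - th' t s| <= k.+1%:R^-1) ->
  exists (phi : nat -> nat) (f h : R * R -> R),
  [/\ [/\ forall n, (n <= phi n)%N, {homo phi : m n / (m < n)%N},
         sqint m2 (Q T l) f & sqint m2 (Q T l) h],
    {ae m2, forall z, Q T l z -> vhalf p (d (phi n) z.1 z.2) @[n --> \oo] --> f z} &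
    {ae m2, forall z, Q T l z -> forall n, `|vhalf p (d (phi n) z.1 z.2)| <= h z}].
Proof.
move=> l0 T0 C0 EA near; have [K [K0 HK]] := vhalf_close l0 T0 C0.
have [||phi [f [h [H1 H2 H3 _]]]] :=
    @L2_complete _ _ _ m2 (Q T l) (measurable_Q T l)
    (fun k (z : R * R) => vhalf p (d k z.1 z.2)).
- move=> k; have [M [_ bd _ _]] := ea_meas (EA k).
  by have [M' b] := bmeas_vhalf bd; exact: bmeas_sqint b.
- move=> e e0; pose N := Num.truncn (4 * K / e).
  have HN k : (N <= k)%N -> k.+1%:R^-1 <= e / (4 * K).
    move=> Nk; rewrite -[leRHS]invrK lef_pV2 ?posrE ?invr_gt0 ?divr_gt0 ?mulr_gt0//.
    rewrite invf_div; apply: le_trans (ltW (truncnS_gt _)) _.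
    by rewrite ler_nat ltnS.
  exists N => m n Nm Nn.
  have h1 (k : nat) : 0 <= (k.+1%:R^-1 : R) <= 1.
    by apply/andP; split; rewrite ?invr_ge0 ?ler0n// invf_le1 ?ltr0n// ler1n.
  have nn t s : 0 < t < T -> 0 < s < l ->
      `|th m t s - th n t s| <= m.+1%:R^-1 + n.+1%:R^-1.
    move=> tT sl; have -> : th m t s - th n t s = (th m t s - th' t s) - (th n t s - th' t s).
      by ring.
    by apply: normB_le; exact: near.
  apply: le_trans (HK _ _ _ _ _ _ _ _ _ _ _ _ _ _ _ _ (h1 m) (h1 n) (EA m) (EA n) nn) _.
  have a1 := HN m Nm; have a2 := HN n Nn.
  rewrite mulrC -ler_pdivlMr//; have -> : e / K = 4 * (e / (4 * K)).
    by field; rewrite gt_eqF.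
  have h4 (x : R) : 4 * x = x + x + x + x by ring.
  by rewrite h4; exact: lerD (lerD (lerD a1 a2) a1) a2.
by exists phi, f, h; split.
Qed.

End strong_compactness.

(** * Passage to the limit on one edge *)

Section limits_in_L2.
Context (R : realType).
Local Notation mu := (@lebesgue_measure R).

(** An upper bound suffices: the sequences to which this is applied are nonnegative error terms. *)
Definition tends0 (u : nat -> R) := forall e, 0 < e -> exists N, forall n,
  (N <= n)%N -> u n <= e.

Lemma tends0D (u v : nat -> R) : tends0 u -> tends0 v -> tends0 (fun n => u n + v n).
Proof.
move=> hu hv e e0; have e2 : 0 < e / 2 by rewrite divr_gt0.
have [N HN] := hu _ e2; have [M HM] := hv _ e2; exists (maxn N M) => n.
rewrite geq_max => /andP[nN nM]; rewrite [leRHS]splitr; apply: lerD; [exact: HN|exact: HM].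
Qed.

Lemma tends0Z (u : nat -> R) (k : R) : 0 <= k -> tends0 u -> tends0 (fun n => k * u n).
Proof.
move=> k0 hu e e0; have k1 : 0 < k + 1 by rewrite ltr_wpDl.
have [N HN] := hu _ (divr_gt0 e0 k1); exists N => n nN.
have := ler_wpM2l k0 (HN n nN); move=> /le_trans; apply.
rewrite mulrCA ger_pMr// ler_pdivrMr// mul1r lerDl//.
Qed.

Lemma tends0_le (u v : nat -> R) : (forall n, u n <= v n) -> tends0 v -> tends0 u.
Proof.
move=> uv hv e e0; have [N HN] := hv e e0; exists N => n nN.
exact: le_trans (uv n) (HN n nN).
Qed.

Lemma harm_gt0 (n : nat) : 0 < (n.+1%:R^-1 : R). Proof. by rewrite invr_gt0 ltr0n. Qed.

Lemma harm_le1 (n : nat) : (n.+1%:R^-1 : R) <= 1.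
Proof. by rewrite invf_le1 ?ltr0n// ler1n. Qed.

Lemma harm_mono (n k : nat) : (n <= k)%N -> (k.+1%:R^-1 : R) <= n.+1%:R^-1.
Proof. by move=> nk; rewrite lef_pV2 ?posrE ?ltr0n// ler_nat. Qed.

Lemma tends0_harm : tends0 (fun n => n.+1%:R^-1).
Proof.
move=> e e0; exists (Num.truncn (e^-1)) => n Nn.
rewrite -[e]invrK lef_pV2 ?posrE ?invr_gt0 ?ltr0n//.
by apply: le_trans (ltW (truncnS_gt _)) _; rewrite ler_nat ltnS.
Qed.

Lemma tends0_cvg (u v : nat -> R) (a : R) : (forall n, `|u n - a| <= v n) -> tends0 v ->
  u n @[n --> \oo] --> a.
Proof.
move=> uv hv; apply/cvgrPdist_le => e e0; have [N HN] := hv e e0.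
by exists N => // n /= Nn; rewrite distrC (le_trans (uv n))// HN.
Qed.

Lemma cvg_tends0 (u : nat -> R) : u n @[n --> \oo] --> (0 : R) -> tends0 u.
Proof.
move=> /cvgrPdist_le h e e0; have [N _ HN] := h e e0; exists N => n Nn.
by have := HN n Nn; rewrite sub0r normrN => /(le_trans (ler_norm _)).
Qed.

Lemma L2_L1 d (X : measurableType d) (m : {measure set X -> \bar R}) (D : set X)
    (f : nat -> X -> R) : measurable D -> (m D < +oo)%E ->
  (forall n, sqint m D (f n)) -> tends0 (fun n => \int[m]_(x in D) (f n x ^+ 2)) ->
  (forall n, intg m D (fun x => `|f n x|)) /\ tends0 (fun n => \int[m]_(x in D) `|f n x|).
Proof.
move=> mD Doo sf f0; have intf n : intg m D (fun x => `|f n x|).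
  by apply: intg_norm => //; exact: sqint_intg.
split => // e e0; pose K := fine (m D).
have K0 : 0 <= K by rewrite fine_ge0.
have [N HN] := tends0Z K0 f0 (exprn_gt0 2 e0); exists N => n nN.
have I0 : 0 <= \int[m]_(x in D) `|f n x| by apply: RI_ge0 => x _.
rewrite -ler_sqr ?nnegrE// ?(ltW e0)//; apply: le_trans (HN n nN).
have s1 : sqint m D (fun=> 1 : R).
  by apply: (@sqint_bounded _ _ _ m _ _ _ 1) => // x _; rewrite normr1.
have := RI_CS mD s1 (sf n); rewrite RI_cst// expr1n mul1r -/K => /(le_trans _); apply.
apply: eq_ler; congr (_ ^+ 2); apply: eq_RI => x _.
by rewrite mul1r.
Qed.

Lemma abscont_interior (l : R) (f g : R -> R) (c : R) : 0 < l ->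
  {within `[0, l], continuous f} -> intgI l g ->
  (forall s, 0 < s < l -> f s = c + \I_(x < s) g x) ->
  abscont l f g /\ f 0 = c.
Proof.
move=> l0 cf ig H; pose F s := c + \I_(x < s) g x.
have F0 : F 0 = c by rewrite /F set_itvoo0 Rintegral_set0 addr0.
have FA : abscont l F g by split => // x x0 xl; rewrite F0.
have E : forall s, 0 <= s <= l -> f s = F s.
  apply: ae_eq_within => //; first exact: AC_within FA.
  by apply: aeT => s; rewrite /= in_itv/= => sl; exact: H.
have f0 : f 0 = c by rewrite E ?lexx ?ltW.
split => //; split => // x x0 xl; by rewrite E ?x0// f0.
Qed.

End limits_in_L2.

Section edge_limit.
Context (R : realType) (p : R).
Hypothesis p1 : 1 < p.
Local Notation mu := (@lebesgue_measure R).
Local Notation m2 := (mu \x mu)%E.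
Local Notation unc u := (fun z : R * R => u z.1 z.2).
Local Notation Q T l := (`]0, T[ `*` `]0, l[ : set (R * R)).
Local Notation r := (fun k : nat => k.+1%:R^-1 : R).

Variables (th0 : R -> R) (l C T : R) (th d V w : nat -> R -> R -> R)
  (A B : nat -> R -> R) (th' V' : R -> R -> R) (A' B' : R -> R)
  (D h : R -> R -> R) (y : nat -> (nat -> R) -> R).
Hypotheses (l0 : 0 < l) (T0 : 0 < T) (C0 : 0 <= C) (th0C : {within `[0, l], continuous th0})
  (EA : forall k, eapprox p th0 l C (k.+1%:R^-1 ^+ 2) T (th k) (d k) (V k) (w k) (A k) (B k))
  (mA : forall k, measI T (A k)) (mB : forall k, measI T (B k))
  (near : forall k t s, 0 < t < T -> 0 < s < l -> `|th k t s - th' t s| <= k.+1%:R^-1)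
  (th'C : ucont2 T l th')
  (yC : forall n, comb n (y n))
  (sV : sqint m2 (Q T l) (unc V')) (sA : sqintI T A') (sB : sqintI T B')
  (cV : tends0 (fun n => \int[m2]_(z in Q T l)
     ((y n (fun k => V k z.1 z.2) - V' z.1 z.2) ^+ 2)))
  (cA : tends0 (fun n => \I_(t < T) ((y n (fun k => A k t) - A' t) ^+ 2)))
  (cB : tends0 (fun n => \I_(t < T) ((y n (fun k => B k t) - B' t) ^+ 2)))
  (sD : sqint m2 (Q T l) (unc D)) (sh : sqint m2 (Q T l) (unc h))
  (cD : {ae m2, forall z, Q T l z -> vhalf p (d n z.1 z.2) @[n --> \oo] --> D z.1 z.2})
  (bD : {ae m2, forall z, Q T l z -> forall n, `|vhalf p (d n z.1 z.2)| <= h z.1 z.2}).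

Let Y n t s := y n (fun k => V k t s).

Lemma comb_V n : sqint m2 (Q T l) (unc (Y n)).
Proof.
apply: (@comb_sqint R _ _ m2 _ n (y n) (fun k z => V k z.1 z.2)) => //.
  exact: measurable_Q.
by move=> k; have [M [_ _ bV _]] := ea_meas (EA k); exact: bmeas_sqint bV.
Qed.

Lemma comb_V_L1 : (forall n, intg m2 (Q T l) (fun z => `|Y n z.1 z.2 - V' z.1 z.2|)) /\
  tends0 (fun n => \int[m2]_(z in Q T l) `|Y n z.1 z.2 - V' z.1 z.2|).
Proof.
apply: (@L2_L1 R _ _ m2 (Q T l) (fun n z => Y n z.1 z.2 - V' z.1 z.2)) => //.
- exact: measurable_Q.
- exact: muQ_lty.
by move=> n; apply: sqintB => //; [exact: measurable_Q|exact: comb_V].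
Qed.

(** The relation in time is linear in the angle and the velocity, so the combinations y n pass
    through it. L^1 convergence of the combined velocities on the rectangle gives, along a
    subsequence, convergence on almost every slice in s. *)
Lemma limit_in_time : {aeI s < l,
  abscont T (th'^~ s) (V'^~ s) /\ th' 0 s = th0 s}.
Proof.
have [iZ cZ] := comb_V_L1.
pose u n s := \I_(t < T) `|Y n t s - V' t s|.
have Fub n := @fubini_intg2 _ _ _ _ _ mu mu `]0, T[%classic `]0, l[%classic
  (measurable_itv _) (measurable_itv _) (fun t s => `|Y n t s - V' t s|) (iZ n).
have u0 n s : 0 <= u n s by exact: RI_ge0.
have E0 n : (fun s => `|u n s - 0|) = u n.
  by apply/funext => s; rewrite subr0 ger0_norm.
have [| |phi [phiN _ cphi]] := @subseq_ae _ _ _ mu `]0, l[%classic (measurable_itv _) u (fun=> 0).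
- by move=> n; rewrite E0; have [] := Fub n.
- by move=> e e0; have [N HN] := cZ e e0; exists N => n /HN; rewrite E0; have [_ _ ->] := Fub n.
have sl_ := sqint_slice_s sV.
have iZs : {ae mu, forall s, forall n, `]0, l[%classic s ->
    intgI T (fun t => `|Y n t s - V' t s|)}.
  by apply/ae_foralln => n; have [] := Fub n.
move: cphi sl_ iZs; apply: aeS3 => s cs ss is_ sl.
have sl' : 0 < s < l by move: sl; rewrite /= in_itv.
have {}cs := cs sl; have iVs : intgI T (V'^~ s).
  by apply: sqint_intg (ss sl) => //; exact: mu_itv_lty.
apply: abscont_interior => //.
  apply: (@ucont2_slice _ l T (fun s t => th' t s)); last exact: ucont2_swap.
  by case/andP: sl' => /ltW -> /ltW ->.
move=> t tT; have tT' := tT; case/andP: tT' => /ltW t0 /ltW tT'.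
have iVk k : intgI t ((V k)^~ s).
  have [M [_ _ bV _]] := ea_meas (EA k).
  by have [_ [+ _]] := bmeas_s bV sl'; exact: sub_itv_intg.
apply/eqP; rewrite -subr_eq0 -normr_le0; apply/ler_addgt0Pr => e e0; rewrite add0r.
have key n : `|th' t s - (th0 s + \I_(x < t) V' x s)| <= 2 * n.+1%:R^-1 + u n s.
  have [iYn YnE] := @comb_intg R _ _ mu `]0, t[%classic n (y n) (fun k t => V k t s)
    (measurable_itv _) (yC _) iVk.
  have iV't : intgI t (V'^~ s) by apply: sub_itv_intg iVs.
  have h1 : `|y n (fun k => th k t s - th' t s)| <= n.+1%:R^-1.
    apply: (comb_bound (yC n)) => k nk.
    exact: le_trans (near k tT sl') (harm_mono _ nk).
  have h2 : `|y n (fun k => th k t s - th0 s - \I_(x < t) V k x s)| <= n.+1%:R^-1.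
    apply: (comb_bound (yC n)) => k nk.
    apply: le_trans (ea_time (EA k) tT sl') _.
    apply: le_trans (harm_mono _ nk); rewrite expr2 ger_pMr ?harm_gt0//; exact: harm_le1.
  have h3 : `|\I_(x < t) Y n x s - \I_(x < t) V' x s| <= u n s.
    rewrite -RIB//; apply: le_trans (RI_norm _ (intgB _ iYn iV't)) _ => //.
    rewrite /u [leRHS](@RI_itv_split _ _ 0 t T)//; last exact: is_.
    by rewrite lerDl; exact: RI_ge0.
  move: h1 h2 h3; rewrite (combB _ _ (yC n)) (comb_cst _ (yC n)).
  rewrite (combB _ _ (yC n)) (combB _ _ (yC n)) (comb_cst _ (yC n)) /Y YnE.
  set a := y n _; set b := y n _; set v := \int[mu]_(x in _) _ => h1 h2 h3.
  have -> : th' t s - (th0 s + v) = (a - th0 s - b) - (a - th' t s) + (b - v) by ring.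
  have -> : 2 * (n.+1%:R^-1 : R) = n.+1%:R^-1 + n.+1%:R^-1 by ring.
  by apply: normD_le => //; exact: normB_le.
have t0' : tends0 (fun n => 2 * r (phi n) + u (phi n) s).
  apply: tends0D; last exact: cvg_tends0.
  apply: tends0Z => //; apply: tends0_le (@tends0_harm R) => n.
  by apply: harm_mono; exact: phiN.
have [N HN] := t0' e e0; exact: le_trans (key (phi N)) (HN N (leqnn N)).
Qed.

Let ths t s := spow (p / 2)^-1 (D t s).
Let p2 : 0 < p / 2. Proof. by rewrite divr_gt0// (lt_trans ltr01). Qed.

Lemma slices_in_space : {aeI t < T,
  [/\ measI l (ths t), measI l (D t), sqintI l (h t),
   {aeI s < l, vhalf p (d n t s) @[n --> \oo] --> D t s} &
   {aeI s < l, forall n, `|vhalf p (d n t s)| <= h t s}]}.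
Proof.
have c1 := @ae_prod1 _ _ _ _ _ mu mu `]0, T[%classic `]0, l[%classic
  (fun t s => vhalf p (d n t s) @[n --> \oo] --> D t s) cD.
have c2 := @ae_prod1 _ _ _ _ _ mu mu `]0, T[%classic `]0, l[%classic
  (fun t s => forall n, `|vhalf p (d n t s)| <= h t s) bD.
have c3 := sqint_slice_t sh.
move: c1 c2 c3; apply: aeS3 => t h1 h2 h3 tT.
have mD : measI l (D t) by exact: (@slice_t R T l D t sD.1 tT).
split => //; [|exact: h3|exact: h1|exact: h2].
apply: (measurableT_comp (f := spow (p / 2)^-1)) => //.
by apply: continuous_measurable_fun; apply: spow_continuous; rewrite invr_gt0.
Qed.

(** At almost every t the slopes converge by dominated convergence, with majorant 1 + h^2, and the
    relation between angle and slope passes to the limit. *)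
Lemma limit_in_space : {aeI t < T, abscont l (th' t) (ths t)}.
Proof.
move: slices_in_space; apply: aeS => t + tT; move=> /(_ tT)[mths mD sht cDt bDt].
have tT' : 0 < t < T by move: tT; rewrite /= in_itv.
have mdn n : measI l (d n t).
  by have [md _ _ _] := eapprox_d p1 l0 (EA n) tT'.
have idn n : intgI l (d n t).
  by have [_ id _ _] := eapprox_d p1 l0 (EA n) tT'.
have [iths _ cI] : [/\ intgI l (ths t),
    \I_(s < l) d n t s @[n --> \oo] --> \I_(s < l) ths t s &
    \I_(s < l) `|d n t s - ths t s| @[n --> \oo] --> (0 : R)].
  apply: (@R_dct _ _ _ mu _ (measurable_itv _) (fun n => d n t) (ths t)
    (fun s => 1 + h t s ^+ 2)) => //.
  - apply: aeS cDt => s + sl; move=> /(_ sl) cs.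
    rewrite (_ : (fun n => d n t s) = (fun n => spow (p / 2)^-1 (vhalf p (d n t s)))).
      by apply: (cvg_comp _ _ cs); apply: spow_continuous; rewrite invr_gt0.
    by apply/funext => n; rewrite vhalfK.
  - by apply: intgD => //; [exact: cst_intg|exact: sht.2].
  - apply: aeS bDt => s + sl n; move=> /(_ sl n) bs.
    apply: le_trans (norm_le_pow p1 _) _; rewrite lerD2l -vhalf_sqr//.
    exact: norm_sqr_le.
have dl n : exists c, forall s, 0 < s < l ->
    `|th' t s - c - \I_(x < s) ths t x| <=
    2 * n.+1%:R^-1 + \I_(s < l) `|d n t s - ths t s|.
  have [g [gA gth]] := ea_hat (EA n) tT'; exists (g 0) => s sl.
  have /andP[/ltW s0 /ltW sl'] := sl.
  have e1 := gth s sl; have e2 := near n tT' sl.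
  have e3 : (n.+1%:R^-1 : R) ^+ 2 <= n.+1%:R^-1.
    by rewrite expr2 ger_pMr ?harm_gt0//; exact: harm_le1.
  have i1 : intgI s (d n t) by apply: sub_itv_intg (idn n).
  have i2 : intgI s (ths t) by apply: sub_itv_intg iths.
  have iB : intgI l (fun s => `|d n t s - ths t s|).
    by apply: intg_norm => //; exact: intgB.
  have e4 : `|\I_(x < s) d n t x - \I_(x < s) ths t x| <=
      \I_(s < l) `|d n t s - ths t s|.
    rewrite -RIB//; apply: le_trans (RI_norm _ (intgB _ i1 i2)) _ => //.
    by rewrite [leRHS](@RI_itv_split _ _ 0 s l)// lerDl; exact: RI_ge0.
  have gs := gA.2 s s0 sl'; set v := \int[mu]_(x in _) _ in gs e4.
  set v' := \I_(x < s) _ in e4 *.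
  have -> : th' t s - g 0 - v' = (v - v') - (th n t s - th' t s) - (g s - th n t s).
    by rewrite gs; ring.
  rewrite mulr_natl mulr2n [leRHS]addrC [leRHS]addrA.
  by apply: normB_le; [exact: normB_le|exact: le_trans e1 e3].
have l2 : 0 < l / 2 < l by rewrite divr_gt0//= ltr_pdivrMr// ltr_pMr// ltr1n.
(* The constants g 0 of the approximations depend on n; comparing with the midpoint l / 2 eliminates
   them. *)
pose c := th' t (l / 2) - \I_(x < l / 2) ths t x.
have cth : {within `[0, l], continuous (th' t)}.
  by apply: ucont2_slice th'C; case/andP: tT' => /ltW -> /ltW ->.
have key s : 0 < s < l -> th' t s = c + \I_(x < s) ths t x.
  move=> sl; apply/eqP; rewrite -subr_eq0 -normr_le0; apply/ler_addgt0Pr => e e0.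
  rewrite add0r; have : tends0 (fun n => 2 * (2 * r n +
      \I_(s < l) `|d n t s - ths t s|)).
    apply: tends0Z => //; apply: tends0D; last exact: cvg_tends0.
    by apply: tends0Z => //; exact: tends0_harm.
  move=> /(_ e e0)[N /(_ N (leqnn N))]; apply: le_trans.
  have [c' Hc'] := dl N; have e1 := Hc' s sl; have e2 := Hc' _ l2.
  rewrite /c; set v := \I_(x < s) _ in e1 *.
  set v' := \I_(x < _) ths t x in e2 *.
  have -> : th' t s - (th' t (l / 2) - v' + v) = (th' t s - c' - v) - (th' t (l / 2) - c' - v').
    by ring.
  by rewrite mulr_natl mulr2n; exact: normB_le.
by have [] := abscont_interior l0 cth iths key.
Qed.

Lemma limit_power : {aeI t < T,
  intgI l (fun s => `|ths t s| `^ p) /\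
  \I_(s < l) (`|ths t s| `^ p) <= C}.
Proof.
move: slices_in_space; apply: aeS => t + tT; move=> /(_ tT)[mths mD sht cDt bDt].
have tT' : 0 < t < T by move: tT; rewrite /= in_itv.
have E : (fun s => `|ths t s| `^ p) = (fun s => D t s ^+ 2).
  by apply/funext => s; rewrite -vhalf_sqr// /vhalf spowVK.
have En n : (fun s => `|d n t s| `^ p) = (fun s => vhalf p (d n t s) ^+ 2).
  by apply/funext => s; rewrite -vhalf_sqr.
have [i1 c1 _] : [/\ intgI l (fun s => D t s ^+ 2),
    \I_(s < l) (vhalf p (d n t s) ^+ 2) @[n --> \oo] -->
      \I_(s < l) (D t s ^+ 2) &
    \I_(s < l) `|vhalf p (d n t s) ^+ 2 - D t s ^+ 2| @[n --> \oo] --> (0 : R)].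
  apply: (@R_dct _ _ _ mu _ (measurable_itv _) (fun n s => vhalf p (d n t s) ^+ 2)
    (fun s => D t s ^+ 2) (fun s => h t s ^+ 2)) => //.
  - move=> n; apply: measurable_funX; apply: measurableT_comp (measurable_vhalf p1) _.
    by have [md _ _ _] := eapprox_d p1 l0 (EA n) tT'.
  - exact: measurable_funX.
  - by apply: aeS cDt => s + sl; move=> /(_ sl) cs; rewrite expr2; apply: cvgM.
  - exact: sht.2.
  - apply: aeS bDt => s + sl n; move=> /(_ sl n) bs.
    by rewrite ger0_norm ?sqr_ge0//; exact: norm_sqr_le.
rewrite E; split => //; apply: cvg_le_cst c1 _ => n.
by rewrite -En; exact: ea_pow (EA n) _ tT'.
Qed.

Let a n t := y n (fun k => A k t).
Let b n t := y n (fun k => B k t).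
Let W k t := \I_(s < l) (w k t s ^+ 2).
Let P n t := y n (fun k => k.+1%:R^-1 * (1 + W k t)).
(** The total error at time t in the flux equation: velocities, multipliers, uniform distance of the
    angles and, in P, the defects of the discrete flux relation. It tends to 0 in L^1(0,T), hence
    almost everywhere along a subsequence. *)
Let X n t := (\I_(s < l) `|Y n t s - V' t s| +
  (l * `|a n t - A' t| + l * `|b n t - B' t|)) + (2 * C * l * n.+1%:R^-1 + P n t).

Lemma P_ge0 n t : 0 <= P n t.
Proof.
rewrite -(comb_cst 0 (yC n)); apply: (comb_mono (yC n)) => k _.
rewrite mulr_ge0 ?(ltW (harm_gt0 R k))// addr_ge0// RI_ge0// => s _; exact: sqr_ge0.
Qed.

Lemma X_ge0 n t : 0 <= X n t.
Proof.
rewrite /X addr_ge0//; last first.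
  by rewrite addr_ge0 ?P_ge0// mulr_ge0 ?(ltW (harm_gt0 R n))// !mulr_ge0// ltW.
rewrite addr_ge0//; first exact: RI_ge0.
by rewrite addr_ge0// mulr_ge0// ltW.
Qed.

Lemma tends0_intgD (u v : nat -> R -> R) :
  (forall n, intgI T (u n)) /\ tends0 (fun n => \I_(t < T) u n t) ->
  (forall n, intgI T (v n)) /\ tends0 (fun n => \I_(t < T) v n t) ->
  (forall n, intgI T (fun t => u n t + v n t)) /\
  tends0 (fun n => \I_(t < T) (u n t + v n t)).
Proof.
move=> [iu cu] [iv cv]; split; first by move=> n; exact: intgD.
by apply: tends0_le (tends0D cu cv) => n; rewrite RID.
Qed.

Lemma tends0_intg_comb (F : nat -> R -> R) (F' : R -> R) :
  (forall k, measI T (F k)) ->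
  (forall k t, 0 < t < T -> `|F k t| <= C) -> sqintI T F' ->
  tends0 (fun n => \I_(t < T) ((y n (fun k => F k t) - F' t) ^+ 2)) ->
  (forall n, intgI T (fun t => l * `|y n (fun k => F k t) - F' t|)) /\
  tends0 (fun n => \I_(t < T) (l * `|y n (fun k => F k t) - F' t|)).
Proof.
move=> mF bF sF cF.
have [| | |i c] := @L2_L1 R _ _ mu `]0, T[%classic (fun n t => y n (fun k => F k t) - F' t) _ _ _ cF => //.
- exact: mu_itv_lty.
- move=> n; apply: sqintB => //; apply: (comb_sqint _ (yC n)) => // k.
  apply: (@sqint_bounded _ _ _ mu _ _ _ C); [by []|exact: mu_itv_lty|exact: mF|].
  by move=> t; rewrite /= in_itv/=; exact: bF.
split; first by move=> n; exact: intgZ.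
by apply: tends0_le (tends0Z (ltW l0) c) => n; rewrite RIZ.
Qed.

Lemma X_tends0 : (forall n, intgI T (X n)) /\
  tends0 (fun n => \I_(t < T) X n t).
Proof.
apply: tends0_intgD.
  apply: tends0_intgD.
    have [iZ cZ] := comb_V_L1.
    have Fub n := @RI_Q R T l (fun t s => `|Y n t s - V' t s|) (iZ n).
    split; first by move=> n; have [] := Fub n.
    by apply: tends0_le cZ => n; have [_ _ ->] := Fub n.
  apply: tends0_intgD; apply: tends0_intg_comb => // k t tT.
    by have [] := ea_multC (EA k) tT.
  by have [] := ea_multC (EA k) tT.
pose K2 := 2 * C + 8 * C ^+ 2 * l * T.
have iW k : intgI T (fun t => k.+1%:R^-1 * (1 + W k t)).
  have [iw _] := eapprox_w2 l0 T0 (EA k) C0.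
  by apply: intgZ => //; apply: intgD => //; exact: cst_intg.
have IW k : \I_(t < T) (k.+1%:R^-1 * (1 + W k t)) <= k.+1%:R^-1 * (T + K2).
  have [iw wK] := eapprox_w2 l0 T0 (EA k) C0.
  rewrite RIZ//; last by apply: intgD => //; exact: cst_intg.
  rewrite ler_wpM2l ?(ltW (harm_gt0 R k))//.
  have i1 : intgI T (fun=> 1 : R) by exact: cst_intg.
  by rewrite RID// RI_cst// mul1r mu_itvE// lerD2l.
apply: tends0_intgD.
  split; first by move=> n; exact: cst_intg.
  have k0 : 0 <= 2 * C * l * T by rewrite !mulr_ge0// ltW.
  apply: tends0_le (tends0Z k0 (@tends0_harm R)) => n.
  by rewrite RI_cst// mu_itvE// mulrAC.
have iP n := @comb_intg R _ _ mu `]0, T[%classic n (y n)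
  (fun k t => k.+1%:R^-1 * (1 + W k t)) (measurable_itv _) (yC n) iW.
split; first by move=> n; have [] := iP n.
have k0 : 0 <= T + K2.
  by rewrite addr_ge0 ?(ltW T0)// addr_ge0 ?mulr_ge0 ?sqr_ge0// ltW.
apply: tends0_le (tends0Z k0 (@tends0_harm R)) => n.
have [_ ->] := iP n; rewrite -(comb_cst ((T + K2) * n.+1%:R^-1) (yC n)).
apply: (comb_mono (yC n)) => k nk; apply: le_trans (IW k) _.
by rewrite mulrC ler_wpM2l//; exact: harm_mono.
Qed.

Lemma trig_form_comb n (u v : nat -> R) x :
  y n (fun k => trig_form (u k) (v k) x) = trig_form (y n u) (y n v) x.
Proof.
rewrite /trig_form (combB _ _ (yC n)); congr (_ - _).
  by rewrite mulrC -(combZ _ _ (yC n)); congr (y n _); apply/funext => k; rewrite mulrC.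
by rewrite mulrC -(combZ _ _ (yC n)); congr (y n _); apply/funext => k; rewrite mulrC.
Qed.

Let w' := edge_w th' V' A' B'.

Lemma w'E t s : w' t s = V' t s - trig_form (A' t) (B' t) (th' t s).
Proof. by rewrite /w' /edge_w /trig_form; ring. Qed.

(** The force is linear in the multipliers but not in the angle. Replacing the angle by its uniform
    limit first makes the convex combination act on the multipliers alone. *)
Lemma comb_w_near n t s : 0 < t < T -> 0 < s < l ->
  `|y n (fun k => w k t s) - w' t s| <= `|Y n t s - V' t s| +
     (`|a n t - A' t| + `|b n t - B' t|) + 2 * C * n.+1%:R^-1.
Proof.
move=> tT sl; have E : (fun k => w k t s) = (fun k => V k t s -
    (trig_form (A k t) (B k t) (th' t s) + (trig_form (A k t) (B k t) (th k t s) -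
    trig_form (A k t) (B k t) (th' t s)))).
  by apply/funext => k; rewrite (ea_eq (EA k) tT sl); ring.
rewrite E (combB _ _ (yC n)) (combD _ _ (yC n)) trig_form_comb -/(a n t) -/(b n t).
have h1 : `|y n (fun k => trig_form (A k t) (B k t) (th k t s) -
    trig_form (A k t) (B k t) (th' t s))| <= 2 * C * n.+1%:R^-1.
  apply: (comb_bound (yC n)) => k nk; apply: le_trans (trig_form_lip _ _ _ _) _.
  have [a1 a2] := ea_multC (EA k) tT.
  apply: ler_pM; rewrite ?addr_ge0//; first by rewrite mulr_natl mulr2n lerD.
  exact: le_trans (near k tT sl) (harm_mono _ nk).
have h2 : `|trig_form (a n t) (b n t) (th' t s) - trig_form (A' t) (B' t) (th' t s)| <=
    `|a n t - A' t| + `|b n t - B' t|.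
  apply: le_trans (trig_form_le _ _ (th' t s)).
  by apply: eq_ler; congr `|_|; rewrite /trig_form; ring.
rewrite w'E; set v := y n _ in h1 *; rewrite -/(Y n t s).
set f := trig_form _ _ _ in h2 *; set f' := trig_form _ _ _ in h2 *.
have -> : Y n t s - (f + v) - (V' t s - f') = (Y n t s - V' t s) - (f - f') - v by ring.
by apply: normB_le => //; exact: normB_le.
Qed.

(** The flux converges pointwise because the slopes do, so its convex combinations have the same
    limit; the right-hand side converges only after combination. Both sides are therefore compared
    along the combinations. *)
Lemma limit_flux : {aeI t < T, flux_eq l (pflux p \o ths t) (w' t)}.
Proof.
have [iX cX] := X_tends0.
have E0 n : (fun t => `|X n t - 0|) = X n.
  by apply/funext => t; rewrite subr0 ger0_norm// X_ge0.
have [| |phi [phiN _ cphi]] := @subseq_ae _ _ _ mu `]0, T[%classic (measurable_itv _) X (fun=> 0).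
- by move=> n; rewrite E0.
- by move=> e e0; have [N HN] := cX e e0; exists N => n /HN; rewrite E0.
have sw : sqint m2 (Q T l) (unc w') by exact: sqint_edge_w.
have s1 : {aeI t < T, sqintI l (V' t) /\ sqintI l (w' t)}.
  have := sqint_slice_t sV; have := sqint_slice_t sw.
  by apply: aeS2 => t h1 h2 tT; split; [exact: h2|exact: h1].
move: cphi s1 slices_in_space; apply: aeS3 => t cX' sw' sl_ tT.
have {}cX' := cvg_tends0 (cX' tT); have {sw'} [sV't sw't] := sw' tT.
have [_ _ _ cDt _] := sl_ tT; have tT' : 0 < t < T by move: tT; rewrite /= in_itv.
have iw' : intgI l (w' t) by apply: sqint_intg sw't => //; exact: mu_itv_lty.
have iwk k : intgI l (w k t).
  by have [M [_ _ _ bw]] := ea_meas (EA k); have [_ []] := bmeas_t bw tT'.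
have iVk k : intgI l (V k t).
  by have [M [_ _ bV _]] := ea_meas (EA k); have [_ []] := bmeas_t bV tT'.
pose O n s := y n (fun k => w k t s).
have OE n s : 0 <= s -> s <= l -> intgI s (O n) /\ \I_(x < s) O n x =
    y n (fun k => \I_(x < s) w k t x).
  move=> s0 s1; apply: (@comb_intg R _ _ mu `]0, s[%classic n (y n) (fun k x => w k t x)) => // k.
  exact: sub_itv_intg (iwk k).
have iYV n : intgI l (fun s => `|Y n t s - V' t s|).
  apply: intg_norm => //; apply: intgB => //.
    by have [] := @comb_intg R _ _ mu `]0, l[%classic n (y n) (fun k x => V k t x)
      (measurable_itv _) (yC n) iVk.
  by apply: sqint_intg sV't => //; exact: mu_itv_lty.
have near' n s : 0 <= s -> s <= l ->
    `|\I_(x < s) O n x - \I_(x < s) w' t x| <= X n t.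
  move=> s0 sl; have [iOl _] := OE n l (ltW l0) (lexx l); have [iO _] := OE n s s0 sl.
  have iws : intgI s (w' t) by exact: sub_itv_intg iw'.
  rewrite -RIB//; apply: le_trans (RI_norm _ (intgB _ iO iws)) _ => //.
  have iN : intgI l (fun x => `|O n x - w' t x|).
    by apply: intg_norm => //; exact: intgB.
  apply: (@le_trans _ _ (\I_(x < l) `|O n x - w' t x|)).
    by rewrite [leRHS](@RI_itv_split _ _ 0 s l)// lerDl; exact: RI_ge0.
  have ic (k : R) : intgI l (fun=> k) by exact: cst_intg.
  apply: (@le_trans _ _ (\I_(x < l) (`|Y n t x - V' t x| +
      ((`|a n t - A' t| + `|b n t - B' t|) + 2 * C * n.+1%:R^-1)))).
    apply: le_RI => //; first by apply: intgD.
    by move=> x; rewrite /= in_itv/= => xl; rewrite addrA; exact: comb_w_near.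
  rewrite RID// RI_cst// mu_itvE// /X.
  have -> : (`|a n t - A' t| + `|b n t - B' t| + 2 * C * n.+1%:R^-1) * l =
    (l * `|a n t - A' t| + l * `|b n t - B' t|) + 2 * C * l * n.+1%:R^-1 by ring.
  by rewrite addrA [leRHS]addrA lerDl P_ge0.
split => //.
  apply/eqP; rewrite -normr_le0; apply/ler_addgt0Pr => e e0; rewrite add0r.
  have [N HN] := cX' e e0; apply: le_trans (HN N (leqnn N)).
  have := near' (phi N) l (ltW l0) (lexx l); have [_ ->] := OE (phi N) l (ltW l0) (lexx l).
  rewrite (_ : (fun k => _) = fun=> 0); first by rewrite (comb_cst _ (yC _)) sub0r normrN.
  by apply/funext => k; have [] := ea_flux (EA k) tT'.
apply: aeS cDt => s + sl; move=> /(_ sl) cs.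
have sl' : 0 < s < l by move: sl; rewrite /= in_itv.
have /andP[/ltW s0 /ltW sll] := sl'.
have cd : pflux p (d n t s) @[n --> \oo] --> pflux p (ths t s).
  rewrite (_ : (fun n => _) = (fun n => pflux p (spow (p / 2)^-1 (vhalf p (d n t s))))).
    apply: (cvg_comp (fun n => spow (p / 2)^-1 (vhalf p (d n t s))) (pflux p)).
      by apply: (cvg_comp _ _ cs); apply: spow_continuous; rewrite invr_gt0.
    exact: pflux_continuous.
  by apply/funext => n; rewrite vhalfK.
have c1 : y (phi n) (fun k => pflux p (d k t s)) @[n --> \oo] --> pflux p (ths t s).
  apply: (@comb_cvg R (fun n => y (phi n)) (fun k => pflux p (d k t s)) _ _ cd) => n.
  exact: comb_le (phiN n) (yC _).
apply: cvg_uniq c1 _; apply: (tends0_cvg _ (tends0Z (ler0n R 2) cX')) => n.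
have h1 := near' (phi n) s s0 sll; have [_ E] := OE (phi n) s s0 sll.
have h2 : `|y (phi n) (fun k => pflux p (d k t s) - \I_(x < s) w k t x)| <=
    X (phi n) t.
  apply: (@le_trans _ _ (P (phi n) t)); last first.
    rewrite /X addrA lerDr addr_ge0//.
      rewrite addr_ge0//; first exact: RI_ge0.
      by rewrite addr_ge0// mulr_ge0// ltW.
    by rewrite mulr_ge0 ?(ltW (harm_gt0 R _))// !mulr_ge0// ltW.
  apply: (comb_norm (yC _)) => k nk; have [_ fb] := ea_flux (EA k) tT'.
  apply: norm_le_sqr1; [exact/ltW/harm_gt0|by apply: RI_ge0 => x _; exact: sqr_ge0|exact: fb].
rewrite (combB _ _ (yC _)) -E in h2; rewrite mulr_natl mulr2n.
set v := \int[mu]_(x in _) w' t x in h1 *; set v' := \int[mu]_(x in _) O _ x in h1 h2 *.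
set q := y _ _ in h2 *; have -> : q - v = (q - v') + (v' - v) by ring.
exact: normD_le.
Qed.

Lemma limit_edge_sol : edge_sol p T l th' ths V' A' B' /\
  forall s, 0 <= s <= l -> th' 0 s = th0 s.
Proof.
split.
  split => //.
  - apply: (measurableT_comp (f := spow (p / 2)^-1)); last exact: sD.1.
    by apply: continuous_measurable_fun; apply: spow_continuous; rewrite invr_gt0.
  - by exists C; exact: limit_power.
  - exact: limit_in_space.
  - by apply: aeS limit_in_time => s + sl; move=> /(_ sl)[].
  - exact: limit_flux.
apply: ae_eq_within => //; first by apply: ucont2_slice th'C; rewrite lexx ltW.
by apply: aeS limit_in_time => s + sl; move=> /(_ sl)[].
Qed.

End edge_limit.

Section quadratic_functionals.
Context (R : realType).

(** The hypotheses of [mazur], in a form stable under sums: sequences in several L^2 spaces can then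
    share one sequence of convex combinations. *)
Definition quad (Q : ((nat -> R) -> R) -> R) := [/\ forall c, 0 <= Q c,
  forall c c', comb 0 c -> comb 0 c' ->
    Q (fun u => (c u + c' u) / 2) + Q (fun u => (c u - c' u) / 2) <= (Q c + Q c') / 2 &
  exists C, forall k, Q (fun u => u k) <= C].

Lemma quad_sum (I : Type) (r : seq I) (F : I -> ((nat -> R) -> R) -> R) :
  (forall i, quad (F i)) -> quad (fun c => \sum_(i <- r) F i c).
Proof.
move=> HF; elim: r => [|i r [h1 h2 [C hC]]].
  split; [by move=> c; rewrite big_nil|move=> c c' _ _; rewrite !big_nil; lra|].
  by exists 0 => k; rewrite big_nil.
have [g1 g2 [C' hC']] := HF i; split.
- by move=> c; rewrite big_cons addr_ge0.
- move=> c c' cc cc'; rewrite !big_cons addrACA.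
  have -> : (F i c + \sum_(j <- r) F j c + (F i c' + \sum_(j <- r) F j c')) / 2 =
    (F i c + F i c') / 2 + (\sum_(j <- r) F j c + \sum_(j <- r) F j c') / 2 by ring.
  by apply: lerD; [exact: g2|exact: h2].
by exists (C' + C) => k; rewrite big_cons lerD.
Qed.

Lemma quad_add Q Q' : quad Q -> quad Q' -> quad (fun c => Q c + Q' c).
Proof.
move=> h h'; have := @quad_sum bool [:: true; false] (fun b => if b then Q else Q').
rewrite (_ : (fun c => _) = (fun c => Q c + Q' c)).
  by apply; case.
by apply/funext => c; rewrite !big_cons big_nil addr0.
Qed.

Lemma quad_L2 d (X : measurableType d) (m : {measure set X -> \bar R}) (D : set X)
    (f : nat -> X -> R) (C : R) : measurable D -> (forall k, sqint m D (f k)) ->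
  (forall k, \int[m]_(x in D) (f k x ^+ 2) <= C) ->
  quad (fun c => \int[m]_(x in D) (c (f^~ x) ^+ 2)).
Proof.
move=> mD sf fC; split.
- by move=> c; apply: RI_ge0 => x _; exact: sqr_ge0.
- move=> c c' cc cc'; have s1 := comb_sqint mD cc sf; have s2 := comb_sqint mD cc' sf.
  have sp : sqint m D (fun x => (c (f^~ x) + c' (f^~ x)) / 2).
    rewrite (_ : (fun x => _) = (fun x => 2^-1 * (c (f^~ x) + c' (f^~ x)))).
      by apply: sqintZ => //; exact: sqintD.
    by apply/funext => x; rewrite mulrC.
  have sm : sqint m D (fun x => (c (f^~ x) - c' (f^~ x)) / 2).
    rewrite (_ : (fun x => _) = (fun x => 2^-1 * (c (f^~ x) - c' (f^~ x)))).
      by apply: sqintZ => //; exact: sqintB.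
    by apply/funext => x; rewrite mulrC.
  rewrite -RID//; [|exact: sp.2|exact: sm.2].
  rewrite -RID//; [|exact: s1.2|exact: s2.2].
  rewrite mulrC -RIZ//; last by apply: intgD => //; [exact: s1.2|exact: s2.2].
  apply: eq_ler; apply: eq_RI => x _.
  by field.
by exists C.
Qed.

Lemma mazur_L2 (Q : ((nat -> R) -> R) -> R) (y : nat -> (nat -> R) -> R)
    d (X : measurableType d) (m : {measure set X -> \bar R}) (D : set X)
    (f : nat -> X -> R) : measurable D -> (forall k, sqint m D (f k)) ->
  (forall n, comb n (y n)) ->
  (forall e, 0 < e -> exists N, forall m n, (N <= m)%N -> (N <= n)%N ->
    Q (fun u => (y m u - y n u) / 2) <= e) ->
  (forall c, \int[m]_(x in D) (c (f^~ x) ^+ 2) <= Q c) ->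
  exists g, sqint m D g /\ tends0 (fun n => \int[m]_(x in D) ((y n (f^~ x) - g x) ^+ 2)).
Proof.
move=> mD sf yC cQ fQ.
have [||_ [g [_ [[_ _ sg _] _ _ H]]]] := @L2_complete _ _ _ m D mD (fun n x => y n (f^~ x)).
- by move=> n; exact: comb_sqint (yC n) sf.
- move=> e e0; have e4 : 0 < e / 4 by rewrite divr_gt0.
  have [N HN] := cQ _ e4; exists N => a b Na Nb.
  have h1 := HN a b Na Nb; have h2 := fQ (fun u => (y a u - y b u) / 2).
  have sy n := comb_sqint mD (yC n) sf.
  have sB := sqintB mD (sy a) (sy b).
  have E : \int[m]_(x in D) (((y a (f^~ x) - y b (f^~ x)) / 2) ^+ 2) =
      4^-1 * \int[m]_(x in D) ((y a (f^~ x) - y b (f^~ x)) ^+ 2).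
    by rewrite -RIZ//; [apply: eq_RI => x _; field|exact: sB.2].
  by have := le_trans h2 h1; rewrite E ler_pdivrMl// mulrC divfK.
by exists g; split.
Qed.

End quadratic_functionals.

(** * Local existence on the network *)

Section local_existence.
Context (R : realType) (p : R) (L : 'I_3 -> R).
Hypotheses (p1 : 1 < p) (L0 : forall j, 0 < L j).
Local Notation mu := (@lebesgue_measure R).
Local Notation m2 := (mu \x mu)%E.
Local Notation unc u := (fun z : R * R => u z.1 z.2).
Local Notation Q T l := (`]0, T[ `*` `]0, l[ : set (R * R)).

Lemma comb_split3 n (c : (nat -> R) -> R) (u v : nat -> R) j : comb n c ->
  c (fun k => split3 (u k) (v k) j) = split3 (c u) (c v) j.
Proof.
move=> cc; elim/ord3P: j; rewrite /split3//=; first exact: combB cc.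
by have := combZ (-1) u cc; rewrite mulN1r => <-; congr c; apply/funext => k; rewrite mulN1r.
Qed.

Lemma split3_sqr (x y : R) j : split3 x y j ^+ 2 <= 2 * x ^+ 2 + 2 * y ^+ 2.
Proof.
have := sqr_ge0 x; have := sqr_ge0 y; have := sqr_ge0 (x + y).
have -> : (x + y) ^+ 2 = x ^+ 2 + y ^+ 2 + 2 * x * y by ring.
elim/ord3P: j; rewrite /split3/= ?sqrrN; last by lra.
  have -> : (x - y) ^+ 2 = x ^+ 2 + y ^+ 2 - 2 * x * y by ring.
  by lra.
by lra.
Qed.

Lemma sqint_split3 T (f g : R -> R) j : sqintI T f -> sqintI T g ->
  sqintI T (fun t => split3 (f t) (g t) j).
Proof.
by move=> sf sg; elim/ord3P: j; [exact: sqintB|exact: sqintN|].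
Qed.

Lemma tends0_split3 T (y : nat -> (nat -> R) -> R) (u v : nat -> R -> R) (u' v' : R -> R) j :
  (forall n, comb n (y n)) ->
  (forall k, sqintI T (u k)) -> (forall k, sqintI T (v k)) ->
  sqintI T u' -> sqintI T v' ->
  tends0 (fun n => \I_(t < T) ((y n (u^~ t) - u' t) ^+ 2)) ->
  tends0 (fun n => \I_(t < T) ((y n (v^~ t) - v' t) ^+ 2)) ->
  tends0 (fun n => \I_(t < T)
    ((y n (fun k => split3 (u k t) (v k t) j) - split3 (u' t) (v' t) j) ^+ 2)).
Proof.
move=> yC su sv su' sv' cu cv.
apply: tends0_le (tends0D (tends0Z (ler0n R 2) cu) (tends0Z (ler0n R 2) cv)) => n.
have s1 : sqintI T (fun t => y n (u^~ t) - u' t).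
  by apply: sqintB => //; exact: comb_sqint (yC n) su.
have s2 : sqintI T (fun t => y n (v^~ t) - v' t).
  by apply: sqintB => //; exact: comb_sqint (yC n) sv.
rewrite -RIZ//; last exact: s1.2.
rewrite -RIZ//; last exact: s2.2.
rewrite -RID//; [|by apply: intgZ => //; exact: s1.2|by apply: intgZ => //; exact: s2.2].
have E t : y n (fun k => split3 (u k t) (v k t) j) - split3 (u' t) (v' t) j =
    split3 (y n (u^~ t) - u' t) (y n (v^~ t) - v' t) j.
  rewrite (comb_split3 _ _ _ (yC n)); elim/ord3P: j; rewrite /split3/=; ring.
apply: le_RI => //.
- rewrite (_ : (fun t => _) = (fun t => split3 (y n (u^~ t) - u' t) (y n (v^~ t) - v' t) j ^+ 2)).
    exact: (sqint_split3 j s1 s2).2.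
  by apply/funext => t; rewrite E.
- by apply: intgD => //; apply: intgZ => //; [exact: s1.2|exact: s2.2].
by move=> t _; rewrite E; exact: split3_sqr.
Qed.

Lemma RI_comp_close (F u v : R -> R) (l e : R) : 0 < l -> continuous F ->
  (forall a b, `|F b - F a| <= `|b - a|) -> (forall a, `|F a| <= 1) ->
  measI l u -> measI l v ->
  (forall s, 0 < s < l -> `|u s - v s| <= e) ->
  `|\I_(s < l) F (u s) - \I_(s < l) F (v s)| <= l * e.
Proof.
move=> l0 cF HF F1 mu_ mv H.
have iF (f : R -> R) : measI l f -> intgI l (F \o f).
  move=> mf; apply: (@intg_bounded _ _ _ mu _ _ _ 1); [by []|exact: mu_itv_lty| |by move=> s _; exact: F1].
  by apply: measurableT_comp mf; exact: continuous_measurable_fun.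
have iB : intgI l (fun s => F (u s) - F (v s)) by apply: intgB => //; exact: iF.
rewrite -RIB//; [|exact: iF..]; apply: le_trans (RI_norm _ iB) _ => //.
have -> : l * e = \I_(s < l) e by rewrite RI_cst// mu_itvE// mulrC.
apply: le_RI => //; [exact: intg_norm|exact: cst_intg|].
by move=> s; rewrite /= in_itv/= => sl; apply: le_trans (HF _ _) (H s sl).
Qed.

Lemma net_approx_le th0 (E0 C e e' T : R) th d V w m : e <= e' ->
  net_approx p L th0 E0 C e T th d V w m -> net_approx p L th0 E0 C e' T th d V w m.
Proof.
move=> ee [h1 h2 h3 h4 h5 he h6 h7 h8 h9 h10]; split => //.
- move=> j t tT; have [g [gA gth]] := h7 j t tT; exists g; split => // s sl.
  exact: le_trans (gth s sl) ee.
- by move=> j t s tT sl; exact: le_trans (h8 j t s tT sl) ee.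
- move=> j t tT; have [w0 wb] := h9 j t tT; split => // s sl.
  apply: le_trans (wb s sl) _; rewrite ler_wpM2r//; apply: RI_ge0 => x _.
  exact: sqr_ge0.
- by move=> j t tT; have [a b] := h10 j t tT; split; exact: le_trans ee.
Qed.

Lemma harm_sqr_le (n k : nat) : (n <= k)%N -> (k.+1%:R^-1 ^+ 2 : R) <= n.+1%:R^-1 ^+ 2.
Proof.
by move=> nk; rewrite lerXn2r ?nnegrE ?(ltW (harm_gt0 R _))//; exact: harm_mono.
Qed.

Lemma midpoint (T : R) : 0 < T -> 0 < T / 2 < T.
Proof. by move=> T0; rewrite divr_gt0//= ltr_pdivrMr// ltr_pMr// ltr1n. Qed.

Lemma converging_approximations (th0 : 'I_3 -> R -> R) (E0 C T : R) : 0 < T ->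
  (forall j, {within `[0, L j], continuous (th0 j)}) ->
  (forall e, 0 < e -> exists th d V w m, net_approx p L th0 E0 C e T th d V w m) ->
  exists th' th d V w m, [/\ 0 <= C, forall j, ucont2 T (L j) (th' j),
    forall k, net_approx p L th0 E0 C (k.+1%:R^-1 ^+ 2) T (th k) (d k) (V k) (w k) (m k) &
    forall (k : nat) j t s, 0 < t < T -> 0 < s < L j ->
      `|th k j t s - th' j t s| <= k.+1%:R^-1].
Proof.
move=> T0 A0 ex.
have /choice[X HX] : forall k : nat, exists X : ('I_3 -> R -> R -> R) * ('I_3 -> R -> R -> R) *
    ('I_3 -> R -> R -> R) * ('I_3 -> R -> R -> R) * ('I_4 -> R -> R),
    net_approx p L th0 E0 C (k.+1%:R^-1 ^+ 2) T X.1.1.1.1 X.1.1.1.2 X.1.1.2 X.1.2 X.2.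
  move=> k; have [th [d [V [w [m H]]]]] := ex _ (exprn_gt0 2 (harm_gt0 R k)).
  by exists (th, d, V, w, m).
have C0 : 0 <= C.
  have [h _] := ap_multC (HX 0%N) e1 (midpoint T0).
  exact: le_trans (normr_ge0 _) h.
have /choice[M0 HM0] : forall j, exists M, 0 <= M /\ forall s, 0 < s < L j -> `|th0 j s| <= M.
  move=> j; have [M [M0 HM]] := within_bounded (A0 j).
  exists M; split; first exact: ltW.
  by move=> s /andP[/ltW s0 /ltW sl]; apply: HM; rewrite s0.
have /choice[M HM] := fun j => eapprox_bounded p1 (L0 j) T0 C0 (HM0 j).1.
have M1 j : M j <= `|M e1| + `|M e2| + `|M e3|.
  apply: le_trans (ler_norm _) _.
  have := normr_ge0 (M e1); have := normr_ge0 (M e2); have := normr_ge0 (M e3).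
  by elim/ord3P: j; lra.
have [| |th' [ucth' near]] := @ascoli R _ T L (fun n => (X n).1.1.1.1)
  (`|M e1| + `|M e2| + `|M e3|) T0 L0.
- move=> n j t s tT sl; apply: le_trans (M1 j).
  apply: (HM j _ _ _ _ _ _ _ _ (HM0 j).2 (approx_edge j (HX n))) => //.
  by rewrite exprn_ile1 ?(ltW (harm_gt0 R n))// harm_le1.
- move=> e e0.
  have /choice[f Hf] : forall j, exists f : R * R, [/\ 0 < f.1, 0 < f.2 &
    forall th0 e' T th d V w A B, 0 < T -> eapprox p th0 (L j) C e' T th d V w A B -> e' <= f.2 ->
    forall t t' s s', 0 < t < T -> 0 < t' < T -> 0 < s < L j -> 0 < s' < L j ->
    `|t - t'| <= f.1 -> `|s - s'| <= f.1 -> `|th t s - th t' s'| <= e].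
    by move=> j; have [a [b H]] := eapprox_equicont p1 (L0 j) C0 e0; exists (a, b).
  pose dl := Num.min (f e1).1 (Num.min (f e2).1 (f e3).1).
  pose e' := Num.min (f e1).2 (Num.min (f e2).2 (f e3).2).
  have dl0 : 0 < dl.
    by have [a1 _ _] := Hf e1; have [a2 _ _] := Hf e2; have [a3 _ _] := Hf e3; rewrite !lt_min a1 a2.
  have e'0 : 0 < e'.
    by have [_ a1 _] := Hf e1; have [_ a2 _] := Hf e2; have [_ a3 _] := Hf e3; rewrite !lt_min a1 a2.
  have dlj j : dl <= (f j).1 by elim/ord3P: j; rewrite !ge_min lexx ?orbT.
  have ej j : e' <= (f j).2 by elim/ord3P: j; rewrite !ge_min lexx ?orbT.
  have [N HN] := @tends0_harm R _ e'0; exists dl, N; split => //.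
  move=> n j t t' s s' Nn tT tT' sl sl' td sd; have [_ _ H] := Hf j.
  apply: (H _ _ _ _ _ _ _ _ _ T0 (approx_edge j (HX n))) => //; last 2 first.
  + exact: le_trans td (dlj j).
  + exact: le_trans sd (dlj j).
  apply: le_trans (ej j); apply: le_trans (HN n Nn).
  by rewrite expr2 ger_pMr ?harm_gt0// harm_le1.
have /choice[a Ha] : forall k, exists n, (k <= n)%N /\
    forall j t s, 0 < t < T -> 0 < s < L j ->
      `|(X n).1.1.1.1 j t s - th' j t s| <= k.+1%:R^-1.
  by move=> k; exact: near (harm_gt0 R k) k.
exists th', (fun k => (X (a k)).1.1.1.1), (fun k => (X (a k)).1.1.1.2),
  (fun k => (X (a k)).1.1.2), (fun k => (X (a k)).1.2), (fun k => (X (a k)).2).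
split => // k; last by have [_] := Ha k; exact.
apply: net_approx_le (HX (a k)); apply: harm_sqr_le; exact: (Ha k).1.
Qed.

Section limit.
Variables (th0 : 'I_3 -> R -> R) (E0 C T : R) (th' : 'I_3 -> R -> R -> R)
  (th d V w : nat -> 'I_3 -> R -> R -> R) (m : nat -> 'I_4 -> R -> R).
Hypotheses (T0 : 0 < T) (C0 : 0 <= C)
  (uc : forall j, ucont2 T (L j) (th' j))
  (NA : forall k, net_approx p L th0 E0 C (k.+1%:R^-1 ^+ 2) T (th k) (d k) (V k) (w k) (m k))
  (near : forall (k : nat) j t s, 0 < t < T -> 0 < s < L j ->
      `|th k j t s - th' j t s| <= k.+1%:R^-1).

Definition strong_along (phi : nat -> nat) (j : 'I_3) (F : (R -> R -> R) * (R -> R -> R)) :=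
  [/\ sqint m2 (Q T (L j)) (unc F.1), sqint m2 (Q T (L j)) (unc F.2),
    {ae m2, forall z, Q T (L j) z ->
      vhalf p (d (phi n) j z.1 z.2) @[n --> \oo] --> F.1 z.1 z.2} &
    {ae m2, forall z, Q T (L j) z -> forall n, `|vhalf p (d (phi n) j z.1 z.2)| <= F.2 z.1 z.2}].

Lemma strong_along_sub phi psi j F : strong_along phi j F -> (forall n, (n <= psi n)%N) ->
  {homo psi : m n / (m < n)%N} -> strong_along (phi \o psi) j F.
Proof.
move=> [h1 h2 h3 h4] np hp; split => //.
  apply: aeS h3 => z + zQ; move=> /(_ zQ) cz.
  apply: (cvg_comp psi (fun n => vhalf p (d (phi n) j z.1 z.2))) cz.
  move=> A [N _ HN]; exists N => // n /= Nn; apply: HN => /=.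
  exact: leq_trans Nn (np n).
by apply: aeS h4 => z + zQ n; move=> /(_ zQ) hz; exact: hz.
Qed.

Lemma strong_along_ex phi j : (forall n, (n <= phi n)%N) ->
  exists psi F, [/\ forall n, (n <= psi n)%N, {homo psi : m n / (m < n)%N} &
    strong_along (phi \o psi) j F].
Proof.
move=> np.
have EA k : eapprox p (th0 j) (L j) C (k.+1%:R^-1 ^+ 2) T (th (phi k) j) (d (phi k) j)
    (V (phi k) j) (w (phi k) j) (fun t => mA ((m (phi k))^~ t) j) (fun t => mB ((m (phi k))^~ t) j).
  apply: eapprox_le (approx_edge j (NA (phi k))); exact: harm_sqr_le.
have nr k t s : 0 < t < T -> 0 < s < L j -> `|th (phi k) j t s - th' j t s| <= k.+1%:R^-1.
  by move=> tT sl; apply: le_trans (near _ tT sl) _; exact: harm_mono.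
have [psi [f [h [[a1 a2 a3 a4] a5 a6]]]] := eapprox_strong_limit p1 (L0 j) T0 C0 EA nr.
exists psi, (fun t s => f (t, s), fun t s => h (t, s)); split => //; split => /=.
- by rewrite (_ : (fun z => _) = f)//; apply/funext => -[].
- by rewrite (_ : (fun z => _) = h)//; apply/funext => -[].
- by apply: aeS a5 => -[].
- by apply: aeS a6 => -[].
Qed.

(** Three successive extractions, one for each edge; strong convergence persists along further
    subsequences. *)
Lemma strong_subsequence : exists phi (F : 'I_3 -> (R -> R -> R) * (R -> R -> R)),
  (forall n, (n <= phi n)%N) /\ forall j, strong_along phi j (F j).
Proof.
have [phi1 [F1 [h1 h1' s1]]] := @strong_along_ex id e1 (fun n => leqnn n).
have [phi2 [F2 [h2 h2' s2]]] := strong_along_ex e2 h1.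
have h12 n : (n <= phi1 (phi2 n))%N by exact: leq_trans (h2 n) (h1 _).
have [phi3 [F3 [h3 h3' s3]]] := strong_along_ex e3 h12.
exists (fun n => phi1 (phi2 (phi3 n))),
  (fun j => match val j with 0%N => F1 | 1%N => F2 | _ => F3 end).
split; first by move=> n; exact: leq_trans (h3 n) (h12 _).
elim/ord3P => /=.
- have := strong_along_sub (strong_along_sub s1 h2 h2') h3 h3'; exact.
- have := strong_along_sub s2 h3 h3'; exact.
exact: s3.
Qed.

End limit.

End local_existence.

Section local_existence.
Context (R : realType) (p : R) (L : 'I_3 -> R).
Hypotheses (p1 : 1 < p) (L0 : forall j, 0 < L j).
Local Notation mu := (@lebesgue_measure R).
Local Notation m2 := (mu \x mu)%E.
Local Notation unc u := (fun z : R * R => u z.1 z.2).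
Local Notation Q T l := (`]0, T[ `*` `]0, l[ : set (R * R)).

Lemma limit_constraint (T : R) (th : nat -> 'I_3 -> R -> R -> R) (th' : 'I_3 -> R -> R -> R)
    (F : R -> R) : 0 < T -> (forall j, ucont2 T (L j) (th' j)) ->
  (forall k j t, 0 < t < T -> measI (L j) (th k j t)) ->
  (forall (k : nat) j t s, 0 < t < T -> 0 < s < L j ->
      `|th k j t s - th' j t s| <= k.+1%:R^-1) ->
  continuous F -> (forall a b, `|F b - F a| <= `|b - a|) -> (forall a, `|F a| <= 1) ->
  (forall k j t, 0 < t < T -> `|\I_(s < L j) F (th k j t s) -
      \I_(s < L e1) F (th k e1 t s)| <= k.+1%:R^-1) ->
  forall j t, 0 <= t <= T -> \I_(s < L j) F (th' j t s) =
      \I_(s < L e1) F (th' e1 t s).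
Proof.
move=> T0 uc mth near cF HF F1 con j t tT; apply/eqP; rewrite -subr_eq0 -normr_le0.
apply/ler_addgt0Pr => e e0; rewrite add0r.
pose K := L j + L e1; have K0 : 0 < K by rewrite addr_gt0.
have eK : 0 < e / (2 * K) by rewrite divr_gt0// mulr_gt0.
have [d1 [d10 H1]] := uc j _ eK; have [d2 [d20 H2]] := uc e1 _ eK.
have K1 : 0 <= 1 + K by rewrite addr_ge0// ltW.
have e2 : 0 < e / 2 by rewrite divr_gt0.
have [N1 HN1] := tends0Z K1 (@tends0_harm R) e2.
pose d := Num.min d1 d2; have d0 : 0 < d by rewrite lt_min d10.
have [N2 HN2] := tends0Z (ltW T0) (@tends0_harm R) d0.
(* The approximations satisfy the constraint at interior times; moving t inward covers the two end
   points of [0,T] as well. *)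
pose N := maxn N1 N2; pose t' := inward T N t.
have t'T : 0 < t' < T by exact: inward_itv.
have t'T' : 0 <= t' <= T by case/andP: t'T => /ltW -> /ltW ->.
have td : `|t' - t| <= d.
  apply: le_trans (inward_near N T0 tT) (le_trans _ (HN2 N (leq_maxr _ _))).
  by rewrite ler_wpM2l ?(ltW T0)// lef_pV2 ?posrE ?ltr0n// ler_nat.
have mth' i x : 0 <= x <= T -> measI (L i) (th' i x).
  move=> xT; exact: within_measurable (ucont2_slice xT (uc i)).
have near1 i s : (i = j \/ i = e1) -> 0 < s < L i ->
    `|th N i t' s - th' i t s| <= N.+1%:R^-1 + e / (2 * K).
  move=> ij sl; have sl' : 0 <= s <= L i by case/andP: sl => /ltW -> /ltW ->.
  have -> : th N i t' s - th' i t s = (th N i t' s - th' i t' s) + (th' i t' s - th' i t s).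
    by ring.
  apply: normD_le; first exact: near.
  case: ij sl' => -> sl'.
    by apply: H1 => //; [apply: le_trans td _; rewrite ge_min lexx|rewrite subrr normr0 ltW].
  by apply: H2 => //; [apply: le_trans td _; rewrite ge_min lexx orbT|rewrite subrr normr0 ltW].
have c1 := RI_comp_close (L0 j) cF HF F1 (mth N j t' t'T) (mth' j t tT)
  (fun s => near1 j s (or_introl erefl)).
have c2 := RI_comp_close (L0 e1) cF HF F1 (mth N e1 t' t'T) (mth' e1 t tT)
  (fun s => near1 e1 s (or_intror erefl)).
have c3 := con N j t' t'T; have hN := HN1 N (leq_maxl _ _).
set a := \int[mu]_(s in _) F (th' j t s) in c1 *.
set b := \int[mu]_(s in _) F (th' e1 t s) in c2 *.
set a' := \int[mu]_(s in _) F (th N j t' s) in c1 c3.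
set b' := \int[mu]_(s in _) F (th N e1 t' s) in c2 c3.
have -> : a - b = (a' - b') - (a' - a) + (b' - b) by ring.
apply: (@le_trans _ _ (N.+1%:R^-1 + L j * (N.+1%:R^-1 + e / (2 * K)) +
   L e1 * (N.+1%:R^-1 + e / (2 * K)))).
  by apply: normD_le => //; exact: normB_le.
have -> : N.+1%:R^-1 + L j * (N.+1%:R^-1 + e / (2 * K)) + L e1 * (N.+1%:R^-1 + e / (2 * K)) =
  (1 + K) * N.+1%:R^-1 + K * (e / (2 * K)) by rewrite /K; ring.
have -> : K * (e / (2 * K)) = e / 2 by field; rewrite gt_eqF.
by rewrite [leRHS]splitr lerD2r.
Qed.

Let pp : 0 < p. Proof. exact: lt_trans ltr01 p1. Qed.

Lemma energy_cvg h N (x : nat -> nat -> R) (y : nat -> R) : (forall i, (i < N)%N ->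
  x n i @[n --> \oo] --> y i) -> energy p h N (x n) @[n --> \oo] --> energy p h N y.
Proof.
move=> xy; apply: cvgM; first exact: cvg_cst.
apply: cvg_big => [|i _]; first exact: add_continuous.
rewrite -spow_norm//; under eq_fun do rewrite -spow_norm//.
apply: cvg_norm; apply: (cvg_comp _ (spow p)); last exact: spow_continuous.
rewrite /slope; case: ifP => [/andP[m0 _]|_]; last exact: cvg_cst.
by apply: cvgM; [apply: cvgB; apply: xy => //; rewrite (leq_ltn_trans (leq_pred _))|exact: cvg_cst].
Qed.

(** For a fixed N the sampled energy is a continuous function of finitely many nodal values, so the
    discrete bound passes to the limit at every interior time. *)
Lemma limit_energy (th0 : 'I_3 -> R -> R) (E0 C T : R) (th' : 'I_3 -> R -> R -> R) th d V w m :
  (forall j, ucont2 T (L j) (th' j)) ->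
  (forall k, net_approx p L th0 E0 C (k.+1%:R^-1 ^+ 2) T (th k) (d k) (V k) (w k) (m k)) ->
  (forall (k : nat) j t s, 0 < t < T -> 0 < s < L j -> `|th k j t s - th' j t s| <= k.+1%:R^-1) ->
  forall t N, 0 < t < T -> (0 < N)%N ->
  net_energy p L N (sample L (fun j => th' j t) N) <= E0 + p * t.
Proof.
move=> uc NA near t N tT N0; have w0 := width_gt0 L0 N0; have wE := widthE L N0.
have tT' : 0 <= t <= T by case/andP: tT => /ltW -> /ltW ->.
have /choice[g Hg] : forall z : nat * 'I_3, exists g, abscont (L z.2) g (d z.1 z.2 t) /\
    forall s, 0 < s < L z.2 -> `|g s - th z.1 z.2 t s| <= z.1.+1%:R^-1 ^+ 2.
  by move=> [k j]; exact: ap_hat (NA k) j t tT.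
apply: (cvg_le_cst (u := fun k => net_energy p L N (sample L (fun j => g (k, j)) N))); last first.
  move=> k; apply: le_trans (ap_energy (NA k) tT); apply: ler_sum => j _.
  apply: energy_sample (Hg (k, j)).1 _ => //.
  have [M HM] := ap_meas (NA k); have [_ bd _ _] := HM j.
  have [md _] := bmeas_t bd tT; have bd' s := bd.2 t s tT.
  apply: (@intg_bounded _ _ _ mu _ _ _ (M `^ p)) => //; first exact: mu_itv_lty.
    by apply: (measurableT_comp (measurable_powR p)); exact: measurableT_comp.
  move=> s sl; have b : `|d k j t s| <= M by exact: bd'.
  by rewrite ger0_norm ?powR_ge0// ge0_ler_powR ?(ltW pp) ?nnegrE ?(le_trans _ b).
have C2 k j s : 0 < s < L j -> `|g (k, j) s - th' j t s| <= 2 * k.+1%:R^-1.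
  move=> sl; have -> : g (k, j) s - th' j t s = (g (k, j) s - th k j t s) +
    (th k j t s - th' j t s) by ring.
  have -> : 2 * k.+1%:R^-1 = k.+1%:R^-1 + k.+1%:R^-1 :> R by ring.
  apply: normD_le; last exact: near.
  apply: le_trans ((Hg (k, j)).2 s sl) _.
  by rewrite expr2 ger_pMr ?harm_gt0// harm_le1.
have t2 := tends0Z (ler0n R 2) (@tends0_harm R).
apply: cvg_big => [|j _]; first exact: add_continuous.
apply: energy_cvg => // i iN; apply: (tends0_cvg (v := fun k => 2 * k.+1%:R^-1)) => // k.
rewrite /sample; apply: (within_le (L0 j) (f := fun s => g (k, j) s - th' j t s)); [|exact: C2|].
  by move=> s; apply: continuousB; [apply: (AC_within (Hg (k, j)).1)|apply: (ucont2_slice tT' (uc j))].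
by rewrite mulr_ge0 ?(ltW (w0 j))//= -[leRHS]wE ler_pM2l// ler_nat ltnW.
Qed.

(** T is chosen before the datum, from a and E0. The actual initial energy E1 is kept apart from E0,
    so that a restart can record the growth p t of the energy while T stays the same. *)
Theorem nice_local (a E0 : R) : 0 < a -> 0 <= E0 -> exists T : R, 0 < T /\ forall th0 E1, E1 <= E0 ->
  (forall j, {within `[0, L j], continuous (th0 j)}) -> oscillates L a th0 ->
  (forall N, (0 < N)%N -> net_energy p L N (sample L th0 N) <= E1) ->
  network_constraint L th0 ->
  exists E ths tht, nice p L th0 T E ths tht /\ forall t N, 0 < t < T -> (0 < N)%N ->
    net_energy p L N (sample L (fun j => theta E j t) N) <= E1 + p * t.
Proof.
move=> a0 E00.
have [T [C [T0 HT]]] := approx_exists p1 L0 a0 E00.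
exists T; split => // th0 E1 E10 A0 o0 P0 con0.
have ex := HT th0 E1 E10 A0 o0 P0 con0.
have [th' [th_ [d_ [V_ [w_ [m_ [C0 uc NA_ near_]]]]]]] :=
  converging_approximations p1 L0 T0 A0 ex.
have [phi [F [phiN HF]]] := strong_subsequence p1 L0 T0 C0 NA_ near_.
pose th k := th_ (phi k); pose d k := d_ (phi k); pose V k := V_ (phi k).
pose w k := w_ (phi k); pose m k := m_ (phi k).
have NA k : net_approx p L th0 E1 C (k.+1%:R^-1 ^+ 2) T (th k) (d k) (V k) (w k) (m k).
  by apply: net_approx_le (NA_ (phi k)); exact: harm_sqr_le.
have near (k : nat) j t s : 0 < t < T -> 0 < s < L j -> `|th k j t s - th' j t s| <= k.+1%:R^-1.
  by move=> tT sl; apply: le_trans (near_ _ j t s tT sl) _; exact: harm_mono.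
have sV j k : sqint m2 (Q T (L j)) (unc (V k j)).
  have [M HM] := ap_meas (NA k); have [_ _ bV _] := HM j; exact: bmeas_sqint bV.
(* Edge 2 carries minus the lambdas and edge 3 carries the mus, so the coefficient bounds on these
   two edges bound all four multipliers. *)
have mC q k t : 0 < t < T -> `|m k q t| <= C.
  move=> tT; have [a1 b1] := ap_multC (NA k) e2 tT; have [a2 b2] := ap_multC (NA k) e3 tT.
  move: a1 a2 b1 b2; rewrite /mA /mB /split3/= !normrN => a1 a2 b1 b2.
  have : [\/ q = 0, q = 1, q = 2%:R | q = 3%:R].
    case: q => -[|[|[|[|//]]]] i4; [constructor 1|constructor 2|constructor 3|constructor 4];
      exact: val_inj.
  by case=> ->.
have sm q k : sqintI T (m k q).
  apply: (@sqint_bounded _ _ _ mu _ _ _ C); [by []|exact: mu_itv_lty|exact: ap_mult (NA k) q|].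
  by move=> t; rewrite /= in_itv/=; exact: mC.
pose QV j (c : (nat -> R) -> R) :=
  \int[m2]_(z in Q T (L j)) (c (fun k => V k j z.1 z.2) ^+ 2).
pose Qm q (c : (nat -> R) -> R) := \I_(t < T) (c (fun k => m k q t) ^+ 2).
have qV j : quad (QV j).
  apply: (@quad_L2 R _ _ m2 (Q T (L j)) (fun k z => V k j z.1 z.2) C) => //.
    exact: measurable_Q.
  move=> k; have [_ _ ->] := @RI_Q R T (L j) (fun t s => V k j t s ^+ 2) (sV j k).2.
  exact: ap_sq (NA k) j.
have qm q : quad (Qm q).
  apply: (@quad_L2 R _ _ mu `]0, T[%classic (fun k => m k q) (C ^+ 2 * T)) => // k.
  apply: (@le_trans _ _ (\I_(t < T) (C ^+ 2))).
    apply: le_RI => //; [exact: (sm q k).2|exact: cst_intg|].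
    by move=> t; rewrite /= in_itv/= => tT; apply: norm_sqr_le; exact: mC.
  by rewrite RI_cst// mu_itvE.
(* One functional for the three velocities and the four multipliers, so that a single sequence y
   serves them all. *)
pose QQ c := \sum_j QV j c + \sum_q Qm q c.
have [Q1 Q2 [K Q3]] : quad QQ by apply: quad_add; exact: quad_sum.
have [y [yC yQ]] := mazur Q1 Q2 Q3.
have QV0 j c : 0 <= QV j c by have [] := qV j.
have Qm0 q c : 0 <= Qm q c by have [] := qm q.
have QVQ j c : QV j c <= QQ c.
  rewrite /QQ (bigD1 j)//= -addrA lerDl addr_ge0//; exact: sumr_ge0.
have QmQ q c : Qm q c <= QQ c.
  rewrite /QQ (bigD1 q)//= addrCA lerDl addr_ge0//; exact: sumr_ge0.
have /choice[V' HV'] : forall j, exists g : R * R -> R, sqint m2 (Q T (L j)) g /\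
    tends0 (fun n => \int[m2]_(z in Q T (L j)) ((y n (fun k => V k j z.1 z.2) - g z) ^+ 2)).
  move=> j; apply: (@mazur_L2 R QQ y _ _ m2 (Q T (L j)) (fun k z => V k j z.1 z.2)) => //.
  - exact: measurable_Q.
  - exact: QVQ.
have /choice[m' Hm'] : forall q, exists g : R -> R, sqintI T g /\
    tends0 (fun n => \I_(t < T) ((y n (fun k => m k q t) - g t) ^+ 2)).
  move=> q; apply: (@mazur_L2 R QQ y _ _ mu `]0, T[%classic (fun k => m k q)) => //.
  exact: QmQ.
(* The indices of m follow the order lambda1, mu1, lambda2, mu2 of [mA] and [mB], whereas
   [Evolution] takes both lambdas first. *)
pose E := Evolution th' (m' 0) (m' 2%:R) (m' 1) (m' 3%:R).
have sol j := @limit_edge_sol R p p1 (th0 j) (L j) C T (fun k => th k j) (fun k => d k j)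
  (fun k => V k j) (fun k => w k j) (fun k t => mA ((m k)^~ t) j) (fun k t => mB ((m k)^~ t) j)
  (th' j) (fun t s => V' j (t, s)) (forceA E j) (forceB E j) (F j).1 (F j).2 y (L0 j) T0 C0 (A0 j)
  (fun k => approx_edge j (NA k)).
have eta j : (fun z => V' j (z.1, z.2)) = V' j by apply/funext => -[].
have mspl (j : 'I_3) (u v : R -> R) : measI T u -> measI T v ->
    measI T (fun t => split3 (u t) (v t) j).
  move=> mu_ mv; elim/ord3P: j; rewrite /split3//=; first exact: measurable_funB.
  exact: measurableT_comp.
have {}sol j : edge_sol p T (L j) (th' j) (fun t s => spow (p / 2)^-1 ((F j).1 t s))
    (fun t s => V' j (t, s)) (forceA E j) (forceB E j) /\
    forall s, 0 <= s <= L j -> th' j 0 s = th0 j s.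
  have [f1 f2 f3 f4] := HF j; apply: sol => //.
  - by move=> k; apply: mspl; exact: ap_mult (NA k) _.
  - by move=> k; apply: mspl; exact: ap_mult (NA k) _.
  - by move=> k t s; exact: near.
  - by rewrite eta; have [] := HV' j.
  - by apply: sqint_split3; [exact: (Hm' 0).1|exact: (Hm' 1).1].
  - by apply: sqint_split3; [exact: (Hm' 2%:R).1|exact: (Hm' 3%:R).1].
  - have [_ h] := HV' j; apply: tends0_le h => n.
    by apply: eq_ler; apply: eq_RI => -[].
  - have [s1 c1] := Hm' 0; have [s2 c2] := Hm' 1.
    by apply: tends0_split3 => //; exact: sm.
  - have [s1 c1] := Hm' 2%:R; have [s2 c2] := Hm' 3%:R.
    by apply: tends0_split3 => //; exact: sm.
exists E, (fun j t s => spow (p / 2)^-1 ((F j).1 t s)), (fun j t s => V' j (t, s)).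
split; last exact: limit_energy NA near.
split.
- by move=> j; have [] := sol j.
- by move=> j; have [] := sol j.
have mth k j t : 0 < t < T -> measI (L j) (th k j t).
  move=> tT; have [M HM] := ap_meas (NA k); have [bth _ _ _] := HM j.
  by have [] := bmeas_t bth tT.
have hs (k : nat) : (k.+1%:R^-1 ^+ 2 : R) <= k.+1%:R^-1.
  by rewrite expr2 ger_pMr ?harm_gt0// harm_le1.
have ccos := limit_constraint T0 uc mth near (@continuous_cos R) (@cos_lip R) (@cos_norm_le1 R).
have csin := limit_constraint T0 uc mth near (@continuous_sin R) (@sin_lip R) (@sin_norm_le1 R).
have {}ccos j t : 0 <= t <= T -> \I_(s < L j) cos (th' j t s) =
    \I_(s < L e1) cos (th' e1 t s).
  apply: ccos => k i x xT; have [h _] := ap_con (NA k) i xT; exact: le_trans h (hs k).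
have {}csin j t : 0 <= t <= T -> \I_(s < L j) sin (th' j t s) =
    \I_(s < L e1) sin (th' e1 t s).
  apply: csin => k i x xT; have [_ h] := ap_con (NA k) i xT; exact: le_trans h (hs k).
by move=> t tT i j /=; rewrite !(ccos _ _ tT) !(csin _ _ tT).
Qed.

End local_existence.

(** * Translation of integrals *)

Section translation.
Context (R : realType).
Local Notation mu := (@lebesgue_measure R).

Lemma mu_shift (h : R) (A : set R) : measurable A ->
  pushforward mu (fun x : measurableTypeR R => x - h : measurableTypeR R) A = mu A.
Proof.
have msh : measurable_fun setT (fun x : measurableTypeR R => x - h : measurableTypeR R).
  exact: measurable_funB.
move=> mA; apply/esym/lebesgue_measure_unique => //= _ [[a b]] _ <-.
rewrite /pushforward.
have -> : (fun x : measurableTypeR R => x - h : measurableTypeR R) @^-1` [set` `]a, b]] = `]a + h, b + h]%classic.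
  apply/seteqP; split => x /=; rewrite !in_itv/= => /andP[h1 h2];
    apply/andP; split; lra.
rewrite !lebesgue_measure_itv/= !lte_fin ltrD2r.
by case: ifP => // _; rewrite -!EFinB; congr _%:E; ring.
Qed.

Lemma ge0_RI_shift (f : R -> R) (a b h : R) : measurable_fun `]a - h, b - h[ f ->
  (forall x, `]a - h, b - h[%classic x -> 0 <= f x) ->
  (\int[mu]_(x in `]a, b[) (f (x - h))%:E =
   \int[mu]_(x in `](a - h)%R, (b - h)%R[) (f x)%:E)%E.
Proof.
have msh : measurable_fun setT (fun x : measurableTypeR R => x - h : measurableTypeR R).
  exact: measurable_funB.
move=> mf f0; have -> : `]a, b[%classic =
    (fun x : measurableTypeR R => x - h : measurableTypeR R) @^-1` `]a - h, b - h[%classic.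
  apply/seteqP; split => x /=; rewrite !in_itv/= => /andP[h1 h2];
    apply/andP; split; lra.
rewrite -(@ge0_integral_pushforward _ _ _ (measurableTypeR R) R _ msh mu _ (EFin \o f))//.
- by apply: eq_measure_integral => A mA _; exact: mu_shift.
- exact/measurable_EFinP.
by move=> x; rewrite inE => xI; rewrite lee_fin f0.
Qed.

Lemma measurable_shift (f : R -> R) (a b h : R) : measurable_fun `]a - h, b - h[ f ->
  measurable_fun `]a, b[ (fun x => f (x - h)).
Proof.
move=> mf; apply: (measurable_comp (F := `]a - h, b - h[%classic)) mf _ => //.
  move=> _ [x + <-]; rewrite /= !in_itv/= => /andP[h1 h2]; apply/andP; split; lra.
exact: measurable_funB.
Qed.

Lemma RI_shift (f : R -> R) (a b h : R) : intg mu `]a - h, b - h[ f ->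
  intg mu `]a, b[ (fun x => f (x - h)) /\
  \I_(a < x < b) f (x - h) = \I_(a - h < x < b - h) f x.
Proof.
move=> iF; have mf := intg_meas iF.
have key (g : R -> R) : intg mu `]a - h, b - h[ g -> (forall x, 0 <= g x) ->
    intg mu `]a, b[ (fun x => g (x - h)) /\
    \I_(a < x < b) g (x - h) = \I_(a - h < x < b - h) g x.
  move=> ig g0; have mg := intg_meas ig.
  have E := ge0_RI_shift mg (fun x _ => g0 x).
  split; last by rewrite /Rintegral E.
  apply: intg_ge0 => //; first exact: measurable_shift.
  by rewrite E (intg_EFin _ ig)// ltry.
(* The nonnegative case is applied to |f| and to |f| + f, whose difference recovers f. *)
have iN : intg mu `]a - h, b - h[ (fun x => `|f x|) by exact: intg_norm.
have [i1 E1] := key (fun x => `|f x|) iN (fun x => normr_ge0 _).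
have iP : intg mu `]a - h, b - h[ (fun x => `|f x| + f x) by exact: intgD.
have [i2 E2] := key (fun x => `|f x| + f x) iP
  ltac:(by move=> x; rewrite -lerBlDl sub0r lerNl -normrN ler_norm).
have E x : f x = (`|f x| + f x) - `|f x| by rewrite addrC addKr.
split.
  rewrite (_ : (fun x => _) = (fun x => (`|f (x - h)| + f (x - h)) - `|f (x - h)|)).
    exact: intgB.
  by apply/funext => x; rewrite -E.
transitivity (\I_(a < x < b) ((`|f (x - h)| + f (x - h)) - `|f (x - h)|)).
  by apply: eq_RI => x _; rewrite -E.
by rewrite RIB// E1 E2 RID// addrC addKr.
Qed.

Lemma ae_shift (P : R -> Prop) (h : R) : {ae mu, forall x, P x} -> {ae mu, forall x, P (x - h)}.
Proof.
move=> [A [mA A0 PA]]; exists [set x | A (x - h)]; split.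
- have msh : measurable_fun setT (fun x : measurableTypeR R => x - h : measurableTypeR R).
    exact: measurable_funB.
  by have := msh measurableT A mA; rewrite setTI.
- by have := mu_shift h mA; rewrite /pushforward A0.
by move=> x /= nP; apply: PA.
Qed.

End translation.

(** * Uniqueness *)

Section uniqueness_tools.
Context (R : realType).
Local Notation mu := (@lebesgue_measure R).
Local Notation m2 := (mu \x mu)%E.
Local Notation unc u := (fun z : R * R => u z.1 z.2).
Local Notation Q T l := (`]0, T[ `*` `]0, l[ : set (R * R)).

Lemma intg_subset d (X : measurableType d) (m : {measure set X -> \bar R}) (D D' : set X)
  (f : X -> R) : measurable D -> measurable D' -> D `<=` D' -> intg m D' f -> intg m D f.
Proof. by move=> mD mD' DD; exact: integrableS. Qed.

Lemma sqint_subset d (X : measurableType d) (m : {measure set X -> \bar R}) (D D' : set X)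
  (f : X -> R) : measurable D -> measurable D' -> D `<=` D' -> sqint m D' f -> sqint m D f.
Proof.
move=> mD mD' DD [mf i]; split; first exact: measurable_funS mf.
exact: intg_subset i.
Qed.

Lemma sub_itv_sqint u (a b c d : R) : a <= c -> d <= b -> sqint mu `]a, b[ u ->
  sqint mu `]c, d[ u.
Proof.
move=> ac db [mu_ iu]; split; last exact: sub_itv_intg iu.
apply: measurable_funS mu_ => //.
by move=> z /=; rewrite !in_itv/= => /andP[? ?]; apply/andP; split; lra.
Qed.

Lemma avg_cvg (T t : R) (U u : R -> R) (h : nat -> R) : abscont T U u -> 0 < t < T ->
  lebesgue_pt (u \_ `]0, T[) t -> (forall n, 0 < h n) -> tends0 h ->
  (U t - U (t - h n)) / h n @[n --> \oo] --> u t.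
Proof.
move=> UA /andP[t0 tT] lt h0 hc; have iu := UA.1.
apply/cvgrPdist_le => e e0; have [d [d0 Hd]] := lebesgue_pt_avg iu t0 tT lt e0.
have [N HN] := hc _ d0.
exists N => // n /= Nn; have hd : h n <= d by exact: HN.
have [a1 a2 a3] := Hd _ (h0 n) hd.
have tt : t - h n <= t by rewrite lerBlDr lerDl ltW.
rewrite (AC_diff UA (ltW a1) tt (ltW tT)).
have iI : intg mu `]t - h n, t[ u by apply: sub_itv_intg iu; exact: ltW.
have -> : u t - (\I_(t - h n < r < t) u r) / h n =
    - ((h n)^-1 * \I_(t - h n < r < t) (u r - u t)).
  rewrite RIB//; last exact: cst_intg.
  rewrite RI_cst// mu_itv_len// subKr.
  by field; rewrite gt_eqF.
rewrite normrN normrM gtr0_norm ?invr_gt0// ler_pdivrMl//.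
have ic : intg mu `]t - h n, t + h n[ (fun r => `|u r - u t|).
  apply: intg_norm => //; apply: intgB => //; last exact: cst_intg.
  by apply: sub_itv_intg iu; exact: ltW.
have id : intg mu `]t - h n, t[ (fun r => u r - u t).
  by apply: intgB => //; exact: cst_intg.
apply: le_trans (RI_norm _ id) _ => //; rewrite mulrC; apply: le_trans a3.
rewrite [leRHS](@RI_itv_split _ _ (t - h n) t (t + h n))//; last by rewrite lerDl ltW.
by rewrite lerDl; exact: RI_ge0.
Qed.

(** At common Lebesgue points both derivatives are limits of left difference quotients; the steps
    are at most t / 2, which keeps these quotients inside ]0,T[. *)
Lemma abscont_unique (T : R) (f g f' g' : R -> R) : abscont T f g -> abscont T f' g' ->
  (forall t, 0 < t < T -> f t = f' t) -> {aeI t < T, g t = g' t}.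
Proof.
move=> fA fA' ff'; have := ae_lebesgue_pt fA.1; have := ae_lebesgue_pt fA'.1.
apply: aeS2 => t l1 l2; rewrite /= in_itv/= => tT; have /andP[t0 _] := tT.
pose h n : R := t / 2 * n.+1%:R^-1.
have t2 : 0 < t / 2 by rewrite divr_gt0.
have h0 n : 0 < h n by rewrite mulr_gt0// harm_gt0.
have hc : tends0 h by apply: tends0Z; [exact: ltW|exact: tends0_harm].
have c1 := avg_cvg fA tT l2 h0 hc; have c2 := avg_cvg fA' tT l1 h0 hc.
apply: cvg_uniq c1 _; rewrite (_ : (fun n => _) = (fun n => (f' t - f' (t - h n)) / h n))//.
apply/funext => n; rewrite !ff'//.
have ht : h n <= t / 2 by rewrite ger_pMr// harm_le1.
have := h0 n; case/andP: tT => _ tT h1; apply/andP; split; lra.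
Qed.

(** Truncated at 1, |u - v| is integrable on the rectangle, and Fubini's theorem exchanges the two
    quantifiers. *)
Lemma ae_swap T l (u v : R -> R -> R) : measurable_fun (Q T l) (unc u) ->
  measurable_fun (Q T l) (unc v) ->
  {aeI s < l, {aeI t < T, u t s = v t s}} ->
  {aeI t < T, {aeI s < l, u t s = v t s}}.
Proof.
move=> mu_ mv H; pose D t s := Num.min 1 `|u t s - v t s|.
have D0 t s : 0 <= D t s by rewrite le_min ler01 normr_ge0.
have mD : measurable_fun (Q T l) (unc D).
  apply: measurable_minr => //; apply: measurableT_comp => //; exact: measurable_funB.
have iD : intg m2 (Q T l) (unc D).
  apply: (@intg_bounded _ _ _ m2 _ _ _ 1) => //; [exact: measurable_Q|exact: muQ_lty|].
  by move=> z _; rewrite ger0_norm// ge_min lexx.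
have [_ i2 e2] := @fubini_intg2 _ _ _ _ _ mu mu _ _ (measurable_itv _) (measurable_itv _) D iD.
have z0 : \int[m2]_(z in Q T l) D z.1 z.2 = 0.
  rewrite e2; apply: etrans (_ : \I_(s < l) (0 : R) = 0); last exact: RI_eq0.
  apply: ae_eq_RI => //; first exact: intg_meas i2.
  apply: aeS2 H (aeT mu (fun=> I)) => s h _ sl.
  apply: etrans (_ : \I_(t < T) (0 : R) = 0); last exact: RI_eq0.
  apply: ae_eq_RI => //; first exact: (measurable_slice2 (measurable_itv _) (measurable_itv _) mD).
  by apply: aeS (h sl) => t e tT; rewrite /D e// subrr normr0 minEle ler10.
have D00 : {ae m2, forall z, Q T l z -> D z.1 z.2 = 0}.
  by apply: ge0_RI_eq0 iD _ z0 => //; exact: measurable_Q.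
have D1 := @ae_prod1 _ _ _ _ _ mu mu `]0, T[%classic `]0, l[%classic (fun t s => D t s = 0) D00.
apply: aeS D1 => t h tT; apply: aeS (h tT) => s e sl; move: (e sl); rewrite /D minEle.
by case: ifP => _ => [/eqP|/normr0P/eqP/subr0_eq//]; rewrite oner_eq0.
Qed.

Lemma abscont_sub l l' (f g : R -> R) : l' <= l -> abscont l f g -> abscont l' f g.
Proof.
move=> ll [ig fg]; split; first exact: sub_itv_intg ig.
by move=> x x0 xl; apply: fg => //; exact: le_trans ll.
Qed.

Lemma aeI_and (T : R) (P P' : R -> Prop) : {aeI t < T, P t} -> {aeI t < T, P' t} ->
  {aeI t < T, P t /\ P' t}.
Proof. by apply: aeS2 => t h h' tT; split; [exact: h|exact: h']. Qed.

Lemma RI_sum3 (T : R) (F : 'I_3 -> R -> R) : (forall j, intgI T (F j)) ->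
  intgI T (fun t => \sum_j F j t) /\ \I_(t < T) (\sum_j F j t) = \sum_j \I_(t < T) F j t.
Proof.
move=> iF; have i2 : intgI T (fun t => F e1 t + F e2 t) by exact: intgD.
rewrite sum3 -RID// -RID//; split; last by apply: eq_RI => t _; rewrite sum3.
by apply: eq_intg (intgD _ i2 (iF e3)) => // t _; rewrite sum3.
Qed.

(** Differentiation under the integral sign in integrated form: Fubini's theorem for u on
    ]0,t[ x ]0,l[. *)
Lemma slices_abscont T l (U u : R -> R -> R) : (forall t, 0 <= t <= T -> intgI l (U t)) ->
  intg m2 (Q T l) (unc u) -> {aeI s < l, abscont T (U^~ s) (u^~ s)} ->
  abscont T (fun t => \I_(s < l) U t s) (fun t => \I_(s < l) u t s).
Proof.
move=> iU iQ A; have [_ iK _] := RI_Q iQ.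
split => // t t0 tT.
have isub : intg m2 (Q t l) (unc u).
  apply: intg_subset iQ; [exact: measurable_Q|exact: measurable_Q|].
  by move=> [r s] [/=] /inI[r0 rt] sl; split => //; rewrite /= in_itv/= r0 (lt_le_trans rt).
have [_ _ E1] := RI_Q isub.
have [_ i2 E2] := @fubini_intg2 _ _ _ _ _ mu mu `]0, t[%classic `]0, l[%classic
  (measurable_itv _) (measurable_itv _) u isub.
have i0 : intgI l (U 0) by apply: iU; rewrite lexx (le_trans t0).
have it : intgI l (U t) by apply: iU; rewrite t0.
rewrite -E1 E2; apply/eqP; rewrite addrC -subr_eq; apply/eqP.
rewrite -RIB//; apply: ae_eq_RI => //; [exact: intg_meas (intgB _ it i0)|exact: intg_meas i2|].
by apply: aeS A => s + sl; move=> /(_ sl)[_ ->//]; rewrite addrC addKr.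
Qed.

(* On an interval where the integral of g is at most 1/2, phi is at most half its supremum. *)
Lemma gronwall (T M : R) (g phi : R -> R) : intgI T g -> measI T phi ->
  (forall t, 0 <= t <= T -> 0 <= phi t <= M) ->
  (forall t, 0 <= t <= T -> phi t <= \I_(x < t) (`|g x| * phi x)) ->
  forall t, 0 <= t <= T -> phi t = 0.
Proof.
move=> ig mphi phiM H.
have h2 : 0 < 2^-1 :> R by rewrite invr_gt0.
have [d [d0 Hd]] := intg_small ig h2.
have igp : intgI T (fun x => `|g x| * phi x).
  apply: eq_intg (intg_mul_bounded _ (intg_norm _ ig) mphi (C := M) _) => // [x _|x /inI[x0 xT]].
    by rewrite mulrC.
  by have /andP[p0 pM] := phiM x ltac:(by rewrite !ltW); rewrite ger0_norm.
suff claim n t : 0 <= t <= T -> t <= n%:R * d -> phi t = 0.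
  move=> t tT; apply: (claim (Num.truncn (t / d)).+1) => //.
  by rewrite -ler_pdivrMr// ltW// truncnS_gt.
elim: n t => [|n IH] t tT tn.
  have /andP[t0 _] := tT; have tz : t = 0 by apply/eqP; rewrite eq_le t0 -[leRHS](mul0r d) tn.
  have := H t tT; have /andP[p0 _] := phiM t tT; rewrite tz set_itvoo0 Rintegral_set0 => h.
  by move: p0; rewrite tz => p0; apply/eqP; rewrite eq_le h.
pose W := [set x | 0 <= x <= T /\ x <= n.+1%:R * d].
have hs : has_sup (phi @` W).
  by split; [exists (phi t), t|exists M => _ [x [xT _] <-]; have /andP[] := phiM x xT].
pose c := sup (phi @` W).
have ub x : W x -> phi x <= c by move=> Wx; apply: sup_upper_bound => //; exists x.
have c0 : 0 <= c by apply: le_trans (ub t _) => //; have /andP[] := phiM t tT.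
suff half x : W x -> phi x <= c / 2.
  have : c <= c / 2 by apply: ge_sup => [|_ [x Wx <-]]; [case: hs|exact: half].
  move=> cc; have cz : c = 0 by lra.
  by apply/eqP; rewrite eq_le -{1}cz ub//; have /andP[->] := phiM t tT.
move=> [xT xn]; have /andP[x0 xT'] := xT.
have [xn'|/ltW nx] := leP x (n%:R * d); first by rewrite IH// divr_ge0.
have nd : 0 <= n%:R * d by rewrite mulr_ge0// ltW.
apply: le_trans (H x xT) _.
have ix : intgI x (fun x => `|g x| * phi x) by exact: sub_itv_intg igp.
rewrite (RI_itv_split nd nx ix) (_ : \I_(y < n%:R * d) (`|g y| * phi y) = 0) ?add0r; last first.
  apply: RI_eq0 => // y /inI[y0 yn]; rewrite IH ?mulr0 ?(ltW yn)// (ltW y0)/=.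
  by apply: le_trans (ltW yn) (le_trans nx xT').
apply: (@le_trans _ _ (\I_(n%:R * d < y < x) (c * `|g y|))).
  apply: le_RI => //; [exact: sub_itv_intg ix|apply: intgZ => //; apply: intg_norm => //; exact: sub_itv_intg ig|].
  move=> y /inI[ny yx]; rewrite mulrC ler_wpM2r// ub//; split; last exact: le_trans (ltW yx) xn.
  by rewrite (le_trans nd (ltW ny)) (le_trans (ltW yx)).
rewrite RIZ//; last by apply: intg_norm => //; exact: sub_itv_intg ig.
apply: (ler_wpM2l c0); apply: Hd => //.
by move: xn; rewrite -natr1 mulrDl mul1r; lra.
Qed.

Lemma within_sqint l (f : R -> R) : {within `[0, l], continuous f} -> sqintI l f.
Proof.
move=> cf; have [M [_ HM]] := within_bounded cf.
apply: (@sqint_bounded _ _ _ mu _ _ _ M) => //; [exact: mu_itv_lty|exact: within_measurable|].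
by move=> x /inI[x0 xl]; rewrite HM// !ltW.
Qed.

(** By Taylor's formula sin f (f - g) is cos g - cos f, and - cos f (f - g) is sin g - sin f, up to
    (f - g)^2. The constraint makes the integrals of these first-order terms the same on all edges,
    and the coefficients sum to 0: only quadratic terms remain. *)
Lemma force_pairing (L : 'I_3 -> R) (f g : 'I_3 -> R -> R) (a b : 'I_3 -> R) :
  (forall j, {within `[0, L j], continuous (f j)}) ->
  (forall j, {within `[0, L j], continuous (g j)}) ->
  network_constraint L f -> network_constraint L g ->
  a e1 + a e2 + a e3 = 0 -> b e1 + b e2 + b e3 = 0 ->
  \sum_j \I_(s < L j) (trig_form (a j) (b j) (f j s) * (f j s - g j s)) <=
  (\sum_j (`|a j| + `|b j|)) * \sum_j \I_(s < L j) ((f j s - g j s) ^+ 2).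
Proof.
move=> cf cg nf ng sa sb.
have it (F : R -> R) (h : 'I_3 -> R -> R) j : continuous F -> (forall x, `|F x| <= 1) ->
    {within `[0, L j], continuous (h j)} -> intgI (L j) (fun s => F (h j s)).
  by move=> cF F1 ch; apply: intg_comp cF F1 (within_measurable ch).
pose D j := \I_(s < L j) ((f j s - g j s) ^+ 2).
have D0 j : 0 <= D j by apply: RI_ge0 => s _; exact: sqr_ge0.
pose cs h j := \I_(s < L j) cos (h j s); pose sn h j := \I_(s < L j) sin (h j s).
have one j : \I_(s < L j) (trig_form (a j) (b j) (f j s) * (f j s - g j s)) <=
    a j * (cs g e1 - cs f e1) + b j * (sn g e1 - sn f e1) + (`|a j| + `|b j|) * D j.
  have sd : sqintI (L j) (fun s => f j s - g j s).
    by apply: sqintB => //; apply: within_sqint.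
  have [cF sF] := nf j e1; have [cG sG] := ng j e1; rewrite /cs /sn -cF -sF -cG -sG.
  have ic := it cos _ j (@continuous_cos R) (@cos_norm_le1 R).
  have is_ := it sin _ j (@continuous_sin R) (@sin_norm_le1 R).
  have jc : intgI (L j) (fun s => cos (g j s) - cos (f j s)) by apply: intgB => //; exact: ic.
  have js : intgI (L j) (fun s => sin (g j s) - sin (f j s)) by apply: intgB => //; exact: is_.
  have i12 : intgI (L j) (fun s => a j * (cos (g j s) - cos (f j s)) + b j * (sin (g j s) - sin (f j s))).
    by apply: intgD => //; exact: intgZ.
  have i3 : intgI (L j) (fun s => (`|a j| + `|b j|) * (f j s - g j s) ^+ 2).
    by apply: intgZ => //; exact: sd.2.
  have Ec : a j * (\I_(s < L j) cos (g j s) - \I_(s < L j) cos (f j s)) =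
      \I_(s < L j) (a j * (cos (g j s) - cos (f j s))).
    by rewrite RIZ// RIB//; exact: ic.
  have Es : b j * (\I_(s < L j) sin (g j s) - \I_(s < L j) sin (f j s)) =
      \I_(s < L j) (b j * (sin (g j s) - sin (f j s))).
    by rewrite RIZ// RIB//; exact: is_.
  rewrite Ec Es /D -RIZ//; last exact: sd.2.
  apply: (@le_trans _ _ (\I_(s < L j) (a j * (cos (g j s) - cos (f j s)) +
      b j * (sin (g j s) - sin (f j s)) + (`|a j| + `|b j|) * (f j s - g j s) ^+ 2))); last first.
    by rewrite RID// RID//; exact: intgZ.
  apply: le_RI => //; [|exact: intgD|].
    exact: sqintM (sqint_trig_form _ _ (within_measurable (cf j))) sd.
  move=> s _; have := cos_taylor (f j s) (g j s); have := sin_taylor (f j s) (g j s).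
  rewrite /trig_form -[X in X ^+ 2]opprB sqrrN.
  set x := f j s; set y := g j s => h1 h2.
  have k1 := ler_norm (- b j * (sin y - sin x - cos x * (y - x))).
  have k2 := ler_norm (- a j * (cos y - cos x - - sin x * (y - x))).
  rewrite !normrM !normrN in k1 k2.
  have := ler_wpM2l (normr_ge0 (b j)) h1; have := ler_wpM2l (normr_ge0 (a j)) h2; lra.
apply: le_trans (ler_sum _ (fun j _ => one j)) _.
have Dj j : (`|a j| + `|b j|) * D j <= (`|a j| + `|b j|) * \sum_i D i.
  by rewrite ler_wpM2l ?addr_ge0// (bigD1 j)//= lerDl sumr_ge0.
have := Dj e1; have := Dj e2; have := Dj e3; rewrite !sum3 => h3 h2 h1.
have -> : a e3 = - (a e1 + a e2) by lra.
have -> : b e3 = - (b e1 + b e2) by lra.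
move: h3 h2 h1; have -> : a e3 = - (a e1 + a e2) by lra.
have -> : b e3 = - (b e1 + b e2) by lra.
set c := cs g e1 - cs f e1; set c' := sn g e1 - sn f e1; lra.
Qed.

End uniqueness_tools.

Section uniqueness.
Context (R : realType) (p : R) (L : 'I_3 -> R).
Hypotheses (p1 : 1 < p) (L0 : forall j, 0 < L j).
Local Notation mu := (@lebesgue_measure R).
Local Notation m2 := (mu \x mu)%E.
Local Notation unc u := (fun z : R * R => u z.1 z.2).
Local Notation Q T l := (`]0, T[ `*` `]0, l[ : set (R * R)).

Lemma edge_sol_sub T T' l th ths tht A B : T' <= T -> edge_sol p T l th ths tht A B ->
  edge_sol p T' l th ths tht A B.
Proof.
move=> TT [h1 h2 h3 [C h4] h5 h6 h7 h8 h9].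
have S1 t : `]0, T'[%classic t -> `]0, T[%classic t.
  by move=> /inI[t0 tT]; rewrite /= in_itv/= t0 (lt_le_trans tT).
have S2 (P : R -> Prop) : {aeI t < T, P t} -> {aeI t < T', P t}.
  by apply: aeS => t h /S1; exact: h.
have SQ : Q T' l `<=` Q T l by move=> [t s] [/= /S1].
split; [|exact: measurable_funS (measurable_Q _ _) SQ h2| | |exact: S2| | | |exact: S2].
- move=> e e0; have [d [d0 H]] := h1 e e0; exists d; split => //.
  move=> t t' s s' /andP[t0 tT] /andP[t0' tT']; apply: H; [rewrite t0|rewrite t0'];
    exact: le_trans TT.
- by apply: sqint_subset h3; [exact: measurable_Q|exact: measurable_Q|exact: SQ].
- by exists C; exact: S2.
- by apply: aeS h6 => s h sl; exact: abscont_sub TT (h sl).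
- exact: sub_itv_sqint h7.
exact: sub_itv_sqint h8.
Qed.

Lemma nice_sub th0 T T' E ths tht : T' <= T -> nice p L th0 T E ths tht ->
  nice p L th0 T' E ths tht.
Proof.
move=> TT [h1 h2 h3]; split => // [j|t /andP[t0 tT]]; first exact: edge_sol_sub (h1 j).
by apply: h3; rewrite t0 (le_trans tT).
Qed.

Variables (th0 : 'I_3 -> R -> R) (T : R) (E E' : evolution R).
Variables (ths tht ths' tht' : 'I_3 -> R -> R -> R).
Hypotheses (N : nice p L th0 T E ths tht) (N' : nice p L th0 T E' ths' tht').

Let ES j : edge_sol p T (L j) (theta E j) (ths j) (tht j) (forceA E j) (forceB E j).
Proof. by case: N. Qed.
Let ES' j : edge_sol p T (L j) (theta E' j) (ths' j) (tht' j) (forceA E' j) (forceB E' j).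
Proof. by case: N'. Qed.
Let gap j t s := theta E j t s - theta E' j t s.
Let gapt j t s := tht j t s - tht' j t s.
Let cont j t : 0 <= t <= T -> {within `[0, L j], continuous (theta E j t)}.
Proof. by move=> tT; exact: ucont2_slice tT (es_cont (ES j)). Qed.
Let cont' j t : 0 <= t <= T -> {within `[0, L j], continuous (theta E' j t)}.
Proof. by move=> tT; exact: ucont2_slice tT (es_cont (ES' j)). Qed.
Let size t := \sum_j \I_(s < L j) (gap j t s ^+ 2).
Let rate t := \sum_j (`|forceA E j t| + `|forceB E j t|) +
  \sum_j (`|forceA E' j t| + `|forceB E' j t|).

Let sq j t : 0 <= t <= T -> intgI (L j) (fun s => gap j t s ^+ 2).
Proof. by move=> tT; apply: (sqintB _ _ _).2 => //; apply: within_sqint; [exact: cont|exact: cont']. Qed.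

(* Monotonicity of the flux leaves only the forcing terms, which the constraint makes quadratic. *)
Lemma gap_rate : {aeI t < T, \sum_j \I_(s < L j) (2 * (gap j t s * gapt j t s)) <= 2 * rate t * size t}.
Proof.
pose W j t := \I_(s < L j) (trig_form (forceA E j t) (forceB E j t) (theta E j t s) *
      (theta E j t s - theta E' j t s)) +
    \I_(s < L j) (trig_form (forceA E' j t) (forceB E' j t) (theta E' j t s) *
      (theta E' j t s - theta E j t s)).
have one j : {aeI t < T, \I_(s < L j) (2 * (gap j t s * gapt j t s)) <= 2 * W j t}.
  rewrite /W.
  have sv := sqint_slice_t (es_tht (ES j)); have sv' := sqint_slice_t (es_tht (ES' j)).
  have ms := es_meas (ES j); have ms' := es_meas (ES' j).
  move: (aeI_and (es_s (ES j)) (es_s (ES' j))) (aeI_and (es_flux (ES j)) (es_flux (ES' j)))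
    (aeI_and sv sv'); apply: aeS3 => t H1 H2 H3 tT.
  have [[A A'] [[fl fl'] [st st']]] := (H1 tT, (H2 tT, H3 tT)).
  have /andP[/ltW t0 /ltW tT'] : 0 < t < T by move: tT; rewrite /= in_itv.
  have tI : 0 <= t <= T by rewrite t0.
  have mq : measI (L j) (pflux p \o ths j t).
    by apply: measurableT_comp => //; [exact: measurable_pflux|exact: slice_t ms tT].
  have mq' : measI (L j) (pflux p \o ths' j t).
    by apply: measurableT_comp => //; [exact: measurable_pflux|exact: slice_t ms' tT].
  have AD := ACB A A'.
  have [i1 i2 e] := flux_ibp (L0 j) fl AD mq; have [i1' i2' e'] := flux_ibp (L0 j) fl' AD mq'.
  have key : 0 <= \I_(s < L j) (pflux p (ths j t s) * (ths j t s - ths' j t s)) -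
      \I_(s < L j) (pflux p (ths' j t s) * (ths j t s - ths' j t s)).
    rewrite -RIB//; apply: RI_ge0 => s _; rewrite -mulrBl; exact: pflux_monotone.
  have sd : sqintI (L j) (gap j t) by apply: sqintB => //; apply: within_sqint; [exact: cont|exact: cont'].
  have j1 : intgI (L j) (fun s => gap j t s * gapt j t s).
    by apply: sqintM => //; exact: sqintB.
  have sf := sqint_trig_form (forceA E j t) (forceB E j t) (within_measurable (cont (j := j) tI)).
  have sf' := sqint_trig_form (forceA E' j t) (forceB E' j t) (within_measurable (cont' (j := j) tI)).
  have j2 : intgI (L j) (fun s => trig_form (forceA E j t) (forceB E j t) (theta E j t s) *
      (theta E j t s - theta E' j t s)) by exact: sqintM.
  have j3 : intgI (L j) (fun s => trig_form (forceA E' j t) (forceB E' j t) (theta E' j t s) *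
      (theta E' j t s - theta E j t s)).
    by apply: sqintM => //; apply: sqintB => //; apply: within_sqint; [exact: cont'|exact: cont].
  rewrite RIZ// ler_pM2l ?ltr0n// -RID// -subr_le0 -RIB//; last exact: intgD.
  move: key; rewrite /comp/= in e e'; rewrite e e' opprK -oppr_le0 opprD opprK => /(le_trans _); apply.
  rewrite -RIB//; apply: eq_ler; apply: eq_RI => s _.
  by rewrite /gap /gapt /edge_w /trig_form; ring.
move: (one e1) (one e2) (one e3); apply: aeS3 => t h1 h2 h3 tT.
have tI : 0 <= t <= T by move: tT => /inI[/ltW -> /ltW ->].
have [_ _ con] := N; have [_ _ con'] := N'.
have P := force_pairing (fun j => cont (j := j) tI) (fun j => cont' (j := j) tI) (con t tI) (con' t tI)
  (split3_sum (lambda1 E t) (mu1 E t)) (split3_sum (lambda2 E t) (mu2 E t)).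
have P' := force_pairing (fun j => cont' (j := j) tI) (fun j => cont (j := j) tI) (con' t tI) (con t tI)
  (split3_sum (lambda1 E' t) (mu1 E' t)) (split3_sum (lambda2 E' t) (mu2 E' t)).
have sz : \sum_j \I_(s < L j) ((theta E' j t s - theta E j t s) ^+ 2) = size t.
  by apply: eq_bigr => j _; apply: eq_RI => s _; rewrite -sqrrN opprB.
rewrite sz in P'.
have all3 j : \I_(s < L j) (2 * (gap j t s * gapt j t s)) <= 2 * W j t.
  by elim/ord3P: j; [exact: h1|exact: h2|exact: h3].
apply: le_trans (ler_sum _ (fun j _ => all3 j)) _.
by rewrite -mulr_sumr -mulrA ler_pM2l ?ltr0n// big_split/= /rate mulrDl; exact: lerD P P'.
Qed.

Theorem nice_unique j t s : 0 <= t <= T -> 0 <= s <= L j -> theta E j t s = theta E' j t s.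
Proof.
move=> tT sl.
have B i : exists M, forall r x, 0 <= r <= T -> 0 <= x <= L i -> `|gap i r x| <= M.
  have [M [_ HM]] := ucont2_bounded (es_cont (ES i)); have [M' [_ HM']] := ucont2_bounded (es_cont (ES' i)).
  by exists (M + M') => r x rT xl; apply: normB_le; [exact: HM|exact: HM'].
have iQ i : sqint m2 (Q T (L i)) (unc (fun t s => gap i t s * gapt i t s)).
  have [M HM] := B i.
  apply: (@sqint_mul_bounded _ _ _ m2 _ _ (unc (gapt i)) (unc (gap i)) M) => //.
  - exact: measurable_Q.
  - by apply: sqintB; [exact: measurable_Q|exact: es_tht (ES i)|exact: es_tht (ES' i)].
  - by apply: measurable_funB; [exact: ucont2_measurable (es_cont (ES i))|exact: ucont2_measurable (es_cont (ES' i))].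
  by move=> [r x] [/= /inI[/ltW a1 /ltW a2] /inI[/ltW a3 /ltW a4]]; apply: HM; rewrite ?a1 ?a3.
(* The time derivative of the squared gap, by the product rule on almost every slice in s. *)
pose u (i : 'I_3) t s := 2 * (gap i t s * gapt i t s).
have iu i : intg m2 (Q T (L i)) (unc (u i)).
  by apply: intgZ; [exact: measurable_Q|exact: (@sqint_Q_intg _ _ _ (fun t s => gap i t s * gapt i t s) (iQ i))].
have AC i : abscont T (fun t => \I_(s < L i) (gap i t s ^+ 2)) (fun t => \I_(s < L i) u i t s).
  apply: slices_abscont (iu i) _ => [r rT|]; first exact: sq.
  move: (es_t (ES i)) (es_t (ES' i)); apply: aeS2 => x h h' xl.
  have H := ACB (h xl) (h' xl).
  by rewrite (_ : u i ^~ x = fun t => gap i t x * gapt i t x + gap i t x * gapt i t x);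
    [exact: (AC_mul H H)|apply/funext => r; rewrite /u /gap /gapt; ring].
have [iS RS] := RI_sum3 (fun j => (AC j).1).
have z0 : size 0 = 0.
  have [_ a _] := N; have [_ a' _] := N'.
  rewrite /size big1// => i _; apply: RI_eq0 => // x /inI[/ltW x0 /ltW xl].
  by rewrite /gap a ?a' ?x0// subrr expr0n.
have sizeE r : 0 <= r <= T -> size r = \I_(x < r) (\sum_i \I_(y < L i) u i x y).
  move=> /andP[r0 rT]; have i' i : intgI r (fun x => \I_(s < L i) u i x s).
    exact: sub_itv_intg (AC i).1.
  rewrite (RI_sum3 i').2 -[size r]subr0 -[X in _ - X]z0 /size -sumrB; apply: eq_bigr => i _.
  by rewrite (AC i).2// addrC addKr.
have size0 r : 0 <= size r by apply: sumr_ge0 => i _; apply: RI_ge0 => x _; exact: sqr_ge0.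
have ir : intgI T (fun t => 2 * rate t).
  have one F vs vt i : edge_sol p T (L i) (theta F i) (vs i) (vt i) (forceA F i) (forceB F i) ->
      intgI T (fun t => `|forceA F i t| + `|forceB F i t|).
    move=> H; apply: intgD => //; apply: intg_norm => //; apply: sqint_intg => //;
      try exact: mu_itv_lty; [exact: es_A H|exact: es_B H].
  apply: intgZ => //; apply: intgD => //.
    exact: (RI_sum3 (fun i => one E ths tht i (ES i))).1.
  exact: (RI_sum3 (fun i => one E' ths' tht' i (ES' i))).1.
have rate0 r : 0 <= rate r by rewrite addr_ge0// sumr_ge0// => i _; rewrite addr_ge0.
have mS : measI T size.
  rewrite (_ : size = fun r => \I_(s < L e1) (gap e1 r s ^+ 2) + \I_(s < L e2) (gap e2 r s ^+ 2) +
    \I_(s < L e3) (gap e3 r s ^+ 2)); last by apply/funext => r; rewrite /size sum3.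
  by apply: measurable_funD; [apply: measurable_funD|]; exact: AC_measurable (AC _).
have [M HM] : exists M, forall r, 0 <= r <= T -> size r <= M.
  exists (\I_(x < T) `|\sum_i \I_(y < L i) u i x y|) => r rT; have /andP[r0 rT'] := rT.
  have is_ : intgI r (fun x => \sum_i \I_(y < L i) u i x y) by exact: sub_itv_intg iS.
  rewrite sizeE//; apply: le_trans (ler_norm _) (le_trans (RI_norm _ is_) _) => //.
  by apply: le_RI_itv => //; exact: intg_norm.
have Z r : 0 <= r <= T -> size r = 0.
  apply: (@gronwall R T M _ _ ir mS) => [x xT|x xT]; first by rewrite size0 HM.
  have /andP[x0 xT'] := xT; rewrite {1}sizeE//.
  have ix : intgI T (fun y => `|2 * rate y| * size y).
    apply: eq_intg (intg_mul_bounded _ (intg_norm _ ir) mS (C := M) _) => // [y _|y /inI[y0 yT]].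
      by rewrite mulrC.
    by rewrite ger0_norm ?HM// !ltW.
  apply: ae_le_RI => //; [exact: sub_itv_intg iS|exact: sub_itv_intg ix|].
  apply: aeS gap_rate => y h /inI[y0 yx].
  have yT := lt_le_trans yx xT'.
  rewrite ger0_norm ?mulr_ge0//; apply: h; by rewrite /= in_itv/= y0.
have : \I_(x < L j) (gap j t x ^+ 2) = 0.
  have := Z t tT; rewrite /size => /psumr_eq0P; apply => // i _.
  by apply: RI_ge0 => x _; exact: sqr_ge0.
move=> Z0; have H : {aeI x < L j, gap j t x ^+ 2 = 0}.
  by apply: ge0_RI_eq0 Z0 => // [|x _]; [exact: sq|exact: sqr_ge0].
apply: (ae_eq_within (L0 j) (cont (j := j) tT) (cont' (j := j) tT)) => //; apply: aeS H => x h xl.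
by apply/eqP; rewrite -subr_eq0 -sqrf_eq0 h.
Qed.

(** Equal angles have equal derivatives and fluxes, hence equal forces. The difference of the
    multipliers defines a form that vanishes along theta, and coercivity at a time with two
    oscillating edges makes this difference 0. *)
Lemma multiplier_unique c : 0 < c -> {aeI t < T, oscillates L c (fun j => theta E j t) ->
  forall j, forceA E j t = forceA E' j t /\ forceB E j t = forceB E' j t}.
Proof.
move=> c0; have [d [d0 G]] := network_gram L0 c0.
have one j : {aeI t < T, {aeI s < L j, trig_form (forceA E j t - forceA E' j t)
    (forceB E j t - forceB E' j t) (theta E j t s) = 0}}.
  (* For almost every s the angles agree as functions of t, hence so do their time derivatives at
     almost every t; the flux equation needs the quantifiers in the other order. *)
  have eqt : {aeI t < T, {aeI s < L j, tht j t s = tht' j t s}}.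
    apply: ae_swap (es_tht (ES j)).1 (es_tht (ES' j)).1 _.
    move: (es_t (ES j)) (es_t (ES' j)) (aeT mu (fun=> I)); apply: aeS3 => s h h' _ sl.
    apply: abscont_unique (h sl) (h' sl) _ => t tT.
    by apply: nice_unique; [case/andP: tT => /ltW -> /ltW ->|case/inI: sl => /ltW -> /ltW ->].
  have eqs : {aeI t < T, {aeI s < L j, ths j t s = ths' j t s}}.
    move: (es_s (ES j)) (es_s (ES' j)); apply: aeS2 => t h h' tT.
    apply: abscont_unique (h tT) (h' tT) _ => s sl.
    by apply: nice_unique; [case/inI: tT => /ltW -> /ltW ->|case/andP: sl => /ltW -> /ltW ->].
  have fl := aeI_and (es_flux (ES j)) (es_flux (ES' j)).
  move: eqt eqs fl; apply: aeS3 => t ht hs hf tT; have [f f'] := hf tT.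
  have [F [FA _ _ qF]] := flux_abscont (L0 j) f; have [F' [FA' _ _ qF']] := flux_abscont (L0 j) f'.
  have FF : forall s, 0 <= s <= L j -> F s = F' s.
    apply: ae_eq_within (AC_within FA) (AC_within FA') _ => //.
    by move: (hs tT) qF qF'; apply: aeS3 => s h1 h2 h3 sl; rewrite -h2// -h3//= h1.
  have ww : {aeI s < L j, edge_w (theta E j) (tht j) (forceA E j) (forceB E j) t s =
      edge_w (theta E' j) (tht' j) (forceA E' j) (forceB E' j) t s}.
    by apply: abscont_unique FA FA' _ => s /andP[/ltW s0 /ltW sl]; apply: FF; rewrite s0.
  move: (ht tT) ww; apply: aeS2 => s h1 h2 sl; move: (h1 sl) (h2 sl); rewrite /edge_w /trig_form.
  rewrite (_ : theta E j t s = theta E' j t s) => [->|]; first lra.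
  by apply: nice_unique; [case/inI: tT => /ltW -> /ltW ->|case/inI: sl => /ltW -> /ltW ->].
move: (one e1) (one e2) (one e3); apply: aeS3 => t h1 h2 h3 tT [j1 [j2 [j12 o1 o2]]].
have tI : 0 <= t <= T by case/inI: tT => /ltW -> /ltW ->.
have [|r [r0 Hr]] := ex_min3 (fun j => within_unif (cont (j := j) tI) d0).
  by move=> j r r' _ rr H x y xl yl xy; apply: H => //; exact: le_trans rr.
have [k [k0 Hk]] := G _ r0.
have := Hk (fun j => theta E j t) (fun j => theta E j t) (fun j => forceA E j t - forceA E' j t)
  (fun j => forceB E j t - forceB E' j t) j1 j2 j12 o1 o2 (fun j => cont (j := j) tI) _ _ _ _ _.
move=> /(_ (fun j x y xl yl xy => Hr j y x yl xl xy) (fun j => within_measurable (cont (j := j) tI))).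
have z j s : 0 < s < L j -> `|theta E j t s - theta E j t s| <= d by rewrite subrr normr0 ltW.
have sA := split3_sum (lambda1 E t) (mu1 E t); have sA' := split3_sum (lambda1 E' t) (mu1 E' t).
have sB := split3_sum (lambda2 E t) (mu2 E t); have sB' := split3_sum (lambda2 E' t) (mu2 E' t).
move=> /(_ z); rewrite /forceA /forceB => /(_ ltac:(lra) ltac:(lra)).
rewrite [leRHS]big1 => [H j|j _]; last first.
  apply: etrans (_ : \I_(s < L j) (0 : R) = 0); last exact: RI_eq0.
  apply: ae_eq_RI => //.
    exact: intg_meas (sqint_trig_form _ _ (within_measurable (cont (j := j) tI))).2.
  have : {aeI s < L j, trig_form (forceA E j t - forceA E' j t)
    (forceB E j t - forceB E' j t) (theta E j t s) = 0} by elim/ord3P: j; [exact: h1|exact: h2|exact: h3].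
  by apply: aeS => s h sl; rewrite h// expr0n.
have pos i : 0 <= (split3 (lambda1 E t) (mu1 E t) i - split3 (lambda1 E' t) (mu1 E' t) i) ^+ 2 +
    (split3 (lambda2 E t) (mu2 E t) i - split3 (lambda2 E' t) (mu2 E' t) i) ^+ 2.
  by rewrite addr_ge0 ?sqr_ge0.
move: H; rewrite pmulr_rle0// => H.
have /psumr_eq0P/(_ j isT)/eqP : \sum_i ((split3 (lambda1 E t) (mu1 E t) i - split3 (lambda1 E' t) (mu1 E' t) i) ^+ 2 +
    (split3 (lambda2 E t) (mu2 E t) i - split3 (lambda2 E' t) (mu2 E' t) i) ^+ 2) = 0.
  by apply/eqP; rewrite eq_le H sumr_ge0.
move=> /(_ (fun i _ => pos i)); rewrite paddr_eq0 ?sqr_ge0// !sqrf_eq0 !subr_eq0.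
by move=> /andP[/eqP -> /eqP ->].
Qed.

End uniqueness.

(** * Restarting *)

Section unions.
Context (R : realType).
Local Notation mu := (@lebesgue_measure R).
Local Notation m2 := (mu \x mu)%E.
Local Notation unc u := (fun z : R * R => u z.1 z.2).
Local Notation Q T l := (`]0, T[ `*` `]0, l[ : set (R * R)).

Lemma intgU d (X : measurableType d) (m : {measure set X -> \bar R}) (D D' : set X)
    (f : X -> R) : measurable D -> measurable D' -> intg m D f -> intg m D' f ->
  intg m (D `|` D') f.
Proof.
move=> mD mD' i i'; have mU : measurable (D `|` D') by exact: measurableU.
have key (A : set X) : measurable A -> A `<=` D `|` D' -> intg m A f ->
    intg m (D `|` D') (fun x => `|(f \_ A) x|).
  move=> mA AU iA; apply: intg_norm => //; rewrite /intg.
  rewrite (_ : EFin \o (f \_ A) = (EFin \o f) \_ A).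
    by apply/integrable_restrict => //; rewrite setIidr.
  by apply/funext => x /=; rewrite !patchE; case: ifP.
have k1 := key D mD (@subsetUl _ _ _) i; have k2 := key D' mD' (@subsetUr _ _ _) i'.
apply: (@intg_le _ _ _ m _ _ _ (fun x => `|(f \_ D) x| + `|(f \_ D') x|)) => //.
- by apply/measurable_funU => //; split; [exact: intg_meas i|exact: intg_meas i'].
- move=> x [Dx|Dx].
    by rewrite [X in `|X| + _]patchE mem_set// lerDl.
  by rewrite [X in _ + `|X|]patchE mem_set// lerDr.
- exact: intgD.
Qed.

(** End points that increase to X: countably many intervals exhaust ]0,X[, so that statements valid
    almost everywhere on each of them combine. *)
Definition inner (X : R) (n : nat) : R := X * (1 - n.+2%:R^-1).

Lemma inner_itv X n : 0 < X -> 0 < inner X n < X.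
Proof.
move=> X0; have h1 : (n.+2%:R^-1 : R) < 1 by rewrite invf_lt1 ?ltr0n// ltr1n.
have h2 : 0 < (n.+2%:R^-1 : R) by rewrite invr_gt0 ltr0n.
apply/andP; split; first by rewrite mulr_gt0// subr_gt0.
by rewrite /inner gtr_pMr// gtrBl.
Qed.

Lemma inner_cover X s : 0 < X -> s < X -> exists n, s < inner X n.
Proof.
move=> X0 sX; have e0 : 0 < (X - s) / X by rewrite divr_gt0// subr_gt0.
have [N HN] := @tends0_harm R _ e0; exists N.
have h : (N.+2%:R^-1 : R) < N.+1%:R^-1 by rewrite ltf_pV2 ?posrE ?ltr0n// ltr_nat.
have := lt_le_trans h (HN N (leqnn N)); rewrite ltr_pdivlMr// /inner => h2.
by rewrite mulrBr mulr1 ltrBrDl -ltrBrDr mulrC.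
Qed.

Lemma measurable_shift2 (T1 T2 l : R) (f : R -> R -> R) : measurable_fun (Q T2 l) (unc f) ->
  measurable_fun (`]T1, (T1 + T2)[ `*` `]0, l[ : set (R * R)) (fun z => f (z.1 - T1) z.2).
Proof.
move=> mf; pose sh (z : R * R) := (z.1 - T1, z.2).
have msh : measurable_fun (`]T1, (T1 + T2)[ `*` `]0, l[ : set (R * R)) sh.
  apply: measurable_funTS; apply: measurable_fun_pair; last exact: measurable_snd.
  by apply: measurable_funB => //; exact: measurable_fst.
apply: (measurable_comp (F := Q T2 l) (f := unc f) (g := sh)) => //; first exact: measurable_Q.
move=> _ [[t s] [/= tI sl] <-]; split => //=; move: tI; rewrite !in_itv/= => /andP[xt ty].
by rewrite subr_gt0 xt/= ltrBlDl.
Qed.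

(* The value at the junction [t = T1] plays no role. *)
Definition splice (T1 : R) (Y : Type) (f g : R -> Y) (y : Y) t :=
  if t < T1 then f t else if T1 < t then g (t - T1) else y.

Lemma spliceL (T1 : R) (Y : Type) (f g : R -> Y) y t : t < T1 -> splice T1 f g y t = f t.
Proof. by rewrite /splice => ->. Qed.

Lemma spliceR (T1 : R) (Y : Type) (f g : R -> Y) y t : 0 < t -> splice T1 f g y (T1 + t) = g t.
Proof. by move=> t0; rewrite /splice ltNge lerDl (ltW t0)/= ltrDl t0 addrC addKr. Qed.

(** The counterpart of [splice] for the angles, which are continuous: at the junction the value of
    the second function is taken. *)
Definition join (T1 : R) (Y : Type) (f g : R -> Y) t := if t < T1 then f t else g (t - T1).

Lemma joinL (T1 : R) (Y : Type) (f g : R -> Y) t : t < T1 -> join T1 f g t = f t.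
Proof. by rewrite /join => ->. Qed.

Lemma joinR (T1 : R) (Y : Type) (f g : R -> Y) t : 0 <= t -> join T1 f g (T1 + t) = g t.
Proof. by move=> t0; rewrite /join ltNge lerDl t0/= addrC addKr. Qed.

Lemma splice_ae (T1 T2 : R) (P : R -> Prop) :
  {aeI t < T1, P t} ->
  {aeI t < T2, P (T1 + t)} ->
  {aeI t < T1 + T2, P t}.
Proof.
move=> h1 h2; have h3 := ae_shift T1 h2.
have h4 : {ae mu, forall t, t != T1}.
  exists [set T1]; split => //; first exact: lebesgue_measure_set1.
  by move=> t /= /negP; rewrite negbK => /eqP.
move: h1 h3 h4; apply: aeS3 => t g1 g2 tT1 /inI[t0 tT].
have [tlt|Tt] := ltP t T1; first by apply: g1; rewrite /= in_itv/= t0.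
have : P (T1 + (t - T1)) by apply: g2; rewrite /= in_itv/= subr_gt0 ltrBlDl lt_neqAle eq_sym tT1 Tt.
by rewrite addrC subrK.
Qed.

Lemma splice_set (T1 T2 : R) : 0 < T1 -> 0 < T2 ->
  `]0, (T1 + T2)[%classic = (`]0, T1[ `|` [set T1]) `|` `]T1, (T1 + T2)[%classic.
Proof.
move=> h1 h2; apply/seteqP; split => t /=; rewrite !in_itv/=.
  move=> /andP[t0 tT]; have [tT1|tT1|->] := ltgtP t T1; [left; left; rewrite t0|right|left; right] => //.
by case=> [[/andP[t0 tT]|->]|/andP[t0 ->]]; rewrite ?t0 ?h1/= ?(lt_trans tT) ?ltrDl// andbT (lt_trans h1).
Qed.

Lemma splice_intg (T1 T2 c : R) (f g : R -> R) : 0 < T1 -> 0 < T2 ->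
  intgI T1 f -> intgI T2 g -> intgI (T1 + T2) (splice T1 f g c).
Proof.
move=> h1 h2 iF ig; rewrite (splice_set h1 h2); apply: intgU => //.
- exact: measurableU.
- apply: intgU => //.
    apply: eq_intg iF => // t /inI[_ tT].
    by rewrite /splice tT.
  have ic : intg mu [set T1] (fun=> c).
    apply: intg_subset (cst_intg 0 (T1 + T2) c) => // t /= ->.
    by rewrite in_itv/= h1 ltrDl.
  by apply: eq_intg ic => // t /= ->; rewrite /splice ltxx.
have ig' : intg mu `]T1 - T1, T1 + T2 - T1[ g by rewrite subrr addrC addKr.
have [i _] := RI_shift ig'; apply: eq_intg i => // t /inI[Tt _].
by rewrite /splice ltNge (ltW Tt)/= Tt.
Qed.

Lemma splice_sqint (T1 T2 c : R) (f g : R -> R) : 0 < T1 -> 0 < T2 ->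
  sqintI T1 f -> sqintI T2 g -> sqintI (T1 + T2) (splice T1 f g c).
Proof.
move=> h1 h2 sf sg.
have iF : intgI T1 f by apply: sqint_intg sf => //; exact: mu_itv_lty.
have ig : intgI T2 g by apply: sqint_intg sg => //; exact: mu_itv_lty.
split; first exact: intg_meas (splice_intg c h1 h2 iF ig).
have := splice_intg (c ^+ 2) h1 h2 sf.2 sg.2; apply: eq_intg => // t _.
by rewrite /splice; case: ifP => // _; case: ifP.
Qed.

Lemma splice_measurable2 (T1 T2 l : R) (f g : R -> R -> R) : 0 < T1 -> 0 < T2 ->
  measurable_fun (Q T1 l) (unc f) -> measurable_fun (Q T2 l) (unc g) ->
  measurable_fun (Q (T1 + T2) l) (unc (splice T1 f g (fun=> 0))).
Proof.
move=> h1 h2 mf mg; rewrite (splice_set h1 h2) (_ : _ `*` _ = (`]0, T1[ `*` `]0, l[ `|` [set T1] `*` `]0, l[) `|` `]T1, (T1 + T2)[ `*` `]0, l[); last first.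
  by apply/seteqP; split => -[t s] /=; [case=> -[[?|?]|?] ?; [left; left|left; right|right]|case=> [[[? ?]|[? ?]]|[? ?]]; split => //; [left; left|left; right|right]].
have mx (A : set R) : measurable A -> measurable (A `*` `]0, l[ : set (R * R)).
  by move=> mA; exact: measurableX.
apply/measurable_funU; [apply: measurableU; exact: mx|exact: mx|split].
  apply/measurable_funU; [exact: mx|exact: mx|split].
    apply: eq_measurable_fun mf => -[t s]; rewrite inE => -[/=]; rewrite in_itv/= => /andP[_ tT] _.
    by rewrite /splice tT.
  have m0 : measurable_fun ([set T1] `*` `]0, l[ : set (R * R)) (fun=> 0 : R) by [].
  by apply: eq_measurable_fun m0 => -[t s]; rewrite inE => -[/= -> _]; rewrite /splice ltxx.
apply: eq_measurable_fun (measurable_shift2 mg) => -[t s].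
rewrite inE => -[/=]; rewrite in_itv/= => /andP[Tt _] _.
by rewrite /splice ltNge (ltW Tt)/= Tt.
Qed.

Lemma splice_abscont (T1 T2 c : R) (F f G g : R -> R) : 0 < T1 -> 0 < T2 ->
  abscont T1 F f -> abscont T2 G g -> F T1 = G 0 ->
  abscont (T1 + T2) (join T1 F G) (splice T1 f g c).
Proof.
move=> h1 h2 FA GA FG; have iS := splice_intg c h1 h2 FA.1 GA.1.
split; first exact: iS.
have E1 t : t <= T1 -> \I_(x < t) splice T1 f g c x = \I_(x < t) f x.
  move=> tT; apply: eq_RI => // x /inI[_ xt].
  by rewrite /splice (lt_le_trans xt tT).
move=> t t0 tT; rewrite /join h1; case: ltP => tT1; first by rewrite E1 ?(ltW tT1)// FA.2// ltW.
have it : intgI t (splice T1 f g c) by apply: sub_itv_intg iS.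
rewrite (RI_itv_split (ltW h1) tT1 it) E1// addrA -(FA.2 T1)// ?ltW// FG.
rewrite GA.2 ?subr_ge0//; last by rewrite lerBlDl.
congr (_ + _).
have ig' : intg mu `]T1 - T1, t - T1[ g.
  by rewrite subrr; apply: sub_itv_intg GA.1 => //; rewrite lerBlDl.
have [_] := RI_shift ig'; rewrite subrr => <-; apply: eq_RI => // x.
by rewrite /= in_itv/= => /andP[Tx _]; rewrite /splice ltNge (ltW Tx)/= Tx.
Qed.

End unions.

Section splice_edges.
Context (R : realType) (p : R).
Local Notation mu := (@lebesgue_measure R).
Local Notation m2 := (mu \x mu)%E.
Local Notation unc u := (fun z : R * R => u z.1 z.2).
Local Notation Q T l := (`]0, T[ `*` `]0, l[ : set (R * R)).

Lemma join_at (T1 : R) (f g : R -> R -> R) s : (join T1 f g)^~ s = join T1 (f^~ s) (g^~ s).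
Proof. by apply/funext => t; rewrite /join; case: ifP. Qed.

Lemma splice_at (T1 : R) (f g : R -> R -> R) s :
  (splice T1 f g (fun=> 0))^~ s = splice T1 (f^~ s) (g^~ s) 0.
Proof. by apply/funext => t; rewrite /splice; case: ifP => // _; case: ifP. Qed.

Lemma splice_ucont2 (T1 T2 l : R) (f g : R -> R -> R) : 0 < T1 -> 0 < T2 ->
  ucont2 T1 l f -> ucont2 T2 l g -> (forall s, 0 <= s <= l -> f T1 s = g 0 s) ->
  ucont2 (T1 + T2) l (join T1 f g).
Proof.
move=> h1 h2 uf ug fg e e0; have e2 : 0 < e / 2 by rewrite divr_gt0.
have [d [d0 Hd]] := uf _ e2; have [d' [d'0 Hd']] := ug _ e2.
exists (Num.min d d'); split; first by rewrite lt_min d0.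
have ee : e / 2 <= e by lra.
(* Across the junction, both values are compared with the common profile at time T1, each at the
   cost of e / 2. *)
have mix t t' s s' : 0 <= t < T1 -> T1 <= t' <= T1 + T2 -> 0 <= s <= l -> 0 <= s' <= l ->
    `|t - t'| <= Num.min d d' -> `|s - s'| <= Num.min d d' ->
    `|join T1 f g t s - join T1 f g t' s'| <= e.
  move=> /andP[t0 tT] /andP[Tt tT'] sl sl'; rewrite !le_min => /andP[td td'] /andP[sd sd'].
  rewrite joinL// /join ltNge Tt/=; move: td td'; rewrite distrC ger0_norm; last lra.
  move=> td td'; have -> : f t s - g (t' - T1) s' = (f t s - f T1 s') + (g 0 s' - g (t' - T1) s').
    by rewrite fg//; ring.
  rewrite [leRHS](_ : e = e / 2 + e / 2); last lra.
  apply: normD_le.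
    by apply: Hd => //; [rewrite t0 ltW|rewrite (ltW h1) lexx|rewrite distrC ger0_norm; lra].
  apply: Hd' => //; first by rewrite lexx ltW.
  - by apply/andP; split; lra.
  - by rewrite sub0r normrN ger0_norm; lra.
  - by rewrite subrr normr0 ltW.
move=> t t' s s' /andP[t0 tT] /andP[t'0 tT'] sl sl' td sd.
have [tT1|tT1] := ltP t T1; have [tT1'|tT1'] := ltP t' T1.
- rewrite !joinL//; apply: le_trans ee; move: td sd; rewrite !le_min => /andP[td _] /andP[sd _].
  by apply: Hd => //; rewrite ?t0 ?t'0 ltW.
- by apply: mix; rewrite ?t0 ?tT1'.
- by rewrite distrC; apply: mix; rewrite ?t'0 ?tT1// distrC.
rewrite /join !ltNge tT1 tT1'/=; apply: le_trans ee.
move: td sd; rewrite !le_min => /andP[_ td] /andP[_ sd].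
apply: Hd' => //; first by apply/andP; split; lra.
  by apply/andP; split; lra.
by have -> : t - T1 - (t' - T1) = t - t' by ring.
Qed.

Lemma splice_edge (T1 T2 l : R) th1 ths1 tht1 A1 B1 th2 ths2 tht2 A2 B2 : 0 < T1 -> 0 < T2 ->
  edge_sol p T1 l th1 ths1 tht1 A1 B1 -> edge_sol p T2 l th2 ths2 tht2 A2 B2 ->
  (forall s, 0 <= s <= l -> th1 T1 s = th2 0 s) ->
  edge_sol p (T1 + T2) l (join T1 th1 th2) (splice T1 ths1 ths2 (fun=> 0))
    (splice T1 tht1 tht2 (fun=> 0)) (splice T1 A1 A2 0) (splice T1 B1 B2 0).
Proof.
move=> h1 h2 S1 S2 eqT.
have inT1 t : `]0, T1[%classic t -> t < T1 by rewrite /= in_itv/= => /andP[].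
have inT2 t : `]0, T2[%classic t -> 0 < t by rewrite /= in_itv/= => /andP[].
have mt := splice_measurable2 h1 h2 (es_tht S1).1 (es_tht S2).1.
split.
- by apply: splice_ucont2 => //; [exact: es_cont S1|exact: es_cont S2].
- by apply: splice_measurable2; [| |exact: es_meas S1|exact: es_meas S2].
- split => //.
  have [_ i1 _] := @RI_Q R T1 l (fun t s => tht1 t s ^+ 2) (es_tht S1).2.
  have [_ i2 _] := @RI_Q R T2 l (fun t s => tht2 t s ^+ 2) (es_tht S2).2.
  apply: (@intg_Q_dom R (T1 + T2) l (fun t s => splice T1 tht1 tht2 (fun=> 0) t s ^+ 2) _ _
    (splice_intg 0 h1 h2 i1 i2) _ _).1 => //.
  + by apply: measurable_funX.
  + by move=> t s; exact: sqr_ge0.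
  apply: splice_ae.
    apply: aeS (sqint_slice_t (es_tht S1)) => t H tT; have tT1 := inT1 t tT.
    by rewrite !spliceL//; split => //; exact: (H tT).2.
  apply: aeS (sqint_slice_t (es_tht S2)) => t H tT; have t0 := inT2 t tT.
  by rewrite !spliceR//; split => //; exact: (H tT).2.
- have [C1 H1] := es_pow S1; have [C2 H2] := es_pow S2; exists (Num.max C1 C2); apply: splice_ae.
    apply: aeS H1 => t H tT; rewrite spliceL; last exact: inT1.
    by have [i b] := H tT; rewrite le_max b.
  apply: aeS H2 => t H tT; rewrite spliceR; last exact: inT2.
  by have [i b] := H tT; rewrite le_max b orbT.
- apply: splice_ae.
    apply: aeS (es_s S1) => t H tT; rewrite joinL ?spliceL; [exact: H|exact: inT1|exact: inT1].
  apply: aeS (es_s S2) => t H tT; have t0 := inT2 t tT.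
  by rewrite joinR ?spliceR; [exact: H| |exact: ltW].
- move: (es_t S1) (es_t S2); apply: aeS2 => s H1 H2 sl; rewrite join_at splice_at.
  apply: splice_abscont; [exact: h1|exact: h2|exact: H1|exact: H2|apply: eqT].
  by move: sl; rewrite /= in_itv/= => /andP[/ltW -> /ltW ->].
- by apply: splice_sqint; [| |exact: es_A S1|exact: es_A S2].
- by apply: splice_sqint; [| |exact: es_B S1|exact: es_B S2].
apply: splice_ae.
  apply: aeS (es_flux S1) => t H tT; have tT1 := inT1 t tT.
  rewrite spliceL// (_ : edge_w _ _ _ _ t = edge_w th1 tht1 A1 B1 t); first exact: H.
  by apply/funext => s; rewrite /edge_w joinL// !spliceL.
apply: aeS (es_flux S2) => t H tT; have t0 := inT2 t tT.
rewrite spliceR// (_ : edge_w _ _ _ _ (T1 + t) = edge_w th2 tht2 A2 B2 t); first exact: H.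
by apply/funext => s; rewrite /edge_w joinR ?ltW// !spliceR.
Qed.

Lemma splice_nice (L : 'I_3 -> R) th0 (T1 T2 : R) E1 E2 ths1 ths2 tht1 tht2 : 0 < T1 -> 0 < T2 ->
  nice p L th0 T1 E1 ths1 tht1 -> nice p L (theta E1 ^~ T1) T2 E2 ths2 tht2 ->
  exists ths tht, nice p L th0 (T1 + T2) (Evolution (fun j => join T1 (theta E1 j) (theta E2 j))
    (splice T1 (lambda1 E1) (lambda1 E2) 0) (splice T1 (lambda2 E1) (lambda2 E2) 0)
    (splice T1 (mu1 E1) (mu1 E2) 0) (splice T1 (mu2 E1) (mu2 E2) 0)) ths tht.
Proof.
move=> h1 h2 [S1 i1 c1] [S2 i2 c2].
exists (fun j => splice T1 (ths1 j) (ths2 j) (fun=> 0)), (fun j => splice T1 (tht1 j) (tht2 j) (fun=> 0)).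
split.
- move=> j; have := splice_edge h1 h2 (S1 j) (S2 j) (fun s sl => esym (i2 j s sl)).
  congr (edge_sol _ _ _ _ _ _); apply/funext => t; rewrite /forceA /forceB /splice /split3/=;
    case: ifP => // _; case: ifP => // _; case: (val j) => [|[|]]; rewrite ?subr0 ?oppr0//.
- by move=> j s sl /=; rewrite joinL// i1.
move=> t /andP[t0 tT]; have [tT1|tT1] := ltP t T1.
  rewrite (_ : (fun j => _) = (theta E1)^~ t); first by apply: c1; rewrite t0 ltW.
  by apply/funext => j /=; rewrite joinL.
rewrite (_ : (fun j => _) = (theta E2)^~ (t - T1)); last first.
  by apply/funext => j /=; rewrite /join ltNge tT1.
by apply: c2; apply/andP; split; lra.
Qed.

End splice_edges.

Section oscillation.
Context (R : realType).
Variables (l : R) (f : R -> R).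
Hypothesis l0 : 0 < l.
Local Notation img := (f @` `[0, l]).

Hypothesis cf : {within `[0, l], continuous f}.

Lemma osc_ge x y : 0 <= x <= l -> 0 <= y <= l -> f x - f y <= osc l f.
Proof.
move=> xl yl; have [M [M0 HM]] := within_bounded cf.
have b1 : has_ubound img.
  exists M => u [s /=]; rewrite in_itv/= => sl <-; exact: le_trans (ler_norm _) (HM s sl).
have b2 : has_lbound img.
  exists (- M) => u [s /=]; rewrite in_itv/= => sl <-.
  by have := HM s sl; rewrite ler_norml => /andP[].
have i u : 0 <= u <= l -> img (f u) by move=> ul; exists u => //=; rewrite in_itv.
exact: lerB (ub_le_sup b1 (i x xl)) (ge_inf b2 (i y yl)).
Qed.

Lemma osc_ge0 : 0 <= osc l f.
Proof. by have := @osc_ge 0 0; rewrite subrr lexx ltW//; apply. Qed.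

End oscillation.

Lemma eq_energy (R : realType) (p h : R) N (x y : nat -> R) : (forall i, (i < N)%N -> x i = y i) ->
  energy p h N x = energy p h N y.
Proof.
move=> xy; congr (_ * _); apply: eq_bigr => i _; rewrite /slope; case: ifP => // /andP[_ iN].
by rewrite !xy// (leq_ltn_trans (leq_pred _)).
Qed.

(** * The maximal time *)

Section maximality.
Context (R : realType) (p : R) (L : 'I_3 -> R) (X : R) (E : evolution R) (th0 : 'I_3 -> R -> R).
Local Notation mu := (@lebesgue_measure R).
Hypotheses (p1 : 1 < p) (L0 : forall j, 0 < L j) (X0 : 0 < X).

Lemma liminf_pos (u : R -> R) : (forall t, 0 < t < X -> 0 <= u t) ->
  limf_einf (fun t : R => (u t)%:E) X^'- <> 0%E ->
  exists c d, [/\ 0 < c, 0 < d & forall t, X - d < t < X -> c <= u t].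
Proof.
move=> u0 ne.
have near d : 0 < d -> X^'- [set t | X - d < t < X].
  move=> d0; rewrite /at_left/= withinE; exists (ball X d); first exact: nbhsx_ballx.
  apply/seteqP; split => t /=; rewrite /ball/= => -[h1 h2]; split => //.
    by case/andP: h1 => h _; rewrite ger0_norm; lra.
  by move: h1; rewrite ltr_norml => /andP[_ h]; rewrite h2 andbT; lra.
have ge0 : (0 <= limf_einf (fun t : R => (u t)%:E) X^'-)%E.
  rewrite limf_einfE; apply: (@le_trans _ _ (ereal_inf [set (u t)%:E | t in [set t | X - X < t < X]])).
    apply: le_ereal_inf_tmp => e [t /= /andP[t0 tX] <-].
    by rewrite lee_fin u0// tX andbT; move: t0; rewrite subrr.
  by apply: ereal_sup_ubound; exists [set t | X - X < t < X] => //; exact: near X0.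
have : (0 < limf_einf (fun t : R => (u t)%:E) X^'-)%E by rewrite lt_def ge0 andbT; apply/eqP.
rewrite limf_einfE => /ereal_sup_gt[_ [V VX <-] pos].
have [c [c0 cu]] : exists c, 0 < c /\ forall t, V t -> c <= u t.
  case e : (ereal_inf _) pos => [r| |]// pos.
    exists r; split => // t Vt; rewrite -lee_fin -e.
    by apply: ereal_inf_lbound; exists t.
  exists 1; split => // t Vt; rewrite -lee_fin; apply: (@le_trans _ _ +oo%E); first exact: leey.
  by rewrite -e; apply: ereal_inf_lbound; exists t.
have [d /= d0 Hd] := VX; exists c, d; split => // t /andP[dt tX]; apply: cu; apply: Hd => //.
by rewrite /ball/= ger0_norm; lra.
Qed.

Lemma maximal_collapse : maximal_solution p L th0 X%:E E ->
  exists j1 j2 : 'I_3, j1 != j2 /\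
    limf_einf (fun t : R => (Num.max (osc (L j1) (theta E j1 t)) (osc (L j2) (theta E j2 t)))%:E)
      X^'- = 0%E.
Proof.
move=> [_ sol max]; apply: contrapT => nlim; apply: max.
have nice_at t : 0 < t < X -> exists ths tht, nice p L th0 t E ths tht.
  by move=> /andP[t0 tX]; exact: weak_nice (sol t t0 tX).
have cont j t : 0 < t < X -> {within `[0, L j], continuous (theta E j t)}.
  move=> tX; have [ths [tht [ES _ _]]] := nice_at t tX.
  by apply: ucont2_slice (es_cont (ES j)); rewrite lexx andbT; case/andP: tX => /ltW.
have pair i j : i != j -> exists c d, [/\ 0 < c, 0 < d & forall t, X - d < t < X ->
    c <= Num.max (osc (L i) (theta E i t)) (osc (L j) (theta E j t))].
  move=> ij; apply: liminf_pos => [t tX|h]; last by apply: nlim; exists i, j.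
  by rewrite le_max osc_ge0//; exact: cont.
have [c1 [d1 [c10 d10 H1]]] := pair e1 e2 isT; have [c2 [d2 [c20 d20 H2]]] := pair e1 e3 isT.
have [c3 [d3 [c30 d30 H3]]] := pair e2 e3 isT.
pose c := Num.min c1 (Num.min c2 c3); have c0 : 0 < c by rewrite !lt_min c10 c20.
pose d := Num.min (Num.min d1 d2) (Num.min d3 X).
have d0 : 0 < d by rewrite !lt_min d10 d20 d30.
have : [&& d <= d1, d <= d2, d <= d3 & d <= X] by rewrite /d !ge_min !lexx !orbT.
move=> /and4P[k1 k2 k3 dX].
(* For each pair of edges the larger oscillation is at least c, so at most one edge oscillates by
   less than c. *)
have oscE t : X - d < t < X -> oscillates L c (fun j => theta E j t).
  move=> /andP[dt tX].
  have := H1 t _; have := H2 t _; have := H3 t _; rewrite tX !andbT.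
  move=> /(_ (le_lt_trans (lerB (lexx X) k3) dt)) h3 /(_ (le_lt_trans (lerB (lexx X) k2) dt)) h2
    /(_ (le_lt_trans (lerB (lexx X) k1) dt)) h1.
  have : [&& c <= c1, c <= c2 & c <= c3] by rewrite /c !ge_min !lexx !orbT.
  move=> /and3P[/le_trans/(_ h1) + /le_trans/(_ h2) + /le_trans/(_ h3)]; rewrite !le_max.
  have [a1|a1] := leP c (osc (L e1) (theta E e1 t)).
    have [a2 _ _ _|a2 _ _] := leP c (osc (L e2) (theta E e2 t)); first by exists e1, e2.
    by move=> a3; exists e1, e3.
  by move=> /= a2 a3 _; exists e2, e3.
(* The first restart time t1 is picked between X - d and Y, outside the null set where the energy of
   the slopes is not controlled; from there the sampled energy bound propagates. *)
pose Y := X - d / 2.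
have Y0 : 0 < Y < X by apply/andP; rewrite /Y; split; lra.
have [ths [tht [ES _ _]]] := nice_at Y Y0.
have /choice[C HC] : forall j, exists C, {aeI t < Y, abscont (L j) (theta E j t) (ths j t) /\
    (intgI (L j) (fun s => `|ths j t s| `^ p) /\ \I_(s < L j) (`|ths j t s| `^ p) <= C)}.
  move=> j; have [C HC] := es_pow (ES j); exists C; move: (es_s (ES j)) HC.
  by apply: aeS2 => t h1 h2 tY; split; [exact: h1|exact: h2].
have ae3 := aeI_and (aeI_and (HC e1) (HC e2)) (HC e3).
have [|t1 [dt1 t1Y gg]] := ae_ex_itv (a := X - d) (b := Y) _ ae3; first by rewrite /Y; lra.
pose E1 := \sum_j C j.
have t1X : t1 < X by apply: lt_trans t1Y _; case/andP: Y0.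
have t10 : 0 < t1 by apply: le_lt_trans dt1; rewrite subr_ge0.
have [[g1 g2] g3] := gg ltac:(by rewrite /= in_itv/= t10).
have ini N : (0 < N)%N -> net_energy p L N (sample L (fun j => theta E j t1) N) <= E1.
  move=> N0; apply: ler_sum => j _.
  have [A [ip b]] : abscont (L j) (theta E j t1) (ths j t1) /\
      (intgI (L j) (fun s => `|ths j t1 s| `^ p) /\ \I_(s < L j) (`|ths j t1 s| `^ p) <= C j).
    by elim/ord3P: j.
  exact: le_trans (energy_sample p1 N0 (width_gt0 L0 N0 j) (widthE L N0 j) A ip) b.
have E10 : 0 <= E1 by apply: le_trans (ini 1%N isT); exact: net_energy_ge0.
have pp := lt_trans ltr01 p1.
(* The drift is p per unit of time and acts for less than X, so E1 + p X bounds the energy at every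
   restart before X, and one T serves them all. *)
have K0 : 0 <= E1 + p * X by rewrite addr_ge0// mulr_ge0// ltW.
have [T [T0 loc]] := nice_local p1 L0 c0 K0.
(* Half of T, because the local energy bound holds at times strictly below T. *)
pose h := T / 2; have h0 : 0 < h by rewrite divr_gt0.
have hT : h < T by rewrite ltr_pdivrMr// ltr_pMr// ltr1n.
(* The local solution from theta(t), appended to E, is a solution up to t + T. By uniqueness it
   agrees with E before X, so its energy bound at t + h transfers to E whenever t + h < X. *)
have restart n : let t := t1 + n%:R * h in t < X ->
    (forall N, (0 < N)%N -> net_energy p L N (sample L (fun j => theta E j t) N) <= E1 + p * (n%:R * h)) ->
    exists G ths tht, [/\ nice p L th0 (t + T) G ths tht,
      forall N, (0 < N)%N -> net_energy p L N (sample L (fun j => theta G j (t + h)) N) <= E1 + p * (n.+1%:R * h),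
      forall t', 0 < t' < X -> t' <= t + T -> forall j r s, 0 <= r <= t' -> 0 <= s <= L j ->
        theta E j r s = theta G j r s &
      forall r, r < t -> [/\ lambda1 G r = lambda1 E r, lambda2 G r = lambda2 E r,
        mu1 G r = mu1 E r & mu2 G r = mu2 E r]].
  move=> t tX en; have nh : 0 <= n%:R * h by rewrite mulr_ge0// ltW.
  have tt : t1 <= t by rewrite lerDl.
  have t0 : 0 < t := lt_le_trans t10 tt.
  have tI : 0 < t < X by rewrite t0.
  have [vs [vt NE]] := nice_at t tI.
  have [||||F [Fs [Ft [NF enF]]]] := loc (fun j => theta E j t) _ _ _ _ en.
  - by rewrite lerD2l ler_pM2l//; apply: le_trans (ltW tX); rewrite lerDr ltW.
  - by move=> j; exact: cont.
  - by apply: oscE; rewrite tX (lt_le_trans dt1).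
  - by have [_ _] := NE; apply; rewrite (ltW t0) lexx.
  have [Gs [Gt NG]] := splice_nice t0 T0 NE NF.
  eexists; exists Gs, Gt; split; first exact: NG.
  - move=> N N0; rewrite (_ : (fun j => _) = fun j => theta F j h); last first.
      by apply/funext => j; rewrite /= joinR// ltW.
    apply: le_trans (enF h N _ N0) _; first by rewrite h0.
    by rewrite -[in leRHS]natr1 mulrDl mul1r mulrDr addrA.
  - move=> t' tX' tT j r s; have [ws [wt NE']] := nice_at t' tX'.
    exact: (nice_unique p1 L0 NE' (nice_sub tT NG)).
  by move=> r rt; rewrite /= !spliceL.
have step n : t1 + n%:R * h < X -> forall N, (0 < N)%N ->
    net_energy p L N (sample L (fun j => theta E j (t1 + n%:R * h)) N) <= E1 + p * (n%:R * h).
  elim: n => [|n IH] nX N N0; first by rewrite mul0r mulr0 !addr0 ini.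
  have E2 : t1 + n.+1%:R * h = t1 + n%:R * h + h by rewrite -natr1; ring.
  have nX' : t1 + n%:R * h < X by apply: lt_trans nX; rewrite E2 ltrDl.
  have [G [vs [vt [NG en eq _]]]] := restart n nX' (IH nX').
  apply: le_trans (en N N0); apply: eq_ler; rewrite E2; apply: eq_bigr => j _.
  have I0 : 0 < t1 + n%:R * h + h < X by rewrite -E2 nX andbT E2 addr_gt0// ltr_pwDl// mulr_ge0// ltW.
  apply: eq_energy => i iN; rewrite /sample; apply: (eq _ I0) => //.
  - by rewrite lerD2l ltW.
  - by rewrite lexx andbT ltW//; case/andP: I0.
  rewrite mulr_ge0 ?(ltW (width_gt0 L0 N0 j))//= -[leRHS](widthE L N0 j).
  by rewrite ler_pM2l ?width_gt0// ler_nat ltnW.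
(* The last restart time before X: the next one is at or beyond X, and T = 2 h carries the solution
   strictly past X. *)
have [n [nX Xn]] : exists n, t1 + n%:R * h < X /\ X <= t1 + n.+1%:R * h.
  have ex : exists n, X <= t1 + n%:R * h.
    by exists (Num.truncn ((X - t1) / h)).+1; rewrite -lerBlDl -ler_pdivrMr// ltW// truncnS_gt.
  case: (ex_minnP ex) => -[|n] Pn mn; first by move: Pn; rewrite mul0r addr0 leNgt t1X.
  by exists n; split => //; rewrite ltNge; apply/negP => /mn; rewrite ltnn.
have [G [vs [vt [NG _ eq mE]]]] := restart n nX (step n nX).
set t := t1 + n%:R * h in nX NG eq mE.
have nh : 0 <= n%:R * h by rewrite mulr_ge0// ltW.
have XT : X < t + T by apply: le_lt_trans Xn _; rewrite -natr1 mulrDl mul1r addrA ltrD2l.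
exists (t + T), G; split; [by rewrite lte_fin| |].
  by apply: (nice_weak p1 _ L0 NG); exact: lt_trans XT.
split => [j r s r0 /=|].
  (* E is known to be a solution on [0,T'] for T' < X, so uniqueness is applied up to the midpoint
     of r and X, which is positive even for r = 0. *)
  rewrite lte_fin in_itv/= => rX sl; have [h1 h2] := midf_lt rX.
  apply/esym; apply: (eq ((r + X) / 2)) => //; last by rewrite r0 ltW.
    by rewrite h2 (le_lt_trans r0 h1).
  exact: ltW (lt_trans h2 XT).
(* Before the last restart the multipliers coincide by construction. After it two edges oscillate
   and [multiplier_unique] applies on each interval up to [inner X m]; the countably many null sets
   are then united. *)
have H (m : nat) : {aeI r < inner X m, oscillates L c (fun j => theta E j r) ->
    forall j, forceA E j r = forceA G j r /\ forceB E j r = forceB G j r}.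
  have mX := inner_itv m X0; have [us [ut NE]] := nice_at _ mX.
  have /andP[m0 mX'] := mX.
  apply: (multiplier_unique p1 L0 NE (nice_sub _ NG) c0).
  by apply: ltW; exact: lt_trans mX' XT.
apply: aeS (ae_foralln H) => r Hr r0; rewrite lte_fin => rX.
have [rt|tr] := ltP r t; first exact: mE.
have [m rm] := inner_cover X0 rX.
have dr : X - d < r by apply: lt_le_trans dt1 (le_trans _ tr); rewrite lerDl.
have HH := Hr m ltac:(by rewrite /= in_itv/= r0) (oscE r ltac:(by rewrite dr)).
have [a2 b2] := HH e2; have [a3 b3] := HH e3.
move: a2 b2 a3 b3; rewrite /forceA /forceB /split3/= => /oppr_inj -> /oppr_inj -> -> ->.
by [].
Qed.

End maximality.

(** The absolutely continuous representative turns membership in W^{1,p} into one bound on the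
    sampled energies of all meshes. *)
Lemma setH_energy (R : realType) (p : R) (L : 'I_3 -> R) (th0 : 'I_3 -> R -> R) : 1 < p ->
  (forall j, 0 < L j) -> setH p L th0 ->
  exists E0, forall N, (0 < N)%N -> net_energy p L N (sample L th0 N) <= E0.
Proof.
move=> p1 L0 [H _]; have pp := lt_trans ltr01 p1.
have /choice[g Hg] j : exists g, abscont (L j) (th0 j) g /\
    intg lebesgue_measure `]0, L j[ (fun s => `|g s| `^ p).
  have [cth [g [_ /(Lp_iff _ _ _ pp)[mg ig] wg]]] := H j; exists g; split => //.
  have [i1 _] := Lp_intg p1 mg ig.
  by apply: plateau_abscont => // a b n tst; exact: wg.
exists (\sum_j \int[lebesgue_measure]_(s in `]0, L j[) (`|g j s| `^ p)) => N N0.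
apply: ler_sum => j _; have [AC ig] := Hg j.
exact: (energy_sample p1 N0 (width_gt0 L0 N0 j) (widthE L N0 j) AC ig).
Qed.

Theorem theorem1p3 (R : realType) (p : R) (hp : 1 < p) (L : 'I_3 -> R)
    (hL3 : 0 < L e3) (hL : L e3 <= Num.min (L e1) (L e2))
    (th0 : 'I_3 -> R -> R) (hth0 : setH p L th0)
    (c : R) (hc : 0 < c)
    (hosc : exists j1 j2 : 'I_3, j1 != j2 /\
      c <= Num.min (osc (L j1) (th0 j1)) (osc (L j2) (th0 j2))) :
  (exists (T : R) (E : evolution R), 0 < T /\ weak_solution p L th0 T E) /\
  (forall (Tmax : \bar R) (E : evolution R),
    maximal_solution p L th0 Tmax E -> (Tmax < +oo)%E ->
    exists j1 j2 : 'I_3, j1 != j2 /\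
      limf_einf (fun t : R =>
          (Num.max (osc (L j1) (theta E j1 t)) (osc (L j2) (theta E j2 t)))%:E)
        (fine Tmax)^'- = 0%E).
Proof.
have L0 j : 0 < L j.
  by move: hL; rewrite le_min => /andP[h1 h2]; elim/ord3P: j => //; exact: lt_le_trans hL3 _.
split.
  have [j1 [j2 [j12]]] := hosc; rewrite le_min => /andP[c1 c2].
  have [E0 HE] := setH_energy hp L0 hth0.
  have E00 : 0 <= E0 by apply: le_trans (HE 1%N isT); exact: net_energy_ge0.
  have cth j : {within `[0, L j], continuous (th0 j)} by have [+ _] := hth0; move=> /(_ j)[].
  have [T [T0 loc]] := nice_local hp L0 hc E00.
  have [|E [ths [tht [N _]]]] := loc th0 E0 (lexx _) cth _ HE hth0.2; first by exists j1, j2.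
  by exists T, E; split => //; exact: nice_weak T0 L0 N.
move=> [X| |] E mx //= _; last by case: mx.
have X0 : 0 < X by case: mx => + _ _; rewrite lte_fin.
exact: maximal_collapse hp L0 X0 mx.
Qed.
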